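(* Let $S$ be a finite set of sequences $\phi\colon\mathbb{N}\to\mathbb{C}$, each of subquadratic word growth, and let $a\colon\mathbb{N}\to S^1$ be an unpretentious completely multiplicative function taking values in the unit circle. Then \[ \lim_{H\to\infty}\limsup_{N\to\infty}\mathbb{E}^{\log}_{n\le N}\sup_{\phi\in S}\Big|\mathbb{E}_{h\le H}a(n+h)\phi(h)\Big|=0 . \]
   Context: $\mathbb{E}_{h\le H}$ is the uniform average over $1\le h\le H$; $\mathbb{E}^{\log}_{n\le N}\psi(n)=\big(\sum_{n\le N}\frac1n\big)^{-1}\sum_{n\le N}\frac{\psi(n)}{n}$. A sequence $\phi$ has subquadratic word growth if it takes finitely many values and the number of words $\epsilon\in\mathbb{C}^k$ with $\limsup_N\mathbb{E}^{\log}_{n\le N}\mathbf 1_{\{\phi(n+h)=\epsilon_h\ \forall h\le k\}}>0$ is $o(k^2)$. Unpretentious: there is $\varphi\colon\mathbb{N}\to\mathbb{N}$ with $\varphi(A)\to\infty$ such that for every $A$, every Dirichlet character $\chi$ of period at most $A$, all sufficiently large $N$ and all real $|t|\le AN$, $\sum_{p\le N}\frac{1-\mathrm{Re}(a(p)\chi(p)p^{-it})}{p}\ge\varphi(A)$. *)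

(* Defs.v *)
From Stdlib Require Import Reals Lra Lia ZArith Znumtheory List.
Open Scope R_scope.

Definition Cx : Type := (R * R)%type.
Definition C0 : Cx := (0, 0).
Definition C1 : Cx := (1, 0).
Definition Cadd (x y : Cx) : Cx := (fst x + fst y, snd x + snd y).
Definition Cmul (x y : Cx) : Cx :=
  (fst x * fst y - snd x * snd y, fst x * snd y + snd x * fst y).
Definition Cscale (r : R) (x : Cx) : Cx := (r * fst x, r * snd x).
Definition Cre (x : Cx) : R := fst x.
Definition Cabs (x : Cx) : R := sqrt (fst x * fst x + snd x * snd x).
(** p^{-it} = exp(-i t log p) for p > 0 *)
Definition Cpow_neg_it (p : nat) (t : R) : Cx :=
  (cos (t * ln (INR p)), - sin (t * ln (INR p))).

Definition C_eq_dec (x y : Cx) : {x = y} + {x <> y}.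
Proof.
  destruct x as [a b], y as [c d].
  destruct (Req_EM_T a c) as [H1|H1]; destruct (Req_EM_T b d) as [H2|H2];
    [left; subst; reflexivity | right | right | right];
    intro H; inversion H; contradiction.
Defined.

Fixpoint sum1 (n : nat) (f : nat -> R) : R :=
  match n with O => 0 | S m => sum1 m f + f (S m) end.
Fixpoint Csum1 (n : nat) (f : nat -> Cx) : Cx :=
  match n with O => C0 | S m => Cadd (Csum1 m f) (f (S m)) end.

Definition Cavg (H : nat) (f : nat -> Cx) : Cx := Cscale (/ INR H) (Csum1 H f).

Definition logavg (N : nat) (psi : nat -> R) : R :=
  (sum1 N (fun n => psi n / INR n)) / (sum1 N (fun n => / INR n)).

Definition is_limsup (u : nat -> R) (l : R) : Prop :=
  forall eps, 0 < eps ->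
    (exists N0, forall n, (N0 <= n)%nat -> u n < l + eps) /\
    (forall N0, exists n, (N0 <= n)%nat /\ l - eps < u n).

Fixpoint word_matchb (phi : nat -> Cx) (n : nat) (w : list Cx) : bool :=
  match w with
  | nil => true
  | e :: w' => if C_eq_dec (phi (S n)) e then word_matchb phi (S n) w' else false
  end.

Definition word_indicator (phi : nat -> Cx) (w : list Cx) (n : nat) : R :=
  if word_matchb phi n w then 1 else 0.

Definition word_has_pos_upper_logdens (phi : nat -> Cx) (w : list Cx) : Prop :=
  exists l, is_limsup (fun N => logavg N (word_indicator phi w)) l /\ 0 < l.

(** Subquadratic word growth: finitely many values (on n >= 1), and the number
    of words of length k with positive upper logarithmic density is o(k^2):
    for every eps > 0, for all large k, every finite family of distinct such
    words of length k has at most eps * k^2 elements. *)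
Definition subquadratic_word_growth (phi : nat -> Cx) : Prop :=
  (exists vals : list Cx, forall n, (1 <= n)%nat -> In (phi n) vals) /\
  (forall eps, 0 < eps -> exists K, forall k, (K <= k)%nat ->
     forall ws : list (list Cx), NoDup ws ->
       (forall w, In w ws -> length w = k /\ word_has_pos_upper_logdens phi w) ->
       INR (length ws) <= eps * INR k ^ 2).

Definition completely_multiplicative (a : nat -> Cx) : Prop :=
  a 1%nat = C1 /\ forall m n, (1 <= m)%nat -> (1 <= n)%nat -> a (m * n)%nat = Cmul (a m) (a n).

Definition unit_circle_valued (a : nat -> Cx) : Prop :=
  forall n, (1 <= n)%nat -> Cabs (a n) = 1.

Definition dirichlet_character (q : nat) (chi : nat -> Cx) : Prop :=
  (1 <= q)%nat /\
  chi 1%nat = C1 /\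
  (forall n, chi (n + q)%nat = chi n) /\
  (forall m n, chi (m * n)%nat = Cmul (chi m) (chi n)) /\
  (forall n, chi n <> C0 <-> Nat.gcd n q = 1%nat).

Definition is_prime_nat (p : nat) : Prop := prime (Z.of_nat p).

Definition prime_ind (p : nat) : R :=
  if prime_dec (Z.of_nat p) then 1 else 0.

Definition pretentious_dist (a chi : nat -> Cx) (N : nat) (t : R) : R :=
  sum1 N (fun p => prime_ind p *
     ((1 - Cre (Cmul (Cmul (a p) (chi p)) (Cpow_neg_it p t))) / INR p)).

Definition unpretentious (a : nat -> Cx) : Prop :=
  exists varphi : nat -> nat,
    (forall M, exists A0, forall A, (A0 <= A)%nat -> (M <= varphi A)%nat) /\
    (forall A q chi, (q <= A)%nat -> dirichlet_character q chi ->
       exists N0, forall N, (N0 <= N)%nat ->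
         forall t, Rabs t <= INR A * INR N ->
           INR (varphi A) <= pretentious_dist a chi N t).

(** sup over a finite list of functions of a nonnegative quantity (0 if empty) *)
Definition sup_list (S : list (nat -> Cx)) (F : (nat -> Cx) -> R) : R :=
  fold_right (fun phi acc => Rmax (F phi) acc) 0 S.

Definition corr_quantity (a : nat -> Cx) (S : list (nat -> Cx)) (H N : nat) : R :=
  logavg N (fun n => sup_list S
    (fun phi => Cabs (Cavg H (fun h => Cmul (a (n + h)%nat) (phi h))))).

(* Main.v *)
(** A sequence with finitely many values is bounded, so it suffices to treat the
    logarithmic mean square of [E_{h <= M} a(n + h) z_h] for one bounded [z].
    - Averaging over the shifts [n + s], [s < M], and Parseval on [Z/2M] reduce [z] to the
      additive characters [h |-> e(alpha h)], uniformly in [alpha].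
    - Fix a finite set [P] of primes with [sum 1/p] large.  By Turan-Kubilius and
      multiplicativity the average twisted by [alpha] is controlled by those twisted by
      [p alpha], [p] in [P].  If the [p alpha] are well spaced, Bessel's inequality gives the
      bound; otherwise [d alpha] is close to an integer for some bounded [d], and the twist is
      nearly periodic.
    - A periodic function is a combination of dilated Dirichlet characters, which leaves the
      short averages of [f = a chi].  These are treated in the manner of Matomaki and
      Radziwill: the mean square of short averages is bounded by that of the Dirichlet
      polynomial [sum f(n) n^(-1-it)] over [|t| <= x/H].  Frequencies [t] at which all prime
      polynomials of some level are small are handled by factoring out one prime and the mean
      value theorem, with a high moment of the previous level inserted.  The remaining [t] form
      a sparse set, on which the Turan-Kubilius inequality for Dirichlet polynomials (dual
      large sieve, with Kusmin-Landau and van der Corput for far apart frequencies) converts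
      non-pretentiousness into a saving. *)

Require Import Defs.
From Stdlib Require Import Reals List Lra Lia Classical ZArith Znumtheory.
From Stdlib Require ClassicalEpsilon.
Open Scope R_scope.

(** Non-pretentiousness saves only a constant factor, too little for a pointwise bound of a
    polynomial over one scale [[x, e x)]. Logarithmic averaging makes it suffice: all scales between
    [h^100] and [h^150] are treated at once. For the exceptional frequencies, [theta] times the sum
    of squares of the single long polynomial [FF] is at most a constant times [log h / KD], and
    Plancherel in the variable [log n] spreads this over the scales, where the trivial bound is
    [50 log h]. No integrals occur. Frequencies run through a lattice [theta * k] with
    [theta * log Z <= PI], and Plancherel in [log n] is Parseval on a cyclic group after [log n] has
    been rounded to multiples of [1/s1]; [s1] is chosen last, so the rounding is harmless. All
    lengths are fixed powers of [h]: the distance at [h^150] is then seen by the primes up to [h],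
    except for a bounded amount, while the exceptional set has at most [h^2] elements. *)

Lemma limsup_exists (u : nat -> R) (B : R) : (forall n, 0 <= u n <= B) -> exists l, is_limsup u l.
Proof.
intros hB.
(* [E] collects the levels that are exceeded infinitely often; the limsup is its supremum. *)
pose (E := fun x => forall N0, exists n, (N0 <= n)%nat /\ x < u n).
destruct (completeness E) as [l [ub lub]].
- exists B; intros x hx; destruct (hx O) as [n [_ hn]]; specialize (hB n); lra.
- exists (-1); intros N0; exists N0; split; [lia|specialize (hB N0); lra].
- exists l; intros eps e0; split.
  + apply NNPP; intros no; assert (hE : E (l + eps / 2)).
    { intros N0; apply NNPP; intros no'; apply no; exists N0; intros n hn.
      destruct (Rlt_dec (l + eps / 2) (u n)) as [h|h]; [exfalso; apply no'; exists n; auto|lra]. }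
    specialize (ub _ hE); lra.
  + intros N0; apply NNPP; intros no; assert (h : l <= l - eps).
    { apply lub; intros x hx; destruct (hx N0) as [n [hn hx']].
      destruct (Rle_dec x (l - eps)) as [h|h]; [exact h|exfalso; apply no; exists n; split; [exact hn|lra]]. }
    lra.
Qed.

Lemma limsup_le (u : nat -> R) (l c : R) : is_limsup u l ->
  (exists N0, forall n, (N0 <= n)%nat -> u n <= c) -> l <= c.
Proof.
intros hl [N0 h]; apply Rnot_lt_le; intros lt.
destruct (hl (l - c)) as [_ h2]; [lra|].
destruct (h2 N0) as [n [hn hu]]; specialize (h n hn); lra.
Qed.

Lemma limsup_ge0 (u : nat -> R) (l : R) : is_limsup u l -> (forall n, 0 <= u n) -> 0 <= l.
Proof.
intros hl h; apply Rnot_lt_le; intros lt.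
destruct (hl (- l)) as [[N0 h1] _]; [lra|].
specialize (h1 N0 (le_n _)); specialize (h N0); lra.
Qed.

From mathcomp Require Import all_boot all_order all_algebra.
From mathcomp Require Import Rstruct complex ring lra zify.
From mathcomp Require cyclic.
Set Implicit Arguments. Unset Strict Implicit. Unset Printing Implicit Defensive.
Import Order.TTheory GRing.Theory Num.Theory.
Local Open Scope complex_scope.
Local Open Scope ring_scope.
Bind Scope ring_scope with RbaseSymbolsImpl.R.

(** * Complex numbers and duality *)

Notation R := Rdefinitions.R.
Notation CC := (complex R).

Definition cre (z : CC) : R := let: Complex a _ := z in a.
Definition cim (z : CC) : R := let: Complex _ b := z in b.
Definition cj (z : CC) : CC := conjc z.
Definition N2 (z : CC) : R := cre z ^+ 2 + cim z ^+ 2.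
Definition cabs (z : CC) : R := Num.sqrt (N2 z).

Lemma cre0 : cre 0 = 0. Proof. by []. Qed.
Lemma cim0 : cim 0 = 0. Proof. by []. Qed.
Lemma cre1 : cre 1 = 1. Proof. by []. Qed.
Lemma cim1 : cim 1 = 0. Proof. by []. Qed.
Lemma creD z w : cre (z + w) = cre z + cre w. Proof. by case: z; case: w. Qed.
Lemma cimD z w : cim (z + w) = cim z + cim w. Proof. by case: z; case: w. Qed.
Lemma creN z : cre (- z) = - cre z. Proof. by case: z. Qed.
Lemma cimN z : cim (- z) = - cim z. Proof. by case: z. Qed.
Lemma creB z w : cre (z - w) = cre z - cre w. Proof. by rewrite creD creN. Qed.
Lemma cimB z w : cim (z - w) = cim z - cim w. Proof. by rewrite cimD cimN. Qed.
Lemma creM z w : cre (z * w) = cre z * cre w - cim z * cim w.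
Proof. by case: z; case: w. Qed.
Lemma cimM z w : cim (z * w) = cre z * cim w + cim z * cre w.
Proof. by case: z => a b; case: w => c d /=; rewrite addrC [b * c]mulrC [a * d]mulrC; ring. Qed.
Lemma cre_rc x : cre x%:C = x. Proof. by []. Qed.
Lemma cim_rc x : cim x%:C = 0. Proof. by []. Qed.
Lemma cre_cj z : cre (cj z) = cre z. Proof. by case: z. Qed.
Lemma cim_cj z : cim (cj z) = - cim z. Proof. by case: z. Qed.
Lemma cplx_eq z w : cre z = cre w -> cim z = cim w -> z = w.
Proof. by case: z => a b; case: w => c d /= -> ->. Qed.
Definition cE := (cre0, cim0, cre1, cim1, creD, cimD, creN, cimN, creM, cimM, cre_rc, cim_rc, cre_cj, cim_cj).

Lemma cre_sum I (r : seq I) P (F : I -> CC) :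
  cre (\sum_(i <- r | P i) F i) = \sum_(i <- r | P i) cre (F i).
Proof. exact: (big_morph cre creD cre0). Qed.

Lemma rcD (x y : R) : (x + y)%:C = x%:C + y%:C. Proof. exact: rmorphD. Qed.
Lemma rcM (x y : R) : (x * y)%:C = x%:C * y%:C. Proof. exact: rmorphM. Qed.
Lemma rcN (x : R) : (- x)%:C = - x%:C. Proof. exact: rmorphN. Qed.
Lemma rc_sum I (r : seq I) P (F : I -> R) :
  (\sum_(i <- r | P i) F i)%:C = \sum_(i <- r | P i) (F i)%:C.
Proof. exact: rmorph_sum. Qed.

Lemma cjM z w : cj (z * w) = cj z * cj w. Proof. exact: rmorphM. Qed.

Lemma cj_sum I (r : seq I) P (F : I -> CC) :
  cj (\sum_(i <- r | P i) F i) = \sum_(i <- r | P i) cj (F i).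
Proof. exact: rmorph_sum. Qed.
Lemma cjK z : cj (cj z) = z. Proof. exact: conjcK. Qed.
Lemma cj_rc (x : R) : cj x%:C = x%:C. Proof. exact: conjc_real. Qed.

Lemma N2_ge0 z : 0 <= N2 z. Proof. by rewrite addr_ge0 // sqr_ge0. Qed.
#[local] Hint Resolve N2_ge0 : core.
Lemma N20 : N2 0 = 0. Proof. by rewrite /N2 cre0 cim0; ring. Qed.
Lemma N21 : N2 1 = 1. Proof. by rewrite /N2 !cE; ring. Qed.
Lemma N2M z w : N2 (z * w) = N2 z * N2 w. Proof. by rewrite /N2 !cE; ring. Qed.
Lemma N2N z : N2 (- z) = N2 z. Proof. by rewrite /N2 !cE; ring. Qed.
Lemma N2_cj z : N2 (cj z) = N2 z. Proof. by rewrite /N2 !cE; ring. Qed.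
Lemma N2_rc x : N2 x%:C = x ^+ 2. Proof. by rewrite /N2 !cE; ring. Qed.
Lemma N2BC z w : N2 (z - w) = N2 (w - z). Proof. by rewrite -N2N opprB. Qed.
Lemma mulcj z : z * cj z = (N2 z)%:C.
Proof. by apply: cplx_eq; rewrite /N2 !cE; ring. Qed.
Lemma N2_mulcj z : N2 z = cre (z * cj z). Proof. by rewrite mulcj. Qed.
Lemma N2X z n : N2 (z ^+ n) = N2 z ^+ n.
Proof. by elim: n => [|n IH]; rewrite ?expr0 ?N21 // !exprS N2M IH. Qed.
Lemma N2D z w : N2 (z + w) = N2 z + N2 w + 2 * cre (z * cj w).
Proof. by rewrite /N2 !cE; ring. Qed.
Lemma N2D_le z w : N2 (z + w) <= 2 * N2 z + 2 * N2 w.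
Proof.
rewrite /N2 !cE.
have := sqr_ge0 (cre z - cre w); have := sqr_ge0 (cim z - cim w); lra.
Qed.
Lemma N2B_le z w : N2 (z - w) <= 2 * N2 z + 2 * N2 w.
Proof. by rewrite -(N2N w) N2D_le. Qed.
Lemma cre_mul_le z w : 2 * cre (z * cj w) <= N2 z + N2 w.
Proof.
rewrite /N2 !cE.
have := sqr_ge0 (cre z - cre w); have := sqr_ge0 (cim z - cim w); lra.
Qed.

Lemma cabs_ge0 z : 0 <= cabs z. Proof. exact: sqrtr_ge0. Qed.
#[local] Hint Resolve cabs_ge0 : core.
Lemma cabs_sqr z : cabs z ^+ 2 = N2 z. Proof. exact: sqr_sqrtr. Qed.
Lemma cabsM z w : cabs (z * w) = cabs z * cabs w.
Proof. by rewrite /cabs N2M sqrtrM. Qed.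
Lemma cabs0 : cabs 0 = 0. Proof. by rewrite /cabs N20 sqrtr0. Qed.
Lemma cabs1 : cabs 1 = 1. Proof. by rewrite /cabs N21 sqrtr1. Qed.
Lemma cabsN z : cabs (- z) = cabs z. Proof. by rewrite /cabs N2N. Qed.
Lemma cabs_cj z : cabs (cj z) = cabs z. Proof. by rewrite /cabs N2_cj. Qed.
Lemma cabs_rc x : cabs x%:C = `|x|. Proof. by rewrite /cabs N2_rc sqrtr_sqr. Qed.
Lemma cabs_le z (x : R) : 0 <= x -> N2 z <= x ^+ 2 -> cabs z <= x.
Proof.
move=> x0 h; rewrite -(ler_pXn2r (ltn0Sn 1)) ?nnegrE //; first by rewrite cabs_sqr.
Qed.
Lemma cre_le_cabs z : `|cre z| <= cabs z.
Proof.
rewrite -(ler_pXn2r (ltn0Sn 1)) ?nnegrE // cabs_sqr real_normK ?num_real // /N2.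
by rewrite lerDl sqr_ge0.
Qed.
Lemma cabsD z w : cabs (z + w) <= cabs z + cabs w.
Proof.
apply: cabs_le; first by rewrite addr_ge0.
have h : cre (z * cj w) <= cabs z * cabs w.
  rewrite -(cabs_cj w) -cabsM.
  exact: le_trans (ler_norm _) (cre_le_cabs _).
rewrite N2D -!cabs_sqr; lra.
Qed.
Lemma cabs_sum I (r : seq I) P (F : I -> CC) :
  cabs (\sum_(i <- r | P i) F i) <= \sum_(i <- r | P i) cabs (F i).
Proof.
apply: (big_ind2 (fun z x => cabs z <= x)) => //; first by rewrite cabs0.
by move=> z x w y h1 h2; apply: le_trans (cabsD _ _) (lerD h1 h2).
Qed.
Lemma cabs_le1 z : N2 z <= 1 -> cabs z <= 1.
Proof. by move=> h; apply: cabs_le; rewrite ?expr1n. Qed.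
Lemma N2_le_sqr z (x : R) : cabs z <= x -> N2 z <= x ^+ 2.
Proof. by move=> h; rewrite -cabs_sqr ler_pXn2r ?nnegrE // (le_trans _ h). Qed.

Lemma CS_real I (r : seq I) P (x y : I -> R) :
  (\sum_(i <- r | P i) x i * y i) ^+ 2 <=
  (\sum_(i <- r | P i) x i ^+ 2) * (\sum_(i <- r | P i) y i ^+ 2).
Proof.
set A := \sum_(i <- r | P i) x i ^+ 2; set B := \sum_(i <- r | P i) y i ^+ 2.
set S := \sum_(i <- r | P i) _.
have A0 : 0 <= A by apply: sumr_ge0 => i _; apply: sqr_ge0.
have key t : 0 <= A - 2 * t * S + t ^+ 2 * B.
  have -> : A - 2 * t * S + t ^+ 2 * B = \sum_(i <- r | P i) (x i - t * y i) ^+ 2.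
    rewrite /A /S /B !mulr_sumr -sumrB -big_split /=.
    by apply: eq_bigr => i _; ring.
  by apply: sumr_ge0 => i _; apply: sqr_ge0.
have B0 : 0 <= B by apply: sumr_ge0 => i _; apply: sqr_ge0.
have [B_eq|Bn] := eqVneq B 0.
  have S0 : S = 0.
    have [//|Sn] := eqVneq S 0.
    (* For [B = 0] the expression is affine in [t], and this [t] brings it to [-1]. *)
    have := key ((A + 1) / (2 * S)); rewrite B_eq mulr0 addr0.
    suff -> : A - 2 * ((A + 1) / (2 * S)) * S = -1 by lra.
    by field.
  by rewrite S0 B_eq mulr0 expr0n.
have Bp : 0 < B by rewrite lt_def Bn B0.
have := key (S / B).
have -> : A - 2 * (S / B) * S + (S / B) ^+ 2 * B = (A * B - S ^+ 2) / B by field.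
by rewrite pmulr_lge0 ?invr_gt0 // subr_ge0.
Qed.

Lemma CS I (r : seq I) P (x y : I -> CC) :
  N2 (\sum_(i <- r | P i) x i * y i) <=
  (\sum_(i <- r | P i) N2 (x i)) * (\sum_(i <- r | P i) N2 (y i)).
Proof.
apply: (@le_trans _ _ ((\sum_(i <- r | P i) cabs (x i) * cabs (y i)) ^+ 2)).
  apply: N2_le_sqr; apply: le_trans (cabs_sum _ _ _) _.
  by under eq_bigr do rewrite cabsM.
apply: le_trans (CS_real _ _ _ _) _.
by under eq_bigr do rewrite cabs_sqr; under [X in _ * X <= _]eq_bigr do rewrite cabs_sqr.
Qed.

(** Cauchy-Schwarz with free positive weights: each term is split as [sqrt w] times [x / sqrt w]. *)
Lemma N2_sum_le I (r : seq I) (P : pred I) (w : I -> R) (x : I -> CC) :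
  (forall i, P i -> 0 < w i) ->
  N2 (\sum_(i <- r | P i) x i) <=
  (\sum_(i <- r | P i) w i) * (\sum_(i <- r | P i) N2 (x i) / w i).
Proof.
move=> w0.
have h i : P i -> 0 <= w i by move=> /w0/ltW.
have -> : \sum_(i <- r | P i) x i =
   \sum_(i <- r | P i) (Num.sqrt (w i))%:C * ((Num.sqrt (w i))^-1%:C * x i).
  apply: eq_bigr => i Pi; rewrite mulrA -rcM divff ?mul1r //.
  by rewrite gt_eqF // sqrtr_gt0 w0.
apply: le_trans (CS _ _ _ _) _.
have -> : \sum_(i <- r | P i) w i = \sum_(i <- r | P i) N2 (Num.sqrt (w i))%:C.
  by apply: eq_bigr => i Pi; rewrite N2_rc sqr_sqrtr // h.
rewrite le_eqVlt; apply/orP; left; apply/eqP; congr (_ * _); apply: eq_bigr => i Pi.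
by rewrite N2M N2_rc exprVn sqr_sqrtr ?h // mulrC.
Qed.

Lemma N2_sum_card I (r : seq I) (P : pred I) (x : I -> CC) :
  N2 (\sum_(i <- r | P i) x i) <=
  (\sum_(i <- r | P i) 1) * (\sum_(i <- r | P i) N2 (x i)).
Proof.
have := @N2_sum_le I r P (fun _ => 1) x (fun i _ => ltr01).
by under [X in _ <= _ * X -> _]eq_bigr do rewrite divr1.
Qed.

(** The duality principle: a matrix and its transpose have the same norm. Testing the hypothesis on
    the conjugates of the sums to be bounded gives [S^2 <= B C S], and one factor [S] cancels. *)
Lemma duality I J (r : seq I) (P : pred I) (s : seq J) (Q : pred J) (A : I -> J -> CC) (C : R) :
  0 <= C ->
  (forall c : I -> CC, \sum_(j <- s | Q j) N2 (\sum_(i <- r | P i) c i * A i j)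
      <= C * \sum_(i <- r | P i) N2 (c i)) ->
  forall b : J -> CC, \sum_(i <- r | P i) N2 (\sum_(j <- s | Q j) b j * A i j)
      <= C * \sum_(j <- s | Q j) N2 (b j).
Proof.
move=> C0 h b.
pose c i := cj (\sum_(j <- s | Q j) b j * A i j).
set S := \sum_(i <- r | P i) _.
have S0 : 0 <= S by apply: sumr_ge0.
have SE : S = cre (\sum_(j <- s | Q j) b j * (\sum_(i <- r | P i) c i * A i j)).
  have -> : \sum_(j <- s | Q j) b j * (\sum_(i <- r | P i) c i * A i j) =
     \sum_(i <- r | P i) c i * (\sum_(j <- s | Q j) b j * A i j).
    under eq_bigr do rewrite mulr_sumr.
    rewrite exchange_big /=; apply: eq_bigr => i _; rewrite mulr_sumr.
    by apply: eq_bigr => j _; ring.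
  rewrite cre_sum; apply: eq_bigr => i _.
  by rewrite N2_mulcj mulrC.
have Sc : \sum_(i <- r | P i) N2 (c i) = S by apply: eq_bigr => i _; rewrite N2_cj.
set B := \sum_(j <- s | Q j) N2 (b j).
have B0 : 0 <= B by apply: sumr_ge0.
have S2 : S ^+ 2 <= B * (C * S).
  apply: (@le_trans _ _ (N2 (\sum_(j <- s | Q j) b j * (\sum_(i <- r | P i) c i * A i j)))).
    by rewrite SE /N2 lerDl sqr_ge0.
  by apply: le_trans (CS _ _ _ _) _; rewrite ler_wpM2l // -Sc.
have [->|Sn] := eqVneq S 0; first by rewrite mulr_ge0.
have Sp : 0 < S by rewrite lt_def Sn.
by move: S2; rewrite expr2 mulrA ler_pM2r // [B * C]mulrC.
Qed.

(** * Additive characters and geometric sums *)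

Definition eix (x : R) : CC := Complex (cos x) (sin x).
Lemma eixD x y : eix (x + y) = eix x * eix y.
Proof.
apply: cplx_eq; rewrite ?cE /=; first by rewrite [LHS]cos_plus.
by rewrite [LHS]sin_plus RplusE !RmultE; ring.
Qed.
Lemma eix0 : eix 0 = 1.
Proof. by apply: cplx_eq; rewrite /= ?cos_0 ?sin_0. Qed.
Lemma N2_eix x : N2 (eix x) = 1.
Proof.
rewrite /N2 /= addrC; have := sin2_cos2 x; rewrite /Rsqr => h.
by rewrite !expr2; exact: h.
Qed.
Lemma cabs_eix x : cabs (eix x) = 1. Proof. by rewrite /cabs N2_eix sqrtr1. Qed.
Lemma eixN x : eix (- x) = cj (eix x).
Proof. by apply: cplx_eq; rewrite ?cE /= ?[LHS]cos_neg ?[LHS]sin_neg. Qed.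

Lemma eixMn x n : eix (n%:R * x) = eix x ^+ n.
Proof.
elim: n => [|n IH]; first by rewrite mul0r eix0 expr0.
by rewrite -natr1 mulrDl mul1r eixD IH exprSr.
Qed.

Lemma R2E : (2 : R) = IZR 2. Proof. by rewrite IZRposE INRE. Qed.
Lemma N2_eixB1 x : N2 (eix x - 1) = 4 * sin (x / 2) ^+ 2.
Proof.
rewrite /N2 !cE /=.
have hx : x = 2 * (x / 2) by field.
have c2 : cos x = 1 - 2 * sin (x / 2) ^+ 2.
  rewrite {1}hx; have := cos_2a_sin (x / 2).
  by rewrite RminusE !RmultE -R2E R1E => ->; rewrite expr2; ring.
have := N2_eix x; rewrite /N2 /= => h; rewrite c2 in h *.
lra.
Qed.

Lemma sin_le_id x : 0 <= x -> sin x <= x.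
Proof.
rewrite le_eqVlt => /orP[/eqP <-|/RltP h]; first by rewrite sin_0.
by apply/RleP/Rlt_le/sin_lt_x.
Qed.

Lemma sqr_sin_le x : sin x ^+ 2 <= x ^+ 2.
Proof.
wlog x0 : x / 0 <= x.
  move=> h; have [|/ltW x0] := lerP 0 x; first exact: h.
  have := h (- x); rewrite oppr_ge0 => /(_ x0).
  by rewrite [sin _]sin_neg RoppE !sqrrN.
have := sin_le_id x0; have := sin_le_id (x := 1).
have [x1|x1] := lerP x 1.
  move=> _ h; rewrite ler_pXn2r ?nnegrE //.
  apply/RleP/sin_ge_0; first exact/RleP.
  apply: (Rle_trans _ (IZR 1)); first exact/RleP.
  by have := PI2_1; have := PI_RGT_0; Lra.lra.
move=> _ _; apply: (@le_trans _ _ 1).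
  by have := N2_eix x; rewrite /N2 /=; have := sqr_ge0 (cos x); lra.
by rewrite -[1](expr1n _ 2) ler_pXn2r ?nnegrE //; lra.
Qed.

Lemma N2_eixB1_le x : N2 (eix x - 1) <= x ^+ 2.
Proof. by rewrite N2_eixB1; have := sqr_sin_le (x / 2); rewrite exprMn; lra. Qed.

(** The Taylor minorant [x - x^3/6] is at least [x/3] as long as [x^2 <= 4]. *)
Lemma third_le_sin x : 0 <= x -> x <= 2 -> x / 3 <= sin x.
Proof.
move=> x0 x2.
have x0' : (Rle 0 x) by exact/RleP.
have x4' : (Rle x (IZR 4)).
  by apply: (Rle_trans _ (IZR 2)); [apply/RleP; rewrite -R2E | Lra.lra].
have [h _] := pre_sin_bound x 0 x0' x4'.
apply: le_trans (_ : x - x ^+ 3 / 6 <= _).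
  have : 0 <= x * ((2 - x) * (2 + x)) by rewrite !mulr_ge0 //; lra.
  lra.
move/RleP: h; apply: le_trans.
rewrite le_eqVlt; apply/orP; left; apply/eqP.
rewrite /sin_approx /sin_term /=.
rewrite !RplusE !RmultE /Rdiv !RmultE !RinvE !R1E.
have -> : IZR (-1) = -1 :> R by [].
by field.
Qed.

(** The right side is [4 sin(x/2)^2], and [PI <= 4] keeps [x/2] in the range where the sine is at
    least a third of its argument. *)
Lemma sqr_le_N2_eixB1 x : `|x| <= PI -> x ^+ 2 / 9 <= N2 (eix x - 1).
Proof.
have p4 : PI <= 4.
  have -> : (4 : R) = IZR 4 by rewrite IZRposE INRE.
  by apply/RleP; exact: PI_4.
rewrite N2_eixB1.
wlog x0 : x / 0 <= x.
  move=> h; have [|/ltW x0] := lerP 0 x; first exact: h.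
  move=> hx; have := h (- x); rewrite oppr_ge0 normrN => /(_ x0 hx).
  by rewrite mulNr [sin _]sin_neg RoppE !sqrrN.
rewrite ger0_norm // => hx.
have h := @third_le_sin (x / 2).
have {}h : x / 6 <= sin (x / 2) by have := h; lra.
have : (x / 6) ^+ 2 <= sin (x / 2) ^+ 2.
  by rewrite ler_pXn2r ?nnegrE //; [lra | apply: le_trans h; lra].
rewrite exprMn; lra.
Qed.

Lemma geom_eix_le (u : R) (N : nat) : u != 0 -> `|u| <= PI ->
  N2 (\sum_(k < N) eix (k%:R * u)) <= 36 / u ^+ 2.
Proof.
move=> u0 hu.
have e : (eix u - 1) * (\sum_(k < N) eix (k%:R * u)) = eix (N%:R * u) - 1.
  under eq_bigr do rewrite eixMn.
  by rewrite -subrX1 eixMn.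
have h1 : N2 (eix (N%:R * u) - 1) <= 4.
  by apply: le_trans (N2B_le _ _) _; rewrite N2_eix N21; lra.
have u2 : 0 < u ^+ 2 by rewrite exprn_even_gt0.
have := sqr_le_N2_eixB1 hu; rewrite ler_pdivlMr //.
set S := \sum_(k < N) _ in e *.
move: h1; rewrite -e N2M => h1 h2.
have := ler_wpM2r (N2_ge0 S) h2; have := h1; lra.
Qed.

Definition hid (P : Prop) : Prop := P.

(* [lra] inspects the whole context, which is slow in long proofs; [lra_of] only lets it see the listed facts. *)
Ltac hide_ctx := repeat match goal with
  | H : is_true ?P |- _ => change (hid (is_true P)) in H
  | H : @eq ?T ?x ?y |- _ => change (hid (@eq T x y)) in H end.
Ltac hlra := hide_ctx; lra.
Tactic Notation "lra_of" ne_constr_list(l) := generalize l; hlra.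

Ltac pos := repeat first
  [ assumption | exact: N2_ge0 | exact: cabs_ge0 | exact: sqr_ge0 | exact: normr_ge0 | exact: ler0n
  | exact: ler01 | exact: ltr01 | exact: sqrtr_ge0 | exact: ltr0Sn
  | lazymatch goal with
    | |- is_true (@Order.le _ _ _ (@GRing.mul _ _ _)) => apply: mulr_ge0
    | |- is_true (@Order.le _ _ _ (@Algebra.add _ _ _)) => apply: addr_ge0
    | |- is_true (@Order.le _ _ _ (@GRing.inv _ _)) => rewrite invr_ge0
    | |- is_true (@Order.le _ _ _ (@GRing.exp _ _ _)) => apply: exprn_ge0
    | |- is_true (@Order.lt _ _ _ (@GRing.mul _ _ _)) => apply: mulr_gt0
    | |- is_true (@Order.lt _ _ _ (@Algebra.add _ _ _)) => apply: addr_gt0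
    | |- is_true (@Order.lt _ _ _ (@GRing.inv _ _)) => rewrite invr_gt0
    | |- is_true (@Order.lt _ _ _ (@GRing.exp _ _ _)) => apply: exprn_gt0
    | |- is_true (@Order.le _ _ _ (\sum_(_ <- _ | _) _)) => apply: sumr_ge0 => ? ?
    | |- is_true (@Order.le _ _ _ _) => apply: ltW; assumption
    end
  | done ].

(** * Logarithms and the mean value theorem for Dirichlet polynomials *)

Lemma lnM (x y : R) : 0 < x -> 0 < y -> ln (x * y) = ln x + ln y.
Proof. by move=> /RltP hx /RltP hy; exact: ln_mult. Qed.
Lemma ln_one : ln 1 = 0. Proof. exact: ln_1. Qed.
Lemma lnV (x : R) : 0 < x -> ln x^-1 = - ln x.
Proof. by move=> /RltP hx; rewrite -RinvE ln_Rinv. Qed.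
Lemma ln_div (x y : R) : 0 < x -> 0 < y -> ln (x / y) = ln x - ln y.
Proof. by move=> hx hy; rewrite lnM ?invr_gt0 // lnV. Qed.
Lemma ltr_ln (x y : R) : 0 < x -> x < y -> ln x < ln y.
Proof. by move=> /RltP hx /RltP hy; apply/RltP; exact: ln_increasing. Qed.
Lemma ler_ln (x y : R) : 0 < x -> x <= y -> ln x <= ln y.
Proof.
by move=> x0; rewrite le_eqVlt => /orP[/eqP->//|h]; apply/ltW/ltr_ln.
Qed.
Lemma expK (x : R) : ln (exp x) = x. Proof. exact: ln_exp. Qed.
Lemma lnK (x : R) : 0 < x -> exp (ln x) = x. Proof. by move/RltP; exact: exp_ln. Qed.
Lemma expD (x y : R) : exp (x + y) = exp x * exp y. Proof. exact: exp_plus. Qed.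
Lemma exp_gt0 (x : R) : 0 < exp x. Proof. by apply/RltP; exact: exp_pos. Qed.
Lemma exp_ge0 (x : R) : 0 <= exp x. Proof. exact/ltW/exp_gt0. Qed.
#[export] Hint Resolve exp_gt0 exp_ge0 : core.
Lemma expN (x : R) : exp (- x) = (exp x)^-1. Proof. by rewrite -RinvE -exp_Ropp. Qed.
Lemma exp_zero : exp 0 = 1. Proof. exact: exp_0. Qed.
Lemma ltr_exp (x y : R) : (exp x < exp y) = (x < y).
Proof.
apply/idP/idP => [/RltP h|/RltP h]; apply/RltP; [exact: exp_lt_inv|exact: exp_increasing].
Qed.
Lemma ler_exp (x y : R) : (exp x <= exp y) = (x <= y).
Proof. by rewrite !leNgt ltr_exp. Qed.
Lemma expMn (x : R) n : exp (n%:R * x) = exp x ^+ n.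
Proof.
elim: n => [|n IH]; first by rewrite mul0r exp_zero expr0.
by rewrite -natr1 mulrDl mul1r expD IH exprSr.
Qed.
Lemma exp_ge1D (x : R) : 1 + x <= exp x. Proof. by apply/RleP; exact: exp_ineq1_le. Qed.
Lemma ln_le_subr1 (x : R) : 0 < x -> ln x <= x - 1.
Proof. by move=> x0; have := exp_ge1D (ln x); rewrite lnK //; lra. Qed.
Lemma ln_ge (x : R) : 0 < x -> 1 - x^-1 <= ln x.
Proof. by move=> x0; have := @ln_le_subr1 x^-1; rewrite invr_gt0 lnV // => /(_ x0); lra. Qed.
Lemma ln_ge0 (x : R) : 1 <= x -> 0 <= ln x.
Proof. by move=> h; rewrite -ln_one ler_ln. Qed.
Lemma ln_le_exp (x y : R) : 0 < x -> (ln x <= y) = (x <= exp y).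
Proof. by move=> x0; rewrite -ler_exp lnK. Qed.
Lemma ln_ge_exp (x y : R) : 0 < x -> (y <= ln x) = (exp y <= x).
Proof. by move=> x0; rewrite -ler_exp lnK. Qed.
Lemma ln_lt_exp (x y : R) : 0 < x -> (ln x < y) = (x < exp y).
Proof. by move=> x0; rewrite -ltr_exp lnK. Qed.
Lemma ln_gt_exp (x y : R) : 0 < x -> (y < ln x) = (exp y < x).
Proof. by move=> x0; rewrite -ltr_exp lnK. Qed.

Definition lnn (n : nat) : R := ln n%:R.
Lemma lnnM m n : (0 < m)%N -> (0 < n)%N -> lnn (m * n) = lnn m + lnn n.
Proof. by move=> m0 n0; rewrite /lnn natrM lnM ?ltr0n. Qed.
Lemma lnn1 : lnn 1 = 0. Proof. exact: ln_one. Qed.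
Lemma ler_lnn m n : (0 < m)%N -> (m <= n)%N -> lnn m <= lnn n.
Proof. by move=> m0 h; rewrite ler_ln ?ltr0n ?ler_nat. Qed.
Lemma ltr_lnn m n : (0 < m)%N -> (m < n)%N -> lnn m < lnn n.
Proof. by move=> m0 h; rewrite ltr_ln ?ltr0n ?ltr_nat. Qed.
Lemma lnn_ge0 n : (0 < n)%N -> 0 <= lnn n.
Proof. by move=> h; rewrite ln_ge0 // ler1n. Qed.
Lemma lnnS_ge m : (0 < m)%N -> m.+1%:R^-1 <= lnn m.+1 - lnn m.
Proof.
move=> m0; rewrite /lnn -ln_div ?ltr0n //.
apply: le_trans (ln_ge _); last by rewrite divr_gt0 ?ltr0n.
rewrite invf_div -natr1; have : (m%:R : R) + 1 != 0 by rewrite natr1 pnatr_eq0.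
by move=> h; rewrite le_eqVlt; apply/orP; left; apply/eqP; field.
Qed.
Lemma lnnS_le m : (0 < m)%N -> lnn m.+1 - lnn m <= m%:R^-1.
Proof.
move=> m0; rewrite /lnn -ln_div ?ltr0n //.
apply: le_trans (ln_le_subr1 _) _; first by rewrite divr_gt0 ?ltr0n.
rewrite -natr1; have : (m%:R : R) != 0 by rewrite pnatr_eq0 -lt0n.
by move=> h; rewrite le_eqVlt; apply/orP; left; apply/eqP; field.
Qed.

Section MeanValue.
Variable (T : R).
Hypothesis T0 : 0 < T.

(** [T] times the summand is at most the decrease of [1 / (1 + T log(m/n))] from [m - 1] to [m],
    because [1/m <= log m - log(m-1)]; the sum telescopes. *)
Lemma schur_up n Z : (0 < n)%N ->
  \sum_(n.+1 <= m < Z) m%:R^-1 / (1 + T * (lnn m - lnn n)) ^+ 2 <= T^-1.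
Proof.
move=> n0.
pose f m : R := (1 + T * (lnn m - lnn n))^-1.
have fge m : (n <= m)%N -> 0 < 1 + T * (lnn m - lnn n).
  by move=> h; apply: ltr_pwDl => //; rewrite mulr_ge0 ?subr_ge0 ?ler_lnn // ltW.
suff key : forall k, T * (\sum_(n.+1 <= m < n.+1 + k) m%:R^-1 / (1 + T * (lnn m - lnn n)) ^+ 2) <= 1 - f (n + k)%N.
  have [h|h] := leqP Z n.+1.
    by rewrite big_geq // invr_ge0 ltW.
  rewrite -(subnKC (ltnW h)).
  rewrite -[T^-1]mul1r ler_pdivlMr // mulrC; apply: le_trans (key _) _.
  by rewrite gerBl invr_ge0 ltW // fge // leq_addr.
elim=> [|k IH].
  by rewrite addn0 big_geq // mulr0 addn0 /f subrr mulr0 addr0 invr1 subrr.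
rewrite [(n.+1 + _)%N]addnS big_nat_recr ?leq_addr //= mulrDr -[(n + k.+1)%N]addSnnS.
set m := (n.+1 + k)%N.
suff : T * (m%:R^-1 / (1 + T * (lnn m - lnn n)) ^+ 2) <= f (n + k)%N - f m.
  by move: IH; rewrite -/m; lra.
have a0 : 0 < 1 + T * (lnn (n + k) - lnn n) by rewrite fge // leq_addr.
have b0 : 0 < 1 + T * (lnn m - lnn n) by rewrite fge // /m addSn leqW // leq_addr.
have hm : m%:R^-1 <= lnn m - lnn (n + k).
  by rewrite /m addSn lnnS_ge // addn_gt0 n0.
rewrite /f; set a := 1 + _ in a0 *; set b := 1 + _ in b0 *.
have ab : b - a = T * (lnn m - lnn (n + k)) by rewrite /a /b; ring.
have m0 : 0 < m%:R^-1 :> R by rewrite invr_gt0 ltr0n.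
have -> : a^-1 - b^-1 = (b - a) / (a * b).
  by field; rewrite !gt_eqF.
rewrite ab -!mulrA ler_pM2l //.
apply: ler_pM => //; [exact: ltW | by rewrite invr_ge0 exprn_ge0 // ltW |].
rewrite lef_pV2 ?posrE ?mulr_gt0 ?exprn_gt0 // expr2 ler_pM2r //.
by rewrite -subr_ge0 ab mulr_ge0 ?ltW // (lt_le_trans m0).
Qed.

(** Below [n] the term at [m] is compared with the increment of the logarithm to its right,
    [1/m <= 2 (log(m+1) - log m)], which costs the factor 2. *)
Lemma schur_down n : (0 < n)%N ->
  \sum_(1 <= m < n) m%:R^-1 / (1 + T * (lnn n - lnn m)) ^+ 2 <= 2 / T.
Proof.
move=> n0.
pose f m : R := (1 + T * (lnn n - lnn m))^-1.
have fge m : (0 < m)%N -> (m <= n)%N -> 0 < 1 + T * (lnn n - lnn m).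
  by move=> m0 h; apply: ltr_pwDl => //; rewrite mulr_ge0 ?subr_ge0 ?ler_lnn // ltW.
suff key : forall k, (0 < k <= n)%N ->
    T * (\sum_(1 <= m < k) m%:R^-1 / (1 + T * (lnn n - lnn m)) ^+ 2) <= 2 * f k.
  rewrite ler_pdivlMr // mulrC; apply: le_trans (key _ _) _; first by rewrite n0 leqnn.
  by rewrite /f subrr mulr0 addr0 invr1 mulr1.
case=> // k; elim: k => [|k IH] /andP[_ hk].
  by rewrite big_geq // mulr0 mulr_ge0 // invr_ge0 ltW // fge.
rewrite big_nat_recr //= mulrDr.
set m := k.+1 in hk *.
suff : T * (m%:R^-1 / (1 + T * (lnn n - lnn m)) ^+ 2) <= 2 * (f m.+1 - f m).
  by move: (IH (ltnW hk)); lra.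
have a0 : 0 < 1 + T * (lnn n - lnn m.+1) by rewrite fge.
have b0 : 0 < 1 + T * (lnn n - lnn m) by rewrite fge // ltnW.
have m0 : 0 < m%:R^-1 :> R by rewrite invr_gt0 ltr0n.
have hm : m%:R^-1 <= 2 * (lnn m.+1 - lnn m).
  apply: le_trans (_ : 2 * m.+1%:R^-1 <= _); last by rewrite ler_pM2l // lnnS_ge.
  have m1 : m%:R^-1 <= 1 :> R by rewrite invf_le1 ?ltr0n ?ler1n.
  rewrite ler_pdivlMr ?ltr0n // -natr1 mulrDr mulVf ?pnatr_eq0 // mulr1; lra.
rewrite /f; set a := 1 + _ in a0 *; set b := 1 + _ in b0 *.
have ab : b - a = T * (lnn m.+1 - lnn m) by rewrite /a /b; ring.
have -> : 2 * (a^-1 - b^-1) = T * ((2 * (lnn m.+1 - lnn m)) / (a * b)).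
  have -> : T * ((2 * (lnn m.+1 - lnn m)) / (a * b)) = 2 * (b - a) / (a * b) by rewrite ab; ring.
  by field; rewrite !gt_eqF.
rewrite ler_pM2l //.
apply: ler_pM => //; [exact: ltW | by rewrite invr_ge0 exprn_ge0 // ltW |].
rewrite lef_pV2 ?posrE ?mulr_gt0 ?exprn_gt0 // expr2 ler_pM2r //.
by rewrite -subr_ge0 ab mulr_ge0 ?ltW // subr_gt0 ltr_lnn.
Qed.

Lemma schur_sum n Z : (0 < n)%N ->
  \sum_(1 <= m < Z) m%:R^-1 / (1 + T * `|lnn n - lnn m|) ^+ 2 <= 3 / T + n%:R^-1.
Proof.
move=> n0.
pose F m : R := m%:R^-1 / (1 + T * `|lnn n - lnn m|) ^+ 2.
have F0 m : 0 <= F m.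
  by rewrite divr_ge0 ?invr_ge0 ?ler0n // exprn_ge0 // addr_ge0 // mulr_ge0 // ltW.
(* The range is enlarged so that it contains the diagonal term [m = n]. *)
pose Z' := (maxn Z n.+1).
apply: le_trans (_ : \sum_(1 <= m < Z') F m <= _).
  have h : (Z <= Z')%N by rewrite leq_max leqnn.
  have [z1|z1] := leqP Z 1.
    by rewrite big_geq // sumr_ge0.
  by rewrite [X in _ <= X](big_cat_nat (n := Z)) //=; [rewrite lerDl sumr_ge0|exact: ltnW].
have nZ : (n < Z')%N by rewrite leq_max leqnn orbT.
rewrite (big_cat_nat (n := n)) //= ?(ltnW nZ) // [X in _ + X]big_ltn //.
have -> : F n = n%:R^-1 by rewrite /F subrr normr0 mulr0 addr0 expr1n divr1.
have h1 := schur_down n0; have h2 := schur_up Z' n0.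
have e1 : \sum_(1 <= m < n) F m = \sum_(1 <= m < n) m%:R^-1 / (1 + T * (lnn n - lnn m)) ^+ 2.
  apply: eq_big_nat => m /andP[m1 mn]; rewrite /F ger0_norm // subr_ge0 ler_lnn //.
  exact: ltnW.
have e2 : \sum_(n.+1 <= m < Z') F m = \sum_(n.+1 <= m < Z') m%:R^-1 / (1 + T * (lnn m - lnn n)) ^+ 2.
  apply: eq_big_nat => m /andP[m1 mn]; rewrite /F distrC ger0_norm // subr_ge0 ler_lnn //.
  exact: ltnW.
by rewrite e1 e2; move: h1 h2; lra.
Qed.
End MeanValue.

(* Fejer averaging: every difference k - 0 with k < N occurs N times among the
   differences i - j with i, j < 2N. *)
Lemma fejer_le (phi : R -> R) N : (forall x, 0 <= phi x) ->
  N%:R * (\sum_(k < N) phi k%:R) <= \sum_(0 <= i < N + N) \sum_(0 <= j < N + N) phi (i%:R - j%:R).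
Proof.
move=> phi0.
have -> : N%:R * (\sum_(k < N) phi k%:R) = \sum_(0 <= j < N) \sum_(0 <= k < N) phi k%:R.
  by rewrite sumr_const_nat subn0 big_mkord mulr_natl.
rewrite [X in _ <= X]exchange_big /=.
apply: le_trans (_ : \sum_(0 <= j < N) \sum_(0 <= i < N + N) phi (i%:R - j%:R) <= _).
  apply: ler_sum_nat => j /andP[_ jN].
  have -> : \sum_(0 <= k < N) phi k%:R = \sum_(j <= i < N + j) phi (i%:R - j%:R).
    rewrite -{1}[j]add0n big_addn addnK; apply: eq_bigr => k _.
    by rewrite natrD addrK.
  rewrite [X in _ <= X](big_cat_nat (n := j)) //=; last by rewrite (leq_trans (ltnW jN)) // leq_addr.
  rewrite -[X in X <= _]add0r; apply: lerD; first by rewrite sumr_ge0.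
  rewrite [X in _ <= X](big_cat_nat (n := (N + j)%N)) //= ?leq_addl ?leq_add2l 1?ltnW //.
  by rewrite lerDl sumr_ge0.
rewrite [X in _ <= X](big_cat_nat (n := N)) //= ?leq_addr //.
by rewrite lerDl sumr_ge0 // => *; rewrite sumr_ge0.
Qed.

(** Averaging over pairs [(i, j)] gives each pair [(n, m)] a squared modulus as weight. Its
    nonnegativity allows the coefficients to be bounded by their moduli in the mean value
    theorem. *)
Lemma sum_sum_N2 I J (r : seq I) (s : seq J) (c : I -> CC) (x : I -> J -> CC) :
  \sum_(i <- s) \sum_(j <- s) N2 (\sum_(n <- r) c n * (x n i * cj (x n j))) =
  \sum_(n <- r) \sum_(m <- r) cre (c n * cj (c m)) * N2 (\sum_(i <- s) x n i * cj (x m i)).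
Proof.
transitivity (cre (\sum_(n <- r) \sum_(m <- r) c n * cj (c m) *
    (N2 (\sum_(i <- s) x n i * cj (x m i)))%:C)); last first.
  rewrite cre_sum; apply: eq_bigr => n _; rewrite cre_sum; apply: eq_bigr => m _.
  by rewrite creM cre_rc cim_rc mulr0 subr0.
under eq_bigr do under eq_bigr do rewrite N2_mulcj cj_sum mulr_suml.
under eq_bigr do rewrite -cre_sum; rewrite -cre_sum; congr cre.
under eq_bigr do under eq_bigr do under eq_bigr do rewrite mulr_sumr.
under eq_bigr => i _.
  rewrite exchange_big; under eq_bigr => n _ do rewrite exchange_big.
  over.
rewrite exchange_big; apply: eq_bigr => n _.
rewrite exchange_big; apply: eq_bigr => m _.
rewrite -mulcj cj_sum mulr_suml mulr_sumr; apply: eq_bigr => i _.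
rewrite !mulr_sumr; apply: eq_bigr => j _.
by rewrite !cjM !cjK; ring.
Qed.

(** The classical bound by [n + T], with the integral over [t] replaced by a sum over a lattice.
    Since [theta * log Z <= PI], no phase difference wraps around the circle, and the squared kernel
    decays like [(1 + T |log(n/m)|)^-2]. Schur's test with the row sums [3/T + 1/n] concludes; the
    constant is [3 * 144]. *)
Lemma mean_value (theta t0 : R) (N Z : nat) (b : nat -> CC) :
  0 < theta -> theta * lnn Z <= PI ->
  theta * \sum_(k < N) N2 (\sum_(1 <= n < Z) b n * eix (- ((t0 + theta * k%:R) * lnn n)))
  <= 432 * \sum_(1 <= n < Z) N2 (b n) * (n%:R + theta * N%:R).
Proof.
move=> th0 hZ.
case: N => [|N'].
  rewrite big_ord0 mulr0 mulr_ge0 // sumr_ge0 // => n _.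
  by rewrite mulr_ge0 // addr_ge0 ?ler0n // mulr_ge0 ?ler0n // ltW.
set N := N'.+1; have N0 : 0 < N%:R :> R by rewrite ltr0n.
pose T := theta * N%:R; have T0 : 0 < T by rewrite mulr_gt0.
pose c n := b n * eix (- (t0 * lnn n)).
have cN n : N2 (c n) = N2 (b n) by rewrite /c N2M N2_eix mulr1.
pose phi (x : R) := N2 (\sum_(1 <= n < Z) c n * eix (- (theta * x * lnn n))).
have -> : \sum_(k < N) N2 (\sum_(1 <= n < Z) b n * eix (- ((t0 + theta * k%:R) * lnn n))) =
          \sum_(k < N) phi k%:R.
  apply: eq_bigr => k _; congr N2; apply: eq_bigr => n _.
  by rewrite /c -mulrA -eixD; congr (_ * eix _); ring.
pose e n (i : nat) := eix (- (theta * i%:R * lnn n)).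
pose G n m := N2 (\sum_(0 <= i < N + N) e n i * cj (e m i)).
have GE n m : G n m = N2 (\sum_(k < N + N) eix (k%:R * (theta * (lnn m - lnn n)))).
  rewrite /G big_mkord; congr N2; apply: eq_bigr => i _; rewrite /e -eixN -eixD; congr eix; ring.
have S1 : \sum_(0 <= i < N + N) \sum_(0 <= j < N + N) phi (i%:R - j%:R) =
   \sum_(1 <= n < Z) \sum_(1 <= m < Z) cre (c n * cj (c m)) * G n m.
  rewrite -sum_sum_N2; apply: eq_bigr => i _; apply: eq_bigr => j _; congr N2.
  apply: eq_bigr => n _; congr (_ * _); rewrite /e -eixN -eixD; congr eix; ring.
have Gle n m : (1 <= n < Z)%N -> (1 <= m < Z)%N ->
    G n m <= 144 * N%:R ^+ 2 / (1 + T * `|lnn n - lnn m|) ^+ 2.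
  move=> /andP[n1 nZ] /andP[m1 mZ].
  set D := `|lnn n - lnn m|; have D0 : 0 <= D by exact: normr_ge0.
  have TD : 0 <= T * D by exact: mulr_ge0 (ltW T0) D0.
  have d0 : 0 < (1 + T * D) ^+ 2 by rewrite exprn_gt0 // ltr_pwDl.
  rewrite ler_pdivlMr //.
  have [h|h] := lerP (T * D) 1.
    have G4 : G n m <= 4 * N%:R ^+ 2.
      apply: le_trans (N2_sum_card _ _ _) _.
      rewrite [X in _ * X](eq_bigr (fun=> 1)); last by move=> i _; rewrite N2M N2_cj !N2_eix mulr1.
      by rewrite sumr_const_nat subn0 natrD; lra.
    apply: le_trans (ler_wpM2r (ltW d0) G4) _.
    have h4 : (1 + T * D) ^+ 2 <= 4.
      by have -> : 4 = 2 ^+ 2 :> R by [rewrite -natrX]; rewrite ler_pXn2r ?nnegrE //; lra.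
    have := sqr_ge0 (N%:R : R); have := ler_wpM2l (sqr_ge0 (N%:R : R)) h4; lra.
  have D1 : 0 < D by rewrite -(pmulr_rgt0 _ T0); lra.
  have u0 : theta * (lnn m - lnn n) != 0.
    apply: mulf_neq0; first by rewrite gt_eqF.
    by rewrite -normr_eq0 distrC gt_eqF.
  have uP : `|theta * (lnn m - lnn n)| <= PI.
    rewrite normrM gtr0_norm // distrC.
    apply: le_trans hZ; rewrite ler_pM2l // ler_norml.
    have := lnn_ge0 n1; have := lnn_ge0 m1.
    have := ler_lnn n1 (ltnW nZ); have := ler_lnn m1 (ltnW mZ); lra.
  have G36 : G n m <= 36 / (theta * D) ^+ 2.
    rewrite GE; apply: le_trans (geom_eix_le _ u0 uP) _.
    by rewrite !exprMn /D real_normK ?num_real // -[lnn n - _]opprB sqrrN.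
  apply: le_trans (ler_wpM2r (ltW d0) G36) _.
  rewrite mulrAC ler_pdivrMr ?exprn_gt0 ?mulr_gt0 //.
  have -> : 144 * N%:R ^+ 2 * (theta * D) ^+ 2 = 36 * (2 * (T * D)) ^+ 2 by rewrite /T; ring.
  by rewrite ler_pM2l // ler_pXn2r ?nnegrE //; lra.
have main : \sum_(1 <= n < Z) \sum_(1 <= m < Z) cre (c n * cj (c m)) * G n m <=
   \sum_(1 <= n < Z) N2 (b n) * n%:R * (144 * N%:R ^+ 2 * (3 / T + n%:R^-1)).
  (* Schur's test needs the weights [n/m] and [m/n], since the row sums are bounded with respect to
     the measure [1/m]. *)
  pose H n m : R := N2 (b n) * n%:R * (m%:R^-1 * (144 * N%:R ^+ 2 / (1 + T * `|lnn n - lnn m|) ^+ 2)).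
  apply: le_trans (_ : \sum_(1 <= n < Z) \sum_(1 <= m < Z) (H n m + H m n) / 2 <= _); last first.
    have -> : \sum_(1 <= n < Z) \sum_(1 <= m < Z) (H n m + H m n) / 2 =
       \sum_(1 <= n < Z) \sum_(1 <= m < Z) H n m.
      under eq_bigr do rewrite -mulr_suml big_split /=.
      rewrite -mulr_suml big_split /= [X in _ + X]exchange_big /=; lra.
    apply: ler_sum_nat => n /andP[n1 _]; rewrite -mulr_sumr ler_wpM2l ?mulr_ge0 ?ler0n //.
    have := schur_sum T0 Z n1.
    set S := (X in X <= _ -> _) => hS.
    rewrite (_ : \sum_(1 <= m < Z) _ = 144 * N%:R ^+ 2 * S); last first.
      by rewrite /S mulr_sumr; apply: eq_bigr => m _; ring.
    by rewrite ler_wpM2l // mulr_ge0 ?exprn_ge0.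
  apply: ler_sum_nat => n hn; apply: ler_sum_nat => m hm.
  have n0 : 0 < n%:R :> R by rewrite ltr0n; case/andP: hn.
  have m0 : 0 < m%:R :> R by rewrite ltr0n; case/andP: hm.
  have h := Gle _ _ hn hm.
  set K := 144 * N%:R ^+ 2 / (1 + T * `|lnn n - lnn m|) ^+ 2 in h.
  have K0 : 0 <= K by exact: le_trans (N2_ge0 _) h.
  have -> : (H n m + H m n) / 2 = (N2 (b n) * (n%:R / m%:R) + N2 (b m) * (m%:R / n%:R)) / 2 * K.
    by rewrite /H [`|lnn m - lnn n|]distrC -/K; ring.
  apply: le_trans (_ : (N2 (b n) * (n%:R / m%:R) + N2 (b m) * (m%:R / n%:R)) / 2 * G n m <= _).
    rewrite ler_wpM2r //; first exact: N2_ge0.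
    pose s := Num.sqrt (n%:R / m%:R : R).
    have s2 : s ^+ 2 = n%:R / m%:R by rewrite sqr_sqrtr // divr_ge0 ?ler0n.
    have s0 : 0 < s by rewrite sqrtr_gt0 divr_gt0.
    have := cre_mul_le (s%:C * c n) (s^-1%:C * c m).
    rewrite (N2M s%:C) (N2M s^-1%:C) !N2_rc !cN exprVn s2 invf_div.
    have -> : s%:C * c n * cj (s^-1%:C * c m) = c n * cj (c m).
      rewrite cjM cj_rc; have -> : s%:C * c n * (s^-1%:C * cj (c m)) = (s * s^-1)%:C * (c n * cj (c m)).
        by rewrite rcM; ring.
      by rewrite divff ?mul1r // gt_eqF.
    by lra.
  rewrite ler_wpM2l // divr_ge0 // addr_ge0 // mulr_ge0 // divr_ge0 // ltW //.
have := fejer_le N (phi := phi) (fun x => N2_ge0 _); rewrite S1 => hf.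
have {}hf := le_trans hf main.
rewrite -(ler_pM2l N0) mulrCA.
apply: le_trans (ler_wpM2l (ltW th0) hf) _.
rewrite !mulr_sumr ler_sum_nat // => n /andP[n1 _].
have n0 : n%:R != 0 :> R by rewrite pnatr_eq0 -lt0n.
have -> : theta * (N2 (b n) * n%:R * (144 * N%:R ^+ 2 * (3 / T + n%:R^-1))) =
   N%:R * (432 * (N2 (b n) * n%:R) + 144 * (N2 (b n) * (theta * N%:R))).
  by rewrite /T; field; rewrite n0 !gt_eqF.
rewrite ler_pM2l //.
have : 0 <= N2 (b n) * (theta * N%:R) by rewrite mulr_ge0 // ltW.
lra.
Qed.

(** * Discrete Fourier transform *)

Lemma PI_gt0 : 0 < PI. Proof. by apply/RltP; exact: PI_RGT_0. Qed.
Lemma PI_ge3 : 3 <= PI.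
Proof.
have h : Rlt (Rdiv (IZR 3) (IZR 2)) (Rdiv PI (IZR 2)) by exact: PI2_3_2.
have -> : (3 : R) = IZR 3 by rewrite IZRposE INRE.
by apply/RleP; Lra.lra.
Qed.
#[export] Hint Resolve PI_gt0 : core.

Lemma eix_eq1 (M d : nat) : (0 < d < M)%N -> eix (2 * PI * d%:R / M%:R) - 1 != 0.
Proof.
move=> /andP[d0 dM].
have M0 : 0 < M%:R :> R by rewrite ltr0n (leq_trans _ dM).
have D0 : 0 < d%:R :> R by rewrite ltr0n.
suff : 0 < N2 (eix (2 * PI * d%:R / M%:R) - 1).
  by apply: contraL => /eqP ->; rewrite N20 ltxx.
rewrite N2_eixB1 mulr_gt0 // exprn_gt0 //.
have -> : 2 * PI * d%:R / M%:R / 2 = PI * (d%:R / M%:R) by field; rewrite gt_eqF.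
apply/RltP/sin_gt_0; apply/RltP.
  by rewrite mulr_gt0 ?divr_gt0.
by rewrite gtr_pMr // ltr_pdivrMr // mul1r ltr_nat.
Qed.

Lemma eix_2PI : eix (2 * PI) = 1.
Proof.
apply: cplx_eq; rewrite !cE /=; have -> : 2 * PI = Rmult (IZR 2) PI by rewrite RmultE -R2E.
  by rewrite cos_2PI.
by rewrite sin_2PI.
Qed.

Lemma orth_eix (M d : nat) (x0 : R) : (0 < d < M)%N ->
  \sum_(k < M) eix (2 * PI * (k%:R - x0) * d%:R / M%:R) = 0.
Proof.
move=> h; have := eix_eq1 h.
have M0 : M%:R != 0 :> R by rewrite pnatr_eq0 -lt0n; case/andP: h => h /(ltn_trans h).
set z := eix _ => z1.
have -> : \sum_(k < M) eix (2 * PI * (k%:R - x0) * d%:R / M%:R) =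
   eix (- (2 * PI * x0 * d%:R / M%:R)) * \sum_(k < M) z ^+ k.
  rewrite mulr_sumr; apply: eq_bigr => k _; rewrite -eixMn -eixD; congr eix; ring.
have : (z - 1) * \sum_(k < M) z ^+ k = 0.
  rewrite -subrX1 -eixMn.
  have -> : M%:R * (2 * PI * d%:R / M%:R) = d%:R * (2 * PI) by field.
  by rewrite eixMn eix_2PI expr1n subrr.
by move/eqP; rewrite mulf_eq0 (negbTE z1) /= => /eqP ->; rewrite mulr0.
Qed.

Lemma cre_nat n : cre n%:R = n%:R.
Proof. by elim: n => // n IH; rewrite -!natr1 creD IH. Qed.
Lemma cim_nat n : cim n%:R = 0.
Proof. by elim: n => // n IH; rewrite -natr1 cimD IH addr0. Qed.

(** The offset [x0] lets the frequencies run over a symmetric range; it changes the coefficients by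
    unimodular factors only. *)
Lemma dft_parseval (M : nat) (x0 : R) (w : nat -> CC) : (0 < M)%N ->
  \sum_(k < M) N2 (\sum_(j < M) w j * eix (- (2 * PI * (k%:R - x0) * j%:R / M%:R))) =
  M%:R * \sum_(j < M) N2 (w j).
Proof.
move=> M0.
transitivity (cre (\sum_(k < M) \sum_(j < M) \sum_(l < M)
   w j * cj (w l) * eix (2 * PI * (k%:R - x0) * (l%:R - j%:R) / M%:R))).
  rewrite cre_sum; apply: eq_bigr => k _; rewrite N2_mulcj cj_sum mulr_suml; congr cre.
  apply: eq_bigr => j _; rewrite mulr_sumr; apply: eq_bigr => l _.
  rewrite cjM -eixN.
  transitivity (w j * cj (w l) * (eix (- (2 * PI * (k%:R - x0) * j%:R / M%:R)) *
     eix (- - (2 * PI * (k%:R - x0) * l%:R / M%:R)))); first by ring.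
  by rewrite -eixD; congr (_ * eix _); ring.
rewrite exchange_big cre_sum mulr_sumr; apply: eq_bigr => j _.
rewrite exchange_big (bigD1 j) //= [X in _ + X]big1 ?addr0; last first.
  move=> l ne; rewrite -mulr_sumr.
  suff -> : \sum_(k < M) eix (2 * PI * (k%:R - x0) * (l%:R - j%:R) / M%:R) = 0 by rewrite mulr0.
  have [lt|lt|/val_inj eq] := ltngtP l j; last by rewrite eq eqxx in ne.
    have := @orth_eix M (j - l) x0; rewrite subn_gt0 lt (leq_ltn_trans (leq_subr _ _)) // => /(_ isT).
    move/(congr1 cj); rewrite cj_sum [in RHS]/cj conjc0 => h; rewrite -[RHS]h.
    apply: eq_bigr => k _; rewrite -eixN natrB 1?ltnW //; congr eix; ring.
  have := @orth_eix M (l - j) x0; rewrite subn_gt0 lt (leq_ltn_trans (leq_subr _ _)) // => /(_ isT).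
  by move=> h; rewrite -[RHS]h; apply: eq_bigr => k _; rewrite natrB 1?ltnW.
rewrite -mulr_sumr (eq_bigr (fun=> 1)); last by move=> k _; rewrite subrr mulr0 mul0r eix0.
rewrite sumr_const card_ord mulcj.
by rewrite creM cre_rc cim_rc mul0r subr0 mulrC cre_nat.
Qed.

Definition symsum (N : nat) (phi : R -> R) : R :=
  phi 0 + \sum_(1 <= k < N.+1) (phi k%:R + phi (- k%:R)).

Lemma symsumS N phi : symsum N.+1 phi = symsum N phi + (phi N.+1%:R + phi (- N.+1%:R)).
Proof. by rewrite /symsum big_nat_recr //= addrA. Qed.

Lemma symsum_ord N phi : symsum N phi = \sum_(k < N.*2.+1) phi (k%:R - N%:R).
Proof.
elim: N phi => [|N IH] phi.
  by rewrite /symsum big_geq // big_ord1 addr0 subr0.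
rewrite symsumS IH doubleS [RHS]big_ord_recl [in RHS]big_ord_recr /= sub0r.
have -> : (bump 0 N.*2.+1)%:R - N.+1%:R = N.+1%:R :> R.
  by rewrite /bump /= add1n -addnn -!natr1 natrD; ring.
have -> : \sum_(i < N.*2.+1) phi ((bump 0 i)%:R - N.+1%:R) = \sum_(k < N.*2.+1) phi (k%:R - N%:R).
  by apply: eq_bigr => k _; rewrite /bump /= add1n -!natr1; congr phi; ring.
ring.
Qed.

Lemma symsum_le N phi psi :
  (forall x, `|x| <= N%:R -> phi x <= psi x) -> symsum N phi <= symsum N psi.
Proof.
move=> h; apply: lerD; first by apply: h; rewrite normr0 ler0n.
apply: ler_sum_nat => k /andP[k1 kN]; apply: lerD; apply: h; rewrite ?normrN normr_nat ler_nat.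
  by rewrite -ltnS. by rewrite -ltnS.
Qed.

(** Summation by parts: linear growth of the partial sums makes the tail weighted by [1/k^2] of size
    [A1/k1], beside the constant part [A0/k1^2]. The induction carries the boundary term along. *)
Lemma tail_sum (g : nat -> R) (A0 A1 : R) (k1 k2 : nat) :
  (forall k, 0 <= g k) -> 0 <= A0 -> 0 <= A1 -> (0 < k1)%N -> (k1 <= k2)%N ->
  (forall N, \sum_(1 <= k < N.+1) g k <= A0 + A1 * N%:R) ->
  \sum_(k1.+1 <= k < k2.+1) g k / k%:R ^+ 2 <= 2 * A0 / k1%:R ^+ 2 + 3 * A1 / k1%:R.
Proof.
move=> g0 A00 A10 k10 k12 hG.
pose G N := \sum_(1 <= k < N.+1) g k.
have k1R : 0 < k1%:R :> R by rewrite ltr0n.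
suff key : forall d, \sum_(k1.+1 <= k < (k1 + d).+1) g k / k%:R ^+ 2 <=
   G (k1 + d)%N / (k1 + d)%:R ^+ 2 + A0 * (k1%:R ^- 2 - (k1 + d)%:R ^- 2) +
   2 * A1 * (k1%:R^-1 - (k1 + d)%:R^-1).
  have := key (k2 - k1)%N; rewrite subnKC // => h; apply: le_trans h _.
  have k2R : 0 < k2%:R :> R by rewrite ltr0n (leq_trans k10).
  have h2 : G k2 / k2%:R ^+ 2 <= A0 * k2%:R ^- 2 + A1 * k2%:R^-1.
    rewrite ler_pdivrMr ?exprn_gt0 //; apply: le_trans (hG k2) _.
    rewrite le_eqVlt; apply/orP; left; apply/eqP; field; by rewrite gt_eqF.
  have h3 : k2%:R^-1 <= k1%:R^-1 :> R by rewrite lef_pV2 ?posrE // ler_nat.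
  have h4 := ler_wpM2l A10 h3.
  have h5 : 0 <= A0 * k1%:R ^- 2 by rewrite mulr_ge0 // invr_ge0 exprn_ge0 // ltW.
  have h6 : 0 <= A1 * k2%:R^-1 by rewrite mulr_ge0 // invr_ge0 ltW.
  lra.
elim=> [|d IH].
  rewrite addn0 big_geq // !subrr !mulr0 !addr0 divr_ge0 ?exprn_ge0 ?ler0n //.
  by rewrite sumr_ge0.
rewrite addnS big_nat_recr /= ?ltnS ?leq_addr //.
set k := (k1 + d)%N in IH *.
have kR : 0 < k%:R :> R by rewrite ltr0n addn_gt0 k10.
have -> : G k.+1 = G k + g k.+1 by rewrite /G big_nat_recr.
rewrite mulrDl.
suff : G k * (k%:R ^- 2 - k.+1%:R ^- 2) <=
   A0 * (k%:R ^- 2 - k.+1%:R ^- 2) + 2 * A1 * (k%:R^-1 - k.+1%:R^-1).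
  move: IH; set S := \sum_(_ <= _ < _) _; set a := k.+1%:R ^- 2; set b := k.+1%:R^-1.
  by set x := k%:R ^- 2; set y := k%:R^-1; lra.
have dd : 0 <= k%:R ^- 2 - k.+1%:R ^- 2 :> R.
  rewrite subr_ge0 lef_pV2; [| by rewrite posrE exprn_gt0 ?ltr0n | by rewrite posrE exprn_gt0].
  by rewrite ler_pXn2r ?nnegrE ?ler0n // ler_nat.
apply: le_trans (ler_wpM2r dd (hG k)) _.
rewrite mulrDl lerD2l -[2 * A1]mulrC -!mulrA ler_wpM2l //.
rewrite -natr1; move: (k%:R : R) kR => x x0.
have x1 : x + 1 != 0 by rewrite gt_eqF //; lra.
have xn : x != 0 by rewrite gt_eqF.
have -> : x * (x ^- 2 - (x + 1) ^- 2) = (2 * x + 1) / (x * (x + 1) ^+ 2) by field; rewrite x1 xn.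
have -> : 2 * (x^-1 - (x + 1)^-1) = (2 * (x + 1)) / (x * (x + 1) ^+ 2) by field; rewrite x1 xn.
rewrite ler_wpM2r //; last by lra.
by rewrite invr_ge0 mulr_ge0 ?exprn_ge0 //; lra.
Qed.

(** * Square means over logarithmic windows *)

Opaque PI.
Lemma eix_lip (x y : R) : N2 (eix x - eix y) <= (x - y) ^+ 2.
Proof.
have -> : eix x - eix y = eix y * (eix (x - y) - 1).
  by rewrite mulrBr mulr1 -eixD; congr (eix _ - _); ring.
by rewrite N2M N2_eix mul1r N2_eixB1_le.
Qed.

Lemma cabs_eix_lip (x y : R) : cabs (eix x - eix y) <= `|x - y|.
Proof. by apply: cabs_le => //; rewrite real_normK ?num_real // eix_lip. Qed.

(** [log n] in units of [1/s1], rounded down. Multiplicative windows thus become intervals of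
    integers, to which a finite Fourier transform applies. *)
Definition nu (s1 n : nat) : nat := Num.truncn (s1%:R * lnn n).
Lemma nu_itv s1 n : (0 < n)%N ->
  ((nu s1 n)%:R : R) <= s1%:R * lnn n < (nu s1 n).+1%:R.
Proof. by move=> n0; apply: Num.Theory.truncn_itv; rewrite mulr_ge0 ?ler0n ?lnn_ge0. Qed.
Lemma leq_nu s1 m n : (0 < m)%N -> (m <= n)%N -> (nu s1 m <= nu s1 n)%N.
Proof.
move=> m0 mn; rewrite -ltnS -(ltr_nat R).
have [h1 _] := andP (nu_itv s1 m0).
have [_ h2] := andP (nu_itv s1 (leq_trans m0 mn)).
by apply: le_lt_trans h1 (le_lt_trans _ h2); rewrite ler_wpM2l ?ler0n // ler_lnn.
Qed.

Lemma symsum_cat k N phi : (k <= N)%N ->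
  symsum N phi = symsum k phi + \sum_(k.+1 <= i < N.+1) (phi i%:R + phi (- i%:R)).
Proof. by move=> h; rewrite /symsum (big_cat_nat (n := k.+1)) //= addrA. Qed.

Lemma symsum_lin N (a d : R) phi :
  symsum N (fun x => a * phi x + d) = a * symsum N phi + (2 * N%:R + 1) * d.
Proof.
elim: N => [|N IH]; first by rewrite /symsum !big_geq // !addr0 mulr0 add0r mul1r.
by rewrite !symsumS IH -natr1; ring.
Qed.

Lemma sum_shift (F : nat -> CC) a s : \sum_(a <= i < a + s) F i = \sum_(i < s) F (a + i)%N.
Proof.
rewrite -{1}[a]add0n big_addn addKn big_mkord.
by apply: eq_bigr => i _; rewrite addnC.
Qed.

Lemma win_bound_arith (e k2 k1 q s1 s X Y S : R) : 0 < q -> 0 < s1 -> 0 < s -> 0 < k2 -> 0 <= e -> k1 <= k2 ->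
  s1 / s ^+ 2 / (2 * q * s1) * (s ^+ 2 * 2 * X + (2 * k1 + 1) * (s ^+ 2 * 2 * e) +
   (2 * Y + k2 * (4 * (2 * q * s1) ^+ 2 * e) + 6 * (2 * q * s1) ^+ 2 * S ^+ 2 / k2)) <=
  q^-1 * (X + s ^- 2 * Y) + q^-1 * (2 * k2 + 1) * (e * (1 + (2 * q * s1 / s) ^+ 2)) +
  6 * (2 * q) * (s1 / s) ^+ 2 * S ^+ 2 / k2.
Proof.
move=> q0 s10 s0 k20 e0 k12.
have -> : s1 / s ^+ 2 / (2 * q * s1) * (s ^+ 2 * 2 * X + (2 * k1 + 1) * (s ^+ 2 * 2 * e) +
   (2 * Y + k2 * (4 * (2 * q * s1) ^+ 2 * e) + 6 * (2 * q * s1) ^+ 2 * S ^+ 2 / k2)) =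
  q^-1 * (X + s ^- 2 * Y) + (q^-1 * ((2 * k1 + 1) * e)) + q^-1 * (2 * k2 * (e * (2 * q * s1 / s) ^+ 2)) +
  6 * (2 * q) * (s1 / s) ^+ 2 * S ^+ 2 / k2.
  by field; rewrite !gt_eqF.
set w := (2 * q * s1 / s) ^+ 2.
have w0 : 0 <= e * w by rewrite /w; pos.
rewrite lerD2r -addrA lerD2l -mulrDr -[X in _ <= X]mulrA.
apply: ler_wpM2l; first by pos.
have := ler_wpM2r e0 k12.
lra.
Qed.

(** * Plancherel for logarithmic windows *)

Section Window.
Variables (Q' s1 s Z : nat) (b : nat -> CC).
Let Q := (2 * Q')%N.
Let M := (Q * s1)%N.
Let theta : R := PI / Q'%:R.
Hypothesis Q0 : (0 < Q')%N.
Hypothesis s10 : (0 < s1)%N.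
Hypothesis s0 : (0 < s)%N.
Hypothesis hnu : forall n, (1 <= n < Z)%N -> (nu s1 n + s <= M)%N.

(** Up to rounding, the sum over the [n] whose logarithm lies in an interval of length [s/s1] ending
    at [j/s1]. *)
Definition win (j : nat) : CC := \sum_(1 <= n < Z | (nu s1 n <= j < nu s1 n + s)%N) b n.
Let B (x : R) : CC := \sum_(1 <= n < Z) b n * eix (- (theta * x * lnn n)).
Let Bt (x : R) : CC := \sum_(1 <= n < Z) b n * eix (- (2 * PI * x * (nu s1 n)%:R / M%:R)).
Let D (x : R) : CC := \sum_(i < s) eix (- (2 * PI * x * i%:R / M%:R)).
Let S : R := \sum_(1 <= n < Z) cabs (b n).
Let M' := (Q' * s1)%N.

Let M0 : (0 < M)%N. Proof. by rewrite /M /Q !muln_gt0 Q0 s10. Qed.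
Let MR : 0 < M%:R :> R. Proof. by rewrite ltr0n. Qed.

(** [win] is the convolution of the coefficients, pushed forward by [nu], with an interval of length
    [s], so its transform is the product of [D] and [Bt]; by [hnu] nothing wraps around modulo [M].
    The symmetric sum has [M + 1] frequencies, one more than Parseval, whence the inequality. *)
Lemma win_dft : M%:R * \sum_(j < M) N2 (win j) <= symsum M' (fun x => N2 (D x) * N2 (Bt x)).
Proof.
rewrite -(@dft_parseval M M'%:R win M0) symsum_ord.
have -> : M'.*2 = M by rewrite /M' /M /Q -mul2n mulnA.
rewrite big_ord_recr /= -[X in X <= _]addr0 lerD ?mulr_ge0 //.
rewrite le_eqVlt; apply/orP; left; apply/eqP; apply: eq_bigr => k _.
rewrite -N2M; congr N2; set x := _ - _.
rewrite [RHS]mulrC [RHS]mulr_suml.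
transitivity (\sum_(j < M) \sum_(1 <= n < Z | (nu s1 n <= j < nu s1 n + s)%N)
     b n * eix (- (2 * PI * x * j%:R / M%:R))).
  by apply: eq_bigr => j _; rewrite /win mulr_suml.
under eq_bigr => j _ do rewrite big_mkcond /=.
rewrite exchange_big /= big_nat_cond [RHS]big_nat_cond; apply: eq_bigr => n /andP[hn _].
rewrite -big_mkcond /= -(big_mkord (fun j => (nu s1 n <= j < nu s1 n + s)%N)
   (fun j => b n * eix (- (2 * PI * x * j%:R / M%:R)))).
rewrite (big_cat_nat (n := nu s1 n)) //=; last by apply: leq_trans (hnu hn); rewrite leq_addr.
rewrite [X in X + _]big_nat_cond [X in X + _]big_pred0 ?add0r; last first.
  by move=> j; apply/negP => /andP[/andP[_ h1] /andP[h2 _]]; move: h1; rewrite ltnNge h2.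
rewrite (big_cat_nat (n := (nu s1 n + s)%N)) ?leq_addr ?hnu //=.
rewrite [X in _ + X]big_nat_cond [X in _ + X]big_pred0 ?addr0; last first.
  by move=> j; apply/negP => /andP[/andP[h1 _] /andP[_ h2]]; move: h2; rewrite ltnNge h1.
rewrite big_nat_cond (eq_bigl (fun j => (nu s1 n <= j < nu s1 n + s)%N && true)); last first.
  by move=> j; case: (_ <= j < _)%N.
rewrite -big_nat_cond sum_shift mulr_sumr.
apply: eq_bigr => i _; rewrite -[RHS]mulrA -eixD natrD; congr (_ * eix _); ring.
Qed.

Lemma D_le x : N2 (D x) <= s%:R ^+ 2.
Proof.
apply: le_trans (N2_sum_card _ _ _) _.
rewrite [X in _ * X](eq_bigr (fun=> 1)); last by move=> i _; rewrite N2_eix.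
by rewrite sumr_const card_ord expr2.
Qed.

(** [D] is a geometric sum whose angle stays at most [PI] for [|x| <= M']; the constant 36 of the
    geometric bound is absorbed by [PI >= 3]. *)
Lemma D_le2 x : x != 0 -> `|x| <= M'%:R -> N2 (D x) <= M%:R ^+ 2 / x ^+ 2.
Proof.
move=> x0 hx.
have MM : M%:R = 2 * M'%:R :> R by rewrite /M /M' /Q -mulnA natrM.
have M'R : 0 < M'%:R :> R by have := MR; rewrite MM; lra.
pose u := - (2 * PI * x / M%:R).
have -> : D x = \sum_(i < s) eix (i%:R * u) by apply: eq_bigr => i _; rewrite /u; congr eix; ring.
have u0 : u != 0.
  rewrite /u oppr_eq0; apply: mulf_neq0; last by rewrite invr_eq0 gt_eqF.
  by apply: mulf_neq0 => //; rewrite gt_eqF // mulr_gt0.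
have hu : `|u| <= PI.
  have -> : u = - (PI * (x / M'%:R)) by rewrite /u MM; field; rewrite gt_eqF.
  rewrite normrN normrM gtr0_norm // normrM normfV [`|M'%:R|]gtr0_norm //.
  by rewrite ger_pMr // ler_pdivrMr // mul1r.
apply: le_trans (geom_eix_le _ u0 hu) _.
have x2 : 0 < x ^+ 2 by rewrite exprn_even_gt0.
have -> : 36 / u ^+ 2 = M%:R ^+ 2 / x ^+ 2 * ((3 / PI) ^+ 2).
  by rewrite /u; field; rewrite x0 !gt_eqF.
have q0 : 0 <= 3 / PI by apply: divr_ge0 => //; exact: ltW.
have q1 : 3 / PI <= 1 by rewrite ler_pdivrMr // mul1r PI_ge3.
apply: ler_piMr; last by apply: exprn_ile1.
by apply: divr_ge0; exact: sqr_ge0.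
Qed.

Lemma Bt_le1 x : N2 (Bt x) <= S ^+ 2.
Proof.
apply: N2_le_sqr; apply: le_trans (cabs_sum _ _ _) _.
by apply: ler_sum => n _; rewrite cabsM cabs_eix mulr1.
Qed.

(** Rounding the logarithm moves each phase by at most [theta * c / s1], an error that vanishes when
    [s1] grows with [c] fixed. *)
Lemma Bt_le2 x (c : R) : `|x| <= c -> N2 (Bt x) <= 2 * N2 (B x) + 2 * (theta * c * S / s1%:R) ^+ 2.
Proof.
move=> hx.
have c0 : 0 <= c by apply: le_trans hx.
have Q'R : 0 < Q'%:R :> R by rewrite ltr0n.
have s1R : 0 < s1%:R :> R by rewrite ltr0n.
have th0 : 0 < theta by rewrite divr_gt0.
have -> : Bt x = B x + (Bt x - B x) by ring.
apply: le_trans (N2D_le _ _) _; rewrite lerD2l ler_pM2l //.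
apply: N2_le_sqr.
rewrite /Bt /B -sumrB; apply: le_trans (cabs_sum _ _ _) _.
have -> : theta * c * S / s1%:R = \sum_(1 <= n < Z) (theta * c / s1%:R) * cabs (b n).
  by rewrite -mulr_sumr -/S; ring.
apply: ler_sum_nat => n /andP[n1 _]; rewrite -mulrBr cabsM mulrC.
rewrite ler_wpM2r //; apply: le_trans (cabs_eix_lip _ _) _.
have MM : M%:R = 2 * Q'%:R * s1%:R :> R by rewrite /M /Q !natrM.
have -> : - (2 * PI * x * (nu s1 n)%:R / M%:R) - - (theta * x * lnn n) =
   theta * x * ((s1%:R * lnn n - (nu s1 n)%:R) / s1%:R).
  by rewrite MM /theta; field; rewrite !gt_eqF.
have [h1 h2] := andP (nu_itv s1 n1).
rewrite -natr1 in h2.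
move: (theta) th0 => th th0.
rewrite normrM [`|th * x|]normrM [`|th|]gtr0_norm // -!mulrA ler_pM2l //.
rewrite [`|_ / s1%:R|]ger0_norm; last by rewrite divr_ge0 ?subr_ge0 // ltW.
apply: ler_pM => //; first by rewrite divr_ge0 ?subr_ge0 // ltW.
by rewrite ler_pdivrMr // mulVf ?gt_eqF //; lra.
Qed.

(* k1 splits low and high frequencies, k2 truncates. *)
Lemma win_bound k1 k2 : (0 < k1 <= k2)%N -> (k2 <= M')%N ->
  s1%:R / s%:R ^+ 2 * \sum_(j < M) N2 (win j) <=
  Q'%:R^-1 * (symsum k1 (fun x => N2 (B x)) +
     \sum_(k1.+1 <= k < k2.+1) ((Q * s1)%:R / s%:R) ^+ 2 / k%:R ^+ 2 *
         (N2 (B k%:R) + N2 (B (- k%:R)))) +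
  Q'%:R^-1 * (2 * k2%:R + 1) * ((theta * k2%:R * S / s1%:R) ^+ 2 * (1 + ((Q * s1)%:R / s%:R) ^+ 2)) +
  6 * Q%:R * (s1%:R / s%:R) ^+ 2 * S ^+ 2 / k2%:R.
Proof.
move=> /andP[k10 k12] k2M.
have sR : 0 < s%:R :> R by rewrite ltr0n.
have s1R : 0 < s1%:R :> R by rewrite ltr0n.
have Q'R : 0 < Q'%:R :> R by rewrite ltr0n.
have k1R : 0 < k1%:R :> R by rewrite ltr0n.
have k2R : 0 < k2%:R :> R by rewrite ltr0n (leq_trans k10).
pose psi x := N2 (D x) * N2 (Bt x).
pose e := (theta * k2%:R * S / s1%:R) ^+ 2.
have e0 : 0 <= e by exact: sqr_ge0.
pose phi x := N2 (B x).
have b1 : symsum k1 psi <= s%:R ^+ 2 * 2 * symsum k1 phi + (2 * k1%:R + 1) * (s%:R ^+ 2 * 2 * e).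
  rewrite -symsum_lin; apply: symsum_le => x hx; rewrite /psi.
  apply: le_trans (_ : s%:R ^+ 2 * (2 * N2 (B x) + 2 * e) <= _); last by rewrite /phi; lra.
  apply: ler_pM => //; first exact: D_le.
  by apply: Bt_le2; apply: le_trans hx _; rewrite ler_nat.
(* Between [k1] and [k2] the decay of [D] is used and the mean square of [B] is kept. *)
have b2 : \sum_(k1.+1 <= k < k2.+1) (psi k%:R + psi (- k%:R)) <=
   2 * (\sum_(k1.+1 <= k < k2.+1) M%:R ^+ 2 / k%:R ^+ 2 * (phi k%:R + phi (- k%:R))) +
   k2%:R * (4 * M%:R ^+ 2 * e).
  apply: le_trans (_ : \sum_(k1.+1 <= k < k2.+1) (2 * (M%:R ^+ 2 / k%:R ^+ 2 * (phi k%:R + phi (- k%:R)))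
       + 4 * M%:R ^+ 2 * e) <= _); last first.
    rewrite big_split /= -mulr_sumr lerD2l sumr_const_nat -[X in X <= _]mulr_natl ler_wpM2r //.
      by apply: mulr_ge0 => //; apply: mulr_ge0 => //; exact: sqr_ge0.
    by rewrite ler_nat subSS leq_subr.
  apply: ler_sum_nat => k /andP[h1 h2].
  have kR : 0 < k%:R :> R by rewrite ltr0n (leq_trans _ h1).
  have kM : k%:R <= M'%:R :> R by rewrite ler_nat (leq_trans _ k2M).
  have kk2 : k%:R <= k2%:R :> R by rewrite ler_nat.
  have ineq x : `|x| = k%:R -> psi x <= M%:R ^+ 2 / k%:R ^+ 2 * (2 * phi x + 2 * e).
    move=> hx.
    have x0 : x != 0 by rewrite -normr_eq0 hx gt_eqF.
    apply: ler_pM => //.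
      apply: le_trans (D_le2 x0 _) _; rewrite ?hx //.
      by rewrite -[x ^+ 2]real_normK ?num_real // hx.
    by apply: Bt_le2; rewrite hx.
  have i1 := ineq k%:R (normr_nat _ _).
  have i2 := ineq (- k%:R); rewrite normrN normr_nat in i2; have {}i2 := i2 erefl.
  have k1' : M%:R ^+ 2 / k%:R ^+ 2 * e <= M%:R ^+ 2 * e.
    rewrite ler_wpM2r // ler_pdivrMr ?exprn_gt0 // ler_peMr ?exprn_ge0 ?ler0n //.
    by rewrite exprn_ege1 // ler1n (leq_trans _ h1).
  move: i1 i2 k1'; lra.
(* Beyond [k2] the trivial bound [S] for [Bt] is enough, thanks to the decay of [D]. *)
have b3 : \sum_(k2.+1 <= k < M'.+1) (psi k%:R + psi (- k%:R)) <= 6 * M%:R ^+ 2 * S ^+ 2 / k2%:R.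
  have h := @tail_sum (fun=> 1) 0 1 k2 M' (fun=> ler01) (lexx _) ler01 (leq_trans k10 k12) k2M.
  have {}h : \sum_(k2.+1 <= k < M'.+1) 1 / k%:R ^+ 2 <= 3 / k2%:R :> R.
    apply: le_trans (h _) _; last by lra.
    by move=> N; rewrite sumr_const_nat subSS subn0 add0r mul1r.
  apply: le_trans (_ : \sum_(k2.+1 <= k < M'.+1) 2 * M%:R ^+ 2 * S ^+ 2 * (1 / k%:R ^+ 2) <= _); last first.
    rewrite -mulr_sumr.
    have c0 : 0 <= 2 * M%:R ^+ 2 * S ^+ 2 by pos.
    by apply: le_trans (ler_wpM2l c0 h) _; lra.
  apply: ler_sum_nat => k /andP[h1 h2].
  have kR : 0 < k%:R :> R by rewrite ltr0n (leq_trans _ h1).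
  have ineq x : `|x| = k%:R -> psi x <= M%:R ^+ 2 / k%:R ^+ 2 * S ^+ 2.
    move=> hx.
    have x0 : x != 0 by rewrite -normr_eq0 hx gt_eqF.
    apply: ler_pM => //; last exact: Bt_le1.
    apply: le_trans (D_le2 x0 _) _; first by rewrite hx ler_nat.
    by rewrite -[x ^+ 2]real_normK ?num_real // hx.
  have i1 := ineq k%:R (normr_nat _ _).
  have i2 := ineq (- k%:R); rewrite normrN normr_nat in i2; have {}i2 := i2 erefl.
  move: i1 i2; lra.
have := win_dft; rewrite (symsum_cat _ (leq_trans k12 k2M)).
rewrite [X in _ <= _ + X -> _](big_cat_nat (n := k2.+1)) //=.
rewrite -/psi => hw.
have {}hw := le_trans hw (lerD b1 (lerD b2 b3)).
have MM : M%:R = 2 * Q'%:R * s1%:R :> R by rewrite /M /Q !natrM.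
have MR' : 0 < M%:R :> R by rewrite ltr0n.
have c0 : 0 < s1%:R / s%:R ^+ 2 / M%:R :> R by pos.
have -> : s1%:R / s%:R ^+ 2 * \sum_(j < M) N2 (win j) =
   s1%:R / s%:R ^+ 2 / M%:R * (M%:R * \sum_(j < M) N2 (win j)) by field; rewrite !gt_eqF.
apply: le_trans (ler_wpM2l (ltW c0) hw) _.
set X := symsum k1 phi.
have -> : \sum_(k1.+1 <= k < k2.+1) ((Q * s1)%:R / s%:R) ^+ 2 / k%:R ^+ 2 * (N2 (B k%:R) + N2 (B (- k%:R)))
  = s%:R ^- 2 * \sum_(k1.+1 <= k < k2.+1) M%:R ^+ 2 / k%:R ^+ 2 * (phi k%:R + phi (- k%:R)).
  rewrite mulr_sumr; apply: eq_bigr => k _; rewrite -/M /phi expr_div_n.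
  by ring.
set Y := \sum_(_ <= _ < _) _.
rewrite -/M -/e /Q natrM MM.
have k12R : k1%:R <= k2%:R :> R by rewrite ler_nat.
exact: win_bound_arith.
Qed.
End Window.

(** * Sums over primes *)

Lemma lnn_fact_le n : lnn n`! <= n%:R * lnn n.
Proof.
elim: n => [|n IH]; first by rewrite fact0 lnn1 mul0r.
rewrite factS lnnM ?fact_gt0 //.
case: n IH => [|n] IH; first by rewrite fact0 lnn1 mulr0 addr0.
have h : lnn n.+1 <= lnn n.+2 by rewrite ler_lnn.
have n0 : 0 <= n.+1%:R :> R by pos.
rewrite -[n.+2%:R]natr1; have := ler_wpM2l n0 h; lra.
Qed.

Lemma lnn_fact_ge n : n%:R * lnn n - n%:R <= lnn n`!.
Proof.
elim: n => [|n IH]; first by rewrite fact0 lnn1 mul0r subr0.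
rewrite factS lnnM ?fact_gt0 //.
case: n IH => [|n] IH; first by rewrite fact0 lnn1 mul1r; lra.
have n0 : 0 < n.+1%:R :> R by pos.
have := lnnS_le (ltn0Sn n); rewrite -(ler_pM2l n0) mulfV ?gt_eqF // => h.
rewrite -[n.+2%:R]natr1; lra.
Qed.

Lemma lnn_prod I (r : seq I) (P : pred I) (F : I -> nat) : (forall i, P i -> (0 < F i)%N) ->
  lnn (\prod_(i <- r | P i) F i) = \sum_(i <- r | P i) lnn (F i).
Proof.
move=> F0.
suff : (0 < \prod_(i <- r | P i) F i)%N /\ lnn (\prod_(i <- r | P i) F i) = \sum_(i <- r | P i) lnn (F i).
  by case.
apply: (big_ind2 (fun (x : nat) (y : R) => (0 < x)%N /\ lnn x = y)); first by rewrite lnn1.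
  move=> x y x' y' [h1 h2] [h3 h4]; rewrite muln_gt0 h1 h3 lnnM //; split => //.
  by rewrite h2 h4.
by move=> i Pi; rewrite F0.
Qed.

Lemma lnnX p k : (0 < p)%N -> lnn (p ^ k) = k%:R * lnn p.
Proof.
move=> p0; elim: k => [|k IH]; first by rewrite expn0 lnn1 mul0r.
by rewrite expnS lnnM ?expn_gt0 ?p0 // IH -natr1; ring.
Qed.

Lemma lnn_factE n : lnn n`! = \sum_(1 <= p < n.+1 | prime p) (logn p n`!)%:R * lnn p.
Proof.
have h : n`! = (\prod_(1 <= p < n.+1 | prime p) p ^ logn p n`!)%N.
  rewrite -{1}(partnT (fact_gt0 n)) (@widen_partn (maxn n`! n.+1)) ?leq_maxl //.
  rewrite (big_cat_nat (n := n.+1)) //=; last by rewrite ltnW // ltnS leq_max leqnn orbT.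
  rewrite [X in (_ * X)%N]big_nat_cond [X in (_ * X)%N]big1 ?muln1; last first.
    move=> p /andP[/andP[np _] _].
    have [pp|/negbTE pp] := boolP (prime p); last by rewrite lognE pp.
    suff -> : logn p n`! = 0%N by [].
    rewrite logn_fact // big_nat_cond big1 // => k /andP[/andP[k1 _] _].
    by rewrite divn_small // (leq_trans np) // -{1}[p]expn1 leq_pexp2l // prime_gt0.
  rewrite big_ltn // lognE /= mul1n [RHS]big_mkcond /= [LHS]big_mkcond /=.
  apply: eq_big_nat => p _.
  by case: ifP => // pp; rewrite lognE pp.
rewrite {1}h lnn_prod; last by move=> p pp; rewrite expn_gt0 prime_gt0.
by apply: eq_bigr => p pp; rewrite lnnX // prime_gt0.
Qed.

(** Mertens' upper bound read off from [log n!]: the exponent of [p] is at least the integer part of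
    [n/p], which is at least [n/(2p)] for [p <= n]. *)
Lemma sum_lnp_le n : (0 < n)%N ->
  \sum_(1 <= p < n.+1 | prime p) lnn p / p%:R <= 2 * lnn n.
Proof.
move=> n0; have nR : 0 < n%:R :> R by rewrite ltr0n.
have h := lnn_fact_le n.
rewrite -(ler_pM2l nR); apply: le_trans (_ : 2 * lnn n`! <= _); last by lra.
rewrite lnn_factE mulr_sumr mulr_sumr big_nat_cond [X in _ <= X]big_nat_cond.
apply: ler_sum => p /andP[/andP[p1 pn] pp].
have pR : 0 < p%:R :> R by rewrite ltr0n.
have -> : n%:R * (lnn p / p%:R) = (n%:R / p%:R) * lnn p by ring.
rewrite mulrA.
rewrite ler_wpM2r ?lnn_ge0 //.
have lg : (n %/ p <= logn p n`!)%N.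
  rewrite logn_fact // big_ltn //; first by rewrite expn1 leq_addr.
have h2 : (n <= 2 * (n %/ p) * p)%N.
  have := divn_eq n p; have := ltn_pmod n (prime_gt0 pp).
  have : (0 < n %/ p)%N by rewrite divn_gt0 ?prime_gt0.
  by set d := (n %/ p)%N; set m := (n %% p)%N; nia.
rewrite ler_pdivrMr //; apply: le_trans (_ : (2 * (n %/ p) * p)%:R <= _).
  by rewrite ler_nat.
by rewrite !natrM ler_pM2r // ler_pM2l // ler_nat.
Qed.

(** Each term is at most a decrement of [(log m + 2) / m]. *)
Lemma sum_ln_telescope n :
  \sum_(2 <= m < n.+1) lnn m / (m%:R * (m%:R - 1)) <= 2.
Proof.
suff key : forall k, \sum_(2 <= m < k.+2) lnn m / (m%:R * (m%:R - 1)) <= 2 - (lnn k.+1 + 2) / k.+1%:R.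
  case: n => [|n]; first by rewrite big_geq.
  apply: le_trans (key n) _; rewrite gerBl divr_ge0 ?ler0n // addr_ge0 //.
  by rewrite lnn_ge0.
elim=> [|k IH]; first by rewrite big_geq // lnn1; lra.
rewrite big_nat_recr //=; set m := k.+2.
suff : lnn m / (m%:R * (m%:R - 1)) <= (lnn k.+1 + 2) / k.+1%:R - (lnn m + 2) / m%:R.
  by move: IH; rewrite -/m; set S := \sum_(_ <= _ < _) _; set u := _ / k.+1%:R; lra.
have mE : m%:R = k.+1%:R + 1 :> R by rewrite natr1.
have k0 : 0 < k.+1%:R :> R by pos.
have k1 : 1 <= k.+1%:R :> R by rewrite ler1n.
have := lnnS_le (ltn0Sn k); rewrite -/m mE.
move: (lnn m) (lnn k.+1) (k.+1%:R : R) k0 k1 => a b x x0 x1 h.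
have x10 : 0 < x + 1 by lra.
have -> : (b + 2) / x - (a + 2) / (x + 1) = ((x + 1) * (b + 2) - x * (a + 2)) / ((x + 1) * x).
  by field; rewrite !gt_eqF.
have -> : x + 1 - 1 = x by ring.
rewrite ler_pM2r ?invr_gt0 ?mulr_gt0 //.
have h2 : (x + 1) * (a - b) <= 2.
  have := ler_wpM2l (ltW x10) h.
  have -> : (x + 1) * x^-1 = 1 + x^-1 by field; rewrite gt_eqF.
  have : x^-1 <= 1 by rewrite invf_le1.
  lra.
lra.
Qed.

(** Legendre's exponent is at most [n/(p-1)], and [1/(p-1) - 1/p] contributes at most 2; the
    remaining 1 of the constant comes from [log n! >= n log n - n]. *)
Lemma sum_lnp_ge n : (0 < n)%N ->
  lnn n - 3 <= \sum_(1 <= p < n.+1 | prime p) lnn p / p%:R.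
Proof.
move=> n0; have nR : 0 < n%:R :> R by rewrite ltr0n.
have h := lnn_fact_ge n.
have h1 : lnn n`! <= \sum_(1 <= p < n.+1 | prime p) n%:R * (lnn p / p%:R + lnn p / (p%:R * (p%:R - 1))).
  rewrite lnn_factE big_nat_cond [X in _ <= X]big_nat_cond.
  apply: ler_sum => p /andP[/andP[p1 pn] pp].
  have p2 : 2 <= p%:R :> R by rewrite ler_nat prime_gt1.
  have -> : n%:R * (lnn p / p%:R + lnn p / (p%:R * (p%:R - 1))) = n%:R / (p%:R - 1) * lnn p.
    by field; rewrite !gt_eqF //; lra.
  rewrite ler_wpM2r ?lnn_ge0 // logn_fact // natr_sum.
  apply: le_trans (_ : \sum_(1 <= k < n.+1) n%:R / p%:R ^+ k <= _).
    apply: ler_sum => k _; rewrite ler_pdivlMr; last by apply: exprn_gt0; lra.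
    by rewrite -natrX -natrM ler_nat leq_divM.
  rewrite -mulr_sumr ler_pM2l //.
  suff key : forall m, \sum_(1 <= k < m.+1) (p%:R : R) ^- k <= (p%:R - 1)^-1 * (1 - p%:R ^- m).
    apply: le_trans (key n) _; rewrite ger_pMr ?invr_gt0; last by lra.
    by rewrite gerBl invr_ge0 exprn_ge0 //; lra.
  elim=> [|m IH]; first by rewrite big_geq // expr0 invr1 subrr mulr0.
  rewrite big_nat_recr //=; apply: le_trans (lerD IH (lexx _)) _.
  rewrite le_eqVlt; apply/orP; left; apply/eqP; rewrite exprS.
  by field; rewrite expf_neq0 ?gt_eqF //; lra.
have h2 : \sum_(1 <= p < n.+1 | prime p) lnn p / (p%:R * (p%:R - 1)) <= 2.
  apply: le_trans (sum_ln_telescope n).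
  case: (n) n0 => // m _; rewrite big_mkcond big_ltn //= add0r big_nat_cond [X in _ <= X]big_nat_cond.
  apply: ler_sum => p /andP[/andP[p2 _] _]; case: ifP => // _.
  have : 2 <= p%:R :> R by rewrite ler_nat.
  move=> p2R; rewrite divr_ge0 ?lnn_ge0 ?(leq_trans _ p2) // mulr_ge0 //; lra.
move: (le_trans h h1); rewrite -mulr_sumr big_split /= => h3.
have : n%:R * (lnn n - 1) <= n%:R * (\sum_(1 <= p < n.+1 | prime p) lnn p / p%:R + 2).
  have := ler_wpM2l (ltW nR) h2; move: h3.
  set S := \sum_(_ <= _ < _ | _) _; set S' := \sum_(_ <= _ < _ | _) lnn _ / (_ * _); lra.
rewrite ler_pM2l //; lra.
Qed.

(** * Primes in logarithmic ranges *)

Definition prange (A B : R) : seq nat :=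
  [seq p <- iota 1 (Num.truncn (exp B)) | prime p && (A <= lnn p < B)].
Lemma mem_prange A B p : (p \in prange A B) = prime p && (A <= lnn p < B).
Proof.
rewrite mem_filter mem_iota; case: (boolP (prime p && _)) => //= /and3P[pp _ h].
rewrite prime_gt0 //= add1n ltnS.
have p0 : 0 < p%:R :> R by rewrite ltr0n prime_gt0.
rewrite -ltnS -(ltr_nat R); apply: lt_trans (_ : exp B < _); first by rewrite -ln_lt_exp.
by have /andP[] := Num.Theory.truncn_itv (exp_ge0 B).
Qed.
Lemma uniq_prange A B : uniq (prange A B). Proof. by rewrite filter_uniq // iota_uniq. Qed.

Lemma sum_prange A B (Z : nat) (F : nat -> R) : (forall p, prime p -> A <= lnn p < B -> (p < Z)%N) ->
  \sum_(p <- prange A B) F p = \sum_(1 <= p < Z | prime p && (A <= lnn p < B)) F p.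
Proof.
move=> h; rewrite -[RHS]big_filter; apply: perm_big; apply: uniq_perm.
- exact: uniq_prange.
- by rewrite filter_uniq // iota_uniq.
move=> p; rewrite mem_prange mem_filter mem_index_iota.
by case: (boolP (prime p && _)) => //= /andP[pp hp]; rewrite prime_gt0 // h.
Qed.

Lemma sum_lnp_le_exp (B : R) : 0 <= B -> \sum_(p <- prange 0 B) lnn p / p%:R <= 2 * B.
Proof.
move=> B0; pose n := Num.truncn (exp B).
have /andP[n1 n2] := Num.Theory.truncn_itv (exp_ge0 B).
have n0 : (0 < n)%N.
  rewrite lt0n; apply/negP => /eqP n0; move: n2; rewrite -/n n0 => h.
  have := exp_ge1D B; lra.
apply: le_trans (_ : \sum_(1 <= p < n.+1 | prime p) lnn p / p%:R <= _).
  rewrite (@sum_prange 0 B n.+1).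
    rewrite big_mkcond [X in _ <= X]big_mkcond /= big_nat_cond [X in _ <= X]big_nat_cond.
    apply: ler_sum => p /andP[/andP[p1 _] _]; case: (prime p) => //=; case: ifP => // _.
    by rewrite divr_ge0 ?lnn_ge0.
  move=> p pp /andP[_ h]; rewrite -(ltr_nat R); apply: lt_trans n2.
  by rewrite -ln_lt_exp // ltr0n prime_gt0.
apply: le_trans (sum_lnp_le n0) _; rewrite ler_pM2l // ln_le_exp ?ltr0n //.
Qed.

Lemma sum_lnp_ge_exp (B : R) : 0 <= B -> B - 5 <= \sum_(p <- prange 0 B) lnn p / p%:R.
Proof.
move=> B0.
have S0 : 0 <= \sum_(p <- prange 0 B) lnn p / p%:R.
  rewrite big_seq; apply: sumr_ge0 => p; rewrite mem_prange => /and3P[pp h _].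
  by rewrite divr_ge0.
have [h|B4] := lerP B 5; first by lra.
pose n := (Num.truncn (exp (B - 1))).
have /andP[n1 n2] := Num.Theory.truncn_itv (exp_ge0 (B - 1)).
have n0 : (0 < n)%N.
  rewrite lt0n; apply/negP => /eqP n0; move: n2; rewrite -/n n0 => h.
  have := exp_ge1D (B - 1); lra.
have nR : 0 < n%:R :> R by rewrite ltr0n.
have h := sum_lnp_ge n0.
apply: le_trans (_ : lnn n - 3 <= _).
  have : B - 1 <= lnn n.+1 by rewrite ln_ge_exp ?ltr0Sn // ltW.
  have := lnnS_le n0; have : n%:R^-1 <= 1 :> R by rewrite invf_le1 // ler1n.
  lra.
apply: le_trans h _.
rewrite (@sum_prange 0 B (Num.truncn (exp B)).+1); last first.
  move=> p pp /andP[_ h]; rewrite -(ltr_nat R).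
  have /andP[_ n3] := Num.Theory.truncn_itv (exp_ge0 B).
  by apply: lt_trans n3; rewrite -ln_lt_exp // ltr0n prime_gt0.
have nN : (n <= Num.truncn (exp B))%N.
  rewrite Num.Theory.truncn_ge_nat // (le_trans n1) // ler_exp; lra.
rewrite [X in _ <= X](big_cat_nat (n := n.+1)) //=.
rewrite -[X in X <= _]addr0 lerD //.
  rewrite big_nat_cond [X in _ <= X]big_nat_cond le_eqVlt; apply/orP; left; apply/eqP.
  apply: eq_bigl => p; case: (boolP (1 <= p < n.+1)%N) => //= /andP[p1 pn].
  case: (prime p) => //=; rewrite lnn_ge0 //=; apply/esym.
  apply: le_lt_trans (_ : B - 1 < _); last by lra.
  by rewrite ln_le_exp ?ltr0n // (le_trans _ n1) // ler_nat.
rewrite big_seq_cond; apply: sumr_ge0 => p /andP[_ /and3P[_ h _]].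
by rewrite divr_ge0.
Qed.

Lemma prange_cat (A B C : R) (F : nat -> R) : A <= B -> B <= C ->
  \sum_(p <- prange A C) F p = \sum_(p <- prange A B) F p + \sum_(p <- prange B C) F p.
Proof.
move=> AB BC; rewrite -big_cat; apply: perm_big; apply: uniq_perm.
- exact: uniq_prange.
- rewrite cat_uniq !uniq_prange /= andbT; apply/hasPn => p; rewrite !mem_prange => /and3P[pp h1 h2].
  by rewrite pp /= negb_and -leNgt h1 orbT.
move=> p; rewrite mem_cat !mem_prange; case: (prime p) => //=.
have [h|h] := ltrP (lnn p) B.
  by rewrite (lt_le_trans h BC) !andbT /= orbF.
by rewrite (le_trans AB h).
Qed.

(** The two Mertens bounds differ by a factor 2. Going up to [8 A] leaves a mass [6 A - 5] of
    [log p / p], to be divided by the largest logarithm [8 A]. *)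
Lemma sum_invp_ge_ratio (A : R) : 4 <= A -> 2^-1 <= \sum_(p <- prange A (8 * A)) p%:R^-1 :> R.
Proof.
move=> A4.
have e8 : 0 <= 8 * A by lra.
have e1 : 0 <= A by lra.
have e2 : A <= 8 * A by lra.
have h1 := sum_lnp_ge_exp e8; have h2 := sum_lnp_le_exp e1.
rewrite (@prange_cat 0 A (8 * A) (fun p => lnn p / p%:R)) // in h1.
have A0 : 0 < 8 * A by lra.
have h4 : \sum_(p <- prange A (8 * A)) lnn p / p%:R <= 8 * A * \sum_(p <- prange A (8 * A)) p%:R^-1.
  rewrite mulr_sumr big_seq [X in _ <= X]big_seq; apply: ler_sum => p.
  rewrite mem_prange => /and3P[pp _ /ltW h].
  by rewrite ler_wpM2r // invr_ge0 ler0n.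
rewrite -(ler_pM2l A0); lra.
Qed.

Lemma sum_invp_ge (A : R) m : 4 <= A -> m%:R / 2 <= \sum_(p <- prange A (8 ^+ m * A)) p%:R^-1 :> R.
Proof.
move=> A4; elim: m => [|m IH].
  by rewrite mul0r big_seq; apply: sumr_ge0 => p _; rewrite invr_ge0 ler0n.
have p8 : 1 <= 8 ^+ m :> R by apply: exprn_ege1; lra.
have h : A <= 8 ^+ m * A by rewrite ler_peMl //; lra.
rewrite (@prange_cat A (8 ^+ m * A)) //; last by rewrite exprS -mulrA ler_peMl //; lra.
have := @sum_invp_ge_ratio (8 ^+ m * A).
rewrite mulrA -exprS => /(_ (le_trans A4 h)); rewrite -[m.+1%:R]natr1.
move: IH; set S1 := \sum_(p <- _) _; set S2 := \sum_(p <- _) _; lra.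
Qed.

(** * Exponential sums *)

Lemma sin3_id (x z : R) : sin x + sin z - sin (x + z) = 4 * sin (x / 2) * sin (z / 2) * sin ((x + z) / 2).
Proof.
set a := x / 2; set b := z / 2.
have -> : (x + z) / 2 = a + b by rewrite /a /b; field.
have -> : x = a + a by rewrite /a; field.
have -> : z = b + b by rewrite /b; field.
have sp u v : sin (u + v) = sin u * cos v + cos u * sin v by exact: sin_plus.
have cp u v : cos (u + v) = cos u * cos v - sin u * sin v by exact: cos_plus.
have h1 : cos a ^+ 2 = 1 - sin a ^+ 2 by have := N2_eix a; rewrite /N2 /=; lra.
have h2 : cos b ^+ 2 = 1 - sin b ^+ 2 by have := N2_eix b; rewrite /N2 /=; lra.
rewrite !sp !cp.
have e1 : (sin a * cos a + cos a * sin a) * (cos b * cos b - sin b * sin b) =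
   2 * sin a * cos a * (1 - 2 * sin b ^+ 2) by rewrite -!expr2 h2; ring.
have e2 : (cos a * cos a - sin a * sin a) * (sin b * cos b + cos b * sin b) =
   2 * sin b * cos b * (1 - 2 * sin a ^+ 2) by rewrite -!expr2 h1; ring.
rewrite e1 e2; ring.
Qed.

Lemma sin_ge0 (x : R) : 0 <= x -> x <= PI -> 0 <= sin x.
Proof. by move=> /RleP h1 /RleP h2; apply/RleP; exact: sin_ge_0. Qed.

(** The Kusmin-Landau weight: [eix y - eix (y + x)] multiplied by it is [eix y] again. *)
Definition wt (x : R) : CC := (1 - eix x)^-1.

Lemma eixB1_neq0 (x : R) : 0 < x -> x <= PI -> 1 - eix x != 0.
Proof.
move=> x0 xp; have := @sqr_le_N2_eixB1 x; rewrite gtr0_norm // => /(_ xp) h.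
apply/negP => /eqP e; move: h; rewrite N2BC e N20.
have : 0 < x ^+ 2 by pos. lra.
Qed.

(** The real part is constant, so the variation of the weight is that of its imaginary part
    [cot(x/2) / 2]. *)
Lemma wtE (x : R) : 0 < x -> x <= PI -> wt x = Complex (1 / 2) (sin x / (2 * (1 - cos x))).
Proof.
move=> x0 xp; have n0 := eixB1_neq0 x0 xp.
have h : cos x ^+ 2 = 1 - sin x ^+ 2 by have := N2_eix x; rewrite /N2 /=; lra.
have c1 : 1 - cos x != 0.
  apply/negP => /eqP c; move: n0; apply/negP; rewrite negbK; apply/eqP.
  have cx : cos x = 1 by lra.
  apply: cplx_eq; rewrite !cE /=; first by rewrite cx subrr.
  have : sin x ^+ 2 = 0 by move: h; rewrite cx expr1n; lra.
  by move/eqP; rewrite expf_eq0 /= => /eqP ->; rewrite subrr.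
apply: (mulfI n0); rewrite /wt mulfV //.
apply: cplx_eq; rewrite !cE /=.
  have -> : (1 - cos x) * (1 / 2) - (0 - sin x) * (sin x / (2 * (1 - cos x))) =
     (1 - 2 * cos x + cos x ^+ 2 + sin x ^+ 2) / (2 * (1 - cos x)) by field.
  by rewrite h; field.
by field.
Qed.

Lemma wt_le (x d : R) : 0 < d -> d <= x -> x <= PI -> cabs (wt x) <= 3 / d.
Proof.
move=> d0 dx xp; have x0 : 0 < x by lra.
have n0 := eixB1_neq0 x0 xp.
have := @sqr_le_N2_eixB1 x; rewrite gtr0_norm // => /(_ xp); rewrite N2BC => h.
have x2 : (d / 3) ^+ 2 <= N2 (1 - eix x).
  apply: le_trans h; rewrite expr_div_n.
  have -> : 3 ^+ 2 = 9 :> R by rewrite -natrX.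
  by apply: ler_wpM2r; [pos | rewrite ler_pXn2r ?nnegrE //; lra].
have c : d / 3 <= cabs (1 - eix x).
  by rewrite -(ler_pXn2r (ltn0Sn 1)) ?nnegrE ?cabs_sqr //; pos.
have e : cabs (wt x) * cabs (1 - eix x) = 1 by rewrite -cabsM mulVf // cabs1.
rewrite ler_pdivlMr //.
have := ler_wpM2l (cabs_ge0 (wt x)) c; rewrite e; lra.
Qed.

(** After clearing denominators the difference is [sin x + sin(y - x) - sin y], which is 4 times a
    product of three nonnegative sines. *)
Lemma wt_mono (x y : R) : 0 < x -> x <= y -> y <= PI -> cim (wt y) <= cim (wt x).
Proof.
move=> x0 xy yp; have y0 : 0 < y by lra.
have xp : x <= PI by lra.
rewrite !wtE //=.
have cpos u : 0 < u -> u <= PI -> 0 < 1 - cos u.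
  move=> u0 up; have := @sqr_le_N2_eixB1 u; rewrite gtr0_norm // => /(_ up).
  have := N2_eix u; rewrite /N2 !cE /=.
  have : 0 < u ^+ 2 by pos. lra.
have cx := cpos _ x0 xp; have cy := cpos _ y0 yp.
rewrite ler_pdivrMr ?mulr_gt0 // mulrAC ler_pdivlMr ?mulr_gt0 //.
have := sin3_id x (y - x).
have -> : x + (y - x) = y by ring.
have -> : sin (y - x) = sin y * cos x - cos y * sin x by exact: sin_minus.
have p1 : 0 <= sin (x / 2) by apply: sin_ge0; lra.
have p2 : 0 <= sin ((y - x) / 2) by apply: sin_ge0; lra.
have p3 : 0 <= sin (y / 2) by apply: sin_ge0; lra.
have : 0 <= 4 * sin (x / 2) * sin ((y - x) / 2) * sin (y / 2) by pos.
lra.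
Qed.

(** Each term is a difference of consecutive exponentials times a weight. Summation by parts leaves
    two boundary terms and the variation of the weights, which telescopes because the increments of
    the phase decrease. Four quantities of size [3/d] remain. *)
Lemma kusmin_landau (phi : nat -> R) (d : R) (a b : nat) : 0 < d ->
  (forall n, (a <= n < b)%N -> d <= phi n.+1 - phi n <= PI) ->
  (forall n, (a <= n)%N -> (n.+1 < b)%N -> phi n.+2 - phi n.+1 <= phi n.+1 - phi n) ->
  cabs (\sum_(a <= n < b) eix (phi n)) <= 12 / d.
Proof.
move=> d0 hd hm.
have [ba|ab] := leqP b a; first by rewrite big_geq // cabs0; pos.
pose D n := phi n.+1 - phi n; pose w n := wt (D n).
have Dpos n : (a <= n < b)%N -> 0 < D n /\ D n <= PI.
  by move=> /hd /andP[h1 h2]; split => //; apply: lt_le_trans h1.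
have zE n : (a <= n < b)%N -> eix (phi n) = (eix (phi n) - eix (phi n.+1)) * w n.
  move=> h; have [p1 p2] := Dpos _ h; have n0 := eixB1_neq0 p1 p2.
  have -> : eix (phi n.+1) = eix (phi n) * eix (D n) by rewrite -eixD; congr eix; rewrite /D; ring.
  by rewrite -{2}[eix (phi n)]mulr1 -mulrBr -mulrA mulfV // mulr1.
have key : forall k, (a + k < b)%N ->
   \sum_(a <= n < (a + k).+1) eix (phi n) =
   eix (phi a) * w a - eix (phi (a + k).+1) * w (a + k)%N +
   \sum_(a <= n < a + k) eix (phi n.+1) * (w n.+1 - w n).
  elim=> [|k IH] hk.
    rewrite addn0 big_nat1 [X in _ + X]big_geq // addr0 {1}zE ?leqnn //; ring.
  rewrite big_nat_recr ?leqW ?leq_addr //= addnS IH; last by rewrite (leq_trans _ hk) // addnS ltnS ltnW.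
  rewrite [in RHS]big_nat_recr ?leq_addr //= [X in _ + X = _]zE; last first.
    by rewrite -addnS hk leq_addr.
  ring.
have bE : b = (a + (b - a).-1).+1 by lia.
rewrite bE key; last by lia.
set k := (b - a).-1.
have kb : (a + k < b)%N by lia.
have t1 : cabs (eix (phi a) * w a) <= 3 / d.
  rewrite cabsM cabs_eix mul1r; apply: wt_le => //; have := hd a; rewrite leqnn ab => /(_ isT) /andP[] //.
have t2 : cabs (eix (phi (a + k).+1) * w (a + k)%N) <= 3 / d.
  by rewrite cabsM cabs_eix mul1r; have := hd (a + k)%N; rewrite leq_addr kb => /(_ isT) /andP[h1 h2]; apply: wt_le.
have t3 : cabs (\sum_(a <= n < a + k) eix (phi n.+1) * (w n.+1 - w n)) <= cim (w (a + k)%N) - cim (w a).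
  apply: le_trans (cabs_sum _ _ _) _.
  rewrite -(telescope_sumr (fun n => cim (w n))) ?leq_addr //.
  apply: ler_sum_nat => n /andP[h1 h2].
  rewrite cabsM cabs_eix mul1r.
  have nb : (n.+1 < b)%N by apply: leq_ltn_trans kb.
  have [p1 p2] : 0 < D n.+1 /\ D n.+1 <= PI by apply: Dpos; rewrite leqW.
  have [p3 p4] : 0 < D n /\ D n <= PI by apply: Dpos; rewrite h1 ltnW.
  have mono := wt_mono p1 (hm _ h1 nb) p4.
  have -> : w n.+1 - w n = Complex 0 (cim (w n.+1) - cim (w n)).
    have r1 : cre (w n.+1) = 1 / 2 by rewrite /w wtE.
    have r2 : cre (w n) = 1 / 2 by rewrite /w wtE.
    by apply: cplx_eq; [rewrite creB r1 r2 subrr | rewrite cimB].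
  apply: cabs_le; first by rewrite subr_ge0.
  by rewrite /N2 /= expr0n add0r.
have imle n : `|cim (w n)| <= cabs (w n).
  rewrite -(ler_pXn2r (ltn0Sn 1)) ?nnegrE // cabs_sqr real_normK ?num_real // /N2.
  by rewrite lerDr sqr_ge0.
have i1 := imle (a + k)%N; have i2 := imle a.
have w1 : cabs (w a) <= 3 / d by move: t1; rewrite cabsM cabs_eix mul1r.
have w2 : cabs (w (a + k)%N) <= 3 / d by move: t2; rewrite cabsM cabs_eix mul1r.
apply: le_trans (cabsD _ _) _.
apply: le_trans (lerD (cabsD _ _) t3) _.
rewrite cabsN.
have : 12 / d = 4 * (3 / d) by ring.
move: i1 i2; rewrite !ler_norml => /andP[_ ?] /andP[? _]; lra.
Qed.

(** The increment at [n] of [log n - log(n + j)], the phase that appears after van der Corput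
    differencing. *)
Definition ediff (j n : nat) : R := lnn n.+1 - lnn n - (lnn (n.+1 + j) - lnn (n + j)).

Lemma ediffE j n : (0 < n)%N -> ediff j n = ln (1 + j%:R / (n%:R * (n + j).+1%:R)).
Proof.
move=> n0.
have nR : 0 < n%:R :> R by rewrite ltr0n.
have p1 : 0 < (n + j)%:R :> R by rewrite ltr0n addn_gt0 n0.
rewrite /ediff /lnn -ln_div ?ltr0n // -ln_div ?ltr0n ?addn_gt0 ?n0 // -ln_div; last 2 first.
- by rewrite divr_gt0 ?ltr0n.
- by rewrite divr_gt0 ?ltr0n ?addn_gt0 ?n0.
congr ln; rewrite addSn -!natr1 natrD in p1 *.
have j0 : 0 <= j%:R :> R by pos.
by field; rewrite !gt_eqF //; lra.
Qed.

Lemma ediff_anti j n : (0 < n)%N -> ediff j n.+1 <= ediff j n.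
Proof.
move=> n0; rewrite !ediffE //; apply: ler_ln; first by apply: ltr_pwDl => //; pos.
rewrite lerD2l ler_wpM2l ?ler0n // lef_pV2 ?posrE ?mulr_gt0 ?ltr0n // -!natrM ler_nat; nia.
Qed.

Lemma ediff_le j n : (0 < n)%N -> ediff j n <= j%:R / n%:R ^+ 2.
Proof.
move=> n0; rewrite ediffE //.
have nR : 0 < n%:R :> R by rewrite ltr0n.
apply: le_trans (ln_le_subr1 _) _; first by apply: ltr_pwDl => //; pos.
rewrite addrAC subrr add0r ler_wpM2l ?ler0n // lef_pV2 ?posrE ?exprn_gt0 ?mulr_gt0 ?ltr0n //.
by rewrite expr2 ler_pM2l // ler_nat leqW // leq_addr.
Qed.

Lemma ediff_ge (j n M : nat) : (0 < n)%N -> (n <= 2 * M)%N -> (j < M)%N ->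
  j%:R / (8 * M%:R ^+ 2) <= ediff j n.
Proof.
move=> n0 nM jM; rewrite ediffE //.
have nR : 0 < n%:R :> R by rewrite ltr0n.
have MR : 0 < M%:R :> R by rewrite ltr0n; lia.
have p : 0 < n%:R * (n + j).+1%:R :> R by rewrite mulr_gt0 ?ltr0n.
have j0 : 0 <= j%:R :> R by pos.
apply: le_trans (ln_ge _); last by apply: ltr_pwDl => //; pos.
set q := n%:R * _ in p *.
have -> : 1 - (1 + j%:R / q)^-1 = j%:R / (q + j%:R).
  by field; rewrite !gt_eqF //; lra.
rewrite ler_wpM2l // lef_pV2 ?posrE; [|by pos|lra].
rewrite /q -natrM -natrD -natrX -[8]/(8%:R) -natrM ler_nat; nia.
Qed.

Lemma harmonic_le h : (0 < h)%N -> \sum_(1 <= d < h.+1) d%:R^-1 <= 1 + lnn h :> R.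
Proof.
elim: h => // h IH _; case: h IH => [|h] IH; first by rewrite big_nat1 lnn1 addr0 invr1.
rewrite big_nat_recr //=; apply: le_trans (lerD (IH isT) (lexx _)) _.
by rewrite -addrA lerD2l -lerBrDl lnnS_ge.
Qed.

(** * Van der Corput's inequality *)

Section VdC.
Variables (z : nat -> CC) (a L h : nat) (K : R).
Hypothesis ha : (0 < h <= a)%N.
Hypothesis zs : forall n, ~~ (a <= n < a + L)%N -> z n = 0.
Hypothesis z1 : forall n, N2 (z n) <= 1.
Hypothesis K0 : 0 <= K.
Hypothesis hcorr : forall d, (0 < d < h)%N ->
  cabs (\sum_(a <= n < a + L) z (n + d)%N * cj (z n)) <= K / d%:R.

Lemma supp_sum (F : nat -> CC) u v : (forall n, ~~ (a <= n < a + L)%N -> F n = 0) ->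
  (u <= a)%N -> (a + L <= v)%N -> \sum_(u <= n < v) F n = \sum_(a <= n < a + L) F n.
Proof.
move=> F0 ua av.
rewrite (big_cat_nat (n := a)) //=; last by rewrite (leq_trans _ av) // leq_addr.
rewrite [X in X + _]big_nat_cond [X in X + _]big1 ?add0r; last first.
  by move=> n /andP[/andP[_ h1] _]; apply: F0; rewrite negb_and -ltnNge h1.
rewrite (big_cat_nat (n := (a + L)%N)) ?leq_addr //=.
rewrite [X in _ + X]big_nat_cond [X in _ + X]big1 ?addr0 //.
by move=> n /andP[/andP[h1 _] _]; apply: F0; rewrite negb_and -leqNgt h1 orbT.
Qed.

Lemma shift_sum (F : nat -> CC) i : (i < h)%N -> (forall n, ~~ (a <= n < a + L)%N -> F n = 0) ->
  \sum_(a - h <= m < a + L) F (m + i)%N = \sum_(a <= n < a + L) F n.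
Proof.
move=> ih F0.
have -> : \sum_(a - h <= m < a + L) F (m + i)%N = \sum_(a - h + i <= n < a + L + i) F n.
  by rewrite big_addn addnK.
by apply: supp_sum => //; lia.
Qed.

(** Averaging over shifts below [h] and Cauchy-Schwarz lead to correlations at distances [d < h],
    whose bounds [K/d] add up to a logarithm. The condition [h <= a] keeps the shifted range inside
    the natural numbers. *)
Lemma vdc : N2 (\sum_(a <= n < a + L) z n) <=
  (L + h)%:R / h%:R * (L%:R + 2 * K * (1 + lnn h)).
Proof.
have [h0 hle] := andP ha.
have hR : 0 < h%:R :> R by rewrite ltr0n.
set S := \sum_(_ <= _ < _) z _.
pose c i j := \sum_(a - h <= m < a + L) z (m + i)%N * cj (z (m + j)%N).
have e1 : h%:R * S = \sum_(a - h <= m < a + L) \sum_(0 <= i < h) z (m + i)%N.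
  rewrite exchange_big /= big_nat_cond (eq_bigr (fun=> S)).
    by rewrite -big_nat_cond sumr_const_nat subn0 mulr_natl.
  by move=> i /andP[/andP[_ ih] _]; rewrite shift_sum.
have cij i d : (i + d < h)%N -> c (i + d)%N i = \sum_(a <= n < a + L) z (n + d)%N * cj (z n).
  move=> ih; rewrite /c -[RHS](@shift_sum (fun n => z (n + d)%N * cj (z n)) i); last 2 first.
  - by apply: leq_ltn_trans ih; rewrite leq_addr.
  - by move=> n /zs ->; rewrite [cj 0]/cj conjc0 mulr0.
  by apply: eq_bigr => m _; rewrite addnA.
have cs i j : cabs (c i j) = cabs (c j i).
  rewrite -cabs_cj /c cj_sum; congr cabs; apply: eq_bigr => m _.
  by rewrite cjM cjK mulrC.
have cd i : (i < h)%N -> cabs (c i i) <= L%:R.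
  move=> ih; have := @cij i 0%N; rewrite !addn0 => -> //.
  apply: le_trans (cabs_sum _ _ _) _.
  apply: le_trans (_ : \sum_(a <= n < a + L) 1 <= _); last by rewrite sumr_const_nat addKn.
  by apply: ler_sum => n _; rewrite addn0 cabsM cabs_cj -expr2 cabs_sqr.
have co i d : (0 < d)%N -> (i + d < h)%N -> cabs (c (i + d)%N i) <= K / d%:R.
  by move=> d0 ih; rewrite cij // hcorr // d0 (leq_ltn_trans _ ih) // leq_addl.
have H0 : 0 <= 1 + lnn h by have := lnn_ge0 h0; lra.
have harm k : (k <= h)%N -> \sum_(1 <= d < k) K / d%:R <= K * (1 + lnn h).
  move=> kh; rewrite -mulr_sumr ler_wpM2l //.
  apply: le_trans (harmonic_le h0).
  have [k1|k1] := leqP k 1; first by rewrite big_geq //; pos.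
  rewrite [X in _ <= X](big_cat_nat (n := k)) //=; [|exact: ltnW|exact: leqW].
  by rewrite lerDl; pos.
have e2 : \sum_(a - h <= m < a + L) N2 (\sum_(0 <= i < h) z (m + i)%N) <=
   \sum_(0 <= i < h) \sum_(0 <= j < h) cabs (c i j).
  have -> : \sum_(a - h <= m < a + L) N2 (\sum_(0 <= i < h) z (m + i)%N) =
     cre (\sum_(0 <= i < h) \sum_(0 <= j < h) c i j).
    transitivity (cre (\sum_(a - h <= m < a + L) \sum_(0 <= i < h) \sum_(0 <= j < h) z (m + i)%N * cj (z (m + j)%N))).
      rewrite cre_sum; apply: eq_bigr => m _; rewrite N2_mulcj cj_sum mulr_suml; congr cre.
      by apply: eq_bigr => i _; rewrite mulr_sumr.
    congr cre; rewrite exchange_big /=; apply: eq_bigr => i _.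
    by rewrite exchange_big.
  apply: le_trans (ler_norm _) (le_trans (cre_le_cabs _) _).
  apply: le_trans (cabs_sum _ _ _) _; apply: ler_sum => i _; exact: cabs_sum.
have e3 : \sum_(0 <= i < h) \sum_(0 <= j < h) cabs (c i j) <= h%:R * (L%:R + 2 * K * (1 + lnn h)).
  apply: le_trans (_ : \sum_(0 <= i < h) (L%:R + 2 * K * (1 + lnn h)) <= _); last first.
    by rewrite sumr_const_nat subn0 -[X in X <= _]mulr_natl.
  apply: ler_sum_nat => i /andP[_ ih].
  rewrite (big_cat_nat (n := i)) //=; last exact: ltnW.
  rewrite [X in _ + X]big_ltn //.
  have q1 : \sum_(0 <= j < i) cabs (c i j) <= K * (1 + lnn h).
    apply: le_trans (harm i.+1 ih); rewrite big_add1 /= big_nat_rev /= add0n.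
    apply: ler_sum_nat => j /andP[_ ji].
    have -> : i = (i - j.+1 + j.+1)%N by lia.
    rewrite {2}(_ : (i - j.+1 + j.+1)%N = i); last by lia.
    by apply: co => //; lia.
  have q2 : \sum_(i.+1 <= j < h) cabs (c i j) <= K * (1 + lnn h).
    apply: le_trans (harm (h - i)%N (leq_subr _ _)); rewrite -{1}[i.+1]add1n big_addn.
    apply: ler_sum_nat => j /andP[j1 ji]; rewrite cs addnC; apply: co => //; lia.
  have := cd i ih; lra.
have : N2 (h%:R * S) <= (L + h)%:R * (h%:R * (L%:R + 2 * K * (1 + lnn h))).
  rewrite e1; apply: le_trans (N2_sum_card _ _ _) _.
  rewrite sumr_const_nat; have -> : (a + L - (a - h))%N = (L + h)%N by lia.
  rewrite ler_wpM2l ?ler0n //; exact: le_trans e2 e3.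
rewrite N2M {1}/N2 cre_nat cim_nat expr0n addr0 => hh.
rewrite -(ler_pM2l (exprn_gt0 2 hR)); apply: le_trans hh _.
rewrite le_eqVlt; apply/orP; left; apply/eqP; field; by rewrite gt_eqF.
Qed.
End VdC.

(** For [tau <= 3 M] the phase increments are at most [tau/n <= 3], below [PI], so the Kusmin-Landau
    bound applies directly. *)
Lemma dirichlet_kl (M a b : nat) (tau : R) : (0 < M <= a)%N -> (b <= 2 * M)%N -> 0 < tau -> tau <= 3 * M%:R ->
  cabs (\sum_(a <= n < b) eix (tau * lnn n)) <= 24 * M%:R / tau.
Proof.
move=> /andP[M0 Ma] bM t0 tM.
have MR : 0 < M%:R :> R by rewrite ltr0n.
have -> : 24 * M%:R / tau = 12 / (tau / (2 * M%:R)) by field; rewrite !gt_eqF.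
apply: kusmin_landau; first by pos.
  move=> n /andP[an nb]; have n0 : (0 < n)%N by lia.
  have nR : 0 < n%:R :> R by rewrite ltr0n.
  rewrite -mulrBr; apply/andP; split.
    rewrite ler_pM2l //; apply: le_trans (lnnS_ge n0).
    by rewrite lef_pV2 ?posrE ?ltr0n // ?mulr_gt0 // -[2]/(2%:R) -natrM ler_nat; lia.
  apply: le_trans (_ : tau * n%:R^-1 <= _); first by rewrite ler_pM2l // lnnS_le.
  apply: le_trans PI_ge3; rewrite ler_pdivrMr //; apply: le_trans tM _.
  by rewrite ler_pM2l // ler_nat; lia.
move=> n an nb; have n0 : (0 < n)%N by lia.
rewrite -!mulrBr ler_pM2l //.
exact: le_trans (lnnS_le (ltn0Sn n)) (lnnS_ge n0).
Qed.

(** For larger [tau] the increments of [tau log n] may wrap around. Differencing by [d] shrinks them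
    to at most [tau d / n^2], which stays below 3 while [tau h <= 3 M^2]. *)
Lemma dirichlet_vdc (M a L h : nat) (tau : R) : (0 < h <= M)%N -> (M <= a)%N -> (a + L <= 2 * M)%N ->
  0 < tau -> tau * h%:R <= 3 * M%:R ^+ 2 ->
  N2 (\sum_(a <= n < a + L) eix (tau * lnn n)) <=
  (L + h)%:R / h%:R * (L%:R + 2 * (96 * M%:R ^+ 2 / tau) * (1 + lnn h)).
Proof.
move=> /andP[h0 hM] Ma aL t0 th.
have MR : 0 < M%:R :> R by rewrite ltr0n; lia.
pose z n := if (a <= n < a + L)%N then eix (tau * lnn n) else 0.
have -> : \sum_(a <= n < a + L) eix (tau * lnn n) = \sum_(a <= n < a + L) z n.
  by apply: eq_big_nat => n hn; rewrite /z hn.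
apply: vdc.
- by rewrite h0 (leq_trans hM).
- by move=> n /negbTE hn; rewrite /z hn.
- by move=> n; rewrite /z; case: ifP; rewrite ?N2_eix ?N20.
- by pos.
move=> d /andP[d0 dh].
have dR : 0 < d%:R :> R by rewrite ltr0n.
have [Ld|dL] := leqP L d.
  rewrite big_nat_cond big1 ?cabs0; first by pos.
  by move=> n /andP[/andP[n1 n2] _]; rewrite /z ifF ?mul0r //; apply/negbTE; lia.
rewrite (big_cat_nat (n := (a + L - d)%N)) /=; [|lia|lia].
rewrite [X in _ + X]big_nat_cond [X in _ + X]big1 ?addr0; last first.
  by move=> n /andP[/andP[n1 n2] _]; rewrite /z ifF ?mul0r //; apply/negbTE; lia.
rewrite -cabs_cj cj_sum.
have -> : \sum_(a <= n < a + L - d) cj (z (n + d)%N * cj (z n)) =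
   \sum_(a <= n < a + L - d) eix (tau * (lnn n - lnn (n + d))).
  apply: eq_big_nat => n /andP[n1 n2]; rewrite /z !ifT; [|lia|lia].
  by rewrite cjM cjK mulrC -eixN -eixD; congr eix; ring.
have -> : 96 * M%:R ^+ 2 / tau / d%:R = 12 / (tau * (d%:R / (8 * M%:R ^+ 2))).
  by field; rewrite !gt_eqF.
have eE n : tau * (lnn n.+1 - lnn (n.+1 + d)) - tau * (lnn n - lnn (n + d)) = tau * ediff d n.
  by rewrite /ediff; ring.
apply: kusmin_landau; first by pos.
  move=> n /andP[n1 n2]; rewrite eE.
  have n0 : (0 < n)%N by lia.
  have nR : 0 < n%:R :> R by rewrite ltr0n.
  apply/andP; split; first by rewrite ler_pM2l //; apply: ediff_ge; lia.
  apply: le_trans (_ : tau * (d%:R / n%:R ^+ 2) <= _); first by rewrite ler_pM2l // ediff_le.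
  apply: le_trans PI_ge3; rewrite mulrA ler_pdivrMr ?exprn_gt0 //.
  apply: le_trans (_ : tau * h%:R <= _); first by rewrite ler_pM2l // ler_nat ltnW.
  apply: le_trans th _; rewrite ler_pM2l // ler_pXn2r ?nnegrE ?ler0n // ler_nat; lia.
move=> n n1 n2; rewrite !eE ler_pM2l //; apply: ediff_anti; lia.
Qed.

(** * Dirichlet polynomials on sparse sets of frequencies *)

Lemma gram_sum I N (r : seq I) (s : seq N) (a : I -> N -> CC) (c : I -> CC) :
  \sum_(n <- s) N2 (\sum_(i <- r) c i * a i n) =
  cre (\sum_(i <- r) \sum_(j <- r) c i * cj (c j) * \sum_(n <- s) a i n * cj (a j n)).
Proof.
transitivity (cre (\sum_(n <- s) \sum_(i <- r) \sum_(j <- r) c i * cj (c j) * (a i n * cj (a j n)))).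
  rewrite cre_sum; apply: eq_bigr => n _; rewrite N2_mulcj cj_sum mulr_suml; congr cre.
  apply: eq_bigr => i _; rewrite mulr_sumr; apply: eq_bigr => j _.
  by rewrite cjM; ring.
congr cre; rewrite exchange_big /=; apply: eq_bigr => i _.
by rewrite exchange_big /=; apply: eq_bigr => j _; rewrite mulr_sumr.
Qed.

(** Perturbation of Gram matrices: an entrywise error [eta] changes the quadratic form by at most
    [eta] times the number of vectors. The model vectors [a'] may live on another index set. *)
Lemma gram_bound (I : eqType) N M (r : seq I) (s : seq N) (u : seq M)
    (a : I -> N -> CC) (a' : I -> M -> CC) (C eta : R) :
  (forall i j, i \in r -> j \in r ->
     cabs (\sum_(n <- s) a i n * cj (a j n) - \sum_(m <- u) a' i m * cj (a' j m)) <= eta) ->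
  (forall c : I -> CC, \sum_(m <- u) N2 (\sum_(i <- r) c i * a' i m) <= C * \sum_(i <- r) N2 (c i)) ->
  forall c : I -> CC, \sum_(n <- s) N2 (\sum_(i <- r) c i * a i n) <=
    (C + eta * (size r)%:R) * \sum_(i <- r) N2 (c i).
Proof.
move=> h1 h2 c.
set S := \sum_(i <- r) N2 (c i).
suff : \sum_(n <- s) N2 (\sum_(i <- r) c i * a i n) - \sum_(m <- u) N2 (\sum_(i <- r) c i * a' i m) <=
    eta * (size r)%:R * S.
  by have := h2 c; rewrite -/S mulrDl; lra.
rewrite !gram_sum -creB -sumrB.
apply: le_trans (ler_norm _) (le_trans (cre_le_cabs _) _).
have [->|r0] := eqVneq r [::]; first by rewrite !big_nil cabs0 mulr0 mul0r.
have eta0 : 0 <= eta.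
  case: (r) r0 h1 => // i r' _ h1; have := h1 i i (mem_head _ _) (mem_head _ _).
  exact: le_trans.
apply: le_trans (_ : \sum_(i <- r) \sum_(j <- r) eta * (cabs (c i) * cabs (c j)) <= _).
  apply: le_trans (cabs_sum _ _ _) _; rewrite big_seq [X in _ <= X]big_seq; apply: ler_sum => i ir.
  rewrite -sumrB; apply: le_trans (cabs_sum _ _ _) _; rewrite big_seq [X in _ <= X]big_seq; apply: ler_sum => j jr.
  rewrite -mulrBr !cabsM cabs_cj mulrC ler_wpM2r ?h1 //; by pos.
under eq_bigr do rewrite -mulr_sumr -mulr_sumr.
rewrite -mulr_sumr -mulr_suml -expr2 -mulrA ler_wpM2l //.
have := CS_real r xpredT (fun=> 1) (fun i => cabs (c i)).
rewrite (eq_bigr (fun i => cabs (c i))); last by move=> i _; rewrite mul1r.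
have -> : \sum_(i <- r) (1 : R) ^+ 2 = (size r)%:R.
  by rewrite (eq_bigr (fun=> 1)) ?big_const_seq ?count_predT ?iter_addr ?addr0 // => i _; rewrite expr1n.
by rewrite [X in _ * X](eq_bigr (fun i => N2 (c i))) // => i _; rewrite cabs_sqr.
Qed.

(** The building block of the Gram entries below. The factor [d] normalises the sum over multiples
    of [d], so that for small [tau] the value hardly depends on [d]. *)
Definition Td (N1 N2' d : nat) (tau : R) : CC :=
  \sum_(N1 <= n < N2' | (d %| n)%N) (d%:R / n%:R)%:C * eix (tau * lnn n).

Lemma Td_neg N1 N2' d tau : Td N1 N2' d (- tau) = cj (Td N1 N2' d tau).
Proof.
rewrite /Td cj_sum; apply: eq_bigr => n _.
by rewrite cjM cj_rc -eixN mulNr.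
Qed.

Lemma abel_bound (z : nat -> CC) (a b : nat) (B : R) : (0 < a)%N -> (a <= b)%N ->
  (forall c, (a <= c <= b)%N -> cabs (\sum_(a <= n < c) z n) <= B) ->
  cabs (\sum_(a <= n < b) (n%:R^-1)%:C * z n) <= B / a%:R.
Proof.
move=> a0 ab hB.
have aR : 0 < a%:R :> R by rewrite ltr0n.
pose Z c := \sum_(a <= n < c) z n.
have B0 : 0 <= B by apply: le_trans (hB a _); rewrite ?leqnn.
suff key : forall k, (a + k <= b)%N ->
   \sum_(a <= n < a + k) (n%:R^-1)%:C * z n =
   ((a + k)%:R^-1)%:C * Z (a + k)%N + \sum_(a <= n < a + k) ((n%:R^-1 - n.+1%:R^-1)%:C * Z n.+1).
  rewrite -(subnKC ab) key ?subnKC //.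
  apply: le_trans (cabsD _ _) _.
  have h1 : cabs ((b%:R^-1)%:C * Z b) <= b%:R^-1 * B.
    rewrite cabsM cabs_rc ger0_norm; last by pos.
    by rewrite ler_wpM2l ?invr_ge0 ?ler0n // hB // ab leqnn.
  have h2 : cabs (\sum_(a <= n < b) ((n%:R^-1 - n.+1%:R^-1)%:C * Z n.+1)) <= (a%:R^-1 - b%:R^-1) * B.
    apply: le_trans (cabs_sum _ _ _) _.
    have -> : (a%:R^-1 - b%:R^-1) * B = \sum_(a <= n < b) (n%:R^-1 - n.+1%:R^-1) * B.
      rewrite -mulr_suml; congr (_ * _).
      rewrite -[RHS]opprK -sumrN; under [in RHS]eq_bigr do rewrite opprB.
      by rewrite (telescope_sumr (fun n => n%:R^-1 : R)) // opprB.
    apply: ler_sum_nat => n /andP[an nb].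
    have d0 : 0 <= n%:R^-1 - n.+1%:R^-1 :> R.
      have n0 : (0 < n)%N by apply: leq_trans an.
      by rewrite subr_ge0 lef_pV2 ?posrE ?ltr0n // ler_nat.
    rewrite cabsM cabs_rc ger0_norm // ler_wpM2l // hB // leqW //.
  apply: le_trans (lerD h1 h2) _; lra.
elim=> [|k IH] hk; first by rewrite addn0 !big_geq // /Z big_geq // mulr0 addr0.
rewrite addnS !big_nat_recr ?leq_addr //= IH; last by rewrite (leq_trans _ hk) // addnS.
have -> : z (a + k)%N = Z (a + k).+1 - Z (a + k)%N by rewrite /Z big_nat_recr ?leq_addr //=; ring.
rewrite rcD rcN; ring.
Qed.

(** Outside the Kusmin-Landau range, van der Corput with shift [g^4] is used. The logarithm is
    bounded by [4 g], and a saving [g^-3] remains in the square, which is more than [23/g]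
    requires. *)
Lemma dyadic_far (A b g : nat) (tau : R) : (0 < g)%N -> (g ^ 4 <= A)%N -> (A <= b)%N -> (b <= 2 * A)%N ->
  0 < tau -> tau * (g ^ 4)%:R <= 3 * A%:R ^+ 2 ->
  cabs (\sum_(A <= n < b) eix (tau * lnn n)) <= A%:R * (24 / tau + 23 / g%:R).
Proof.
move=> g0 gA Ab b2 t0 th.
have gR : 0 < g%:R :> R by rewrite ltr0n.
have h0 : (0 < g ^ 4)%N by rewrite expn_gt0 g0.
have A0 : (0 < A)%N by apply: leq_trans gA.
have AR : 0 < A%:R :> R by rewrite ltr0n.
have [t3|t3] := lerP tau (3 * A%:R).
  apply: le_trans (dirichlet_kl _ b2 t0 t3) _; first by rewrite A0 leqnn.
  rewrite mulrDr [24 * _]mulrC -mulrA lerDl; by pos.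
apply: le_trans (_ : 23 * A%:R / g%:R <= _); last first.
  rewrite mulrDr; have : 0 <= A%:R * (24 / tau) by pos. by lra.
apply: cabs_le; first by pos.
have := @dirichlet_vdc A A (b - A) (g ^ 4) tau.
rewrite subnKC // => /(_ _ (leqnn _) b2 t0 th); rewrite h0 gA => /(_ isT) h.
apply: le_trans h _.
have lg : 1 + lnn (g ^ 4) <= 4 * g%:R.
  rewrite lnnX //; have := ln_le_subr1 gR; rewrite -/(lnn g) -[4%:R]/(4 : R); lra.
have lg0 : 0 <= 1 + lnn (g ^ 4) by have := lnn_ge0 h0; lra.
have e1 : 96 * A%:R ^+ 2 / tau <= 32 * A%:R.
  rewrite ler_pdivrMr //; have := ler_wpM2l (ltW AR) (ltW t3); lra.
have e2 : (b - A)%:R + 2 * (96 * A%:R ^+ 2 / tau) * (1 + lnn (g ^ 4)) <= A%:R * (257 * g%:R).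
  have : (b - A)%:R <= A%:R :> R by rewrite ler_nat; lia.
  have g1 : 1 <= g%:R :> R by rewrite ler1n.
  have := ler_wpM2r lg0 e1; have := ler_wpM2l (ltW AR) lg; have := ler_wpM2l (ltW AR) g1.
  lra.
have e3 : (b - A + g ^ 4)%:R / (g ^ 4)%:R <= 2 * A%:R / (g ^ 4)%:R :> R.
  by rewrite ler_wpM2r ?invr_ge0 ?ler0n // -[2]/(2%:R) -natrM ler_nat; lia.
apply: le_trans (ler_pM _ _ e3 e2) _.
- by pos.
- have : 0 <= 96 * A%:R ^+ 2 / tau by pos.
  by move=> ?; pos.
rewrite natrX.
have -> : 2 * A%:R / g%:R ^+ 4 * (A%:R * (257 * g%:R)) = A%:R ^+ 2 / g%:R ^+ 2 * (514 / g%:R) :> R.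
  by field; rewrite gt_eqF.
have -> : (23 * A%:R / g%:R) ^+ 2 = A%:R ^+ 2 / g%:R ^+ 2 * 529 :> R by field; rewrite gt_eqF.
apply: ler_wpM2l; first by pos.
rewrite ler_pdivrMr //; have : 1 <= g%:R :> R by rewrite ler1n.
lra.
Qed.

Lemma logsum_far (J a b g : nat) (tau : R) : (0 < g)%N -> (g ^ 4 <= a)%N -> (b <= 2 ^ J * a)%N ->
  0 < tau -> tau * (g ^ 4)%:R <= 3 * a%:R ^+ 2 ->
  cabs (\sum_(a <= m < b) (m%:R^-1)%:C * eix (tau * lnn m)) <= J%:R * (24 / tau + 23 / g%:R).
Proof.
move=> g0; have gR : 0 < g%:R :> R by rewrite ltr0n.
elim: J a => [|J IH] a ga hb t0 th.
  by rewrite big_geq ?cabs0 ?mul0r //; rewrite expn0 mul1n in hb.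
have a0 : (0 < a)%N by apply: leq_trans ga; rewrite expn_gt0 g0.
have aR : 0 < a%:R :> R by rewrite ltr0n.
have E0 : 0 <= 24 / tau + 23 / g%:R by pos.
have [ba|ab] := leqP b a; first by rewrite big_geq // cabs0; pos.
have first_part c : (a <= c)%N -> (c <= 2 * a)%N ->
    cabs (\sum_(a <= m < c) (m%:R^-1)%:C * eix (tau * lnn m)) <= 24 / tau + 23 / g%:R.
  move=> ac c2.
  apply: le_trans (abel_bound (B := a%:R * (24 / tau + 23 / g%:R)) a0 ac _) _.
    move=> e /andP[ae ec]; apply: dyadic_far => //; lia.
  by rewrite mulrAC mulfV ?gt_eqF // mul1r.
rewrite -natr1 mulrDl mul1r.
have [b2|b2] := leqP b (2 * a).
  apply: le_trans (first_part _ (ltnW ab) b2) _; rewrite lerDr; by pos.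
rewrite (big_cat_nat (n := (2 * a)%N)) //=; [|lia|lia].
apply: le_trans (cabsD _ _) _; rewrite [X in _ <= X]addrC; apply: lerD; first by apply: first_part; lia.
apply: IH => //; first by lia.
  by rewrite mulnA -expnSr.
apply: le_trans th _; rewrite ler_pM2l // ler_pXn2r ?nnegrE ?ler0n // ler_nat; lia.
Qed.

Definition cdiv (n d : nat) : nat := ((n + d.-1) %/ d)%N.

Lemma cdivS n d : (0 < d)%N -> cdiv n.+1 d = (cdiv n d + (d %| n))%N.
Proof.
move=> d0; rewrite /cdiv /dvdn {1 2}(divn_eq n d).
set q := (n %/ d)%N; set r := (n %% d)%N.
have rd : (r < d)%N by rewrite ltn_mod.
have -> : ((q * d + r).+1 + d.-1 = q.+1 * d + r)%N by lia.
rewrite -addnA !divnMDl // (divn_small rd) addn0.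
have [->|rn] := eqVneq r 0%N.
  by rewrite add0n divn_small ?prednK //; lia.
have -> : (r + d.-1 = 1 * d + r.-1)%N by lia.
by rewrite divnMDl // divn_small //; lia.
Qed.

Lemma sum_multiples (F : nat -> CC) (N1 N2' d : nat) : (0 < d)%N -> (N1 <= N2')%N ->
  \sum_(N1 <= n < N2' | (d %| n)%N) F n = \sum_(cdiv N1 d <= m < cdiv N2' d) F (d * m)%N.
Proof.
move=> d0 /subnKC <-; elim: (N2' - N1)%N => [|k IH]; first by rewrite addn0 !big_geq.
have mono j : (cdiv N1 d <= cdiv (N1 + j) d)%N.
  by elim: j => [|j IHj]; rewrite ?addn0 // addnS cdivS // (leq_trans IHj) // leq_addr.
rewrite addnS cdivS // big_mkcond big_nat_recr ?leq_addr //= -big_mkcond /= IH.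
case: ifP => dv; last by rewrite addn0 addr0.
rewrite addn1 big_nat_recr //=; congr (_ + F _).
case/dvdnP: dv => q ->; rewrite /cdiv divnMDl // divn_small ?addn0 1?mulnC //.
by rewrite prednK.
Qed.

Lemma cdiv_ge n d : (0 < d)%N -> (n <= d * cdiv n d)%N.
Proof.
by move=> d0; rewrite /cdiv; have := divn_eq (n + d.-1) d; have := ltn_pmod (n + d.-1) d0; lia.
Qed.
Lemma cdiv_lt n d : (0 < d)%N -> (d * cdiv n d < n + d)%N.
Proof.
by move=> d0; rewrite /cdiv mulnC; have := leq_divM (n + d.-1) d; lia.
Qed.

Definition fz (tau : R) (n : nat) : CC := (n%:R^-1)%:C * eix (tau * lnn n).

Lemma fz_diff tau (x y : nat) : (0 < x)%N -> (x <= y)%N ->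
  cabs (fz tau y - fz tau x) <= (1 + `|tau|) * (y%:R - x%:R) / x%:R ^+ 2.
Proof.
move=> x0 xy; have y0 : (0 < y)%N by apply: leq_trans xy.
have xR : 0 < x%:R :> R by rewrite ltr0n.
have yR : 0 < y%:R :> R by rewrite ltr0n.
have xyR : x%:R <= y%:R :> R by rewrite ler_nat.
have -> : fz tau y - fz tau x = (y%:R^-1 - x%:R^-1)%:C * eix (tau * lnn y) +
   (x%:R^-1)%:C * (eix (tau * lnn y) - eix (tau * lnn x)).
  by rewrite /fz rcD rcN; ring.
apply: le_trans (cabsD _ _) _; rewrite !cabsM cabs_eix mulr1 !cabs_rc.
have h1 : `|y%:R^-1 - x%:R^-1| <= (y%:R - x%:R) / x%:R ^+ 2 :> R.
  have -> : y%:R^-1 - x%:R^-1 = - ((y%:R - x%:R) / (x%:R * y%:R)) :> R by field; rewrite !gt_eqF.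
  rewrite normrN ger0_norm; last by rewrite divr_ge0 ?subr_ge0 // mulr_ge0 // ltW.
  by rewrite ler_wpM2l ?subr_ge0 // lef_pV2 ?posrE ?mulr_gt0 ?exprn_gt0 // expr2 ler_pM2l.
have h2 : cabs (eix (tau * lnn y) - eix (tau * lnn x)) <= `|tau| * ((y%:R - x%:R) / x%:R).
  apply: le_trans (cabs_eix_lip _ _) _; rewrite -mulrBr normrM ler_wpM2l //.
  rewrite ger0_norm ?subr_ge0 ?ler_lnn // /lnn -ln_div //.
  apply: le_trans (ln_le_subr1 _) _; first by pos.
  by rewrite mulrBl mulfV ?gt_eqF.
rewrite [`|x%:R^-1|]ger0_norm; last by pos.
have xi : 0 <= x%:R^-1 :> R by pos.
have := ler_wpM2l xi h2.
have -> : x%:R^-1 * (`|tau| * ((y%:R - x%:R) / x%:R)) = `|tau| * (y%:R - x%:R) / x%:R ^+ 2.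
  by field; rewrite gt_eqF.
have -> : (1 + `|tau|) * (y%:R - x%:R) / x%:R ^+ 2 = (y%:R - x%:R) / x%:R ^+ 2 + `|tau| * (y%:R - x%:R) / x%:R ^+ 2 by ring.
by move=> h3; apply: lerD.
Qed.

Lemma sum_inv_sqr (a b : nat) : (0 < a)%N -> \sum_(a <= m < b) (m%:R ^- 2 : R) <= 2 / a%:R.
Proof.
move=> a0; have aR : 0 < a%:R :> R by rewrite ltr0n.
have [ba|ab] := leqP b a; first by rewrite big_geq //; pos.
apply: le_trans (_ : \sum_(a <= m < b) 2 * (m%:R^-1 - m.+1%:R^-1) <= _).
  apply: ler_sum_nat => m /andP[am _]; have m0 : (0 < m)%N by apply: leq_trans am.
  have m1 : 1 <= m%:R :> R by rewrite ler1n.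
  have mR : 0 < m%:R :> R by rewrite ltr0n.
  rewrite -[m.+1%:R]natr1; move: (m%:R : R) m1 mR => x x1 x0.
  have -> : 2 * (x^-1 - (x + 1)^-1) = 2 / (x * (x + 1)) by field; rewrite !gt_eqF //; lra.
  rewrite -[X in X <= _]mul1r ler_pdivrMr; last by pos.
  rewrite mulrAC ler_pdivlMr; last by apply: mulr_gt0 => //; lra.
  have := ler_wpM2l (ltW x0) x1; lra.
rewrite -mulr_sumr ler_pM2l //.
have -> : \sum_(a <= i < b) (i%:R^-1 - i.+1%:R^-1 : R) = a%:R^-1 - b%:R^-1.
  rewrite -[LHS]opprK -sumrN; under eq_bigr do rewrite opprB.
  by rewrite (telescope_sumr (fun n => n%:R^-1 : R)) ?(ltnW ab) // opprB.
by rewrite gerBl invr_ge0 ler0n.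
Qed.

Lemma sum_fz_short tau (u v N d : nat) : (0 < N)%N -> (N <= u)%N -> (v <= u + d)%N ->
  cabs (\sum_(u <= n < v) fz tau n) <= d%:R / N%:R.
Proof.
move=> N0 Nu vd; have NR : 0 < N%:R :> R by rewrite ltr0n.
apply: le_trans (cabs_sum _ _ _) _.
apply: le_trans (_ : \sum_(u <= n < v) N%:R^-1 <= _).
  apply: ler_sum_nat => n /andP[un _].
  rewrite /fz cabsM cabs_eix mulr1 cabs_rc ger0_norm ?invr_ge0 ?ler0n //.
  by rewrite lef_pV2 ?posrE ?ltr0n ?ler_nat; lia.
rewrite sumr_const_nat -[X in X <= _]mulr_natl ler_wpM2r ?invr_ge0 ?ler0n // ler_nat; lia.
Qed.

Lemma sum_reshape (F : nat -> CC) (d a b : nat) : (a <= b)%N ->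
  \sum_(d * a <= n < d * b) F n = \sum_(a <= m < b) \sum_(0 <= i < d) F (d * m + i)%N.
Proof.
move=> /subnKC <-; elim: (b - a)%N => [|k IH]; first by rewrite addn0 !big_geq.
rewrite addnS [RHS]big_nat_recr ?leq_addr //= -IH.
rewrite (big_cat_nat (n := (d * (a + k))%N)) /=; [|by rewrite leq_mul2l leq_addr orbT|by rewrite leq_mul2l leqnSn orbT].
by congr (_ + _); rewrite mulnS [(d + _)%N]addnC sum_shift [RHS]big_mkord.
Qed.

(** Each multiple [d m], with its weight [d], stands for the [d] integers from [d m] on. Over such a
    block the terms vary by at most [(1 + |tau|) / (d m^2)], and otherwise only the two ends of the
    range fail to match. *)
Lemma Td_near (N1 N2' d : nat) (tau : R) : (0 < d)%N -> (0 < N1)%N -> (N1 <= N2')%N ->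
  cabs (Td N1 N2' d tau - Td N1 N2' 1 tau) <= (4 + 2 * `|tau|) * d%:R / N1%:R.
Proof.
move=> d0 N10 N12.
have NR : 0 < N1%:R :> R by rewrite ltr0n.
have dR : 0 < d%:R :> R by rewrite ltr0n.
set a := cdiv N1 d; set b := cdiv N2' d.
have ge1 := cdiv_ge N1 d0; have ge2 := cdiv_ge N2' d0.
have lt1 := cdiv_lt N1 d0; have lt2 := cdiv_lt N2' d0.
rewrite -/a in ge1 lt1; rewrite -/b in ge2 lt2.
have a0 : (0 < a)%N by case: (a) ge1 => //; rewrite muln0; lia.
have aR : 0 < a%:R :> R by rewrite ltr0n.
have ab : (a <= b)%N.
  by rewrite leqNgt; apply/negP => ba; have := leq_mul (leqnn d) ba; lia.
have E1 : Td N1 N2' 1 tau = \sum_(N1 <= n < N2') fz tau n.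
  rewrite /Td; apply: eq_big => n; first by rewrite dvd1n.
  by move=> _; rewrite /fz div1r.
have Ed : Td N1 N2' d tau = \sum_(a <= m < b) \sum_(0 <= i < d) fz tau (d * m).
  rewrite /Td sum_multiples //; apply: eq_big_nat => m /andP[am _].
  have m0 : (0 < m)%N by apply: leq_trans am.
  rewrite sumr_const_nat subn0 /fz -[RHS]mulr_natl [RHS]mulrA; congr (_ * _).
  have -> : (d%:R : CC) = (d%:R)%:C by rewrite rmorph_nat.
  by rewrite -rcM.
have E2 : \sum_(d * a <= n < d * b) fz tau n = \sum_(a <= m < b) \sum_(0 <= i < d) fz tau (d * m + i)%N.
  by rewrite sum_reshape.
have h1 : cabs (\sum_(d * a <= n < d * b) fz tau n - Td N1 N2' d tau) <= (2 + 2 * `|tau|) * d%:R / N1%:R.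
  rewrite E2 Ed -sumrB; apply: le_trans (cabs_sum _ _ _) _.
  apply: le_trans (_ : \sum_(a <= m < b) (1 + `|tau|) * m%:R ^- 2 <= _).
    apply: ler_sum_nat => m /andP[am _]; have m0 : (0 < m)%N by apply: leq_trans am.
    have mR : 0 < m%:R :> R by rewrite ltr0n.
    rewrite -sumrB; apply: le_trans (cabs_sum _ _ _) _.
    apply: le_trans (_ : \sum_(0 <= i < d) (1 + `|tau|) * d%:R / (d * m)%:R ^+ 2 <= _).
      apply: ler_sum_nat => i /andP[_ id].
      apply: le_trans (fz_diff _ _ _) _; [by rewrite muln_gt0 d0|by rewrite leq_addr|].
      rewrite natrD addrAC subrr add0r ler_wpM2r //; first by pos.
      by rewrite ler_wpM2l ?ler_nat ?(ltnW id) //; pos.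
    rewrite sumr_const_nat subn0 -mulr_natl natrM le_eqVlt; apply/orP; left; apply/eqP.
    by field; rewrite !gt_eqF.
  rewrite -mulr_sumr.
  have p1 : 0 <= 1 + `|tau| by pos.
  apply: le_trans (ler_wpM2l p1 (sum_inv_sqr _ a0)) _.
  have : a%:R^-1 <= d%:R / N1%:R :> R.
    rewrite -[X in X <= _]mul1r ler_pdivrMr // mulrAC ler_pdivlMr // mul1r -natrM ler_nat //.
  move=> h; have := ler_wpM2l p1 h; lra.
have e3 : \sum_(N1 <= n < N2') fz tau n + \sum_(N2' <= n < d * b) fz tau n =
   \sum_(N1 <= n < d * a) fz tau n + \sum_(d * a <= n < d * b) fz tau n.
  rewrite -!big_cat_nat //=; [by rewrite leq_mul2l ab orbT].
have s1 : cabs (\sum_(N2' <= n < d * b) fz tau n) <= d%:R / N1%:R by apply: sum_fz_short => //; lia.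
have s2 : cabs (\sum_(N1 <= n < d * a) fz tau n) <= d%:R / N1%:R by apply: sum_fz_short => //; lia.
have -> : Td N1 N2' d tau - Td N1 N2' 1 tau =
   - (\sum_(d * a <= n < d * b) fz tau n - Td N1 N2' d tau) +
   (\sum_(N2' <= n < d * b) fz tau n + - \sum_(N1 <= n < d * a) fz tau n).
  rewrite E1; have -> : \sum_(N1 <= n < N2') fz tau n = \sum_(N1 <= n < d * a) fz tau n +
     \sum_(d * a <= n < d * b) fz tau n - \sum_(N2' <= n < d * b) fz tau n by rewrite -e3; ring.
  ring.
apply: le_trans (cabsD _ _) _; rewrite cabsN.
apply: le_trans (lerD h1 (cabsD _ _)) _; rewrite cabsN.
have -> : (4 + 2 * `|tau|) * d%:R / N1%:R = (2 + 2 * `|tau|) * d%:R / N1%:R + (d%:R / N1%:R + d%:R / N1%:R) by ring.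
by rewrite lerD2l lerD.
Qed.

(** The substitution [n = d m] leads to a logarithmic sum over at most [J + 1] dyadic blocks. *)
Lemma Td_far (N1 N2' d g J : nat) (tau : R) : (0 < d)%N -> (0 < g)%N -> (N1 <= N2')%N ->
  (d <= N1)%N -> (g ^ 4 * d <= N1)%N -> (N2' <= 2 ^ J * N1)%N ->
  0 < `|tau| -> `|tau| * (g ^ 4)%:R * d%:R ^+ 2 <= 3 * N1%:R ^+ 2 ->
  cabs (Td N1 N2' d tau) <= J.+1%:R * (24 / `|tau| + 23 / g%:R).
Proof.
move=> d0 g0 N12 dN gN NJ t0 tg.
wlog tp : tau t0 tg / 0 < tau.
  move=> h; have [tn|tn|te] := ltgtP tau 0; last by rewrite te normr0 ltxx in t0.
    rewrite -[tau]opprK Td_neg cabs_cj normrN; apply: h; rewrite ?normrN //; lra.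
  exact: h.
rewrite gtr0_norm // in t0 tg *.
set a := cdiv N1 d; set b := cdiv N2' d.
have ge1 := cdiv_ge N1 d0; have lt2 := cdiv_lt N2' d0.
rewrite -/a in ge1; rewrite -/b in lt2.
have aR : N1%:R <= d%:R * a%:R :> R by rewrite -natrM ler_nat.
have NR : 0 < N1%:R :> R by rewrite ltr0n; lia.
have dR : 0 < d%:R :> R by rewrite ltr0n.
have -> : Td N1 N2' d tau = eix (tau * lnn d) * \sum_(a <= m < b) (m%:R^-1)%:C * eix (tau * lnn m).
  rewrite /Td sum_multiples // mulr_sumr; apply: eq_big_nat => m /andP[am _].
  have m0 : (0 < m)%N by apply: leq_trans am; rewrite -/a; case: (a) ge1 => //; rewrite muln0; lia.
  have -> : d%:R / (d * m)%:R = m%:R^-1 :> R by rewrite natrM; field; rewrite !pnatr_eq0 -!lt0n m0 d0.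
  by rewrite lnnM // mulrDr eixD; ring.
rewrite cabsM cabs_eix mul1r; apply: logsum_far => //.
- by rewrite -(leq_pmul2l d0) mulnC; apply: leq_trans ge1.
- rewrite -(leq_pmul2l d0) expnS; apply: leq_trans (ltnW lt2) _.
  have := leq_mul (leqnn (2 ^ J)) ge1; rewrite !mulnA [(2 ^ J * d)%N]mulnC; nia.
rewrite -(ler_pM2r (exprn_gt0 2 dR)); apply: le_trans tg _.
have : N1%:R ^+ 2 <= (d%:R * a%:R) ^+ 2 :> R by rewrite ler_pXn2r ?nnegrE ?mulr_ge0 ?ler0n.
rewrite exprMn; lra.
Qed.

Arguments cj _ : simpl never.
Arguments eix _ : simpl never.
Arguments real_complex_def {F} phF x : simpl never.
Lemma rc_comb4 (s x1 x2 x3 x4 : R) (e : CC) :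
  s%:C * (x1%:C * e - x2%:C * e - x3%:C * e + x4%:C * e) = (s * (x1 - x2 - x3 + x4))%:C * e.
Proof. by rewrite rcM !rcD !rcN; ring. Qed.

Lemma tk_alg_ne (a b x y v p q : R) : a != 0 -> b != 0 -> p = a ^+ 2 -> q = b ^+ 2 ->
  a * (x - p^-1) * (b * (y - q^-1)) * v =
  (a * b)^-1 * (x * y * (p * q * v) - x * (p * v) - y * (q * v) + true%:R * (1 * v)).
Proof. by move=> a0 b0 -> ->; rewrite /=; field; rewrite a0 b0. Qed.

Lemma tk_alg_eq (a v p : R) (x : bool) : a != 0 -> p = a ^+ 2 ->
  a * (x%:R - p^-1) * (a * (x%:R - p^-1)) * v =
  (1 - 2 / p) * (x%:R * (p * v)) + p^-1 * (true%:R * (1 * v)).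
Proof. by move=> a0 ->; case: x; rewrite /=; field; rewrite a0. Qed.

(** * Large sieve and Turan-Kubilius inequality at sparse frequencies *)

Section SparseLargeSieve.
Variables (N1 N2' w z2 : nat) (theta tb tau0 eta : R) (ks : seq nat).
Hypothesis N10 : (0 < N1)%N.
Hypothesis w0 : (0 < w)%N.
Hypothesis th0 : 0 < theta.
Hypothesis thN : theta * lnn N2' <= PI.
Hypothesis thw : theta * w%:R <= N1%:R.
Hypothesis tw : tau0 <= theta * w%:R.
Hypothesis uk : uniq ks.
Let tt (k : nat) : R := tb + theta * k%:R.
Hypothesis eta0 : 0 <= eta.
Hypothesis hfar : forall k l, k \in ks -> l \in ks -> tau0 <= `|tt k - tt l| ->
  cabs (Td N1 N2' 1 (tt k - tt l)) <= eta.
Hypothesis hdiff : forall k l d, k \in ks -> l \in ks -> (0 < d <= z2)%N ->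
  cabs (Td N1 N2' d (tt k - tt l) - Td N1 N2' 1 (tt k - tt l)) <= eta.

Definition an (t : R) (n : nat) : CC := ((Num.sqrt n%:R)^-1)%:C * eix (t * lnn n).

Lemma an_gram t u n : an t n * cj (an u n) = (n%:R^-1)%:C * eix ((t - u) * lnn n).
Proof.
rewrite /an cjM cj_rc.
have -> : n%:R^-1 = (Num.sqrt n%:R)^-1 * (Num.sqrt n%:R)^-1 :> R.
  by rewrite -invfM -expr2 sqr_sqrtr ?ler0n.
rewrite rcM mulrBl eixD eixN; ring.
Qed.

Lemma Td1E tau : Td N1 N2' 1 tau = \sum_(N1 <= n < N2') (n%:R^-1)%:C * eix (tau * lnn n).
Proof.
by rewrite /Td; apply: eq_big => n; [rewrite dvd1n|move=> _; rewrite div1r].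
Qed.

(** The [w] lattice points of one cluster are covered by the mean value theorem in dual form; by
    [theta * w <= N1] the length of the polynomial dominates the frequency range. *)
Lemma cluster_dual (t0 : R) (c : nat -> CC) :
  \sum_(N1 <= n < N2') N2 (\sum_(0 <= i < w) c i * an (t0 + theta * i%:R) n) <=
  864 / theta * \sum_(0 <= i < w) N2 (c i).
Proof.
have C0 : 0 <= 864 / theta by pos.
pose A (i n : nat) : CC := ((Num.sqrt n%:R)^-1)%:C * eix (- ((t0 + theta * i%:R) * lnn n)).
have h1 (b : nat -> CC) : \sum_(0 <= i < w) N2 (\sum_(N1 <= n < N2') b n * A i n) <=
    864 / theta * \sum_(N1 <= n < N2') N2 (b n).
  have [NN|NN] := leqP N2' N1.
    rewrite [X in _ * X]big_geq // mulr0 big1 // => i _; by rewrite big_geq // N20.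
  (* The mean value theorem sums from 1, so the coefficients are extended by 0 below [N1]. *)
  pose b' n := if (N1 <= n)%N then b n * ((Num.sqrt n%:R)^-1)%:C else 0.
  have := @mean_value theta t0 w N2' b' th0 thN.
  have e (F : nat -> CC) : (forall n, (n < N1)%N -> F n = 0) -> \sum_(1 <= n < N2') F n = \sum_(N1 <= n < N2') F n.
    move=> F0; rewrite (big_cat_nat (n := N1)) // ?(ltnW NN) //= big_nat_cond big1 ?add0r //.
    by move=> n /andP[/andP[_ h] _]; apply: F0.
  have eR (F : nat -> R) : (forall n, (n < N1)%N -> F n = 0) -> \sum_(1 <= n < N2') F n = \sum_(N1 <= n < N2') F n.
    move=> F0; rewrite (big_cat_nat (n := N1)) // ?(ltnW NN) //= big_nat_cond big1 ?add0r //.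
    by move=> n /andP[/andP[_ h] _]; apply: F0.
  rewrite eR; last by move=> n h; rewrite /b' leqNgt h /= N20 mul0r.
  rewrite -(big_mkord xpredT (fun i => N2 (\sum_(1 <= n < N2') b' n * eix (- ((t0 + theta * i%:R) * lnn n))))).
  have -> : \sum_(0 <= i < w) N2 (\sum_(1 <= n < N2') b' n * eix (- ((t0 + theta * i%:R) * lnn n))) =
     \sum_(0 <= i < w) N2 (\sum_(N1 <= n < N2') b n * A i n).
    apply: eq_bigr => i _; congr N2; rewrite e; last by move=> n h; rewrite /b' leqNgt h /= mul0r.
    by apply: eq_big_nat => n /andP[h _]; rewrite /b' h /A mulrA.
  move=> h; rewrite mulrAC ler_pdivlMr // mulrC; apply: le_trans h _.
  rewrite !mulr_sumr; apply: ler_sum_nat => n /andP[nN _].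
  have nR : 0 < n%:R :> R by rewrite ltr0n (leq_trans N10).
  rewrite /b' nN N2M N2_rc exprVn sqr_sqrtr ?ler0n //.
  have : n%:R + theta * w%:R <= 2 * n%:R.
    have : N1%:R <= n%:R :> R by rewrite ler_nat. by move: thw; lra.
  move=> h2.
  have q : 0 <= N2 (b n) / n%:R by pos.
  have := ler_wpM2l q h2.
  have -> : N2 (b n) / n%:R * (2 * n%:R) = 2 * N2 (b n) by field; rewrite gt_eqF.
  lra.
have := @duality nat nat (index_iota N1 N2') xpredT (index_iota 0 w) xpredT (fun n i => A i n) (864 / theta) C0 h1 (fun i => cj (c i)).
have -> : \sum_(i <- index_iota 0 w) N2 (cj (c i)) = \sum_(i <- index_iota 0 w) N2 (c i).
  by apply: eq_bigr => i _; rewrite N2_cj.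
apply: le_trans; rewrite le_eqVlt; apply/orP; left; apply/eqP; apply: eq_bigr => n _.
rewrite -N2_cj cj_sum; congr N2; apply: eq_bigr => i _.
by rewrite cjM /an cjM cj_rc -eixN /A.
Qed.

Lemma cluster_sum (r : seq nat) (c : nat) (F : nat -> CC) : uniq r ->
  \sum_(k <- r | (k %/ w == c)%N) F k = \sum_(0 <= i < w) (if (c * w + i)%N \in r then F (c * w + i)%N else 0).
Proof.
move=> ur; rewrite -[LHS]big_filter -[RHS]big_mkcond -[RHS]big_filter.
rewrite -(big_map (fun i => c * w + i)%N xpredT F).
apply: perm_big; apply: uniq_perm.
- by rewrite filter_uniq.
- by rewrite map_inj_uniq ?filter_uniq ?iota_uniq // => i j /addnI.
move=> k; rewrite mem_filter; apply/andP/mapP.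
  move=> [/eqP kc kr]; exists (k %% w)%N; last by rewrite -kc -divn_eq.
  by rewrite mem_filter mem_index_iota -kc -divn_eq kr /= ltn_pmod.
case=> i; rewrite mem_filter mem_index_iota => /andP[h1 /andP[_ h2]] ->; split => //.
by rewrite divnMDl // divn_small // addn0.
Qed.

Lemma cluster_sumR (r : seq nat) (c : nat) (F : nat -> R) : uniq r ->
  \sum_(k <- r | (k %/ w == c)%N) F k = \sum_(0 <= i < w) (if (c * w + i)%N \in r then F (c * w + i)%N else 0).
Proof.
move=> ur; have := congr1 cre (@cluster_sum r c (fun k => (F k)%:C) ur).
rewrite !cre_sum /= => ->; apply: eq_bigr => i _; by case: ifP.
Qed.

(** Different clusters of equal parity are a full cluster apart, so their frequencies are at
    distance at least [tau0] and nearly orthogonal. The model system [a'] is block diagonal, with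
    one copy of the integers per cluster. *)
Lemma parity_class (r : seq nat) (e : bool) : {subset r <= ks} -> uniq r -> (forall k, k \in r -> odd (k %/ w) = e) ->
  forall c : nat -> CC,
  \sum_(N1 <= n < N2') N2 (\sum_(k <- r) c k * an (tt k) n) <=
  (864 / theta + eta * (size r)%:R) * \sum_(k <- r) N2 (c k).
Proof.
move=> rs ur re.
pose Nc := (\max_(k <- r) (k %/ w)).+1.
have kN k : k \in r -> (k %/ w < Nc)%N by move=> kr; rewrite ltnS; apply: leq_bigmax_seq.
pose u := [seq (n, c) | n <- index_iota N1 N2', c <- index_iota 0 Nc].
pose a' k (x : nat * nat) : CC := if (k %/ w == x.2)%N then an (tt k) x.1 else 0.
apply: (gram_bound (u := u) (a' := a')).
  move=> k l kr lr.
  have -> : \sum_(x <- u) a' k x * cj (a' l x) = if (k %/ w == l %/ w)%N then \sum_(N1 <= n < N2') an (tt k) n * cj (an (tt l) n) else 0.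
    rewrite big_allpairs_dep /=.
    transitivity (\sum_(N1 <= n < N2') \sum_(0 <= c < Nc) (if (c == k %/ w)%N then (if (k %/ w == l %/ w)%N then an (tt k) n * cj (an (tt l) n) else 0) else 0)).
      apply: eq_bigr => n _; apply: eq_bigr => c _; rewrite /a' /= [(c == _)%N]eq_sym.
      case: eqP => [<-|_]; last by rewrite mul0r.
      by rewrite eq_sym; case: eqP => // _; rewrite [cj 0]/cj conjc0 mulr0.
    case: ifP => _; last by rewrite big1 // => n _; rewrite big1 // => c _; case: ifP.
    apply: eq_bigr => n _; rewrite (bigD1_seq (k %/ w)%N) ?iota_uniq ?mem_index_iota ?kN //= eqxx.
    by rewrite big1 ?addr0 // => c /negbTE ->.
  case: eqP => kl; first by rewrite subrr cabs0.
  rewrite subr0.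
  have -> : \sum_(n <- index_iota N1 N2') an (tt k) n * cj (an (tt l) n) = Td N1 N2' 1 (tt k - tt l).
    by rewrite Td1E; apply: eq_bigr => n _; rewrite an_gram.
  apply: hfar; try exact: rs.
  have -> : tt k - tt l = theta * (k%:R - l%:R) by rewrite /tt; ring.
  rewrite normrM gtr0_norm //; apply: le_trans tw _; rewrite ler_pM2l //.
  have par : odd (k %/ w) = odd (l %/ w) by rewrite !re.
  have hk := divn_eq k w; have hl := divn_eq l w.
  have mk := ltn_pmod k w0; have ml := ltn_pmod l w0.
  wlog lt : k l kr lr kl par hk hl mk ml / (k %/ w < l %/ w)%N.
    move=> H; case: (ltngtP (k %/ w) (l %/ w)) => [h|h|//]; first exact: H.
    by rewrite distrC; apply: H => //; exact: nesym.
  have lt2 : ((k %/ w).+2 <= l %/ w)%N.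
    rewrite ltn_neqAle lt andbT; apply/negP => /eqP e2.
    by move: par; rewrite -e2 /=; case: (odd _).
  have kl2 : (k + w <= l)%N.
    have q := leq_mul lt2 (leqnn w); rewrite !mulSn in q; apply: leq_trans (leq_trans _ q) (leq_divM l w).
    by rewrite addnC leq_add2l {1}hk [leqRHS]addnC leq_add2l ltnW.
  have : (k + w)%:R <= l%:R :> R by rewrite ler_nat.
  rewrite natrD ler0_norm; last by rewrite subr_le0 ler_nat; exact: leq_trans (leq_addr _ _) kl2.
  lra.
move=> c; rewrite big_allpairs_dep /= exchange_big /=.
have -> : \sum_(k <- r) N2 (c k) = \sum_(0 <= e <Nc) \sum_(k <- r | (k %/ w == e)%N) N2 (c k).
  under [RHS]eq_bigr do rewrite big_mkcond /=.
  rewrite exchange_big /= big_seq [RHS]big_seq; apply: eq_bigr => k kr.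
  rewrite (bigD1_seq (k %/ w)%N) ?iota_uniq ?mem_index_iota ?kN //= eqxx.
  by rewrite big1 ?addr0 // => c' /negbTE; rewrite eq_sym => ->.
rewrite mulr_sumr; apply: ler_sum => e' _.
rewrite cluster_sumR //.
have -> : \sum_(n <- index_iota N1 N2') N2 (\sum_(k <- r) c k * a' k (n, e')) =
  \sum_(N1 <= n < N2') N2 (\sum_(0 <= i < w) (if (e' * w + i)%N \in r then c (e' * w + i)%N else 0) * an (tt (e' * w) + theta * i%:R) n).
  apply: eq_bigr => n _; congr N2.
  transitivity (\sum_(k <- r | (k %/ w == e')%N) c k * an (tt k) n).
    rewrite [RHS]big_mkcond; apply: eq_bigr => k _; rewrite /a' /=; case: ifP => // _.
    by rewrite mulr0.
  rewrite cluster_sum //; apply: eq_bigr => i _.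
  have -> : tt (e' * w + i) = tt (e' * w) + theta * i%:R by rewrite /tt natrD; ring.
  by case: ifP => // _; rewrite mul0r.
apply: le_trans (cluster_dual _ _) _; rewrite ler_wpM2l //; first by pos.
by apply: ler_sum => i _; case: ifP => // _; rewrite N20.
Qed.

(** [864 / theta] for each parity class, doubled when the two classes are added. *)
Definition CH : R := 1728 / theta + 2 * eta * (size ks)%:R.

Lemma CH_ge0 : 0 <= CH. Proof. by rewrite /CH; pos. Qed.

Lemma H0_dual (c : nat -> CC) :
  \sum_(N1 <= n < N2') N2 (\sum_(k <- ks) c k * an (tt k) n) <= CH * \sum_(k <- ks) N2 (c k).
Proof.
pose r1 := [seq k <- ks | odd (k %/ w)]; pose r2 := [seq k <- ks | ~~ odd (k %/ w)].
have split (V : zmodType) (F : nat -> V) : \sum_(k <- ks) F k = \sum_(k <- r1) F k + \sum_(k <- r2) F k.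
  by rewrite !big_filter [LHS](bigID (fun k => odd (k %/ w))).
have b1 : \sum_(N1 <= n < N2') N2 (\sum_(k <- r1) c k * an (tt k) n) <= (864 / theta + eta * (size ks)%:R) * \sum_(k <- r1) N2 (c k).
  apply: le_trans (parity_class (e := true) _ _ _ _) _; rewrite ?filter_uniq //.
  - by move=> k; rewrite mem_filter => /andP[].
  - by move=> k; rewrite mem_filter => /andP[].
  rewrite ler_wpM2r; [by []|by pos|rewrite lerD2l ler_wpM2l // ler_nat size_filter count_size //].
have b2 : \sum_(N1 <= n < N2') N2 (\sum_(k <- r2) c k * an (tt k) n) <= (864 / theta + eta * (size ks)%:R) * \sum_(k <- r2) N2 (c k).
  apply: le_trans (parity_class (e := false) _ _ _ _) _; rewrite ?filter_uniq //.
  - by move=> k; rewrite mem_filter => /andP[].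
  - by move=> k; rewrite mem_filter => /andP[/negbTE].
  rewrite ler_wpM2r; [by []|by pos|rewrite lerD2l ler_wpM2l // ler_nat size_filter count_size //].
apply: le_trans (_ : \sum_(N1 <= n < N2') (2 * N2 (\sum_(k <- r1) c k * an (tt k) n) + 2 * N2 (\sum_(k <- r2) c k * an (tt k) n)) <= _).
  by apply: ler_sum => n _; rewrite split N2D_le.
rewrite big_split /= -!mulr_sumr [in X in _ <= X]split /CH.
move: b1 b2; set x := \sum_(k <- r1) N2 _; set y := \sum_(k <- r2) N2 _; lra.
Qed.

(** Duality applied to [H0_dual]: the large sieve inequality itself, whose cost depends on the
    frequencies only through [CH]. *)
Lemma H0 (b : nat -> CC) :
  \sum_(k <- ks) N2 (\sum_(N1 <= n < N2') b n * (n%:R^-1)%:C * eix (- (tt k * lnn n))) <=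
  CH * \sum_(N1 <= n < N2') N2 (b n) / n%:R.
Proof.
have := @duality nat nat ks xpredT (index_iota N1 N2') xpredT (fun k n => an (tt k) n) CH CH_ge0 H0_dual
   (fun n => cj (b n) * ((Num.sqrt n%:R)^-1)%:C).
have -> : \sum_(n <- index_iota N1 N2') N2 (cj (b n) * ((Num.sqrt n%:R)^-1)%:C) = \sum_(N1 <= n < N2') N2 (b n) / n%:R.
  by apply: eq_bigr => n _; rewrite N2M N2_cj N2_rc exprVn sqr_sqrtr ?ler0n.
apply: le_trans; rewrite le_eqVlt; apply/orP; left; apply/eqP; apply: eq_bigr => k _.
rewrite -[LHS]N2_cj cj_sum; congr N2; apply: eq_bigr => n _.
rewrite !cjM cj_rc -eixN opprK /an.
have -> : n%:R^-1 = (Num.sqrt n%:R)^-1 * (Num.sqrt n%:R)^-1 :> R.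
  by rewrite -invfM -expr2 sqr_sqrtr ?ler0n.
rewrite rcM; ring.
Qed.

Variable ps : seq nat.
Hypothesis up : uniq ps.
Hypothesis pp : forall p, p \in ps -> prime p.
Hypothesis pz : forall p q, p \in ps -> q \in ps -> (p * q <= z2)%N.

(** The vectors of a Turan-Kubilius inequality: [n^(-1/2 + it)] times the centred divisibility by
    [p], scaled so that the squared norm drops only by about the factor [1 - 1/p]. *)
Definition bp (x : nat * nat) (n : nat) : CC :=
  (Num.sqrt x.2%:R * ((x.2 %| n)%:R - x.2%:R^-1))%:C * an (tt x.1) n.

(** Expanding the two centred indicators gives [Td] at [p q], [p], [q] and 1 with signs [+ - - +].
    Each agrees with [Td] at 1 up to [eta], so they cancel. *)
Lemma bp_gram_ne k l p q : k \in ks -> l \in ks -> p \in ps -> q \in ps -> p != q ->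
  cabs (\sum_(N1 <= n < N2') bp (k, p) n * cj (bp (l, q) n)) <= 3 * eta.
Proof.
move=> kk lk ppr qpr pq.
have p0 : 0 < p%:R :> R by rewrite ltr0n prime_gt0 // pp.
have q0 : 0 < q%:R :> R by rewrite ltr0n prime_gt0 // pp.
have cop : coprime p q by rewrite prime_coprime ?pp // dvdn_prime2 ?pp.
set tau := tt k - tt l.
pose T d := Td N1 N2' d tau.
have TdE d : T d = \sum_(N1 <= n < N2') ((d %| n)%:R * (d%:R / n%:R))%:C * eix (tau * lnn n).
  rewrite /T /Td big_mkcond; apply: eq_bigr => n _; case: ifP => _; first by rewrite mul1r.
  by rewrite mul0r mul0r.
have -> : \sum_(N1 <= n < N2') bp (k, p) n * cj (bp (l, q) n) =
   ((Num.sqrt p%:R * Num.sqrt q%:R)^-1)%:C * (T (p * q)%N - T p - T q + T 1%N).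
  rewrite !TdE -!sumrB -big_split /= mulr_sumr; apply: eq_bigr => n _.
  rewrite /bp /= cjM cj_rc.
  have -> : (p * q %| n)%N%:R = (p %| n)%N%:R * (q %| n)%N%:R :> R.
    by rewrite Gauss_dvd // -mulnb natrM.
  rewrite dvd1n.
  set A := an _ _; set B := an _ _.
  transitivity ((Num.sqrt p%:R * ((p %| n)%:R - p%:R^-1) * (Num.sqrt q%:R * ((q %| n)%:R - q%:R^-1)))%:C * (A * cj B)).
    by rewrite (rcM (Num.sqrt p%:R * _)); ring.
  rewrite /A /B an_gram -/tau rc_comb4 [LHS]mulrA -rcM; congr (_%:C * _).
  rewrite natrM; apply: tk_alg_ne; rewrite ?sqr_sqrtr ?ler0n // gt_eqF // sqrtr_gt0 //.
rewrite cabsM cabs_rc ger0_norm; last by pos.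
have h d : (0 < d <= z2)%N -> cabs (T d - T 1%N) <= eta by move=> hd; apply: hdiff.
have pq0 : (0 < p * q <= z2)%N by rewrite muln_gt0 !prime_gt0 ?pp //= pz.
have pz' : (0 < p <= z2)%N.
  by rewrite prime_gt0 ?pp //=; apply: leq_trans (pz ppr qpr); rewrite leq_pmulr // prime_gt0 // pp.
have qz' : (0 < q <= z2)%N.
  by rewrite prime_gt0 ?pp //=; apply: leq_trans (pz ppr qpr); rewrite leq_pmull // prime_gt0 // pp.
have -> : T (p * q)%N - T p - T q + T 1%N = (T (p * q)%N - T 1%N) + (- (T p - T 1%N) + - (T q - T 1%N)) by ring.
have hh : cabs (T (p * q)%N - T 1%N + (- (T p - T 1%N) + - (T q - T 1%N))) <= 3 * eta.
  apply: le_trans (cabsD _ _) _; apply: le_trans (lerD (h _ pq0) (cabsD _ _)) _.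
  by rewrite !cabsN; have := h _ pz'; have := h _ qz'; lra.
apply: le_trans (ler_wpM2l _ hh) _; first by pos.
rewrite ler_piMl //; first by pos.
rewrite invf_le1 ?mulr_gt0 ?sqrtr_gt0 //.
have s1 x : (x \in ps) -> 1 <= Num.sqrt x%:R :> R.
  by move=> xp; rewrite -{1}sqrtr1 ler_wsqrtr // ler1n prime_gt0 // pp.
have e1 := s1 _ ppr; have e2 := s1 _ qpr.
have := ler_pM ler01 ler01 e1 e2; by rewrite mulr1.
Qed.

(** For equal primes the expansion is [(1 - 2/p) Td p + (1/p) Td 1], which equals the stated main
    term when [Td p] is replaced by [Td 1]. *)
Lemma bp_gram_eq k l p : k \in ks -> l \in ks -> p \in ps ->
  cabs (\sum_(N1 <= n < N2') bp (k, p) n * cj (bp (l, p) n) -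
        (1 - p%:R^-1)%:C * Td N1 N2' 1 (tt k - tt l)) <= 3 * eta.
Proof.
move=> kk lk ppr.
have p2 : 2 <= p%:R :> R by rewrite ler_nat prime_gt1 // pp.
set tau := tt k - tt l.
pose T d := Td N1 N2' d tau.
have TdE d : T d = \sum_(N1 <= n < N2') ((d %| n)%:R * (d%:R / n%:R))%:C * eix (tau * lnn n).
  rewrite /T /Td big_mkcond; apply: eq_bigr => n _; case: ifP => _; first by rewrite mul1r.
  by rewrite mul0r mul0r.
have -> : \sum_(N1 <= n < N2') bp (k, p) n * cj (bp (l, p) n) = (1 - 2 / p%:R)%:C * T p + (p%:R^-1)%:C * T 1%N.
  rewrite !TdE !mulr_sumr -big_split /=; apply: eq_bigr => n _.
  rewrite /bp /= cjM cj_rc dvd1n.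
  set A := an _ _; set B := an _ _; set v := _ * (_ - _).
  transitivity ((v * v)%:C * (A * cj B)); first by rewrite (rcM v v); ring.
  rewrite /A /B an_gram -/tau [LHS]mulrA -rcM.
  rewrite [(1 - 2 / p%:R)%:C * _]mulrA [(p%:R^-1)%:C * _]mulrA -!rcM -mulrDl -rcD; congr (_%:C * _).
  have p0 : 0 < p%:R :> R by lra.
  by apply: tk_alg_eq; rewrite ?sqr_sqrtr ?ler0n // gt_eqF // sqrtr_gt0.
have -> : (1 - 2 / p%:R)%:C * T p + (p%:R^-1)%:C * T 1%N - (1 - p%:R^-1)%:C * T 1%N =
   (1 - 2 / p%:R)%:C * (T p - T 1%N).
  rewrite !rcD !rcN !rcM; have -> : (2 : R)%:C = 1 + 1 by rewrite -rcD.
  ring.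
have pz' : (0 < p <= z2)%N.
  by rewrite prime_gt0 ?pp //=; apply: leq_trans (pz ppr ppr); rewrite leq_pmulr // prime_gt0 // pp.
have h : cabs (T p - T 1%N) <= eta by apply: hdiff.
rewrite cabsM cabs_rc.
have i1 : p%:R^-1 <= 2^-1 :> R by rewrite lef_pV2 ?posrE //; lra.
have i0 : 0 <= p%:R^-1 :> R by pos.
rewrite ger0_norm; last by lra.
have c0 := cabs_ge0 (T p - T 1%N); have := mulr_ge0 i0 c0; move: eta0 h; lra.
Qed.

(** The model system is orthogonal in the prime: for each [p] one copy of the vectors [an], shrunk
    by [sqrt (1 - 1/p)]. Hence [H0_dual] carries over prime by prime. *)
Lemma H1_dual (c : nat * nat -> CC) :
  \sum_(N1 <= n < N2') N2 (\sum_(x <- [seq (k, p) | k <- ks, p <- ps]) c x * bp x n) <=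
  (CH + 3 * eta * (size ks * size ps)%:R) * \sum_(x <- [seq (k, p) | k <- ks, p <- ps]) N2 (c x).
Proof.
rewrite -(size_allpairs (fun k p => (k, p)) ks ps).
pose u := [seq (n, p) | n <- index_iota N1 N2', p <- ps].
pose a' (x : nat * nat) (y : nat * nat) : CC :=
  if x.2 == y.2 then (Num.sqrt (1 - x.2%:R^-1))%:C * an (tt x.1) y.1 else 0.
have pV p : p \in ps -> 0 <= 1 - p%:R^-1 :> R.
  by move=> h; rewrite subr_ge0 invf_le1 ?ler1n ?ltr0n prime_gt0 // pp.
apply: (gram_bound (u := u) (a' := a')).
  move=> [k p] [l q] /allpairsP[[k' p'] /= [kk pps [-> ->]]] /allpairsP[[l' q'] /= [ll qps [-> ->]]].
  have -> : \sum_(y <- u) a' (k', p') y * cj (a' (l', q') y) =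
     if p' == q' then (1 - p'%:R^-1)%:C * Td N1 N2' 1 (tt k' - tt l') else 0.
    rewrite big_allpairs_dep /= exchange_big /= (bigD1_seq p') //= [X in _ + X]big1 ?addr0; last first.
      by move=> y /negbTE yp; rewrite big1 // => n _; rewrite /a' /= eq_sym yp mul0r.
    rewrite Td1E; case: eqP => [<-|pq]; last first.
      rewrite big1 // => n _; rewrite /a' /= eqxx; have /eqP/negbTE := pq; rewrite eq_sym => ->.
      by rewrite [cj 0]/cj conjc0 mulr0.
    rewrite mulr_sumr; apply: eq_bigr => n _; rewrite /a' /= eqxx cjM cj_rc -an_gram.
    have e : (1 - p'%:R^-1)%:C = (Num.sqrt (1 - p'%:R^-1))%:C * (Num.sqrt (1 - p'%:R^-1))%:C :> CC.
      by rewrite -rcM -expr2 sqr_sqrtr // pV.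
    by rewrite [in RHS]e; ring.
  case: eqP => [<-|/eqP pq]; first exact: bp_gram_eq.
  by rewrite subr0; apply: bp_gram_ne.
move=> {}c; rewrite big_allpairs_dep /= exchange_big /=.
rewrite [in X in _ <= X]big_allpairs_dep /= [in X in _ <= X]exchange_big /= mulr_sumr.
rewrite big_seq [X in _ <= X]big_seq; apply: ler_sum => p pps.
apply: le_trans (_ : \sum_(N1 <= n < N2') N2 (\sum_(k <- ks) c (k, p) * an (tt k) n) <= _); last exact: H0_dual.
apply: ler_sum => n _.
have -> : \sum_(x <- [seq (k, p0) | k <- ks, p0 <- ps]) c x * a' x (n, p) =
  (Num.sqrt (1 - p%:R^-1))%:C * \sum_(k <- ks) c (k, p) * an (tt k) n.
  rewrite big_allpairs_dep /= mulr_sumr; apply: eq_bigr => k _.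
  rewrite (bigD1_seq p) //= [X in _ + X]big1 ?addr0; last by move=> q /negbTE qp; rewrite /a' /= qp mulr0.
  by rewrite /a' /= eqxx; ring.
rewrite N2M N2_rc sqr_sqrtr ?pV // ler_piMl // gerBl invr_ge0 ler0n //.
Qed.

(** The Turan-Kubilius inequality for Dirichlet polynomials, by duality: for most [p], [p] times the
    part supported on multiples of [p] is close to the whole polynomial, in mean square over
    [ks]. *)
Lemma H1 (b : nat -> CC) :
  \sum_(k <- ks) \sum_(p <- ps) p%:R^-1 *
     N2 (\sum_(N1 <= n < N2') b n * ((p%:R * (p %| n)%:R - 1) / n%:R)%:C * eix (- (tt k * lnn n))) <=
  (CH + 3 * eta * (size ks * size ps)%:R) * \sum_(N1 <= n < N2') N2 (b n) / n%:R.
Proof.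
have C0 : 0 <= CH + 3 * eta * (size ks * size ps)%:R by have := CH_ge0; move=> ?; pos.
have := @duality _ _ [seq (k, p) | k <- ks, p <- ps] xpredT (index_iota N1 N2') xpredT bp _ C0 H1_dual
   (fun n => cj (b n) * ((Num.sqrt n%:R)^-1)%:C).
have -> : \sum_(n <- index_iota N1 N2') N2 (cj (b n) * ((Num.sqrt n%:R)^-1)%:C) = \sum_(N1 <= n < N2') N2 (b n) / n%:R.
  by apply: eq_bigr => n _; rewrite N2M N2_cj N2_rc exprVn sqr_sqrtr ?ler0n.
apply: le_trans; rewrite big_allpairs_dep /=.
rewrite le_eqVlt; apply/orP; left; apply/eqP; apply: eq_bigr => k _.
rewrite big_seq [RHS]big_seq; apply: eq_bigr => p pps.
have p0 : 0 < p%:R :> R by rewrite ltr0n prime_gt0 // pp.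
have s0 : 0 < Num.sqrt p%:R :> R by rewrite sqrtr_gt0.
have sp : Num.sqrt p%:R ^+ 2 = p%:R :> R by rewrite sqr_sqrtr ?ler0n.
have -> : p%:R^-1 = N2 (((Num.sqrt p%:R)^-1)%:C) :> R by rewrite N2_rc exprVn sp.
rewrite -N2M -[LHS]N2_cj; congr N2; rewrite cjM cj_rc cj_sum mulr_sumr; apply: eq_bigr => n _.
rewrite !cjM cj_rc -eixN opprK /bp /an /=.
have -> : (p%:R * (p %| n)%:R - 1) / n%:R =
  Num.sqrt p%:R * (Num.sqrt p%:R * ((p %| n)%:R - p%:R^-1)) * ((Num.sqrt n%:R)^-1 * (Num.sqrt n%:R)^-1) :> R.
  rewrite -invfM -expr2 sqr_sqrtr ?ler0n //; congr (_ / _).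
  by rewrite mulrA -expr2 sp mulrBr mulfV // gt_eqF.
rewrite !(rcM (_ * _)) !(rcM (Num.sqrt p%:R)).
have e : ((Num.sqrt (p%:R : R))^-1)%:C * (Num.sqrt (p%:R : R))%:C = 1 by rewrite -rcM mulVf // gt_eqF.
rewrite [((_ / _)%:C)]rcM.
transitivity (((Num.sqrt p%:R)^-1)%:C * (Num.sqrt p%:R)%:C * (cj (b n) * ((Num.sqrt n%:R)^-1)%:C *
  ((Num.sqrt p%:R)%:C * ((p %| n)%:R - p%:R^-1)%:C * (((Num.sqrt n%:R)^-1)%:C * eix (tt k * lnn n))))); first by ring.
by rewrite e mul1r.
Qed.
End SparseLargeSieve.

(** * Moments of prime polynomials and the Turan-Kubilius inequality *)

Lemma ler_sum_seq (I : eqType) (r : seq I) (P : pred I) (F G : I -> R) :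
  (forall i, i \in r -> P i -> F i <= G i) -> \sum_(i <- r | P i) F i <= \sum_(i <- r | P i) G i.
Proof.
by move=> h; rewrite big_seq_cond [X in _ <= X]big_seq_cond; apply: ler_sum => i /andP[]; exact: h.
Qed.

Lemma sumr_const_size I (r : seq I) (c : R) : \sum_(i <- r) c = (size r)%:R * c.
Proof. by rewrite big_const_seq count_predT iter_addr_0 mulr_natl. Qed.

(** Only the first term of the range escapes the comparison with the logarithm; [c] bounds it, and
    both [c = 1] and [c = 1/x] are needed. *)
Lemma harm_up (c x y : R) (Z : nat) : (forall m, (0 < m)%N -> x <= m%:R -> m%:R^-1 <= c) -> 0 <= c -> 0 < x -> x <= y ->
  \sum_(1 <= m < Z | x <= m%:R < y) (m%:R^-1 : R) <= c + ln (y / x).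
Proof.
move=> hc c0 x0 xy; have y0 : 0 < y by lra.
have l0 : 0 <= ln (y / x) by apply: ln_ge0; rewrite ler_pdivlMr // mul1r.
have claim m : \sum_(1 <= m < m.+1 | x <= m%:R < y) (m%:R^-1 : R) <= if x <= m%:R then c + (ln (Num.min m%:R y) - ln x) else 0.
  elim: m => [|m IH]; first by rewrite big_geq //; case: ifP => // h; have := lt_le_trans x0 h; rewrite ltxx.
  rewrite big_mkcond big_nat_recr //= -big_mkcond /=; move: IH.
  set S := \sum_(_ <= _ < _ | _) _.
  have mS : m.+1%:R = m%:R + 1 :> R by rewrite -natr1.
  have [h1|h1] := lerP x m%:R.
    have m0 : (0 < m)%N by rewrite -(ltr0n R); apply: lt_le_trans h1.
    have mR : 0 < m%:R :> R by rewrite ltr0n.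
    have -> : x <= m.+1%:R by lra.
    have [h2|h2] := ltrP m.+1%:R y => /= IH.
      have := lnnS_ge m0; rewrite /lnn.
      have e : Num.min m%:R y = m%:R by rewrite min_l //; lra.
      by move: IH; rewrite e; set q := _^-1; lra.
    have := @ler_ln (Num.min m%:R y) y; rewrite lt_min mR y0 ge_min lexx orbT => /(_ isT isT); lra.
  move=> IH; have [h2|h2] /= := lerP x m.+1%:R; last by lra.
  have := hc m.+1 isT h2.
  have : 0 <= ln (Num.min m.+1%:R y) - ln x.
    have : ln x <= ln (Num.min m.+1%:R y) by apply: ler_ln; rewrite // le_min h2.
    lra.
  case: ifP => _; set q := _^-1; lra.
case: Z => [|m]; first by rewrite big_geq //; lra.
apply: le_trans (claim m) _; rewrite ln_div //; case: ifP => h; last by move: l0; rewrite ln_div //; lra.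
have mR : 0 < m%:R :> R by apply: lt_le_trans h.
have := @ler_ln (Num.min m%:R y) y; rewrite lt_min mR y0 ge_min lexx orbT => /(_ isT isT); lra.
Qed.

Lemma harm_up1 (x y : R) (Z : nat) : 0 < x -> x <= y ->
  \sum_(1 <= m < Z | x <= m%:R < y) (m%:R^-1 : R) <= 1 + ln (y / x).
Proof.
move=> x0 xy; apply: harm_up => // m m0 _.
by rewrite -[X in _ <= X]invr1 lef_pV2 ?posrE ?ltr0n // ler1n.
Qed.

Lemma harm_upV (x y : R) (Z : nat) : 0 < x -> x <= y ->
  \sum_(1 <= m < Z | x <= m%:R < y) (m%:R^-1 : R) <= x^-1 + ln (y / x).
Proof.
move=> x0 xy; apply: harm_up => //; last by pos.
by move=> m m0 h; rewrite lef_pV2 ?posrE ?ltr0n.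
Qed.

Lemma harm_lo (x y : R) (Z : nat) : 0 < x -> x <= y -> y <= Z%:R ->
  ln (y / x) - x^-1 <= \sum_(1 <= m < Z | x <= m%:R < y) (m%:R^-1 : R).
Proof.
move=> x0 xy yZ; have y0 : 0 < y by lra.
have xV : 0 < x^-1 by rewrite invr_gt0.
have claim m : ln (Num.min m.+1%:R y) - ln x - x^-1 <= \sum_(1 <= m < m.+1 | x <= m%:R < y) (m%:R^-1 : R).
  elim: m => [|m IH].
    rewrite big_geq //; have := @ler_ln (Num.min 1 y) 1; rewrite lt_min ltr01 y0 ge_min lexx ln_one => /(_ isT isT).
    have := ln_le_subr1 xV; rewrite lnV //; lra.
  have mR : 0 < m.+1%:R :> R by rewrite ltr0n.
  have mS : m.+2%:R = m.+1%:R + 1 :> R by rewrite -[m.+2%:R]natr1.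
  have [h1|h1] := lerP x m.+1%:R; last first.
    apply: le_trans (_ : 0 <= _); last by apply: sumr_ge0 => i _; pos.
    have : ln (Num.min m.+2%:R y) <= ln (x * (1 + x^-1)).
      apply: ler_ln; first by rewrite lt_min y0 andbT; lra.
      rewrite ge_min; apply/orP; left; rewrite mulrDr mulr1 divff ?gt_eqF //; lra.
    have := @ln_le_subr1 (1 + x^-1); rewrite lnM //; last by lra.
    have -> : 0 < 1 + x^-1 by lra.
    move=> /(_ isT); lra.
  rewrite big_mkcond big_nat_recr //= -big_mkcond /= h1 /=; move: IH.
  set S := \sum_(_ <= _ < _ | _) _.
  have [h2|h2] /= := ltrP m.+1%:R y => IH.
    have := @lnnS_le m.+1 isT; rewrite /lnn.
    have : ln (Num.min m.+2%:R y) <= ln m.+2%:R by apply: ler_ln; [rewrite lt_min y0 andbT; lra|rewrite ge_min lexx].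
    by move: IH; set q := m.+1%:R^-1; lra.
  have -> : Num.min m.+2%:R y = y by rewrite min_r //; lra.
  by move: IH; lra.
case: Z yZ => [|m] yZ; first by lra.
by apply: le_trans (claim m); rewrite ln_div // min_r.
Qed.

Definition omega (s : seq nat) (n : nat) : nat := count (fun p => (p %| n)%N) s.

(** From [x^m <= m! C(x+m, m)]. It trades the power [omega^(2l)] for the multiplicative weight
    [2^omega] at the price of a factorial. *)
Lemma pow_le_fact x m : (x ^ m <= m`! * 2 ^ (x + m))%N.
Proof.
have h1 : (x ^ m <= (x + m) ^_ m)%N.
  elim: m x => [|m IH] x; first by rewrite expn0 ffactn0.
  rewrite addnS ffactSS expnS; apply: leq_mul; last exact: IH.
  by rewrite leqW // leq_addr.
have h2 n k : ('C(n, k) <= 2 ^ n)%N.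
  elim: n k => [|n IH] [|k] //; first by rewrite bin0 expn_gt0.
  by rewrite binS expnS mul2n -addnn leq_add.
by apply: leq_trans h1 _; rewrite -bin_ffact mulnC leq_mul2l h2 orbT.
Qed.

Lemma cdiv_rng (Z p : nat) : (0 < p)%N -> (0 < Z)%N -> (0 < cdiv Z p <= Z)%N.
Proof.
case: p => // p _; case: Z => // Z _; rewrite /cdiv /= divn_gt0 // addSn ltnS leq_addl /=.
by rewrite -[X in (_ <= X)%N](mulnK Z.+1 (ltn0Sn p)); apply: leq_div2r; rewrite mulSn addnC -addnS addnC mulnS; lia.
Qed.

(** Induction on the primes: a new [p] adds a sum over its multiples, which after division by [p]
    runs over an interval with the same ratio [y/x]. *)
Lemma sum_2omega (s : seq nat) (x y : R) (Z : nat) : uniq s -> (forall p, p \in s -> prime p) -> 0 < x -> x <= y ->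
  \sum_(1 <= n < Z | x <= n%:R < y) (2 ^ omega s n)%:R / n%:R <= (1 + ln (y / x)) * \prod_(p <- s) (1 + p%:R^-1).
Proof.
elim: s x y => [|p s IH] x y.
  move=> _ _ x0 xy; rewrite big_nil mulr1; apply: le_trans (harm_up1 Z x0 xy).
  by apply: ler_sum => n _; rewrite /omega /= expn0 mul1r.
move=> /andP[ps us] pr x0 xy.
have pp : prime p by apply: pr; rewrite mem_head.
have p0 : (0 < p)%N by rewrite prime_gt0.
have pR : 0 < p%:R :> R by rewrite ltr0n.
have pr' q : q \in s -> prime q by move=> qs; apply: pr; rewrite in_cons qs orbT.
have IH1 := IH x y us pr' x0 xy.
have xp0 : 0 < x / p%:R by pos.
have xyp : x / p%:R <= y / p%:R by rewrite ler_pM2r ?invr_gt0.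
have IH2 := IH (x / p%:R) (y / p%:R) us pr' xp0 xyp.
have ratio : y / p%:R / (x / p%:R) = y / x by field; rewrite !gt_eqF.
rewrite ratio in IH2.
have step : \sum_(1 <= n < Z | x <= n%:R < y) (2 ^ omega (p :: s) n)%:R / n%:R <=
   \sum_(1 <= n < Z | x <= n%:R < y) (2 ^ omega s n)%:R / n%:R +
   p%:R^-1 * \sum_(1 <= n < Z | x / p%:R <= n%:R < y / p%:R) (2 ^ omega s n)%:R / n%:R :> R.
  have -> : \sum_(1 <= n < Z | x <= n%:R < y) (2 ^ omega (p :: s) n)%:R / n%:R =
     \sum_(1 <= n < Z | x <= n%:R < y) (2 ^ omega s n)%:R / n%:R +
     \sum_(1 <= n < Z | (p %| n)%N) (if x <= n%:R < y then (2 ^ omega s n)%:R / n%:R else 0) :> R.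
    rewrite [X in _ = _ + X]big_mkcond [X in _ = X + _]big_mkcond [LHS]big_mkcond -big_split /=.
    apply: eq_bigr => n _; case: ifP => _; last by case: ifP; rewrite addr0.
    rewrite /omega /= -/(omega s n); case: (p %| n)%N; rewrite /= ?add0n ?addr0 //.
    by rewrite add1n expnS natrM; ring.
  rewrite lerD2l.
  have [Z1|Z1] := leqP Z 1; first by rewrite !big_geq // mulr0.
  pose G n : R := if x <= n%:R < y then (2 ^ omega s n)%:R / n%:R else 0.
  have := congr1 cre (@sum_multiples (fun n => (G n)%:C) 1 Z p p0 (ltnW Z1)).
  rewrite !cre_sum /= => ->.
  have c1 : cdiv 1 p = 1%N by rewrite /cdiv add1n prednK // divnn p0.
  rewrite c1 [X in _ <= X]mulr_sumr [X in _ <= X]big_mkcond /=.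
  have /andP[cZ1 cZ] := cdiv_rng p0 (ltnW Z1).
  rewrite [X in _ <= X](big_cat_nat (n := cdiv Z p)) //= -[X in X <= _]addr0; apply: lerD; last first.
    by apply: sumr_ge0 => n _; case: ifP => // _; pos.
  apply: ler_sum_nat => m /andP[m1 _].
  have mR : 0 < m%:R :> R by rewrite ltr0n.
  rewrite /G natrM ler_pdivrMr // ltr_pdivlMr // ![m%:R * p%:R]mulrC.
  case: ifP => // _.
  have -> : omega s (p * m) = omega s m.
    rewrite /omega; apply: eq_in_count => q qs.
    rewrite Euclid_dvdM ?(pr' q qs) // dvdn_prime2 ?(pr' q qs) //.
    by case: eqP => // qp; move: ps; rewrite -qp qs.
  by rewrite le_eqVlt; apply/orP; left; apply/eqP; field; rewrite !gt_eqF.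
apply: le_trans step _; rewrite big_cons.
have := ler_wpM2l (_ : 0 <= p%:R^-1) IH2; rewrite invr_ge0 ler0n => /(_ isT).
move: IH1; set S1 := \sum_(_ <= _ < _ | _) _; set S2 := \sum_(_ <= _ < _ | _) _; set P := \prod_(_ <- _) _; lra.
Qed.

Lemma prod_le_exp (s : seq nat) : \prod_(p <- s) (1 + p%:R^-1) <= exp (\sum_(p <- s) p%:R^-1) :> R.
Proof.
elim: s => [|p s IH]; first by rewrite !big_nil exp_zero.
rewrite !big_cons expD; apply: ler_pM => //; [by pos|by apply: prodr_ge0 => q _; pos|exact: exp_ge1D].
Qed.

Definition dpol (f : nat -> CC) (s : seq nat) (t : R) : CC := \sum_(p <- s) f p * (p%:R^-1)%:C * eix (- (t * lnn p)).
Definition dser (Z : nat) (x y : R) (g : nat -> CC) (t : R) : CC :=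
  \sum_(1 <= n < Z | x <= n%:R < y) g n * (n%:R^-1)%:C * eix (- (t * lnn n)).

Lemma term_mul (p m : nat) (t : R) (a b : CC) : (0 < p)%N -> (0 < m)%N ->
  a * (p%:R^-1)%:C * eix (- (t * lnn p)) * (b * (m%:R^-1)%:C * eix (- (t * lnn m))) =
  a * b * ((p * m)%:R^-1)%:C * eix (- (t * lnn (p * m))).
Proof.
move=> p0 m0; rewrite lnnM // mulrDr opprD eixD natrM invfM rcM; ring.
Qed.

Lemma dpol_mul (Z : nat) (f beta : nat -> CC) (s : seq nat) (t : R) : (0 < Z)%N -> (forall p, p \in s -> (0 < p)%N) ->
  (forall p n, p \in s -> beta n != 0 -> (n < Z)%N -> (p * n < Z)%N) ->
  dpol f s t * (\sum_(1 <= n < Z) beta n * (n%:R^-1)%:C * eix (- (t * lnn n))) =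
  \sum_(1 <= n < Z) (\sum_(p <- s | (p %| n)%N) f p * beta (n %/ p)%N) * (n%:R^-1)%:C * eix (- (t * lnn n)).
Proof.
move=> Z0 s0 hs; rewrite /dpol mulr_suml.
transitivity (\sum_(p <- s) \sum_(1 <= n < Z | (p %| n)%N) f p * beta (n %/ p)%N * (n%:R^-1)%:C * eix (- (t * lnn n))).
  rewrite big_seq [RHS]big_seq; apply: eq_bigr => p ps.
  have p0 := s0 p ps.
  rewrite sum_multiples // mulr_sumr.
  have c1 : cdiv 1 p = 1%N by rewrite /cdiv add1n prednK // divnn p0.
  have /andP[cZ1 cZ] := cdiv_rng p0 Z0.
  rewrite c1 [LHS](big_cat_nat (n := cdiv Z p)) //=.
  have aux : forall u v w : CC, v = 0 -> u = w -> u + v = w by move=> u v w -> ->; rewrite addr0.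
  apply: aux.
  - rewrite big_nat_cond big1 //.
  move=> n /andP[/andP[n1 n2] _]; have [->|bn] := eqVneq (beta n) 0; first by rewrite !(mul0r, mulr0).
  have := hs p n ps bn n2; have := cdiv_ge Z p0; nia.
  - by apply: eq_big_nat => m /andP[m1 _]; rewrite term_mul // mulKn.
under eq_bigr do rewrite big_mkcond /=.
rewrite exchange_big /=; apply: eq_bigr => n _.
by rewrite -big_mkcond /= !mulr_suml.
Qed.

Lemma omega_div s p n : (0 < n)%N -> (p %| n)%N -> (omega s (n %/ p) <= omega s n)%N.
Proof.
move=> n0 pn; apply: sub_count => q /= /dvdn_trans; apply.
by apply/dvdnP; exists p; rewrite mulnC divnK.
Qed.

(** * High moments of prime polynomials *)

Section Moment.
Variables (f g : nat -> CC) (s : seq nat) (a b lo hi : R) (Z : nat).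
Hypothesis us : uniq s.
Hypothesis ps : forall p, p \in s -> prime p.
Hypothesis f1 : forall n, N2 (f n) <= 1.
Hypothesis g1 : forall n, N2 (g n) <= 1.
Hypothesis lohi : forall p, p \in s -> lo <= p%:R < hi.
Hypothesis a0 : 0 < a.
Hypothesis ab : a <= b.
Hypothesis lo0 : 0 < lo.
Hypothesis lh : lo <= hi.
Hypothesis hi1 : 1 <= hi.
Hypothesis Z0 : (0 < Z)%N.

(** With one more prime polynomial, each [n] arises from at most [omega s n] primes. This yields the
    coefficient bound [omega^l] without multinomial coefficients. *)
Lemma dir_pow (l : nat) : b * hi ^+ l <= Z%:R -> exists beta, [/\
  forall t, dpol f s t ^+ l * dser Z a b g t = \sum_(1 <= n < Z) beta n * (n%:R^-1)%:C * eix (- (t * lnn n)),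
  forall n, (0 < n)%N -> cabs (beta n) <= (omega s n ^ l)%:R &
  forall n, beta n != 0 -> a * lo ^+ l <= n%:R < b * hi ^+ l].
Proof.
have b0 : 0 < b by exact: lt_le_trans a0 ab.
have hi0 : 0 < hi by exact: lt_le_trans lo0 lh.
elim: l => [|l IH] hZ.
  exists (fun n => if a <= n%:R < b then g n else 0); split.
  - by move=> t; rewrite expr0 mul1r /dser big_mkcond; apply: eq_bigr => n _; case: ifP => // _; rewrite !mul0r.
  - by move=> n _; rewrite expn0; case: ifP => _; rewrite ?cabs0 // cabs_le1.
  - by move=> n; rewrite !expr0 !mulr1; case: ifP => // _; rewrite eqxx.
have hl0 : 0 < hi ^+ l by rewrite exprn_gt0.
have ll0 : 0 < lo ^+ l by rewrite exprn_gt0.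
have hZ' : b * hi ^+ l <= Z%:R.
  by apply: le_trans hZ; rewrite ler_pM2l // exprS ler_peMl // ltW.
have [beta [h1 h2 h3]] := IH hZ'.
exists (fun n => \sum_(p <- s | (p %| n)%N) f p * beta (n %/ p)%N); split.
- move=> t; rewrite exprS -mulrA h1; apply: dpol_mul => //; first by move=> p /ps/prime_gt0.
  move=> p n pS /h3/andP[_ n2] _; rewrite -(ltr_nat R) natrM; apply: lt_le_trans hZ.
  have /andP[_ p2] := lohi pS; rewrite exprS mulrCA.
  apply: le_lt_trans (_ : hi * n%:R < _); first by rewrite ler_wpM2r // ltW.
  by rewrite ltr_pM2l.
- move=> n n0; apply: le_trans (cabs_sum _ _ _) _.
  apply: le_trans (_ : \sum_(p <- s | (p %| n)%N) (omega s n ^ l)%:R <= _).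
    apply: ler_sum_seq => p pS pn; rewrite cabsM -[X in _ <= X]mul1r; apply: ler_pM => //; first exact: cabs_le1.
    have p0 := prime_gt0 (ps pS).
    apply: le_trans (h2 _ _) _; first by rewrite divn_gt0 // dvdn_leq.
    by rewrite ler_nat; case: (l) => [|l']; rewrite ?expn0 ?leq_exp2r ?omega_div.
  rewrite -natr_sum ler_nat big_const_seq iter_addn_0 mulnC expnS.
  by rewrite /omega leq_mul2r leqnn orbT.
- move=> n nz.
  have [p pS /andP[pn bn]] : exists2 p, p \in s & (p %| n)%N && (beta (n %/ p)%N != 0).
    apply/hasP; apply: contraR nz => /hasPn hn; rewrite big_seq_cond big1 // => p /andP[pS pn].
    by have := hn p pS; rewrite pn /= negbK => /eqP->; rewrite mulr0.
  have /andP[n1 n2] := h3 _ bn; have /andP[p1 p2] := lohi pS.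
  rewrite -(divnK pn) natrM !exprSr !mulrA; apply/andP; split.
    by apply: ler_pM => //; pos.
  apply: le_lt_trans (_ : b * hi ^+ l * p%:R < _); first by rewrite ler_wpM2r // ltW.
  by rewrite ltr_pM2l //; pos.
Qed.

(** The mean value theorem for the product. The frequency range [theta * N] does not exceed the
    smallest [n] of the support, so the term [n] dominates, and the coefficients enter through
    [omega^(2l) <= (2l)! 4^l 2^omega]. *)
Lemma moment (theta t0 : R) (N l : nat) : b * hi ^+ l <= Z%:R -> 0 < theta -> theta * lnn Z <= PI ->
  theta * N%:R <= a * lo ^+ l ->
  theta * \sum_(k < N) N2 (dpol f s (t0 + theta * k%:R) ^+ l * dser Z a b g (t0 + theta * k%:R)) <=
  864 * ((l.*2)`!%:R * 4 ^+ l) * ((1 + ln (b * hi ^+ l / (a * lo ^+ l))) * exp (\sum_(p <- s) p%:R^-1)).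
Proof.
move=> hZ th0 thZ thN; have [beta [h1 h2 h3]] := dir_pow hZ.
under eq_bigr do rewrite h1.
apply: le_trans (mean_value t0 N (fun n => beta n * (n%:R^-1)%:C) th0 thZ) _.
have all0 : 0 < a * lo ^+ l by rewrite mulr_gt0 // exprn_gt0.
have abl : a * lo ^+ l <= b * hi ^+ l.
  have h0 := le_trans (ltW lo0) lh.
  apply: ler_pM => //; [exact: ltW|by rewrite exprn_ge0 // ltW|].
  by case: (l) => [|l']; rewrite ?expr0 // ler_pXn2r ?nnegrE // ltW.
have S2 := sum_2omega Z us ps all0 abl.
apply: le_trans (_ : 864 * ((l.*2)`!%:R * 4 ^+ l) * \sum_(1 <= n < Z | a * lo ^+ l <= n%:R < b * hi ^+ l) (2 ^ omega s n)%:R / n%:R <= _); last first.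
  apply: ler_wpM2l; first by pos.
  apply: le_trans S2 _; apply: ler_wpM2l; last exact: prod_le_exp.
  by have := ln_ge0 (_ : 1 <= b * hi ^+ l / (a * lo ^+ l)); rewrite ler_pdivlMr // mul1r => /(_ abl); lra.
have -> : 864 * ((l.*2)`!%:R * 4 ^+ l) = 432 * (2 * ((l.*2)`!%:R * 4 ^+ l)) :> R by ring.
rewrite -!mulrA ler_pM2l ?ltr0n // !mulrA mulr_sumr [X in _ <= X]big_mkcond /=.
apply: ler_sum_nat => n /andP[n1 _].
have nR : 0 < n%:R :> R by rewrite ltr0n.
have [->|bn] := eqVneq (beta n) 0; first by rewrite mul0r N20 mul0r; case: ifP => // _; pos.
have hn := h3 n bn; rewrite hn; have /andP[hn1 _] := hn.
rewrite N2M N2_rc.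
have B : N2 (beta n) <= (l.*2)`!%:R * 4 ^+ l * (2 ^ omega s n)%:R.
  apply: le_trans (N2_le_sqr (h2 n n1)) _.
  have -> : (omega s n ^ l)%:R ^+ 2 = (omega s n ^ l.*2)%:R :> R by rewrite -muln2 expnM [in RHS]natrX.
  apply: le_trans (_ : ((l.*2)`! * 2 ^ (omega s n + l.*2))%:R <= _); first by rewrite ler_nat pow_le_fact.
  rewrite natrM expnD natrM -mul2n expnM -[(2 ^ 2)%N]/4%N [(4 ^ l)%:R]natrX [_ * 4 ^+ l]mulrC mulrA.
  by rewrite lexx.
apply: le_trans (_ : N2 (beta n) * (2 / n%:R) <= _).
  rewrite -mulrA; apply: ler_wpM2l => //; rewrite exprVn ler_pdivrMl ?exprn_gt0 //.
  have -> : n%:R ^+ 2 * (2 / n%:R) = n%:R + n%:R :> R by field; rewrite gt_eqF.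
  exact: lerD (lexx _) (le_trans thN hn1).
apply: le_trans (ler_wpM2r _ B) _; first by pos.
by rewrite le_eqVlt; apply/orP; left; apply/eqP; field; rewrite gt_eqF.
Qed.
End Moment.

Lemma harm_mult (x y : R) (d Z : nat) : (0 < d)%N -> 0 < x -> x <= y -> y <= Z%:R ->
  `| \sum_(1 <= n < Z | x <= n%:R < y) (d %| n)%N%:R / n%:R - ln (y / x) / d%:R | <= x^-1 :> R.
Proof.
move=> d0 x0 xy yZ; have dR : 0 < d%:R :> R by rewrite ltr0n.
have Z0 : (0 < Z)%N by rewrite -(ltr0n R); lra.
have -> : \sum_(1 <= n < Z | x <= n%:R < y) (d %| n)%N%:R / n%:R = d%:R^-1 * \sum_(1 <= m < cdiv Z d | x / d%:R <= m%:R < y / d%:R) m%:R^-1 :> R.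
  have := congr1 cre (@sum_multiples (fun n => (if x <= n%:R < y then n%:R^-1 else 0)%:C) 1 Z d d0 Z0).
  rewrite !cre_sum /=.
  have c1 : cdiv 1 d = 1%N by rewrite /cdiv add1n prednK // divnn d0.
  rewrite c1 => e.
  transitivity (\sum_(1 <= i < Z | (d %| i)%N) (if x <= i%:R < y then i%:R^-1 else 0) : R).
    rewrite big_mkcond [RHS]big_mkcond; apply: eq_bigr => n _.
    by case: (d %| n)%N; case: ifP => // _; rewrite ?mul1r ?mul0r.
  rewrite e mulr_sumr [RHS]big_mkcond; apply: eq_big_nat => m /andP[m1 _].
  rewrite ler_pdivrMr // ltr_pdivlMr // natrM ![d%:R * _]mulrC.
  by case: ifP => // _; rewrite invfM mulrC.
have xd : 0 < x / d%:R by pos.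
have xyd : x / d%:R <= y / d%:R by rewrite ler_pM2r ?invr_gt0.
have cZ : y / d%:R <= (cdiv Z d)%:R.
  rewrite ler_pdivrMr // -natrM; apply: le_trans yZ _; rewrite ler_nat mulnC; exact: cdiv_ge.
have := harm_upV (cdiv Z d) xd xyd; have := harm_lo xd xyd cZ.
have -> : y / d%:R / (x / d%:R) = y / x by field; rewrite !gt_eqF.
have -> : (x / d%:R)^-1 = d%:R * x^-1 by rewrite invf_div mulrC.
set S := \sum_(_ <= _ < _ | _) _ => h1 h2.
have -> : d%:R^-1 * S - ln (y / x) / d%:R = d%:R^-1 * (S - ln (y / x)) by ring.
rewrite normrM ger0_norm ?invr_ge0 ?ler0n // ler_pdivrMl // ler_norml; lra.
Qed.

(** Divisibilities by distinct primes are independent up to the error [O(1/x)] of counting multiples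
    with weight [1/n], so the variance comes from the diagonal. *)
Lemma turan_kubilius (x y : R) (Z : nat) (s : seq nat) : uniq s -> (forall p, p \in s -> prime p) ->
  1 <= x -> x <= y -> y <= Z%:R ->
  \sum_(1 <= n < Z | x <= n%:R < y) ((omega s n)%:R - \sum_(p <- s) p%:R^-1) ^+ 2 / n%:R <=
  2 * ln (y / x) * \sum_(p <- s) p%:R^-1 + 4 * (size s)%:R ^+ 2 / x :> R.
Proof.
move=> us ps x1 xy yZ; have x0 : 0 < x by lra.
pose l := ln (y / x).
have l0 : 0 <= l by apply: ln_ge0; rewrite ler_pdivlMr // mul1r.
pose Sd d : R := \sum_(1 <= n < Z | x <= n%:R < y) (d %| n)%N%:R / n%:R.
have Sd_le d : (0 < d)%N -> `|Sd d - l / d%:R| <= x^-1 by move=> d0; exact: harm_mult.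
pose c (p : nat) n : R := (p %| n)%N%:R - p%:R^-1.
have oE n : (omega s n)%:R - \sum_(p <- s) p%:R^-1 = \sum_(p <- s) c p n :> R.
  rewrite sumrB; congr (_ - _); rewrite /omega -sum1_count natr_sum big_mkcond /=.
  by apply: eq_bigr => p _; case: (p %| n)%N.
have -> : \sum_(1 <= n < Z | x <= n%:R < y) ((omega s n)%:R - \sum_(p <- s) p%:R^-1) ^+ 2 / n%:R =
  \sum_(p <- s) \sum_(q <- s) \sum_(1 <= n < Z | x <= n%:R < y) c p n * c q n / n%:R :> R.
  under eq_bigr => n _.
    rewrite oE expr2 mulr_suml mulr_suml; under eq_bigr do rewrite mulr_sumr mulr_suml.
    over.
  rewrite exchange_big; apply: eq_bigr => p _ /=; rewrite exchange_big; apply: eq_bigr => q _ /=.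
  by apply: eq_bigr => n _.
have pairE p q : \sum_(1 <= n < Z | x <= n%:R < y) c p n * c q n / n%:R =
   \sum_(1 <= n < Z | x <= n%:R < y) ((p %| n) && (q %| n))%N%:R / n%:R - Sd p / q%:R - Sd q / p%:R + Sd 1 / (p%:R * q%:R).
  rewrite /Sd !mulr_suml -!sumrB -big_split /=; apply: eq_bigr => n _; rewrite /c dvd1n invfM.
  by case: (p %| n)%N; case: (q %| n)%N; rewrite /=; ring.
have pR p : p \in s -> 2 <= p%:R :> R by move=> /ps/prime_gt1; rewrite ler_nat.
have ne p q : p \in s -> q \in s -> p != q -> \sum_(1 <= n < Z | x <= n%:R < y) c p n * c q n / n%:R <= 4 / x.
  move=> pS qS pq; have p2 := pR p pS; have q2 := pR q qS.
  have p0 := prime_gt0 (ps p pS); have q0 := prime_gt0 (ps q qS).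
  have cop : coprime p q by rewrite prime_coprime ?ps // dvdn_prime2 ?ps.
  rewrite pairE; under eq_bigr do rewrite -Gauss_dvd //.
  have pq0 : (0 < p * q)%N by rewrite muln_gt0 p0.
  have := Sd_le _ pq0; have := Sd_le _ p0; have := Sd_le _ q0; have := Sd_le _ (isT : (0 < 1)%N).
  rewrite -/(Sd (p * q)%N) natrM invfM divr1 !ler_norml.
  have [P0 P1] : 0 < p%:R^-1 :> R /\ p%:R^-1 <= 1 :> R by split; [rewrite invr_gt0; lra_of p2|rewrite -[X in _ <= X]invr1 lef_pV2 ?posrE //; lra_of p2].
  have [Q0 Q1] : 0 < q%:R^-1 :> R /\ q%:R^-1 <= 1 :> R by split; [rewrite invr_gt0; lra_of q2|rewrite -[X in _ <= X]invr1 lef_pV2 ?posrE //; lra_of q2].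
  have xi : 0 < x^-1 by rewrite invr_gt0.
  move: P0 P1 Q0 Q1 xi; set P := p%:R^-1; set Q := q%:R^-1; set V := x^-1 => P0 P1 Q0 Q1 V0.
  have au (a0 b0 : R) : a0 <= V -> 0 <= b0 -> b0 <= 1 -> a0 * b0 <= V by clear -V0; nra.
  move=> /andP[a1 a2] /andP[b1 b2] /andP[c1 c2] /andP[d1 d2].
  have e1 : (l * P - Sd p) * Q <= V by apply: au; lra_of c1 Q0 Q1.
  have e2 : (l * Q - Sd q) * P <= V by apply: au; lra_of b1 P0 P1.
  have e3 : (Sd 1 - l) * (P * Q) <= V by apply: au; [lra_of a2|apply: mulr_ge0; lra_of P0 Q0|apply: mulr_ile1; lra_of P0 P1 Q0 Q1].
  lra_of e1 e2 e3 d1 d2 V0.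
have eqp p : p \in s -> \sum_(1 <= n < Z | x <= n%:R < y) c p n * c p n / n%:R <= 2 * l * p%:R^-1 + 4 / x.
  move=> pS; have p2 := pR p pS; have p0 := prime_gt0 (ps p pS).
  rewrite pairE; under eq_bigr do rewrite andbb.
  have := Sd_le _ p0; have := Sd_le _ (isT : (0 < 1)%N); rewrite divr1 -/(Sd p) invfM !ler_norml.
  have [P0 P1] : 0 < p%:R^-1 :> R /\ p%:R^-1 <= 2^-1 :> R by split; [rewrite invr_gt0; lra_of p2|rewrite lef_pV2 ?posrE //; lra_of p2].
  have xi : 0 < x^-1 by rewrite invr_gt0.
  move: P0 P1 xi; set P := p%:R^-1; set V := x^-1 => P0 P1 V0.
  have au (a0 b0 : R) : a0 <= V -> 0 <= b0 -> b0 <= 1 -> a0 * b0 <= V by clear -V0; nra.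
  move=> /andP[a1 a2] /andP[b1 b2].
  have S0 : 0 <= Sd p by rewrite /Sd; pos.
  have e1 : 0 <= Sd p * P by apply: mulr_ge0 => //; lra_of P0.
  have e3 : (Sd 1 - l) * (P * P) <= V by apply: au; [lra_of a2|apply: mulr_ge0; lra_of P0|apply: mulr_ile1; lra_of P0 P1].
  have e4 : l * (P * P) <= l * P by apply: ler_wpM2l => //; rewrite ger_pMr; lra_of P0 P1.
  lra_of e1 e3 e4 a1 a2 b1 b2 V0 l0 S0 P0 P1.
apply: le_trans (_ : \sum_(p <- s) (2 * l * p%:R^-1 + \sum_(q <- s) 4 / x) <= _); last first.
  rewrite big_split /= -mulr_sumr lerD2l !sumr_const_size le_eqVlt; apply/orP; left; apply/eqP; ring.
apply: ler_sum_seq => p pS _.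
rewrite (bigD1_seq p) //= [X in _ <= _ + X](bigD1_seq p) //= addrA.
apply: lerD; first exact: eqp.
by rewrite big_seq_cond [X in _ <= X]big_seq_cond; apply: ler_sum => q /andP[qS qp]; apply: ne => //; rewrite eq_sym.
Qed.

(** * Factorisation through prime levels *)

Lemma symsum_affine (theta : R) (N : nat) (phi : R -> R) :
  symsum N (fun x => phi (theta * x)) = \sum_(k < N.*2.+1) phi (- (theta * N%:R) + theta * k%:R).
Proof. by rewrite symsum_ord; apply: eq_bigr => k _; congr phi; ring. Qed.

Lemma symsum_sum N I (r : seq I) (F : I -> R -> R) :
  symsum N (fun x => \sum_(i <- r) F i x) = \sum_(i <- r) symsum N (F i).
Proof.
rewrite symsum_ord exchange_big /=; apply: eq_bigr => i _; by rewrite symsum_ord.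
Qed.

Lemma symsumZ N (c : R) phi : symsum N (fun x => c * phi x) = c * symsum N phi.
Proof. by rewrite !symsum_ord mulr_sumr. Qed.

Lemma symsumD N phi psi : symsum N (fun x => phi x + psi x) = symsum N phi + symsum N psi.
Proof. by rewrite !symsum_ord big_split. Qed.

Lemma symsum_le_all N phi psi : (forall x, phi x <= psi x) -> symsum N phi <= symsum N psi.
Proof. by move=> h; apply: symsum_le. Qed.

Lemma symsum_mono N N' phi : (N <= N')%N -> (forall x, 0 <= phi x) -> symsum N phi <= symsum N' phi.
Proof.
move=> NN h; rewrite (symsum_cat _ NN) lerDl; apply: sumr_ge0 => i _; exact: addr_ge0.
Qed.

Lemma ee_arith (c r w : R) : 0 <= r -> r <= w -> 0 <= c -> c <= 1 -> (c - r) ^+ 2 <= 2 * (w - 1) ^+ 2 + 3.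
Proof.
move=> r0 rw c0 c1; have h1 : (c - r) ^+ 2 <= 1 + w ^+ 2 by nra.
have : 0 <= (w - 2) ^+ 2 by exact: sqr_ge0.
rewrite !expr2; move: h1; rewrite !expr2; lra.
Qed.

Lemma ramare_arith (l k z w S L : R) : l ^+ 2 * L = l -> w <= z -> 0 < l -> 0 < k -> k <= 1 ->
  2 * l ^+ 2 * (2 * (1 + k) * L + 4 * S ^+ 2 * z) + 3 * (z + k) + 3 * (w + k) <= 8 * l + 6 * k + (8 * (S * l) ^+ 2 + 6) * z.
Proof.
move=> e wz l0 k0 k1.
have -> : 2 * l ^+ 2 * (2 * (1 + k) * L + 4 * S ^+ 2 * z) = 4 * (1 + k) * (l ^+ 2 * L) + 8 * (S * l) ^+ 2 * z by ring.
rewrite e; have : 4 * (1 + k) * l <= 8 * l by nra.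
lra.
Qed.

Lemma double_le (A B : R) : A <= 864 * B -> 2 * A <= 1728 * B. Proof. lra. Qed.

Lemma reorder2 (t c S : R) : t * (2 * c * S) = 2 * (c * (t * S)). Proof. ring. Qed.

(** * Factoring out one prime from a logarithmic cell *)

Section Ramare.
Variables (f : nat -> CC) (s : seq nat) (K Z : nat) (x : R).
Hypothesis f1 : forall n, N2 (f n) <= 1.
Hypothesis fM : forall m n, (0 < m)%N -> (0 < n)%N -> f (m * n)%N = f m * f n.
Hypothesis us : uniq s.
Hypothesis ps : forall p, p \in s -> prime p.
Hypothesis K0 : (0 < K)%N.
Hypothesis x1 : 1 <= x.
Let y := x * exp (1 + K%:R^-1).
Hypothesis yZ : y <= Z%:R.

(** The cofactor of the primes of cell [v], which satisfy [v/K <= log p < (v+1)/K]. Its range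
    depends on the cell alone, which separates the prime from the cofactor. *)
Definition cellA (v : nat) (t : R) : CC := dser Z (x * exp (- (v%:R / K%:R))) (x * exp (1 - v%:R / K%:R)) f t.
Definition cell (v : nat) : seq nat := [seq p <- s | nu K p == v].
Definition inA (p n : nat) : bool := x * exp (- ((nu K p)%:R / K%:R)) <= n%:R < x * exp (1 - (nu K p)%:R / K%:R).
(** The multiplicity of [n] in the sum over all cells of prime polynomial times cofactor. *)
Definition rr (n : nat) : nat := count (fun p => (p %| n)%N && inA p (n %/ p)%N) s.

Lemma KR : 0 < K%:R :> R. Proof. by rewrite ltr0n. Qed.

Lemma nu_exp p : (0 < p)%N -> exp ((nu K p)%:R / K%:R) <= p%:R < exp ((nu K p)%:R / K%:R + K%:R^-1).
Proof.
move=> p0; have pR : 0 < p%:R :> R by rewrite ltr0n.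
have /andP[h1 h2] := nu_itv K p0; have k0 := KR.
rewrite -ln_ge_exp // -ln_lt_exp // -[ln p%:R]/(lnn p) ler_pdivrMr // mulrC h1 /=.
have -> : (nu K p)%:R / K%:R + K%:R^-1 = (nu K p).+1%:R / K%:R :> R by rewrite -[_.+1%:R]natr1 mulrDl mul1r.
by rewrite ltr_pdivlMr // mulrC.
Qed.

Lemma inA_itv p m : (0 < p)%N -> inA p m -> x <= (p * m)%:R < y.
Proof.
move=> p0 /andP[h1 h2]; have /andP[e1 e2] := nu_exp p0.
have x0 : 0 < x by apply: lt_le_trans x1.
rewrite natrM; apply/andP; split.
  apply: le_trans (ler_pM _ _ e1 h1) => //; last by rewrite mulr_ge0 // ltW.
  by rewrite mulrCA -expD addrN exp_zero mulr1.
apply: lt_le_trans (ltr_pM _ _ e2 h2) _ => //.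
by rewrite mulrCA -expD /y; apply: ler_wpM2l; [exact: ltW|rewrite ler_exp; lra].
Qed.

Lemma rr_le n : (rr n <= omega s n)%N.
Proof. by apply: sub_count => p /andP[]. Qed.

Lemma rr_out n : ~~ (x <= n%:R < y) -> rr n = 0%N.
Proof.
move=> nx; apply/eqP; rewrite -leqn0 leqNgt -has_count; apply: contra nx => /hasP[p pS /andP[pn]].
by move=> /(inA_itv (prime_gt0 (ps pS))); rewrite mulnC divnK.
Qed.

Lemma rr_in n : x * exp K%:R^-1 <= n%:R < x * exp 1 -> rr n = omega s n.
Proof.
move=> /andP[n1 n2]; apply: eq_in_count => p pS; case pn: (p %| n)%N => //=.
have p0 := prime_gt0 (ps pS); have /andP[e1 e2] := nu_exp p0.
have pR : 0 < p%:R :> R by rewrite ltr0n.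
have x0 : 0 < x by apply: lt_le_trans x1.
have nE : (n %/ p)%:R = n%:R / p%:R :> R.
  by rewrite -[in RHS](divnK pn) natrM mulfK // gt_eqF.
rewrite /inA nE ler_pdivlMr // ltr_pdivrMr //; apply/andP; split.
  apply: le_trans n1; rewrite -mulrA; apply: ler_wpM2l; first exact: ltW.
  apply: le_trans (ler_wpM2l _ (ltW e2)) _ => //.
  by rewrite -expD ler_exp; lra.
apply: lt_le_trans n2 _; rewrite -mulrA; apply: ler_wpM2l; first exact: ltW.
rewrite expD expN -mulrA ler_pMr // ler_pdivlMl //; lra.
Qed.

Lemma cellprod (vs : seq nat) (t : R) : uniq vs -> (forall p, p \in s -> nu K p \in vs) ->
  \sum_(v <- vs) dpol f (cell v) t * cellA v t = \sum_(1 <= n < Z) (f n * ((rr n)%:R)%:C) * (n%:R^-1)%:C * eix (- (t * lnn n)).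
Proof.
move=> uv hv.
have Z0 : (0 < Z)%N.
  rewrite -(ltr0n R); apply: lt_le_trans yZ; rewrite mulr_gt0 //; exact: lt_le_trans x1.
transitivity (\sum_(p <- s) dpol f [:: p] t * cellA (nu K p) t).
  transitivity (\sum_(v <- vs) \sum_(p <- s | nu K p == v) dpol f [:: p] t * cellA v t).
    apply: eq_bigr => v _; rewrite /dpol big_filter mulr_suml; apply: eq_bigr => p _; by rewrite big_seq1.
  rewrite (exchange_big_dep predT) //= big_seq [RHS]big_seq; apply: eq_bigr => p pS.
  under eq_bigl do rewrite eq_sym.
  by rewrite -big_filter filter_pred1_uniq ?hv // big_seq1.
transitivity (\sum_(p <- s) \sum_(1 <= n < Z) (if (p %| n)%N && inA p (n %/ p)%N then f n else 0) * (n%:R^-1)%:C * eix (- (t * lnn n))).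
  rewrite big_seq [RHS]big_seq; apply: eq_bigr => p pS; have p0 := prime_gt0 (ps pS).
  have -> : cellA (nu K p) t = \sum_(1 <= n < Z) (if inA p n then f n else 0) * (n%:R^-1)%:C * eix (- (t * lnn n)).
    by rewrite /cellA /dser big_mkcond; apply: eq_bigr => n _; rewrite -/(inA p n); case: ifP => // _; rewrite !mul0r.
  rewrite dpol_mul //.
  - apply: eq_big_nat => n /andP[n1 _]; congr (_ * _ * _); rewrite big_mkcond big_seq1.
    case pn: (p %| n)%N => //=; case: ifP => _; last by rewrite mulr0.
    have q0 : (0 < n %/ p)%N by rewrite divn_gt0 // dvdn_leq.
    by rewrite -(fM p0 q0) mulnC divnK.
  - by move=> q; rewrite inE => /eqP->.
  - move=> q n; rewrite inE => /eqP->; case: ifP => [h _ _|]; last by rewrite eqxx.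
    by have /andP[_ h2] := inA_itv p0 h; rewrite -(ltr_nat R); apply: lt_le_trans yZ.
rewrite exchange_big /=; apply: eq_bigr => n _; rewrite -!mulr_suml; congr (_ * _ * _).
rewrite /rr -sum1_count natr_sum rc_sum mulr_sumr -big_mkcond /=; apply: eq_bigr => p _.
by rewrite [1%:R]/(1 : R) mulr1.
Qed.

Let L : R := \sum_(p <- s) p%:R^-1.
Hypothesis L0 : 0 < L.

Lemma dser_one (g : nat -> CC) (a b t : R) : dser Z a b g t = \sum_(1 <= n < Z) (if a <= n%:R < b then g n else 0) * (n%:R^-1)%:C * eix (- (t * lnn n)).
Proof. by rewrite /dser big_mkcond; apply: eq_bigr => n _; case: ifP => // _; rewrite !mul0r. Qed.

Definition ee (n : nat) : R := (x <= n%:R < x * exp 1)%R%:R - L^-1 * (rr n)%:R.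

(** In the interior of the block [rr] is [omega], and the error is the Turan-Kubilius deviation. The
    two boundary zones of logarithmic length [1/K] come from rounding [log p] to cells. *)
Lemma ee_le n : ee n ^+ 2 <= (if x <= n%:R < y then 2 * (L^-1) ^+ 2 * ((omega s n)%:R - L) ^+ 2 else 0) +
   (if x <= n%:R < x * exp K%:R^-1 then 3 else 0) + (if x * exp 1 <= n%:R < y then 3 else 0).
Proof.
have x0 : 0 < x by apply: lt_le_trans x1.
have L0' : 0 < L^-1 by rewrite invr_gt0.
have ey : x * exp 1 <= y by rewrite /y ler_pM2l // ler_exp lerDl invr_ge0.
have i3 (b : bool) : 0 <= (if b then 3 else 0 : R) by case: b.
have [xy|xy] := boolP (x <= n%:R < y); last first.
  rewrite /ee rr_out // mulr0 subr0.
  have -> : (x <= n%:R < x * exp 1) = false.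
    by apply: contraNF xy => /andP[-> h]; exact: lt_le_trans h ey.
  by rewrite expr0n /=; apply: addr_ge0 => //; apply: addr_ge0.
have [xm|xm] := boolP (x * exp K%:R^-1 <= n%:R < x * exp 1).
  rewrite /ee rr_in // -[X in X <= _]addr0; apply: lerD; last exact: i3.
  rewrite -[X in X <= _]addr0; apply: lerD; last exact: i3.
  have -> : (x <= n%:R < x * exp 1) by move: xm xy => /andP[_ ->] /andP[-> _].
  have e : 1 - L^-1 * (omega s n)%:R = - (L^-1 * ((omega s n)%:R - L)) by rewrite mulrBr mulVf ?gt_eqF //; ring.
  rewrite e sqrrN exprMn -mulrA.
  have : 0 <= L^-1 ^+ 2 * ((omega s n)%:R - L) ^+ 2 by pos.
  by set u := _ * _; lra.
have h3 : (if x <= n%:R < x * exp K%:R^-1 then 3 else 0) + (if x * exp 1 <= n%:R < y then 3 else 0) >= 3 :> R.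
  move: xm xy => /nandP[] + /andP[-> ->]; rewrite ?andbT /=.
    by rewrite -ltNge => ->; rewrite lerDl.
  by rewrite -leNgt => ->; rewrite lerDr.
rewrite -addrA; apply: le_trans (lerD (lexx _) h3).
have -> : 2 * L^-1 ^+ 2 * ((omega s n)%:R - L) ^+ 2 = 2 * (L^-1 * (omega s n)%:R - 1) ^+ 2.
  by rewrite -mulrA -exprMn mulrBr mulVf // gt_eqF.
have r1 : L^-1 * (rr n)%:R <= L^-1 * (omega s n)%:R by rewrite ler_pM2l // ler_nat rr_le.
have r0 : 0 <= L^-1 * (rr n)%:R by rewrite mulr_ge0 // ltW.
rewrite /ee; move: r1 r0; set r := L^-1 * (rr n)%:R; set w := L^-1 * _ => r1 r0.
have c01 : 0 <= ((x <= n%:R < x * exp 1)%R%:R : R) <= 1 by rewrite ler0n lern1 leq_b1.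
move: c01; set c := _%:R => /andP[c0 c1].
exact: ee_arith.
Qed.

(** [8/L] comes from the variance of [omega], [6/K] from the boundary zones, and the last term from
    the errors in counting multiples. *)
Lemma ramare_err (theta : R) (N : nat) (vs : seq nat) : 0 < theta -> theta * lnn Z <= PI -> theta * N.*2.+1%:R <= x ->
  uniq vs -> (forall p, p \in s -> nu K p \in vs) ->
  theta * symsum N (fun k => N2 (dser Z x (x * exp 1) f (theta * k) - (L^-1)%:C * \sum_(v <- vs) dpol f (cell v) (theta * k) * cellA v (theta * k))) <=
  864 * (8 / L + 6 / K%:R + (8 * ((size s)%:R / L) ^+ 2 + 6) / x).
Proof.
move=> th0 thZ thN uv hv.
have x0 : 0 < x by apply: lt_le_trans x1.
have K1 : K%:R^-1 <= 1 :> R by rewrite -[X in _ <= X]invr1 lef_pV2 ?posrE ?ltr0n // ler1n.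
have Ki : 0 < K%:R^-1 :> R by rewrite invr_gt0 ltr0n.
have coef t : dser Z x (x * exp 1) f t - (L^-1)%:C * \sum_(v <- vs) dpol f (cell v) t * cellA v t =
   \sum_(1 <= n < Z) (f n * (ee n)%:C * (n%:R^-1)%:C) * eix (- (t * lnn n)).
  rewrite cellprod // dser_one mulr_sumr -sumrB; apply: eq_bigr => n _.
  rewrite /ee rcD rcN rcM; case: ifP => _; rewrite /=; [rewrite [1%:R%:C]/(1 : CC)|rewrite [0%:R%:C]/(0 : CC)]; ring.
rewrite (symsum_affine theta N (fun t => N2 (dser Z x (x * exp 1) f t - (L^-1)%:C * \sum_(v <- vs) dpol f (cell v) t * cellA v t))).
under eq_bigr do rewrite coef.
apply: le_trans (mean_value _ _ (fun n => f n * (ee n)%:C * (n%:R^-1)%:C) th0 thZ) _.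
have -> : 864 = 432 * 2 :> R by ring.
rewrite -mulrA ler_pM2l ?ltr0n //.
have xK : x <= x * exp K%:R^-1 by rewrite ler_peMr ?(ltW x0) //; have := exp_ge1D K%:R^-1; lra.
have x1y : x * exp 1 <= y by rewrite /y ler_pM2l // ler_exp lerDl ltW.
have xx1 : x <= x * exp 1 by rewrite ler_peMr ?(ltW x0) //; have := exp_ge1D 1; lra.
have xy : x <= y by exact: le_trans x1y.
have TK := turan_kubilius us ps x1 xy yZ.
have E1 := harm_upV Z x0 xK.
have E2 := harm_upV Z (lt_le_trans x0 xx1) x1y.
apply: le_trans (_ : \sum_(1 <= n < Z) 2 * (((if x <= n%:R < y then 2 * (L^-1) ^+ 2 * ((omega s n)%:R - L) ^+ 2 else 0) +
   (if x <= n%:R < x * exp K%:R^-1 then 3 else 0) + (if x * exp 1 <= n%:R < y then 3 else 0)) * n%:R^-1) <= _).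
  apply: ler_sum_nat => n /andP[n1 _]; have nR : 0 < n%:R :> R by rewrite ltr0n.
  have [e0|e0] := eqVneq (ee n) 0.
    rewrite e0 mulr0 mul0r N20 mul0r; apply: mulr_ge0 => //; apply: mulr_ge0; last by pos.
    by apply: le_trans (ee_le n); exact: sqr_ge0.
  have xn : x <= n%:R.
    apply: contraNT e0; rewrite -ltNge => h; rewrite /ee rr_out ?mulr0 ?subr0; last by rewrite leNgt h.
    by rewrite leNgt h.
  have st : N2 (f n * (ee n)%:C * (n%:R^-1)%:C) <= ee n ^+ 2 * n%:R^-1 ^+ 2.
    rewrite !N2M !N2_rc; apply: ler_wpM2r; first exact: sqr_ge0.
    by rewrite ler_piMl // sqr_ge0.
  apply: le_trans (ler_pM _ _ st (lerD (lexx n%:R) (le_trans thN xn))) _ => //; first by pos.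
  have -> : ee n ^+ 2 * n%:R^-1 ^+ 2 * (n%:R + n%:R) = 2 * (ee n ^+ 2 * n%:R^-1) by field; rewrite gt_eqF.
  by rewrite ler_pM2l ?ltr0n //; apply: ler_wpM2r; [rewrite invr_ge0|exact: ee_le].
rewrite -mulr_sumr ler_pM2l ?ltr0n //.
have -> : \sum_(1 <= n < Z) ((if x <= n%:R < y then 2 * (L^-1) ^+ 2 * ((omega s n)%:R - L) ^+ 2 else 0) +
   (if x <= n%:R < x * exp K%:R^-1 then 3 else 0) + (if x * exp 1 <= n%:R < y then 3 else 0)) * n%:R^-1 =
   2 * (L^-1) ^+ 2 * (\sum_(1 <= n < Z | x <= n%:R < y) ((omega s n)%:R - L) ^+ 2 / n%:R) +
   3 * (\sum_(1 <= n < Z | x <= n%:R < x * exp K%:R^-1) n%:R^-1) +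
   3 * (\sum_(1 <= n < Z | x * exp 1 <= n%:R < y) n%:R^-1).
  rewrite !mulr_sumr [X in _ = X + _ + _]big_mkcond [X in _ = _ + X + _]big_mkcond [X in _ = _ + X]big_mkcond -!big_split /=.
  apply: eq_bigr => n _; rewrite !mulrDl; congr (_ + _ + _); case: ifP => _; rewrite ?mul0r //; ring.
have l1 : ln (y / x) = 1 + K%:R^-1 by rewrite /y mulrAC divff ?gt_eqF // mul1r expK.
have l2 : ln (x * exp K%:R^-1 / x) = K%:R^-1 by rewrite mulrAC divff ?gt_eqF // mul1r expK.
have l3 : ln (y / (x * exp 1)) = K%:R^-1.
  rewrite ln_div ?mulr_gt0 // /y !lnM // !expK; ring.
rewrite l1 in TK; rewrite l2 in E1; rewrite l3 in E2.
have xV : (x * exp 1)^-1 <= x^-1 by rewrite lef_pV2 ?posrE ?mulr_gt0.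
have c0 : 0 <= 2 * L^-1 ^+ 2 by pos.
have Lb : L^-1 ^+ 2 * L = L^-1 by field; rewrite gt_eqF.
have Li : 0 < L^-1 by rewrite invr_gt0.
apply: le_trans (lerD (lerD (ler_wpM2l c0 TK) (ler_wpM2l _ E1)) (ler_wpM2l _ E2)) _ => //.
rewrite -/L; move: xV Lb Li Ki K1.
set l := L^-1; set k := K%:R^-1; set z := x^-1; set w := (x * exp 1)^-1; set S := (size s)%:R.
move=> xV Lb Li Ki K1; exact: ramare_arith.
Qed.

(** Where all prime polynomials are below [tau] they can be taken out of the products;
    Cauchy-Schwarz over the cells leaves the mean squares of the cofactors. *)
Lemma level_bound (theta : R) (N : nat) (vs : seq nat) (tau M : nat -> R) (T : R -> bool) :
  0 < theta -> theta * lnn Z <= PI -> theta * N.*2.+1%:R <= x ->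
  uniq vs -> (forall p, p \in s -> nu K p \in vs) ->
  (forall t v, T t -> v \in vs -> N2 (dpol f (cell v) t) <= tau v) ->
  (forall v, v \in vs -> 0 <= tau v) ->
  (forall v, v \in vs -> theta * symsum N (fun k => if T (theta * k) then N2 (cellA v (theta * k)) else 0) <= M v) ->
  theta * symsum N (fun k => if T (theta * k) then N2 (dser Z x (x * exp 1) f (theta * k)) else 0) <=
  1728 * (8 / L + 6 / K%:R + (8 * ((size s)%:R / L) ^+ 2 + 6) / x) + 2 * (L^-1 ^+ 2 * (size vs)%:R * \sum_(v <- vs) tau v * M v).
Proof.
move=> th0 thZ thN uv hv hT t0 hM.
have RE := ramare_err th0 thZ thN uv hv.
have pw k : (if T (theta * k) then N2 (dser Z x (x * exp 1) f (theta * k)) else 0) <=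
   2 * N2 (dser Z x (x * exp 1) f (theta * k) - (L^-1)%:C * \sum_(v <- vs) dpol f (cell v) (theta * k) * cellA v (theta * k)) +
   2 * (L^-1 ^+ 2 * (size vs)%:R) * (\sum_(v <- vs) tau v * (if T (theta * k) then N2 (cellA v (theta * k)) else 0)).
  case Tk: (T _); last first.
    by apply: addr_ge0; [pos|rewrite big1 ?mulr0 // => v _; rewrite mulr0].
  set B := dser _ _ _ _ _; set C := _ * \sum_(v <- vs) _ * _.
  have {1}-> : B = B - C + C by ring.
  apply: le_trans (N2D_le _ _) _; rewrite lerD2l -mulrA ler_pM2l ?ltr0n // /C N2M N2_rc -mulrA.
  apply: ler_wpM2l; first exact: sqr_ge0.
  apply: le_trans (N2_sum_card _ _ _) _; rewrite sumr_const_size mulr1; apply: ler_wpM2l => //.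
  by apply: ler_sum_seq => v vS _; rewrite N2M; apply: ler_wpM2r => //; exact: hT.
apply: le_trans (ler_wpM2l (ltW th0) (symsum_le_all N pw)) _.
rewrite symsumD !symsumZ symsum_sum mulrDr; apply: lerD.
  by rewrite mulrCA; exact: double_le RE.
rewrite reorder2 ler_pM2l ?ltr0n //; apply: ler_wpM2l; first by apply: mulr_ge0; [exact: sqr_ge0|exact: ler0n].
rewrite mulr_sumr; apply: ler_sum_seq => v vS _.
rewrite symsumZ mulrCA; apply: ler_wpM2l; [exact: t0|exact: hM].
Qed.
End Ramare.

(** * Levels of primes and the step from one level to the next *)

Definition lvs (A B K : nat) : seq nat := iota (K * A) (K * (B - A)).
(** Each prime polynomial of the level is at most [P^(-al)] in modulus, where [P = e^(v/K)] is the
    size of the primes in its cell. *)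
Definition small (f : nat -> CC) (A B K : nat) (al t : R) : bool :=
  all (fun v => N2 (dpol f (cell (prange A%:R B%:R) K v) t) <= exp (- (2 * al * (v%:R / K%:R)))) (lvs A B K).

Lemma mem_lvs A B K v : (A <= B)%N -> (v \in lvs A B K) = (K * A <= v < K * B)%N.
Proof. by move=> AB; rewrite mem_iota mulnBr subnKC // leq_mul2l AB orbT. Qed.

Lemma size_lvs A B K : (size (lvs A B K) <= K * B)%N.
Proof. by rewrite size_iota leq_mul2l leq_subr orbT. Qed.

Lemma nu_lvs A B K p : (0 < K)%N -> (A <= B)%N -> p \in prange A%:R B%:R -> nu K p \in lvs A B K.
Proof.
move=> K0 AB; rewrite mem_prange => /and3P[/prime_gt0 p0 h1 h2].
have kR : 0 < K%:R :> R by rewrite ltr0n.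
have /andP[n1 n2] := nu_itv K p0.
rewrite mem_lvs // -(ltr_nat R) natrM -ltnS -(ltr_nat R) natrM; apply/andP; split.
  by apply: le_lt_trans n2; rewrite ler_pM2l.
by apply: le_lt_trans n1 _; rewrite ltr_pM2l.
Qed.

Lemma lvs_rng (A B K v : nat) : (0 < K)%N -> (A <= B)%N -> v \in lvs A B K -> (A%:R <= (v%:R / K%:R : R)) && ((v%:R / K%:R : R) < B%:R).
Proof.
move=> K0 AB; have kR : 0 < K%:R :> R by rewrite ltr0n.
by rewrite mem_lvs // ler_pdivlMr // ltr_pdivrMr // -!natrM ler_nat ltr_nat ![(_ * K)%N]mulnC.
Qed.

Lemma cell_itv A B K r p : (0 < K)%N -> p \in cell (prange A B) K r ->
  prime p /\ exp (r%:R / K%:R) <= p%:R < exp ((r%:R + 1) / K%:R).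
Proof.
move=> K0; rewrite mem_filter mem_prange => /andP[/eqP<- /and3P[pp _ _]]; split=> //.
by have := nu_exp K0 (prime_gt0 pp); rewrite mulrDl mul1r.
Qed.

Lemma uniq_cell A B K r : uniq (cell (prange A B) K r).
Proof. by rewrite filter_uniq // uniq_prange. Qed.

(** Bounded by the sum over all integers of the cell, which is at most [1 + 1/K]. *)
Lemma cell_mass A B K r : (0 < K)%N -> \sum_(p <- cell (prange A B) K r) p%:R^-1 <= 2 :> R.
Proof.
move=> K0; have kR : 0 < K%:R :> R by rewrite ltr0n.
have K1 : K%:R^-1 <= 1 :> R by rewrite -[X in _ <= X]invr1 lef_pV2 ?posrE ?ltr0n // ler1n.
pose Z := (Num.truncn (exp B)).+1.
have hZ p : prime p -> A <= lnn p < B -> (p < Z)%N.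
  move=> /prime_gt0 p0 /andP[_ h]; rewrite -(ltr_nat R).
  apply: lt_trans (_ : exp B < _); first by rewrite -ln_lt_exp ?ltr0n.
  by rewrite truncnS_gt.
rewrite big_filter big_mkcond /= (sum_prange _ hZ).
apply: le_trans (_ : \sum_(1 <= p < Z | exp (r%:R / K%:R) <= p%:R < exp ((r%:R + 1) / K%:R)) p%:R^-1 <= _).
  rewrite big_mkcond [X in _ <= X]big_mkcond; apply: ler_sum_nat => p /andP[p0 _].
  case: ifP => // _; last by case: ifP => // _; pos.
  case: ifP => [/eqP<-|_]; last by case: ifP => // _; pos.
  by have := nu_exp K0 p0; rewrite mulrDl mul1r => ->.
apply: le_trans (harm_up1 _ (exp_gt0 _) _) _; first by rewrite ler_exp ler_pM2r ?invr_gt0 // lerDl.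
rewrite ln_div // !expK mulrDl mul1r; lra.
Qed.

Lemma size_prange A B : (size (prange A B))%:R <= exp B.
Proof.
apply: le_trans (_ : (Num.truncn (exp B))%:R <= _); last by rewrite truncn_le.
by rewrite ler_nat size_filter; apply: leq_trans (count_size _ _) _; rewrite size_iota.
Qed.

Section Step.
Variables (f : nat -> CC) (Z N : nat) (theta : R).
Hypothesis f1 : forall n, N2 (f n) <= 1.
Hypothesis fM : forall m n, (0 < m)%N -> (0 < n)%N -> f (m * n)%N = f m * f n.
Hypothesis th0 : 0 < theta.
Hypothesis thZ : theta * lnn Z <= PI.

Lemma moment_cell (g : nat -> CC) (A B : R) (K r l : nat) (a b : R) : (0 < K)%N ->
  (forall n, N2 (g n) <= 1) -> 0 < a -> a <= b ->
  b * exp (l%:R * ((r%:R + 1) / K%:R)) <= Z%:R -> theta * N.*2.+1%:R <= a * exp (l%:R * (r%:R / K%:R)) ->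
  theta * symsum N (fun k => N2 (dpol f (cell (prange A B) K r) (theta * k) ^+ l * dser Z a b g (theta * k))) <=
  864 * ((l.*2)`!%:R * 4 ^+ l) * ((1 + ln (b / a) + l%:R) * exp 2).
Proof.
move=> K0 g1 a0 ab bZ aN; have kR : 0 < K%:R :> R by rewrite ltr0n.
have K1 : K%:R^-1 <= 1 :> R by rewrite -[X in _ <= X]invr1 lef_pV2 ?posrE ?ltr0n // ler1n.
have b0 : 0 < b by exact: lt_le_trans ab.
rewrite (symsum_affine theta N (fun t => N2 (dpol f (cell (prange A B) K r) t ^+ l * dser Z a b g t))).
have rK : 0 <= r%:R / K%:R :> R by pos.
have rK' : r%:R / K%:R <= (r%:R + 1) / K%:R :> R by rewrite ler_pM2r ?invr_gt0 // lerDl.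
have Z0 : (0 < Z)%N by rewrite -(ltr0n R); apply: lt_le_trans bZ; rewrite mulr_gt0.
rewrite expMn in bZ; rewrite expMn in aN.
have lohi : exp (r%:R / K%:R) <= exp ((r%:R + 1) / K%:R) by rewrite ler_exp.
have hi1 : 1 <= exp ((r%:R + 1) / K%:R) by apply: le_trans (_ : exp 0 <= _); [rewrite exp_zero|rewrite ler_exp; exact: le_trans rK rK'].
have pr p : p \in cell (prange A B) K r -> prime p by move=> /(cell_itv K0)[].
have it p : p \in cell (prange A B) K r -> exp (r%:R / K%:R) <= p%:R < exp ((r%:R + 1) / K%:R) by move=> /(cell_itv K0)[].
apply: le_trans (moment (uniq_cell A B K r) pr f1 g1 it a0 ab (exp_gt0 _) lohi hi1 Z0 _ bZ th0 thZ aN) _.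
have LN : ln (b * exp ((r%:R + 1) / K%:R) ^+ l / (a * exp (r%:R / K%:R) ^+ l)) = ln b + l%:R * ((r%:R + 1) / K%:R) - (ln a + l%:R * (r%:R / K%:R)).
  by rewrite ln_div ?mulr_gt0 ?exprn_gt0 // !lnM ?exprn_gt0 // -!expMn !expK.
apply: ler_wpM2l; first by pos.
rewrite LN ln_div //; apply: ler_pM => //.
- have : ln a <= ln b by exact: ler_ln.
  have : l%:R * (r%:R / K%:R) <= l%:R * ((r%:R + 1) / K%:R) :> R by apply: ler_wpM2l.
  lra.
- have : l%:R * ((r%:R + 1) / K%:R) - l%:R * (r%:R / K%:R) <= l%:R :> R.
    have -> : l%:R * ((r%:R + 1) / K%:R) - l%:R * (r%:R / K%:R) = l%:R * K%:R^-1 :> R by field; rewrite gt_eqF.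
    by rewrite ler_piMr.
  lra.
- by rewrite ler_exp cell_mass.
Qed.

(** Where a prime polynomial is large, its renormalised power has modulus at least 1 and may be
    inserted with any exponent [l]. *)
Lemma insert_poly (A B al : R) (K r l : nat) (g : nat -> CC) (a b : R) (T : R -> bool) :
  (forall t, T t -> exp (- (2 * al * (r%:R / K%:R))) <= N2 (dpol f (cell (prange A B) K r) t)) ->
  forall k, (if T k then N2 (dser Z a b g k) else 0) <=
    exp (2 * al * (l%:R * (r%:R / K%:R))) * N2 (dpol f (cell (prange A B) K r) k ^+ l * dser Z a b g k).
Proof.
move=> hT k; case Tk: (T k); last by apply: mulr_ge0.
rewrite N2M mulrA ler_peMl // N2X.
have -> : exp (2 * al * (l%:R * (r%:R / K%:R))) = exp (2 * al * (r%:R / K%:R)) ^+ l by rewrite -expMn mulrCA mulrA.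
rewrite -exprMn exprn_ege1 //; apply: le_trans (ler_wpM2l _ (hT _ Tk)) => //.
by rewrite -expD addrN exp_zero.
Qed.

(** The least [l] with [l r/K' >= v/K]: the [l]-th power of a prime polynomial of the earlier level
    makes up for the length [e^(v/K)] that the cofactor has lost. *)
Definition lval (K K' v r : nat) : nat := cdiv (v * K') (r * K).

Lemma lval_itv (K K' v r : nat) : (0 < K)%N -> (0 < K')%N -> (0 < r)%N ->
  v%:R / K%:R <= (lval K K' v r)%:R * (r%:R / K'%:R) :> R /\ (lval K K' v r)%:R * (r%:R / K'%:R) <= v%:R / K%:R + r%:R / K'%:R :> R.
Proof.
move=> K0 K0' r0; have rK : (0 < r * K)%N by rewrite muln_gt0 r0.
have kR : 0 < K%:R :> R by rewrite ltr0n.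
have kR' : 0 < K'%:R :> R by rewrite ltr0n.
have := cdiv_ge (v * K') rK; have := cdiv_lt (v * K') rK; rewrite -/(lval K K' v r); set l := lval _ _ _ _.
rewrite -(ltr_nat R) -(ler_nat R) natrD !natrM => h1 h2.
have kk : 0 < K%:R * K'%:R :> R by rewrite mulr_gt0.
split.
  rewrite -(ler_pM2r kk); have -> : v%:R / K%:R * (K%:R * K'%:R) = v%:R * K'%:R :> R by field; rewrite gt_eqF.
  have -> : l%:R * (r%:R / K'%:R) * (K%:R * K'%:R) = r%:R * K%:R * l%:R :> R by field; rewrite gt_eqF.
  by [].
rewrite -(ler_pM2r kk).
have -> : l%:R * (r%:R / K'%:R) * (K%:R * K'%:R) = r%:R * K%:R * l%:R :> R by field; rewrite gt_eqF.
have -> : (v%:R / K%:R + r%:R / K'%:R) * (K%:R * K'%:R) = v%:R * K'%:R + r%:R * K%:R :> R by field; rewrite !gt_eqF.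
exact: ltW.
Qed.

Definition tm (al' : R) (K K' v r : nat) : R :=
  let l := lval K K' v r in
  exp (2 * al' * (l%:R * (r%:R / K'%:R))) * (864 * ((l.*2)`!%:R * 4 ^+ l) * ((2 + l%:R) * exp 2)).

(** If [t] is not small at the earlier level, the polynomial of some cell [r] of that level is large
    at [t]. Inserting its power [lval] restores the length of the cofactor to at least [x], as
    frequencies up to [x] require. *)
Lemma level_step (x al al' : R) (A B A' B' K K' : nat) :
  (0 < K)%N -> (0 < K')%N -> (A <= B)%N -> (0 < A')%N -> (A' <= B')%N -> (B' <= B)%N -> 1 <= x ->
  x * exp (3 + 2 * B%:R) <= Z%:R -> theta * N.*2.+1%:R <= x ->
  forall L : R, L = \sum_(p <- prange A%:R B%:R) p%:R^-1 -> 1 <= L ->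
  theta * symsum N (fun k => if small f A B K al (theta * k) && ~~ small f A' B' K' al' (theta * k) then N2 (dser Z x (x * exp 1) f (theta * k)) else 0) <=
  1728 * (8 / L + 6 / K%:R + (8 * ((size (prange A%:R B%:R))%:R / L) ^+ 2 + 6) / x) +
  2 * (L^-1 ^+ 2 * (size (lvs A B K))%:R * \sum_(v <- lvs A B K) exp (- (2 * al * (v%:R / K%:R))) * \sum_(r <- lvs A' B' K') tm al' K K' v r).
Proof.
move=> K0 K0' AB A0' AB' BB x1 xZ thN L Ld L1.
have L0 : 0 < L by apply: lt_le_trans L1.
rewrite Ld in L0 *.
have x0 : 0 < x by apply: lt_le_trans x1.
have kR : 0 < K%:R :> R by rewrite ltr0n.
have K1 : K%:R^-1 <= 1 :> R by rewrite -[X in _ <= X]invr1 lef_pV2 ?posrE ?ltr0n // ler1n.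
have kR' : 0 < K'%:R :> R by rewrite ltr0n.
have K1' : K'%:R^-1 <= 1 :> R by rewrite -[X in _ <= X]invr1 lef_pV2 ?posrE ?ltr0n // ler1n.
have pr p : p \in prange A%:R B%:R -> prime p by rewrite mem_prange => /andP[].
have xZ' : x * exp (1 + K%:R^-1) <= Z%:R.
  apply: le_trans xZ; apply: ler_wpM2l; first exact: ltW.
  have : 0 <= B%:R :> R by []. rewrite ler_exp; lra.
apply: (@level_bound f (prange A%:R B%:R) K Z x f1 fM (uniq_prange _ _) pr K0 x1 xZ' L0 theta N (lvs A B K)
  (fun v => exp (- (2 * al * (v%:R / K%:R)))) (fun v => \sum_(r <- lvs A' B' K') tm al' K K' v r)
  (fun t => small f A B K al t && ~~ small f A' B' K' al' t)) => //.
- exact: iota_uniq.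
- by move=> p pS; apply: nu_lvs.
- by move=> t v /andP[/allP h _] vS; exact: h.
move=> v vS.
have /andP[V1 V2] := lvs_rng K0 AB vS.
(* [Tr r] selects the frequencies at which the polynomial of cell [r] is large; the cells are then
   added up. *)
pose Tr r t := small f A B K al t && ~~ (N2 (dpol f (cell (prange A'%:R B'%:R) K' r) t) <= exp (- (2 * al' * (r%:R / K'%:R)))).
apply: le_trans (_ : theta * symsum N (fun k => \sum_(r <- lvs A' B' K') (if Tr r (theta * k) then N2 (cellA f K Z x v (theta * k)) else 0)) <= _).
  apply: ler_wpM2l; first exact: ltW.
  apply: symsum_le_all => k; case: ifP => [/andP[sm]|_]; last by apply: sumr_ge0 => r _; case: ifP.
  rewrite -has_predC => /hasP[r rS /= nr].
  by rewrite (bigD1_seq r) ?iota_uniq //= /Tr sm nr /= lerDl; apply: sumr_ge0 => r' _; case: ifP.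
rewrite symsum_sum mulr_sumr; apply: ler_sum_seq => r rS _.
have /andP[r1 r2] := lvs_rng K0' AB' rS.
have A1 : 1 <= A'%:R :> R by rewrite ler1n.
have rho1 : 1 <= r%:R / K'%:R :> R by exact: le_trans r1.
have r0 : (0 < r)%N.
  by rewrite lt0n; apply: contraTneq rho1 => ->; rewrite mul0r -ltNge ltr01.
have [l1 l2] := lval_itv v K0 K0' r0.
have hT t : Tr r t -> exp (- (2 * al' * (r%:R / K'%:R))) <= N2 (dpol f (cell (prange A'%:R B'%:R) K' r) t).
  by move=> /andP[_]; rewrite -ltNge; exact: ltW.
pose l := lval K K' v r.
(* As [r/K'] is at least 1, the exponent exceeds [v/K] by at most 1. *)
have lV : l%:R <= v%:R / K%:R + 1 :> R.
  have ll : l%:R * (r%:R / K'%:R - 1) <= 1 * (v%:R / K%:R) + (r%:R / K'%:R - 1) - l%:R + 1 :> R by rewrite /l; lra.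
  have [//|h] := lerP l%:R (v%:R / K%:R + 1 : R).
  have : 0 <= (l%:R - 1) * (r%:R / K'%:R - 1) :> R.
    by apply: mulr_ge0; [(have : 0 <= v%:R / K%:R :> R by pos); lra|lra].
  lra.
apply: le_trans (_ : theta * (exp (2 * al' * (l%:R * (r%:R / K'%:R))) * symsum N (fun k => N2 (dpol f (cell (prange A'%:R B'%:R) K' r) (theta * k) ^+ l * cellA f K Z x v (theta * k)))) <= _).
  apply: ler_wpM2l; first exact: ltW.
  rewrite -symsumZ; apply: symsum_le_all => k; exact: insert_poly.
rewrite mulrCA /tm -/l; apply: ler_wpM2l => //.
have a0 : 0 < x * exp (- (v%:R / K%:R)) by rewrite mulr_gt0.
have ab : x * exp (- (v%:R / K%:R)) <= x * exp (1 - v%:R / K%:R) by rewrite ler_pM2l // ler_exp lerDr.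
have BR : B'%:R <= B%:R :> R by rewrite ler_nat.
apply: le_trans (@moment_cell f A'%:R B'%:R K' r l _ _ K0' f1 a0 ab _ _) _.
- rewrite -mulrA -expD; apply: le_trans xZ; apply: ler_wpM2l; first exact: ltW.
  rewrite ler_exp.
  have -> : l%:R * ((r%:R + 1) / K'%:R) = l%:R * (r%:R / K'%:R) + l%:R * K'%:R^-1 :> R by field; rewrite gt_eqF.
  have : l%:R * K'%:R^-1 <= l%:R :> R by rewrite ler_piMr.
  move: l1 l2; rewrite -/l; lra.
- apply: le_trans thN _; rewrite -mulrA -expD ler_peMr ?(ltW x0) //.
  apply: le_trans (exp_ge1D _); move: l1; rewrite -/l; lra.
- apply: ler_wpM2l; first by pos.
  apply: ler_wpM2r => //; rewrite ln_div ?mulr_gt0 // !lnM // !expK; lra.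
Qed.

(** There is no earlier level to draw on. Instead the frequencies stay below [x e^(-B)], so that
    even the shortest cofactor is long enough. *)
Lemma level_zero (x al : R) (A B K : nat) :
  (0 < K)%N -> (A <= B)%N -> 1 <= x -> x * exp 2 <= Z%:R -> theta * N.*2.+1%:R <= x * exp (- B%:R) ->
  forall L : R, L = \sum_(p <- prange A%:R B%:R) p%:R^-1 -> 1 <= L ->
  theta * symsum N (fun k => if small f A B K al (theta * k) then N2 (dser Z x (x * exp 1) f (theta * k)) else 0) <=
  1728 * (8 / L + 6 / K%:R + (8 * ((size (prange A%:R B%:R))%:R / L) ^+ 2 + 6) / x) +
  2 * (L^-1 ^+ 2 * (size (lvs A B K))%:R * \sum_(v <- lvs A B K) exp (- (2 * al * (v%:R / K%:R))) * (864 * (2 * exp 2))).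
Proof.
move=> K0 AB x1 xZ thN L Ld L1.
have L0 : 0 < L by apply: lt_le_trans L1.
rewrite Ld in L0 *.
have x0 : 0 < x by apply: lt_le_trans x1.
have kR : 0 < K%:R :> R by rewrite ltr0n.
have K1 : K%:R^-1 <= 1 :> R by rewrite -[X in _ <= X]invr1 lef_pV2 ?posrE ?ltr0n // ler1n.
have pr p : p \in prange A%:R B%:R -> prime p by rewrite mem_prange => /andP[].
have xZ' : x * exp (1 + K%:R^-1) <= Z%:R.
  apply: le_trans xZ; apply: ler_wpM2l; first exact: ltW.
  rewrite ler_exp; lra.
have thN' : theta * N.*2.+1%:R <= x.
  apply: le_trans thN _; rewrite ger_pMr // -[X in _ <= X]exp_zero ler_exp oppr_le0; exact: ler0n.
apply: (@level_bound f (prange A%:R B%:R) K Z x f1 fM (uniq_prange _ _) pr K0 x1 xZ' L0 theta N (lvs A B K)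
  (fun v => exp (- (2 * al * (v%:R / K%:R)))) (fun v => 864 * (2 * exp 2))
  (fun t => small f A B K al t)) => //.
- exact: iota_uniq.
- by move=> p pS; apply: nu_lvs.
- by move=> t v /allP h vS; exact: h.
move=> v vS.
have /andP[V1 V2] := lvs_rng K0 AB vS.
(* With exponent 0 the moment bound is the plain mean value theorem for the cofactor. *)
apply: le_trans (_ : theta * symsum N (fun k => N2 (dpol f (cell (prange A%:R B%:R) K 0) (theta * k) ^+ 0 * cellA f K Z x v (theta * k))) <= _).
  apply: ler_wpM2l; first exact: ltW.
  by apply: symsum_le_all => k; rewrite expr0 mul1r; case: ifP.
have a0 : 0 < x * exp (- (v%:R / K%:R)) by rewrite mulr_gt0.
have ab : x * exp (- (v%:R / K%:R)) <= x * exp (1 - v%:R / K%:R) by rewrite ler_pM2l // ler_exp lerDr.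
apply: le_trans (@moment_cell f A%:R B%:R K 0 0 _ _ K0 f1 a0 ab _ _) _.
- rewrite mul0r exp_zero mulr1; apply: le_trans xZ'; apply: ler_wpM2l; first exact: ltW.
  have : 0 <= v%:R / K%:R :> R by pos.
  have : 0 < K%:R^-1 :> R by rewrite invr_gt0.
  rewrite ler_exp; lra.
- rewrite mul0r exp_zero mulr1; apply: le_trans thN _; rewrite ler_pM2l // ler_exp; lra.
- rewrite expr0 mulr1 ln_div ?mulr_gt0 // !lnM // !expK /= fact0 mulr1.
  rewrite ler_pM2l ?ltr0n //; apply: ler_wpM2r => //; lra.
Qed.
End Step.

(** * Choice of the levels *)

Lemma fact_le_exp n m : (n <= m)%N -> (n`! <= m ^ n)%N.
Proof.
elim: n => [|n IH] nm; first by rewrite expn0.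
by rewrite factS expnS leq_mul // IH // ltnW.
Qed.

Lemma fact_exp (l : nat) (Y : R) : (0 < l)%N -> l%:R <= Y ->
  (l.*2)`!%:R * 4 ^+ l * (2 + l%:R) <= exp (l%:R * (2 * ln Y + 5) + 1).
Proof.
move=> l0 lY; have lR : 0 < l%:R :> R by rewrite ltr0n.
have -> : l%:R * (2 * ln Y + 5) + 1 = l.*2%:R * (1 + ln Y) + l%:R * 2 + (1 + l%:R) by rewrite -mul2n natrM; ring.
rewrite expD; apply: ler_pM; [by pos|by pos| |by have := exp_ge1D (1 + l%:R); lra].
have e1 : 2 <= exp 1 by have := exp_ge1D 1; lra.
rewrite expD; apply: ler_pM; [by pos|by pos| |].
  rewrite expMn; apply: le_trans (_ : (l.*2)%:R ^+ l.*2 <= _).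
    by rewrite -natrX ler_nat fact_le_exp.
  rewrite ler_pXn2r ?nnegrE // ?double_gt0 //.
  rewrite expD -mul2n natrM; apply: ler_pM => //; rewrite lnK //; exact: lt_le_trans lY.
rewrite expMn; case: (l) => [|l']; first by rewrite !expr0.
rewrite ler_pXn2r ?nnegrE //; have -> : 2 = 1 + 1 :> R by ring.
by rewrite expD; nra.
Qed.

(** [G] is the scale of the level: [V = v/K] lies between [G^6] and [G^9], and [r/K'] for the
    previous level between [G^2] and [G^3]. The difference of the exponents gains [2 (alpha/G) V],
    while the factorial costs about [l log l] with [l <= 2 V / G^2]. The condition on [ln G] makes
    the gain win, and [exp(-alpha G^5)] is left. *)
Lemma term_bound (al al' alpha G : R) (K K' v r : nat) : (0 < K)%N -> (0 < K')%N -> (0 < r)%N ->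
  3 <= G -> 0 < alpha -> 4 * (18 * ln G + 5) <= alpha * G -> 0 <= al' -> al' <= 2 * alpha -> alpha / G <= al - al' ->
  G ^+ 6 <= v%:R / K%:R -> v%:R / K%:R <= G ^+ 9 -> G ^+ 2 <= r%:R / K'%:R -> r%:R / K'%:R <= G ^+ 3 ->
  exp (- (2 * al * (v%:R / K%:R))) * tm al' K K' v r <= 864 * exp 3 * exp (- (alpha * G ^+ 5)).
Proof.
move=> K0 K0' r0 G3 a0 hG al0 al2 da V1 V2 r1 r2.
have [l1 l2] := lval_itv v K0 K0' r0.
rewrite /tm; move: l1 l2; set l := lval K K' v r; move: V1 V2 r1 r2.
set V := v%:R / K%:R; set rho := r%:R / K'%:R => V1 V2 r1 r2 l1 l2.
have G0 : 0 < G by lra.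
have G1 : 1 <= G by lra.
have V0 : 0 < V by apply: lt_le_trans V1; rewrite exprn_gt0.
have rho0 : 0 < rho by apply: lt_le_trans r1; rewrite exprn_gt0.
have l0 : (0 < l)%N.
  by rewrite lt0n; apply/negP => /eqP e; move: l1; rewrite e mul0r; lra.
have lR : 1 <= l%:R :> R by rewrite ler1n.
have G2 : 0 < G ^+ 2 by rewrite exprn_gt0.
have G26 : G ^+ 2 <= V.
  by apply: le_trans V1; rewrite ler_weXn2l.
have lY : l%:R <= 2 * V / G ^+ 2.
  rewrite ler_pdivlMr //; apply: le_trans (_ : l%:R * rho - rho + G ^+ 2 <= _); last by lra.
  have : 0 <= (l%:R - 1) * (rho - G ^+ 2) by apply: mulr_ge0; lra_of lR r1.
  lra.
have lV : l%:R <= V.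
  apply: le_trans lY _; rewrite ler_pdivrMr // mulrC ler_pM2l //.
  by rewrite expr2; nra.
have lnV9 : ln V <= 9 * ln G.
  have -> : 9 * ln G = ln (G ^+ 9) by rewrite -[G in RHS]lnK // -expMn expK.
  exact: ler_ln.
have lnG0 : 0 <= ln G by exact: ln_ge0.
have F := fact_exp l0 lV.
apply: le_trans (_ : exp (- (2 * al * V)) * (exp (2 * al' * (l%:R * rho)) * (864 * exp 2 * exp (l%:R * (2 * ln V + 5) + 1))) <= _).
  apply: ler_wpM2l => //; apply: ler_wpM2l => //.
  have -> : 864 * ((l.*2)`!%:R * 4 ^+ l) * ((2 + l%:R) * exp 2) = 864 * exp 2 * ((l.*2)`!%:R * 4 ^+ l * (2 + l%:R)) by ring.
  by apply: ler_wpM2l => //; pos.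
have -> : exp (- (2 * al * V)) * (exp (2 * al' * (l%:R * rho)) * (864 * exp 2 * exp (l%:R * (2 * ln V + 5) + 1))) =
  864 * exp (- (2 * al * V) + 2 * al' * (l%:R * rho) + 2 + (l%:R * (2 * ln V + 5) + 1)) by rewrite !expD; ring.
have -> : 864 * exp 3 * exp (- (alpha * G ^+ 5)) = 864 * exp (3 - alpha * G ^+ 5) by rewrite (expD 3) mulrA.
rewrite ler_pM2l ?ltr0n // ler_exp.
have e1 : 2 * al' * (l%:R * rho) <= 2 * al' * (V + rho) by apply: ler_wpM2l => //; lra.
have e2 : 2 * (alpha / G) * V <= 2 * (al - al') * V by apply: ler_wpM2r; lra_of V0 da.
have e3 : 2 * al' * rho <= 4 * alpha * G ^+ 3.
  by apply: ler_pM; lra_of al0 al2 rho0 r2 a0.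
have e4 : 4 * alpha * G ^+ 3 <= alpha / G * V / 2.
  have -> : 4 * alpha * G ^+ 3 = alpha / G * (8 * G ^+ 4) / 2 by field; rewrite gt_eqF.
  rewrite ler_pM2r ?invr_gt0 ?ltr0n //; apply: ler_wpM2l; first by pos.
  apply: le_trans V1; have -> : G ^+ 6 = G ^+ 2 * G ^+ 4 by rewrite -exprD.
  apply: ler_wpM2r; first by rewrite exprn_ge0 // ltW.
  by rewrite expr2; nra.
have e5 : l%:R * (2 * ln V + 5) <= alpha / G * V / 2.
  apply: le_trans (_ : 2 * V / G ^+ 2 * (18 * ln G + 5) <= _).
    have lnV0 : 0 <= ln V by apply: ln_ge0; lra.
    apply: ler_pM => //; lra_of lnV0 lnV9 lR.
  have -> : 2 * V / G ^+ 2 * (18 * ln G + 5) = V / G ^+ 2 / 2 * (4 * (18 * ln G + 5)) by field; rewrite gt_eqF.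
  have -> : alpha / G * V / 2 = V / G ^+ 2 / 2 * (alpha * G) by field; rewrite gt_eqF.
  by apply: ler_wpM2l => //; pos.
have e6 : alpha * G ^+ 5 <= alpha / G * V.
  have -> : alpha * G ^+ 5 = alpha / G * G ^+ 6 by field; rewrite gt_eqF.
  by apply: ler_wpM2l => //; pos.
move: e2 e4 e5 e6; set aG := alpha / G; lra.
Qed.

(** Level [j] has the primes with [log p] between [G^6] and [G^9], where [G = Gs D j]. As [G] is
    cubed at each step, the previous level lies between [G^2] and [G^3] in terms of the current
    [G]. *)
Definition Gs (D j : nat) : nat := (2 ^ (D * 3 ^ j))%N.
Definition Ks (K j : nat) : nat := (K * 2 ^ j)%N.
(** Increases from [al] towards [2 al]; the steps [al / 2^(j+1)] remain at least [al / G]. *)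
Definition als (al : R) (j : nat) : R := al * (2 - 2^-1 ^+ j).
Definition smallj (f : nat -> CC) (D K : nat) (al : R) (j : nat) (t : R) : bool :=
  small f (Gs D j ^ 6) (Gs D j ^ 9) (Ks K j) (als al j) t.

Lemma Gs_S D j : Gs D j.+1 = (Gs D j ^ 3)%N.
Proof. by rewrite /Gs -expnM expnS; congr (_ ^ _)%N; ring. Qed.

Lemma Gs_gt0 D j : (0 < Gs D j)%N. Proof. by rewrite expn_gt0. Qed.

Lemma Gs_ge D j : (0 < D)%N -> (D * 2 ^ j <= Gs D j)%N.
Proof.
move=> D0; apply: leq_trans (_ : D * 3 ^ j <= _)%N; last exact/ltnW/ltn_expl.
by rewrite leq_mul2l; case: j => [|j]; rewrite ?expn0 ?orbT // leq_exp2r ?orbT.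
Qed.

Lemma Gs_ge2 D j : (0 < D)%N -> (2 ^ j <= Gs D j)%N.
Proof. by move=> D0; apply: leq_trans (Gs_ge j D0); rewrite leq_pmull. Qed.

Lemma exp_ge_pow (y : R) n : 0 <= y -> (y / n%:R) ^+ n <= exp y.
Proof.
move=> y0; case: n => [|n]; first by rewrite expr0; have := exp_ge1D y; lra.
have n0 : 0 < n.+1%:R :> R by rewrite ltr0n.
have -> : exp y = exp (y / n.+1%:R) ^+ n.+1 by rewrite -expMn mulrC divfK ?gt_eqF.
have : 0 <= y / n.+1%:R by pos.
set z := y / _ => z0; rewrite ler_pXn2r ?nnegrE //; have := exp_ge1D z; lra.
Qed.

Lemma ln_le_sqrt (G : R) : 1 <= G -> ln G <= 2 * Num.sqrt G.
Proof.
move=> G1; have s0 : 0 < Num.sqrt G by rewrite sqrtr_gt0; lra.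
have -> : ln G = 2 * ln (Num.sqrt G) by rewrite -{1}[G]sqr_sqrtr ?expr2 ?lnM //; lra.
have := ln_le_subr1 s0; lra.
Qed.

(** The second condition beats the factorial. The third beats the number of cells, [K^3 G^24] for
    two factors from one level and one from the previous; 40000 is an upper bound for [1728 e^3]. *)
Definition goodG (al eps : R) (K : nat) (G : R) : Prop :=
  [/\ 3 <= G, 4 * (18 * ln G + 5) <= al * G & (40 * 1000) * K%:R ^+ 3 * G ^+ 24 * exp (- (al * G ^+ 5)) <= eps / G].

Lemma goodG_ex (al eps : R) (K : nat) : 0 < al -> 0 < eps -> exists G0 : R, forall G, G0 <= G -> goodG al eps K G.
Proof.
move=> a0 e0; pose c : R := (40 * 1000) * K%:R ^+ 3 * 6%:R ^+ 6 / al ^+ 6 / eps.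
exists (3 + (200 / al) ^+ 2 + c) => G hG.
have c0 : 0 <= c by rewrite /c; pos.
have s0 : 0 <= (200 / al) ^+ 2 by exact: sqr_ge0.
have G0 : 0 < G by lra.
split; first by lra.
  have sG : 200 / al <= Num.sqrt G.
    rewrite -(ger0_norm (_ : 0 <= 200 / al)); last by pos.
    by rewrite -sqrtr_sqr ler_sqrt //; lra.
  have sG1 : 1 <= Num.sqrt G by rewrite -sqrtr1 ler_sqrt //; lra.
  have := @ln_le_sqrt G; have -> : 1 <= G by lra.
  move=> /(_ isT) h.
  have e : al * G = al * Num.sqrt G * Num.sqrt G by rewrite -mulrA -expr2 sqr_sqrtr // ltW.
  have : 200 <= al * Num.sqrt G by move: sG; rewrite ler_pdivrMr // mulrC.
  rewrite e; move: sG1 h; set q := Num.sqrt G; set y := al * q => q1 h y1.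
  have : 200 * q <= y * q by apply: ler_wpM2r => //; lra.
  lra.
have y0 : 0 < al * G ^+ 5 by rewrite mulr_gt0 // exprn_gt0.
have := @exp_ge_pow (al * G ^+ 5) 6 (ltW y0) => h.
have p0 : 0 < (al * G ^+ 5 / 6%:R) ^+ 6 by rewrite exprn_gt0 // divr_gt0 // ltr0n.
have G24 : 0 <= (40 * 1000) * K%:R ^+ 3 * G ^+ 24 by move: (ltW G0) => ?; pos.
rewrite expN; apply: le_trans (ler_wpM2l G24 (_ : _ <= ((al * G ^+ 5 / 6%:R) ^+ 6)^-1)) _.
  by rewrite lef_pV2 ?posrE.
have -> : (40 * 1000) * K%:R ^+ 3 * G ^+ 24 / (al * G ^+ 5 / 6%:R) ^+ 6 = c * (eps / G ^+ 6).
  by rewrite /c; field; rewrite !gt_eqF.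
apply: le_trans (_ : G * (eps / G ^+ 6) <= _).
  by apply: ler_wpM2r; [move: (ltW G0) => ?; pos|lra].
have -> : G * (eps / G ^+ 6) = eps / G * (G ^+ 4)^-1 by field; rewrite gt_eqF.
rewrite ler_piMr //; first by move: (ltW G0) => ?; pos.
by rewrite invf_le1 ?exprn_gt0 // exprn_ege1 //; lra.
Qed.

Lemma exp3_le : exp 3 <= 23.
Proof.
have h : (1 - 24^-1) ^+ 24 <= exp (- 1).
  have -> : exp (- 1) = exp (- 24%:R^-1) ^+ 24 by rewrite -expMn; congr exp; field.
  rewrite ler_pXn2r ?nnegrE //; have := exp_ge1D (- 24%:R^-1 : R); lra.
have e : exp 3 = (exp (-1))^-1 ^+ 3 by rewrite -expN opprK -expMn mulr1.
have p0 : 0 < (1 - 24^-1) ^+ 24 :> R by rewrite exprn_gt0 //; lra.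
rewrite e; apply: le_trans (_ : ((1 - 24^-1) ^+ 24)^-1 ^+ 3 <= _).
  by rewrite ler_pXn2r ?nnegrE ?invr_ge0 ?(ltW p0) // lef_pV2 ?posrE.
rewrite exprVn invf_ple ?posrE ?exprn_gt0 //; last by lra.
by rewrite -exprM; lra.
Qed.

Lemma err_arith (a b c p q : R) : a <= 16 * p * q -> c <= 14 * p * q -> a + b * q + c <= (30 * p + b) * q.
Proof. lra. Qed.

Lemma als_diff (al G : R) j : 0 < al -> 2 ^+ j.+1 <= G -> al / G <= als al j.+1 - als al j.
Proof.
move=> a0 h; have p0 : 0 < 2 ^+ j.+1 :> R by rewrite exprn_gt0 // ltr0n.
have -> : als al j.+1 - als al j = al / 2 ^+ j.+1 by rewrite /als -exprVn exprS; field.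
by rewrite ler_pM2l // lef_pV2 ?posrE //; exact: lt_le_trans h.
Qed.

Lemma ln_20G (G : R) : 1 <= G -> ln (20 * G ^+ 27) <= 4 + 27 * ln G.
Proof.
move=> G1; have G0 : 0 < G by lra.
have e : ln (G ^+ 27) = 27 * ln G by rewrite -{1}[G]lnK // -expMn expK.
have p : 0 < G ^+ 27 by rewrite exprn_gt0.
have q : (0 : R) < 20 by lra.
rewrite (lnM q p) e; suff : ln 20 <= 4 by lra.
rewrite ln_le_exp //; have -> : exp 4 = exp 2^-1 ^+ 8 by rewrite -expMn; congr exp; field.
have h : 3 / 2 <= exp 2^-1 by have := exp_ge1D 2^-1; lra.
apply: le_trans (_ : (3 / 2) ^+ 8 <= _); first by lra.
by rewrite ler_pXn2r ?nnegrE //; lra.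
Qed.

(** * Mean square over the small frequencies *)

Section LevelSum.
Variables (f : nat -> CC) (Z N D K : nat) (theta x al eps : R).
Hypothesis f1 : forall n, N2 (f n) <= 1.
Hypothesis fM : forall m n, (0 < m)%N -> (0 < n)%N -> f (m * n)%N = f m * f n.
Hypothesis th0 : 0 < theta.
Hypothesis thZ : theta * lnn Z <= PI.
Hypothesis al0 : 0 < al.
Hypothesis eps0 : 0 < eps.
Hypothesis D2 : (1 < D)%N.
Hypothesis K0 : (0 < K)%N.
Hypothesis gG : forall j, goodG al eps K (Gs D j)%:R.

Lemma Ks_gt0 j : (0 < Ks K j)%N. Proof. by rewrite muln_gt0 K0 expn_gt0. Qed.

(** With [G = 2^m] and [m = D 3^j] one has [G^9 = 8^m G^6], so the range consists of [m] steps of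
    ratio 8, each of mass at least 1/2. This is why [Gs] is a power of 2. *)
Lemma lvl_L j : exists L : R, L = \sum_(p <- prange (Gs D j ^ 6)%:R (Gs D j ^ 9)%:R) p%:R^-1 /\ (D * 3 ^ j)%:R / 2 <= L.
Proof.
eexists; split; first reflexivity.
have h4 : 4 <= (Gs D j ^ 6)%:R :> R.
  rewrite ler_nat /Gs -expnM; apply: (@leq_trans (2 ^ 2)) => //; rewrite leq_exp2l //.
  apply: leq_trans (_ : (D * 3 ^ j * 6 >= 2 * 1 * 1)%N) => //; rewrite leq_mul // leq_mul // ?expn_gt0 // ltnW.
apply: le_trans (sum_invp_ge (D * 3 ^ j) h4) _.
have -> : 8 ^+ (D * 3 ^ j) * (Gs D j ^ 6)%:R = (Gs D j ^ 9)%:R :> R; last by [].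
have -> : (Gs D j ^ 9 = 8 ^ (D * 3 ^ j) * Gs D j ^ 6)%N.
  by rewrite -[8%N]/(2 ^ 3)%N -!expnM -expnD; congr (_ ^ _)%N; ring.
by rewrite natrM [(8 ^ _)%:R]natrX.
Qed.

Definition cc : R := 1728 * (30 / D%:R + 6 / K%:R) + eps.

(** [L] grows like [3^j] and the number of cells per unit like [2^j], so the errors of the levels
    form a convergent series; [x] is far larger than the number of primes of the level. *)
Lemma lvl_err j (L : R) : exp (10 * (Gs D j ^ 9)%:R) <= x -> (D * 3 ^ j)%:R / 2 <= L ->
  1728 * (8 / L + 6 / (Ks K j)%:R + (8 * ((size (prange (Gs D j ^ 6)%:R (Gs D j ^ 9)%:R))%:R / L) ^+ 2 + 6) / x) <=
  1728 * (30 / D%:R + 6 / K%:R) / 2 ^+ j.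
Proof.
move=> xe L1; rewrite -mulrA ler_pM2l ?ltr0n //.
have DR : 2 <= D%:R :> R by rewrite ler_nat.
have p2 : 0 < 2 ^+ j :> R by rewrite exprn_gt0 ?ltr0n.
have p23 : D%:R * 2 ^+ j <= (D * 3 ^ j)%:R :> R.
  rewrite natrM natrX; apply: ler_wpM2l => //.
  by case: (j) => [|j']; rewrite ?expr0 // ler_pXn2r ?nnegrE // ler_nat.
have L2 : D%:R * 2 ^+ j / 2 <= L by lra.
have D0 : 0 < D%:R * 2 ^+ j :> R by rewrite mulr_gt0 //; lra.
have L0 : 0 < L by apply: lt_le_trans L2; rewrite divr_gt0.
have L1' : 1 <= L.
  apply: le_trans L2; rewrite ler_pdivlMr ?ltr0n // mul1r.
  by apply: le_trans (_ : 2 * 1 <= _); [rewrite mulr1|apply: ler_pM => //; apply: exprn_ege1; rewrite ler1n].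
have x0 : 0 < x by apply: lt_le_trans xe.
have e1 : 8 / L <= 16 / D%:R / 2 ^+ j.
  rewrite ler_pdivrMr // -mulrA -invfM mulrAC ler_pdivlMr //; lra.
have e2 : 6 / (Ks K j)%:R = 6 / K%:R / 2 ^+ j :> R by rewrite /Ks natrM natrX invfM mulrA.
have e3 : (8 * ((size (prange (Gs D j ^ 6)%:R (Gs D j ^ 9)%:R))%:R / L) ^+ 2 + 6) / x <= 14 / D%:R / 2 ^+ j.
  set b : R := (Gs D j ^ 9)%:R in xe *.
  have bb : D%:R * 2 ^+ j <= b.
    apply: le_trans (_ : (Gs D j)%:R <= _).
      by rewrite -natrX -natrM ler_nat Gs_ge // ltnW.
    by rewrite /b ler_nat -{1}[Gs D j]expn1 leq_pexp2l // Gs_gt0.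
  have S : (size (prange (Gs D j ^ 6)%:R b))%:R / L <= exp b.
    by rewrite ler_pdivrMr //; apply: le_trans (size_prange _ _) _; rewrite ler_peMr.
  have S2 : ((size (prange (Gs D j ^ 6)%:R b))%:R / L) ^+ 2 <= exp (2 * b).
    by have -> : exp (2 * b) = exp b ^+ 2; [rewrite -expMn|rewrite ler_pXn2r ?nnegrE //; pos].
  have b0 : 0 <= b by exact: ler0n.
  have E1 : 1 <= exp (2 * b) by apply: le_trans (exp_ge1D _); lra.
  rewrite ler_pdivrMr //; apply: le_trans (_ : 14 * exp (2 * b) <= _); first by lra.
  rewrite -!mulrA ler_pM2l ?ltr0n // mulrA -invfM ler_pdivlMl //.
  apply: le_trans xe; have -> : 10 * b = 8 * b + 2 * b by ring.
  rewrite expD; apply: ler_wpM2r => //; apply: le_trans (exp_ge1D _); lra.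
by rewrite e2; exact: err_arith.
Qed.

Lemma als_le j : 0 <= als al j /\ als al j <= 2 * al.
Proof.
have : 0 <= 2^-1 ^+ j :> R by pos.
have : 2^-1 ^+ j <= 1 :> R by rewrite exprn_ile1 // ?invr_ge0 // invf_le1 ?ltr0n // ler1n.
set u := 2^-1 ^+ j => u1 u0; have a := al0; rewrite /als -/u; split; nra.
Qed.

Lemma lvl_size j : (size (lvs (Gs D j ^ 6) (Gs D j ^ 9) (Ks K j)))%:R <= K%:R * (Gs D j)%:R ^+ 10 :> R.
Proof.
apply: le_trans (_ : (Ks K j * Gs D j ^ 9)%:R <= _); first by rewrite ler_nat size_lvs.
rewrite -natrX -natrM ler_nat /Ks expnS -mulnA leq_mul2l leq_mul2r Gs_ge2 ?orbT //; exact: ltnW.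
Qed.

Lemma level_j j : exp (10 * (Gs D j.+1 ^ 9)%:R) <= x -> x * exp (3 + 2 * (Gs D j.+1 ^ 9)%:R) <= Z%:R ->
  theta * N.*2.+1%:R <= x ->
  theta * symsum N (fun k => if smallj f D K al j.+1 (theta * k) && ~~ smallj f D K al j (theta * k) then N2 (dser Z x (x * exp 1) f (theta * k)) else 0) <= cc / 2 ^+ j.+1.
Proof.
move=> xe xZ thN; have [L [Ld L1]] := lvl_L j.+1.
have x1 : 1 <= x by apply: le_trans xe; apply: le_trans (exp_ge1D _); have : 0 <= (Gs D j.+1 ^ 9)%:R :> R by []; lra.
have L1' : 1 <= L.
  apply: le_trans L1; rewrite ler_pdivlMr ?ltr0n // mul1r ler_nat.
  by apply: (@leq_trans (2 * 1)) => //; rewrite leq_mul // expn_gt0.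
have Gpow m n : (m <= n)%N -> (Gs D j.+1 ^ m <= Gs D j.+1 ^ n)%N by move=> mn; rewrite leq_pexp2l // Gs_gt0.
have eA : (Gs D j ^ 6 = Gs D j.+1 ^ 2)%N by rewrite Gs_S -expnM.
have eB : (Gs D j ^ 9 = Gs D j.+1 ^ 3)%N by rewrite Gs_S -expnM.
rewrite /smallj eA eB.
have G2' : (0 < Gs D j.+1 ^ 2)%N by rewrite expn_gt0 Gs_gt0.
have LS := @level_step f Z N theta f1 fM th0 thZ x (als al j.+1) (als al j) _ _ _ _ _ _ (Ks_gt0 j.+1) (Ks_gt0 j) (Gpow 6%N 9%N isT) G2' (Gpow 2%N 3%N isT) (Gpow 3%N 9%N isT) x1 xZ thN L Ld L1'.
apply: le_trans LS _.
rewrite /cc [X in _ <= X]mulrDl; apply: lerD; first exact: lvl_err.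
have [G3 G4 G5] := gG j.+1.
set G : R := (Gs D j.+1)%:R in G3 G4 G5 *.
set vs := lvs (Gs D j.+1 ^ 6) _ _; set rs := lvs (Gs D j.+1 ^ 2) _ _.
pose c : R := 864 * exp 3 * exp (- (al * G ^+ 5)).
have c0 : 0 <= c by rewrite /c; pos.
have [alp0 alp2] := als_le j.
have G0 : 0 < G by lra.
have pw : 2 ^+ j.+1 <= G by have := Gs_ge2 j.+1 (ltnW D2); rewrite -(ler_nat R) natrX.
have da := als_diff al0 pw.
have tb v r : v \in vs -> r \in rs -> exp (- (2 * als al j.+1 * (v%:R / (Ks K j.+1)%:R))) * tm (als al j) (Ks K j.+1) (Ks K j) v r <= c.
  move=> vS rS.
  have /andP[V1 V2] := lvs_rng (Ks_gt0 j.+1) (Gpow 6%N 9%N isT) vS.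
  have /andP[r1 r2] := lvs_rng (Ks_gt0 j) (Gpow 2%N 3%N isT) rS.
  rewrite natrX in V1; rewrite natrX in V2; rewrite natrX in r1; rewrite natrX in r2.
  have r0 : (0 < r)%N.
    rewrite lt0n; apply/negP => /eqP e; move: r1; rewrite e mul0r -/G.
    by have := exprn_gt0 2 G0; lra.
  by apply: (term_bound (Ks_gt0 _) (Ks_gt0 _) r0 G3 al0 G4 alp0 alp2 da) => //; exact: ltW.
apply: le_trans (_ : 2 * (1 * (size vs)%:R * ((size vs)%:R * ((size rs)%:R * c))) <= _).
  rewrite ler_pM2l ?ltr0n //; apply: ler_pM.
  - by pos.
  - apply: sumr_ge0 => v _; apply: mulr_ge0 => //; apply: sumr_ge0 => r _; rewrite /tm; pos.
  - apply: ler_wpM2r => //; rewrite exprVn invf_le1 ?exprn_gt0 //; last by lra.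
    exact: exprn_ege1.
  rewrite -!sumr_const_size; apply: ler_sum_seq => v vS _; rewrite mulr_sumr.
  by apply: ler_sum_seq => r rS _; exact: tb.
have sv : (size vs)%:R <= K%:R * G ^+ 10 := lvl_size j.+1.
have sr : (size rs)%:R <= K%:R * G ^+ 4.
  apply: le_trans (_ : (Ks K j * Gs D j.+1 ^ 3)%:R <= _); first by rewrite ler_nat size_lvs.
  rewrite /G -natrX -natrM ler_nat /Ks expnS -mulnA leq_mul2l leq_mul2r.
  by rewrite (leq_trans _ (Gs_ge2 j.+1 (ltnW D2))) ?leq_exp2l ?orbT.
apply: le_trans (_ : eps / G <= _); last first.
  by rewrite ler_pM2l // lef_pV2 ?posrE ?exprn_gt0 ?ltr0n ?Gs_gt0.
apply: le_trans G5.
apply: le_trans (_ : 2 * (1 * (K%:R * G ^+ 10) * (K%:R * G ^+ 10 * (K%:R * G ^+ 4 * c))) <= _).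
  rewrite ler_pM2l ?ltr0n // !mul1r; apply: ler_pM; [by []|by pos|exact: sv|].
  apply: ler_pM; [by []|by pos|exact: sv|]; exact: ler_wpM2r.
have -> : 2 * (1 * (K%:R * G ^+ 10) * (K%:R * G ^+ 10 * (K%:R * G ^+ 4 * c))) = 1728 * exp 3 * (K%:R ^+ 3 * G ^+ 24 * exp (- (al * G ^+ 5))) by rewrite /c; ring.
have -> : (40 * 1000) * K%:R ^+ 3 * G ^+ 24 * exp (- (al * G ^+ 5)) = (40 * 1000) * (K%:R ^+ 3 * G ^+ 24 * exp (- (al * G ^+ 5))) by ring.
apply: ler_wpM2r; first by move: (ltW G0) => ?; pos.
have := exp3_le; lra.
Qed.

Lemma level_0 : exp (10 * (Gs D 0 ^ 9)%:R) <= x -> x * exp (3 + 2 * (Gs D 0 ^ 9)%:R) <= Z%:R ->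
  theta * N.*2.+1%:R <= x * exp (- (Gs D 0 ^ 9)%:R) ->
  theta * symsum N (fun k => if smallj f D K al 0 (theta * k) then N2 (dser Z x (x * exp 1) f (theta * k)) else 0) <= cc.
Proof.
move=> xe xZ thN; have [L [Ld L1]] := lvl_L 0.
have b0 : 0 <= (Gs D 0 ^ 9)%:R :> R by [].
have x1 : 1 <= x by apply: le_trans xe; apply: le_trans (exp_ge1D _); lra.
have x0 : 0 < x by apply: lt_le_trans x1.
have L1' : 1 <= L.
  by apply: le_trans L1; rewrite ler_pdivlMr ?ltr0n // mul1r ler_nat expn0 muln1.
have Gpow m n : (m <= n)%N -> (Gs D 0 ^ m <= Gs D 0 ^ n)%N by move=> mn; rewrite leq_pexp2l // Gs_gt0.
have xZ' : x * exp 2 <= Z%:R by apply: le_trans xZ; rewrite ler_pM2l // ler_exp; lra.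
rewrite /smallj.
have LS := @level_zero f Z N theta f1 fM th0 thZ x (als al 0) _ _ _ (Ks_gt0 0) (Gpow 6%N 9%N isT) x1 xZ' thN L Ld L1'.
apply: le_trans LS _.
have := lvl_err xe L1; rewrite expr0 divr1 => le1.
rewrite /cc; apply: lerD; first exact: le1.
have [G3 G4 G5] := gG 0.
set G : R := (Gs D 0)%:R in G3 G4 G5 *.
set vs := lvs (Gs D 0 ^ 6) _ _.
have G0 : 0 < G by lra_of G3.
have sv : (size vs)%:R <= K%:R * G ^+ 10 := lvl_size 0.
have tb v : v \in vs -> exp (- (2 * als al 0 * (v%:R / (Ks K 0)%:R))) * (864 * (2 * exp 2)) <= 1728 * exp 3 * exp (- (al * G ^+ 5)).
  move=> vS; have /andP[V1 V2] := lvs_rng (Ks_gt0 0) (Gpow 6%N 9%N isT) vS.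
  rewrite natrX -/G in V1.
  have e1 : exp (- (2 * als al 0 * (v%:R / (Ks K 0)%:R))) <= exp (- (al * G ^+ 5)).
    rewrite ler_exp lerN2 /als expr0.
    have G56 : G ^+ 5 <= G ^+ 6 by rewrite ler_weXn2l //; lra_of G3.
    have V0 : G ^+ 5 <= v%:R / (Ks K 0)%:R by lra_of V1 G56.
    have p5 : 0 < G ^+ 5 by rewrite exprn_gt0.
    apply: ler_pM; [exact: ltW|exact: ltW| |exact: V0].
    by lra_of al0.
  apply: le_trans (ler_wpM2r _ e1) _; first by pos.
  have e2 : exp 2 <= exp 3 by rewrite ler_exp; hlra.
  have := exp_ge0 (- (al * G ^+ 5)); set w := exp (- _); set p := exp 2 in e2 *; set q := exp 3 in e2 * => w0.
  have : w * p <= w * q by exact: ler_wpM2l.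
  hlra.
apply: le_trans (_ : 2 * (1 * (size vs)%:R * ((size vs)%:R * (1728 * exp 3 * exp (- (al * G ^+ 5))))) <= _).
  rewrite ler_pM2l ?ltr0n //; apply: ler_pM.
  - by pos.
  - by apply: sumr_ge0 => v _; pos.
  - apply: ler_wpM2r => //; rewrite exprVn invf_le1 ?exprn_gt0 //; last by lra_of L1'.
    exact: exprn_ege1.
  by rewrite -!sumr_const_size; apply: ler_sum_seq => v vS _; exact: tb.
apply: le_trans (_ : eps / G <= _); last first.
  by rewrite ler_pdivrMr // ler_peMr ?(ltW eps0) //; lra_of G3.
apply: le_trans G5.
set c : R := 1728 * exp 3 * exp (- (al * G ^+ 5)).
have c0 : 0 <= c by rewrite /c; pos.
have K1 : 1 <= K%:R :> R by rewrite ler1n.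
have G1 : 1 <= G by lra_of G3.
apply: le_trans (_ : 2 * (1 * (K%:R * G ^+ 10) * (K%:R * G ^+ 10 * c)) <= _).
  rewrite ler_pM2l ?ltr0n // !mul1r; apply: ler_pM; [by []|by pos|exact: sv|]; exact: ler_wpM2r.
apply: le_trans (_ : 2 * (1 * (K%:R * G ^+ 10) * (K%:R * G ^+ 10 * c)) * (K%:R * G ^+ 4 / 2) <= _).
  rewrite ler_peMr //; first by move: (ltW G0) => ?; pos.
  rewrite ler_pdivlMr ?ltr0n // mul1r; apply: le_trans (_ : 1 * G <= _); first by lra_of G3.
  by apply: ler_pM => //; rewrite -{1}[G]expr1 ler_weXn2l.
have -> : 2 * (1 * (K%:R * G ^+ 10) * (K%:R * G ^+ 10 * c)) * (K%:R * G ^+ 4 / 2) = 1728 * exp 3 * (K%:R ^+ 3 * G ^+ 24 * exp (- (al * G ^+ 5))) by rewrite /c; field.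
have -> : (40 * 1000) * K%:R ^+ 3 * G ^+ 24 * exp (- (al * G ^+ 5)) = (40 * 1000) * (K%:R ^+ 3 * G ^+ 24 * exp (- (al * G ^+ 5))) by ring.
apply: ler_wpM2r; first by move: (ltW G0) => ?; pos.
have := exp3_le; hlra.
Qed.

Lemma Gs_mono j j' : (j <= j')%N -> (Gs D j <= Gs D j')%N.
Proof. by move=> jj; rewrite leq_exp2l // leq_mul2l leq_exp2l // jj orbT. Qed.

(** A frequency small at level [J + 1] is either small at level [J] already or turns small there,
    and the latter costs [cc / 2^(J+1)]. *)
Lemma level_sum J : exp (10 * (Gs D J ^ 9)%:R) <= x -> x * exp (3 + 2 * (Gs D J ^ 9)%:R) <= Z%:R ->
  theta * N.*2.+1%:R <= x * exp (- (Gs D 0 ^ 9)%:R) ->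
  theta * symsum N (fun k => if smallj f D K al J (theta * k) then N2 (dser Z x (x * exp 1) f (theta * k)) else 0) <= cc * (2 - 2^-1 ^+ J).
Proof.
elim: J => [|J IH] xe xZ thN; first by rewrite expr0 -[2 - 1]/(1 + 1 - 1 : R) addrK mulr1; exact: level_0.
have GJ : (Gs D J ^ 9)%:R <= (Gs D J.+1 ^ 9)%:R :> R by rewrite ler_nat leq_exp2r // Gs_mono.
have x0 : 0 < x by apply: lt_le_trans xe.
have thN' : theta * N.*2.+1%:R <= x.
  by apply: le_trans thN _; rewrite ger_pMr // -[X in _ <= X]exp_zero ler_exp oppr_le0 ler0n.
have xe' : exp (10 * (Gs D J ^ 9)%:R) <= x by apply: le_trans xe; rewrite ler_exp; lra.
have xZ' : x * exp (3 + 2 * (Gs D J ^ 9)%:R) <= Z%:R by apply: le_trans xZ; rewrite ler_pM2l // ler_exp; lra.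
have h1 := IH xe' xZ' thN; have h2 := level_j xe xZ thN'.
apply: le_trans (_ : theta * symsum N (fun k => (if smallj f D K al J (theta * k) then N2 (dser Z x (x * exp 1) f (theta * k)) else 0) + (if smallj f D K al J.+1 (theta * k) && ~~ smallj f D K al J (theta * k) then N2 (dser Z x (x * exp 1) f (theta * k)) else 0)) <= _).
  apply: ler_wpM2l; first exact: ltW.
  apply: symsum_le_all => k; case: (smallj f D K al J.+1 _); case: (smallj f D K al J _); rewrite /= ?addr0 ?add0r //.
rewrite symsumD mulrDr; apply: le_trans (lerD h1 h2) _.
rewrite -exprVn !exprS; set u := 2^-1 ^+ J; lra.
Qed.

End LevelSum.

Lemma exp1_ge2 : 2 <= exp 1. Proof. by have := exp_ge1D 1; lra. Qed.

Lemma N21_le : N2 1 <= 1. Proof. by rewrite N21. Qed.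

Lemma ln2_le1 : ln 2 <= 1.
Proof. have h : (0 : R) < 2 by lra. by have := ln_le_subr1 h; lra. Qed.

Lemma per_arith (al alJ Lam rho G : R) (l : nat) : 0 < al -> 0 <= alJ -> alJ <= 2 * al -> 0 < Lam -> (0 < l)%N ->
  0 < rho -> l%:R * rho <= Lam + rho -> rho <= Lam -> l%:R <= Lam -> l%:R <= 2 * Lam / G ^+ 6 ->
  ln Lam <= 4 + 27 * ln G -> 0 <= ln Lam -> 0 <= ln G -> 3 <= G -> 4 * (18 * ln G + 5) <= al * G ->
  exp (2 * alJ * (l%:R * rho)) * (864 * ((l.*2)`!%:R * 4 ^+ l) * ((1 + ln (2 / 1) + l%:R) * exp 2)) <= 864 * exp 3 * exp (9 * al * Lam).
Proof.
move=> a0 alp0 alp2 Lam0 l0 rho0 l2 rL lL lY lnL lnL0 lnG0 G3 G4.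
have F := fact_exp l0 lL.
have lR : 0 <= l%:R :> R by [].
have ln2 : ln (2 / 1) <= 1 by rewrite divr1; exact: ln2_le1.
have ln20 : 0 <= ln (2 / 1) by apply: ln_ge0; rewrite divr1; lra.
have p6 : 0 < G ^+ 6 by rewrite exprn_gt0 //; lra.
have e1 : exp (2 * alJ * (l%:R * rho)) <= exp (8 * al * Lam).
  rewrite ler_exp; have -> : 8 * al * Lam = 2 * (2 * al) * (2 * Lam) by ring.
  by apply: ler_pM; [apply: mulr_ge0|apply: mulr_ge0 => //; exact: ltW|lra|lra].
have e2 : l%:R * (2 * ln Lam + 5) <= al * Lam.
  apply: le_trans (_ : 2 * Lam / G ^+ 6 * (54 * ln G + 13) <= _).
    by apply: ler_pM => //; lra.
  have -> : 2 * Lam / G ^+ 6 * (54 * ln G + 13) = Lam * (2 * (54 * ln G + 13)) / G ^+ 6 by ring.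
  rewrite ler_pdivrMr // mulrAC [X in _ <= X]mulrC; apply: ler_wpM2l; first exact: ltW.
  have h3 : 3 * (al * G) <= al * G ^+ 2.
    by rewrite mulrCA ler_pM2l // expr2; apply: ler_wpM2r; lra.
  have h4 : al * G ^+ 2 <= al * G ^+ 6 by rewrite ler_pM2l // ler_weXn2l //; lra.
  lra.
apply: le_trans (_ : exp (8 * al * Lam) * (864 * exp 2 * exp (al * Lam + 1)) <= _); last first.
  have -> : exp (8 * al * Lam) * (864 * exp 2 * exp (al * Lam + 1)) = 864 * exp (8 * al * Lam + 2 + (al * Lam + 1)) by rewrite (expD (_ + 2)) (expD (8 * _ * _)); ring.
  have -> : 864 * exp 3 * exp (9 * al * Lam) = 864 * exp (3 + 9 * al * Lam) by rewrite (expD 3) mulrA.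
  rewrite ler_pM2l ?ltr0n // ler_exp; lra.
apply: ler_pM => //.
  by apply: mulr_ge0; [pos|apply: mulr_ge0 => //; lra].
apply: le_trans (_ : 864 * exp 2 * ((l.*2)`!%:R * 4 ^+ l * (2 + l%:R)) <= _).
  have -> : 864 * exp 2 * ((l.*2)`!%:R * 4 ^+ l * (2 + l%:R)) = 864 * ((l.*2)`!%:R * 4 ^+ l) * ((2 + l%:R) * exp 2) by ring.
  by apply: ler_wpM2l; [pos|apply: ler_wpM2r => //; lra].
apply: ler_wpM2l; first by pos.
by apply: le_trans F _; rewrite ler_exp lerD2r.
Qed.

Lemma count_arith (al eps Lam G : R) (K : nat) (S : R) : 0 < al -> eps <= 1 -> 3 <= G -> 1 <= K%:R :> R ->
  S <= K%:R * G ^+ 10 -> 0 <= S -> (40 * 1000) * K%:R ^+ 3 * G ^+ 24 * exp (- (al * G ^+ 5)) <= eps / G -> G ^+ 9 <= Lam ->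
  S * (864 * exp 3 * exp (9 * al * Lam)) <= exp (10 * al * Lam).
Proof.
move=> a0 eps1 G3 K1 sv S0 G5 L1; have G0 : 0 < G by lra.
have G1 : 1 <= G by lra.
have -> : 10 * al * Lam = al * Lam + 9 * al * Lam by ring.
rewrite (expD (al * Lam)) [X in X <= _]mulrA; apply: ler_wpM2r => //.
apply: le_trans (_ : exp (al * G ^+ 5) <= _); last first.
  by rewrite ler_exp ler_pM2l //; apply: le_trans L1; exact: ler_weXn2l.
have G5' : (40 * 1000) * K%:R ^+ 3 * G ^+ 24 <= exp (al * G ^+ 5).
  have : (40 * 1000) * K%:R ^+ 3 * G ^+ 24 * exp (- (al * G ^+ 5)) <= 1.
    by apply: le_trans G5 _; rewrite ler_pdivrMr // mul1r; lra.
  by rewrite expN ler_pdivrMr // mul1r.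
apply: le_trans G5'; apply: le_trans (_ : K%:R * G ^+ 10 * (864 * exp 3) <= _).
  by apply: ler_wpM2r => //; pos.
have e3 := exp3_le.
apply: le_trans (_ : K%:R * G ^+ 10 * (40 * 1000) <= _).
  by apply: ler_wpM2l; [move: (ltW G0) => ?; pos|lra].
have -> : 40 * 1000 * K%:R ^+ 3 * G ^+ 24 = K%:R * G ^+ 10 * (40 * 1000) * (K%:R ^+ 2 * G ^+ 14) by ring.
rewrite ler_peMr //; first by move: (ltW G0) => ?; pos.
apply: le_trans (_ : 1 * 1 <= _); first by rewrite mulr1.
by apply: ler_pM => //; exact: exprn_ege1.
Qed.

(** * Counting the frequencies that are not small *)

Section CountU.
Variables (f : nat -> CC) (Z N D K : nat) (theta al eps : R).
Hypothesis f1 : forall n, N2 (f n) <= 1.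
Hypothesis th0 : 0 < theta.
Hypothesis thZ : theta * lnn Z <= PI.
Hypothesis al0 : 0 < al.
Hypothesis D2 : (1 < D)%N.
Hypothesis K0 : (0 < K)%N.
Hypothesis gG : forall j, goodG al eps K (Gs D j)%:R.

(** At such a frequency some polynomial of level [J] is large. Its power of length just above
    [e^Lam] is inserted and the moment bound counts the frequencies. The exponent is proportional to
    [al], which makes the set as sparse as desired. *)
Lemma count_U J (Lam : R) : eps <= 1 -> (Gs D J ^ 9)%:R <= Lam -> Lam <= 20 * (Gs D J)%:R ^+ 27 ->
  exp (4 * Lam + 1) <= Z%:R -> theta * N.*2.+1%:R <= exp Lam ->
  theta * symsum N (fun k => if smallj f D K al J (theta * k) then 0 else 1) <= exp (10 * al * Lam).
Proof.
move=> eps1 L1 L2 LZ thN; have [G3 G4 G5] := gG J.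
have a0 := al0.
rewrite natrX in L1; set G : R := (Gs D J)%:R in G3 G4 G5 L1 L2 *.
have G0 : 0 < G by lra.
have G1 : 1 <= G by lra.
have G69 : G ^+ 6 <= G ^+ 9 by rewrite ler_weXn2l.
have p6 : 0 < G ^+ 6 by rewrite exprn_gt0.
have G16 : G <= G ^+ 6 by rewrite -{1}[G]expr1 ler_weXn2l.
have Lam0 : 0 < Lam by lra.
have lnG0 : 0 <= ln G by exact: ln_ge0.
have lnL : ln Lam <= 4 + 27 * ln G.
  by apply: le_trans (ln_20G G1); exact: ler_ln.
have lnL0 : 0 <= ln Lam by apply: ln_ge0; lra.
set vs := lvs (Gs D J ^ 6) (Gs D J ^ 9) (Ks K J).
pose P r t := dpol f (cell (prange (Gs D J ^ 6)%:R (Gs D J ^ 9)%:R) (Ks K J) r) t.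
pose Tr r t := ~~ (N2 (P r t) <= exp (- (2 * als al J * (r%:R / (Ks K J)%:R)))).
have Z2 : (1 < Z)%N.
  rewrite -(ltr_nat R); apply: lt_le_trans LZ; apply: lt_le_trans (exp_ge1D _); lra_of Lam0.
(* The cofactor in the moment bound is made trivial: [[1, 2)] contains only [n = 1]. *)
have d1 t : dser Z 1 2 (fun=> 1) t = 1.
  rewrite /dser big_ltn_cond // lexx ltr_nat /= lnn1 mulr0 oppr0 eix0 invr1 mulr1 mul1r.
  rewrite big_nat_cond big1 ?addr0 // => n /andP[/andP[n2 _] /andP[_]].
  by rewrite ltr_nat ltnNge n2.
have a1 : (1 : R) <= 2 by hlra.
have [alp0 alp2] := als_le al0 J.
have GG : (Gs D J ^ 6 <= Gs D J ^ 9)%N by rewrite leq_pexp2l // Gs_gt0.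
have per r : r \in vs -> theta * symsum N (fun k => if Tr r (theta * k) then N2 (dser Z 1 2 (fun=> 1) (theta * k)) else 0) <= 864 * exp 3 * exp (9 * al * Lam).
  move=> rS; have /andP[r1 r2] := lvs_rng (Ks_gt0 K0 J) GG rS.
  rewrite natrX -/G in r1; rewrite natrX -/G in r2.
  set rho : R := r%:R / (Ks K J)%:R in r1 r2 *.
  have rho0 : 0 < rho by lra_of r1 p6.
  pose l := (Num.truncn (Lam / rho)).+1.
  have Lr0 : 0 <= Lam / rho by apply: divr_ge0; exact: ltW.
  have /andP[t1 t2] := truncn_itv Lr0.
  have l1 : Lam <= l%:R * rho by rewrite -ler_pdivrMr //; exact: ltW.
  have lS : l%:R = (Num.truncn (Lam / rho))%:R + 1 :> R by rewrite /l -[_.+1%:R]natr1.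
  have l2 : l%:R * rho <= Lam + rho.
    by rewrite lS mulrDl mul1r lerD2r -ler_pdivlMr.
  have lY : l%:R <= 2 * Lam / G ^+ 6.
    rewrite ler_pdivlMr //.
    have : 0 <= (l%:R - 1) * (rho - G ^+ 6) by apply: mulr_ge0; rewrite ?subr_ge0 ?ler1n.
    have q6 : G ^+ 6 <= Lam by exact: le_trans G69 L1.
    by move=> q; lra_of q q6 l2.
  have lL : l%:R <= Lam.
    apply: le_trans lY _; rewrite ler_pdivrMr // mulrC; apply: ler_wpM2l; first exact: ltW.
    lra_of G3 G16.
  have hT t : Tr r t -> exp (- (2 * als al J * rho)) <= N2 (P r t) by rewrite /Tr -ltNge => /ltW.
  apply: le_trans (_ : theta * (exp (2 * als al J * (l%:R * rho)) * symsum N (fun k => N2 (P r (theta * k) ^+ l * dser Z 1 2 (fun=> 1) (theta * k)))) <= _).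
    apply: ler_wpM2l; first exact: ltW.
    rewrite -symsumZ; apply: symsum_le_all => k; exact: (@insert_poly f Z _ _ _ _ _ _ _ _ _ _ hT).
  have c1 : 2 * exp (l%:R * ((r%:R + 1) / (Ks K J)%:R)) <= Z%:R.
    have kR : 0 < (Ks K J)%:R :> R by rewrite ltr0n Ks_gt0.
    have ki : (Ks K J)%:R^-1 <= 1 :> R by rewrite -[X in _ <= X]invr1 lef_pV2 ?posrE // ler1n Ks_gt0.
    apply: le_trans LZ; apply: le_trans (_ : exp 1 * exp (4 * Lam) <= _); last by rewrite -expD [1 + _]addrC.
    apply: ler_pM => //; first exact: exp1_ge2.
    rewrite ler_exp mulrDl mul1r mulrDr -/rho.
    have : l%:R * (Ks K J)%:R^-1 <= l%:R :> R by rewrite ler_piMr.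
    by move=> q; lra_of q l2 lL r2 L1 Lam0.
  have c2 : theta * N.*2.+1%:R <= 1 * exp (l%:R * rho) by rewrite mul1r; apply: le_trans thN _; rewrite ler_exp.
  have MC := @moment_cell f Z N theta f1 th0 thZ (fun=> 1) (Gs D J ^ 6)%:R (Gs D J ^ 9)%:R (Ks K J) r l 1 2 (Ks_gt0 K0 J) (fun=> N21_le) ltr01 a1 c1 c2.
  rewrite mulrCA; apply: le_trans (ler_wpM2l (exp_ge0 _) MC) _.
  have rL : rho <= Lam by exact: le_trans (ltW r2) L1.
  exact: (@per_arith al (als al J) Lam rho G l).
apply: le_trans (_ : theta * symsum N (fun k => \sum_(r <- vs) (if Tr r (theta * k) then N2 (dser Z 1 2 (fun=> 1) (theta * k)) else 0)) <= _).
  apply: ler_wpM2l; first exact: ltW.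
  apply: symsum_le_all => k; case: ifP => [_|/negbT].
    by apply: sumr_ge0 => r _; case: ifP.
  rewrite -has_predC => /hasP[r rS /= nr].
  rewrite (bigD1_seq r) ?iota_uniq //= /Tr nr d1 N21 lerDl; apply: sumr_ge0 => r' _; case: ifP => // _.
rewrite symsum_sum mulr_sumr; apply: le_trans (_ : \sum_(r <- vs) 864 * exp 3 * exp (9 * al * Lam) <= _).
  by apply: ler_sum_seq => r rS _; exact: per.
rewrite sumr_const_size.
have sv : (size vs)%:R <= K%:R * G ^+ 10 := lvl_size K D2 J.
have K1 : 1 <= K%:R :> R by rewrite ler1n.
exact: (@count_arith al eps Lam G K).
Qed.
End CountU.

(** * Non-pretentiousness on sparse sets of frequencies *)

(** For [|u| = 1] one has [|u - 1|^2 = 2 (1 - Re u)]. The value 0 occurs at primes dividing the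
    modulus of a character. *)
Lemma N2_sub1_ge (z e : CC) : N2 z = 1 \/ z = 0 -> N2 e = 1 -> 1 - cre (z * e) <= N2 (z * e - 1).
Proof.
move=> [z1|->] e1; last by rewrite mul0r sub0r N2N N21 /= ; lra.
have : N2 (z * e) = 1 by rewrite N2M z1 e1 mulr1.
have := N2_ge0 (z * e - 1).
move: (z * e) => u; case: u => a b; rewrite /N2 /= => h1 h2.
have a1 : a <= 1 by nra.
nra.
Qed.

Lemma natpow_le (h a b : nat) : (0 < h)%N -> (a <= b)%N -> (h ^ a <= h ^ b)%N.
Proof. by move=> h0 ab; rewrite leq_pexp2l. Qed.

Lemma sum_nat_supp (F : nat -> CC) a b a' b' : (a' <= a)%N -> (b <= b')%N ->
  (forall n, (a' <= n < b')%N -> ~~ (a <= n < b)%N -> F n = 0) -> \sum_(a <= n < b) F n = \sum_(a' <= n < b') F n.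
Proof.
move=> aa bb hz; rewrite (big_nat_widen _ _ _ _ _ bb) (big_nat_widenl _ _ _ _ _ aa) big_mkcond /=.
apply: eq_big_nat => n nn; case: ifP => // /negbT hn; rewrite hz //.
by rewrite andbC.
Qed.

Lemma h2_arith (x y l t : R) : x <= 1764 * t * (1 + 50 * l) -> y <= 1731 * t * (12 * l) -> 1 <= l -> 1 <= t ->
  2 * x + 2 * y <= 300 * 1000 * l * t.
Proof.
move=> h1 h2 l1 t1; have : t <= l * t by rewrite ler_peMl //; lra.
have : 0 < l * t by rewrite mulr_gt0; lra.
lra.
Qed.

Lemma mult_id (x e : CC) (p n : R) (d : bool) :
  x * ((p * d%:R - 1) * n)%:C * e = (if d then x * (p * n)%:C * e else 0) - x * n%:C * e.
Proof.
case: d.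
  have -> : (p * true%:R - 1) * n = p * n + - n by rewrite mulr1; ring.
  rewrite rcD rcN; ring.
have -> : (p * false%:R - 1) * n = - n by rewrite mulr0; ring.
rewrite rcN; ring.
Qed.

Lemma ln_pow (x : R) n : 0 < x -> ln (x ^+ n) = n%:R * ln x.
Proof. by move=> x0; rewrite -{1}(lnK x0) -expMn expK. Qed.

(** * Distance to characters and the long polynomial at sparse frequencies *)

Section HTwo.
Variables (f : nat -> CC) (h : nat) (theta tb : R) (ks : seq nat).
Hypothesis f1 : forall n, N2 (f n) <= 1.
Hypothesis fM : forall m n, (0 < m)%N -> (0 < n)%N -> f (m * n)%N = f m * f n.
Hypothesis fp : forall p, prime p -> N2 (f p) = 1 \/ f p = 0.
Hypothesis h10 : (10 <= h)%N.
Hypothesis hJ : (h ^ 51 <= 2 ^ h)%N.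
Hypothesis th0 : 0 < theta.
Hypothesis th1 : theta <= 1.
Hypothesis thZ : theta * lnn (h ^ 150) <= PI.
Hypothesis uk : uniq ks.
Let tt (k : nat) : R := tb + theta * k%:R.
Hypothesis tdiff : forall k l, k \in ks -> l \in ks -> `|tt k - tt l| <= h%:R ^+ 151.
Hypothesis sks : (size ks)%:R <= h%:R ^+ 2 :> R.

Let hR : 10 <= h%:R :> R. Proof. by rewrite ler_nat. Qed.
Let h0 : (0 < h)%N. Proof. exact: leq_trans h10. Qed.
Let eta : R := 110 / h%:R ^+ 4.
(** One power of [h] below the start of [FF], so that the range contains all [n/p] with [p <= h]. *)
Let N0 := (h ^ 99)%N.
Let NE := (h ^ 150)%N.
Let w := (Num.truncn (h%:R ^+ 5 / theta)).+1.

(** By [hJ] there are at most [h] dyadic blocks between [h^99] and [h^150], and the parameter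
    [g = h^5] saves more than their number. *)
Lemma h2_far (d : nat) (tau : R) : (0 < d <= h ^ 2)%N -> h%:R ^+ 5 <= `|tau| -> `|tau| <= h%:R ^+ 151 ->
  cabs (Td N0 NE d tau) <= eta / 2.
Proof.
move=> /andP[d0 d2] t1 t2; have hr := hR; have hp : 0 < h%:R :> R by lra.
have h5 : 0 < h%:R ^+ 5 :> R by rewrite exprn_gt0.
have t0 : 0 < `|tau| by exact: lt_le_trans t1.
apply: le_trans (@Td_far N0 NE d (h ^ 5) h tau d0 _ _ _ _ _ t0 _) _.
- by rewrite expn_gt0 h0.
- exact: natpow_le.
- by apply: leq_trans d2 _; exact: natpow_le.
- apply: leq_trans (_ : (h ^ 5) ^ 4 * h ^ 2 <= _)%N; first by rewrite leq_mul2l d2 orbT.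
  by rewrite -expnM -expnD; exact: natpow_le.
- by rewrite /NE /N0 -[150%N]/(51 + 99)%N expnD leq_mul2r hJ orbT.
- rewrite /N0 -expnM natrX natrX -exprM.
  apply: le_trans (_ : h%:R ^+ 151 * h%:R ^+ (5 * 4) * (h%:R ^+ 2) ^+ 2 <= _).
    apply: ler_pM; [by pos|by pos| |].
      by apply: ler_wpM2r => //; pos.
    by rewrite ler_pXn2r ?nnegrE ?exprn_ge0 //; rewrite -natrX ler_nat.
  rewrite -exprM -!exprD; apply: le_trans (_ : h%:R ^+ (99 * 2) <= _).
    by rewrite ler_weXn2l //; lra.
  by rewrite ler_peMl ?exprn_ge0 // ler1n.
have b1 : 24 / `|tau| <= 24 / h%:R ^+ 5 by rewrite ler_pM2l ?ltr0n // lef_pV2 ?posrE.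
have hS : h.+1%:R <= h%:R * 11 / 10 :> R.
  by rewrite -[h.+1%:R]natr1; lra.
apply: le_trans (_ : h%:R * 11 / 10 * (47 / h%:R ^+ 5) <= _).
  apply: ler_pM => //; first by pos.
  rewrite natrX; move: b1; set q := (h%:R ^+ 5)^-1; lra.
have -> : h%:R * 11 / 10 * (47 / h%:R ^+ 5) = 517 / 10 / h%:R ^+ 4 :> R by field; rewrite gt_eqF.
rewrite /eta; have : 0 < (h%:R ^+ 4)^-1 :> R by rewrite invr_gt0 exprn_gt0.
set q := _^-1; lra.
Qed.

Lemma h2_near (d : nat) (tau : R) : (0 < d <= h ^ 2)%N -> `|tau| <= h%:R ^+ 5 ->
  cabs (Td N0 NE d tau - Td N0 NE 1 tau) <= eta.
Proof.
move=> /andP[d0 d2] t1; have hr := hR; have hp : 0 < h%:R :> R by lra.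
have N00 : (0 < N0)%N by rewrite expn_gt0 h0.
apply: le_trans (Td_near tau d0 N00 _) _; first exact: natpow_le.
have dR : d%:R <= h%:R ^+ 2 :> R by rewrite -natrX ler_nat.
have h5 : 1 <= h%:R ^+ 5 :> R by apply: exprn_ege1; lra.
apply: le_trans (_ : h%:R ^+ 6 * h%:R ^+ 2 / N0%:R <= _).
  apply: ler_wpM2r; first by pos.
  apply: ler_pM => //; first by pos.
  by rewrite exprSr; nra.
rewrite /N0 natrX /eta.
have -> : h%:R ^+ 6 * h%:R ^+ 2 / h%:R ^+ 99 = 1 / h%:R ^+ 4 * (h%:R ^+ 87)^-1 :> R by field; rewrite gt_eqF.
have e1 : (h%:R ^+ 87)^-1 <= 1 :> R by rewrite invf_le1 ?exprn_gt0 // exprn_ege1 //; lra.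
apply: le_trans (_ : 1 / h%:R ^+ 4 * 1 <= _); first by apply: ler_wpM2l => //; pos.
by rewrite mulr1 ler_pM2r ?invr_gt0 ?exprn_gt0 // ler1n.
Qed.

Let eta0 : 0 <= eta. Proof. by rewrite /eta; pos. Qed.

Lemma h2_hfar k l : k \in ks -> l \in ks -> h%:R ^+ 5 <= `|tt k - tt l| -> cabs (Td N0 NE 1 (tt k - tt l)) <= eta.
Proof.
move=> kS lS t1; apply: le_trans (_ : eta / 2 <= _); last by have e0 := eta0; lra.
by apply: h2_far => //; [rewrite expn_gt0 h0|exact: tdiff].
Qed.

Lemma h2_hdiff k l d : k \in ks -> l \in ks -> (0 < d <= h ^ 2)%N -> cabs (Td N0 NE d (tt k - tt l) - Td N0 NE 1 (tt k - tt l)) <= eta.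
Proof.
move=> kS lS dd; have [t1|t1] := lerP `|tt k - tt l| (h%:R ^+ 5); first exact: h2_near.
have e1 := h2_far dd (ltW t1) (tdiff kS lS).
have d1 : (0 < 1 <= h ^ 2)%N by rewrite expn_gt0 h0.
have e2 := h2_far d1 (ltW t1) (tdiff kS lS).
by apply: le_trans (cabsD _ _) _; rewrite cabsN; lra.
Qed.

Let w0 : (0 < w)%N. Proof. by []. Qed.
Let N00 : (0 < N0)%N. Proof. by rewrite expn_gt0 h0. Qed.
Let tw : h%:R ^+ 5 <= theta * w%:R.
Proof.
rewrite mulrC -ler_pdivrMr //; apply: ltW.
have hp : 0 <= h%:R ^+ 5 / theta :> R by pos.
by have /andP[] := truncn_itv hp.
Qed.
Let thw : theta * w%:R <= N0%:R.
Proof.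
have hr := hR; have hp : 0 <= h%:R ^+ 5 / theta :> R by pos.
have /andP[t1 _] := truncn_itv hp.
have -> : w%:R = (Num.truncn (h%:R ^+ 5 / theta))%:R + 1 :> R by rewrite /w -[_.+1%:R]natr1.
apply: le_trans (_ : h%:R ^+ 5 + 1 <= _).
  rewrite mulrDr mulr1; apply: lerD; last exact: th1.
  by rewrite mulrC -ler_pdivlMr.
have h5 : 1 <= h%:R ^+ 5 :> R by apply: exprn_ege1; lra.
rewrite /N0 natrX; apply: le_trans (_ : h%:R ^+ 6 <= _); last by rewrite ler_weXn2l //; lra.
by rewrite exprS; nra.
Qed.

Let ps : seq nat := [seq p <- index_iota 1 h.+1 | prime p].
Let psP p : p \in ps -> prime p /\ (p <= h)%N.
Proof. by rewrite mem_filter mem_index_iota => /andP[-> /andP[_ ?]]. Qed.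
Let ups : uniq ps. Proof. by rewrite filter_uniq // iota_uniq. Qed.
Let psp p : p \in ps -> prime p. Proof. by move=> /psP[]. Qed.
Let psz p q : p \in ps -> q \in ps -> (p * q <= h ^ 2)%N.
Proof. by move=> /psP[_ a] /psP[_ b]; rewrite expnS expn1 leq_mul. Qed.
Let sps : (size ps)%:R <= h%:R :> R.
Proof. by rewrite ler_nat size_filter; apply: leq_trans (count_size _ _) _; rewrite size_iota subn1. Qed.

Let A0 := @H0 N0 NE w theta tb (h%:R ^+ 5) eta ks N00 w0 th0 thZ thw tw uk eta0 h2_hfar.
Let A1 := @H1 N0 NE w (h ^ 2) theta tb (h%:R ^+ 5) eta ks N00 w0 th0 thZ thw tw uk eta0 h2_hfar h2_hdiff ps ups psp psz.
Hypothesis lnh1 : 1 <= lnn h.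

Definition FF (t : R) : CC := \sum_(h ^ 100 <= n < h ^ 150) f n * (n%:R^-1)%:C * eix (- (t * lnn n)).
Let b n := if (h ^ 100 <= n)%N then f n else 0.
Let c p n := if (h ^ 100 <= p * n < h ^ 150)%N then f n else 0.
Let G p t : CC := \sum_(N0 <= n < NE) c p n * (n%:R^-1)%:C * eix (- (t * lnn n)).

Lemma h2_FE t : FF t = \sum_(N0 <= n < NE) b n * (n%:R^-1)%:C * eix (- (t * lnn n)).
Proof.
transitivity (\sum_(h ^ 100 <= n < h ^ 150) b n * (n%:R^-1)%:C * eix (- (t * lnn n))).
  by apply: eq_big_nat => n /andP[n1 _]; rewrite /b n1.
apply: sum_nat_supp; [exact: natpow_le|by []|].
by move=> n /andP[_ n2]; rewrite n2 andbT /b => /negbTE->; rewrite !mul0r.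
Qed.

(** Complete multiplicativity turns the sum over multiples of [p] into [f(p) p^(-it)] times a sum
    over the range divided by [p]. *)
Lemma h2_id p t : p \in ps ->
  \sum_(N0 <= n < NE) b n * ((p%:R * (p %| n)%N%:R - 1) / n%:R)%:C * eix (- (t * lnn n)) = f p * eix (- (t * lnn p)) * G p t - FF t.
Proof.
move=> /psP[pp ph]; have p0 := prime_gt0 pp; have pR : p%:R != 0 :> R by rewrite pnatr_eq0 -lt0n.
rewrite h2_FE.
have -> : \sum_(N0 <= n < NE) b n * ((p%:R * (p %| n)%N%:R - 1) / n%:R)%:C * eix (- (t * lnn n)) =
  \sum_(N0 <= n < NE | (p %| n)%N) b n * (p%:R / n%:R)%:C * eix (- (t * lnn n)) - \sum_(N0 <= n < NE) b n * (n%:R^-1)%:C * eix (- (t * lnn n)).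
  rewrite [X in _ = X - _]big_mkcond -sumrB; apply: eq_bigr => n _.
  exact: mult_id.
congr (_ - _); rewrite sum_multiples //; last exact: natpow_le.
pose X m := if (h ^ 100 <= p * m < h ^ 150)%N then f p * eix (- (t * lnn p)) * (f m * (m%:R^-1)%:C * eix (- (t * lnn m))) else 0.
have cle n : (cdiv n p <= n)%N by case: n => [|n]; [rewrite /cdiv add0n divn_small // prednK|have /andP[] := cdiv_rng p0 (ltn0Sn n)].
transitivity (\sum_(cdiv N0 p <= m < cdiv NE p) X m).
  apply: eq_big_nat => m /andP[m1 m2].
  have m0 : (0 < m)%N.
    by apply: leq_trans m1; have /andP[] := cdiv_rng p0 N00.
  have pm : (p * m < h ^ 150)%N.
    have := cdiv_lt NE p0; rewrite /NE => h1.
    have : (p * m.+1 <= p * cdiv (h ^ 150) p)%N by rewrite leq_mul2l m2 orbT.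
    rewrite mulnS => h2; have h3 := leq_ltn_trans h2 h1; by rewrite addnC ltn_add2r in h3.
  rewrite /X /b pm andbT; case: ifP => _; last by rewrite !mul0r.
  have -> : p%:R / (p * m)%:R = m%:R^-1 :> R by rewrite natrM invfM mulrA divff // mul1r.
  rewrite fM // lnnM // mulrDr opprD eixD; ring.
rewrite (@sum_nat_supp X (cdiv N0 p) (cdiv NE p) 0 NE) //.
  rewrite /G mulr_sumr (@sum_nat_supp (fun m => f p * eix (- (t * lnn p)) * (c p m * (m%:R^-1)%:C * eix (- (t * lnn m)))) N0 NE 0 NE) //.
    by apply: eq_bigr => m _; rewrite /X /c; case: ifP => // _; rewrite !(mul0r, mulr0).
  move=> m /andP[_ m2]; rewrite m2 andbT -ltnNge /c => mN.
  have -> : (h ^ 100 <= p * m)%N = false.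
    apply/negbTE; rewrite -ltnNge -[100%N]/(1 + 99)%N expnD expn1.
    by apply: leq_ltn_trans (_ : h * m < _)%N; [rewrite leq_mul2r ph orbT|rewrite ltn_mul2l h0].
  by rewrite /= !(mul0r, mulr0).
move=> m _; rewrite /X negb_and -leqNgt -ltnNge => /orP[m1|m1].
  have -> : (h ^ 100 <= p * m)%N = false; last by [].
  apply/negbTE; rewrite -ltnNge; have := cdiv_lt N0 p0.
  have : (p * m.+1 <= p * cdiv N0 p)%N by rewrite leq_mul2l m1 orbT.
  have : (N0 <= h ^ 100)%N by exact: natpow_le.
  rewrite mulnS; set q := (p * cdiv _ _)%N; set q' := (h ^ 100)%N; lia.
have -> : (p * m < h ^ 150)%N = false; last by rewrite andbF.
apply/negbTE; rewrite -leqNgt; apply: leq_trans (cdiv_ge _ p0) _; by rewrite leq_mul2l m1 orbT.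
Qed.

(** The ranges of [FF] and [G p] differ only near the two ends, by intervals of ratio [p] with
    harmonic mass at most [1 + log p] each. *)
Lemma h2_edge p : p \in ps -> \sum_(k <- ks) N2 (FF (tt k) - G p (tt k)) <= CH theta eta ks * (2 * (1 + lnn p)).
Proof.
move=> pS; have /psP[pp ph] := pS; have p0 := prime_gt0 pp; have pR : 0 < p%:R :> R by rewrite ltr0n.
have hr := hR; have hp : 0 < h%:R :> R by lra.
have -> : \sum_(k <- ks) N2 (FF (tt k) - G p (tt k)) = \sum_(k <- ks) N2 (\sum_(N0 <= n < NE) (b n - c p n) * (n%:R^-1)%:C * eix (- (tt k * lnn n))).
  apply: eq_bigr => k _; rewrite h2_FE -sumrB; congr N2; apply: eq_bigr => n _; ring.
apply: le_trans (A0 (fun n => b n - c p n)) _.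
apply: ler_wpM2l; first exact: CH_ge0.
pose lo m : R := h%:R ^+ m / p%:R; pose hi m : R := h%:R ^+ m.
have hm m : \sum_(1 <= n < NE | lo m <= n%:R < hi m) n%:R^-1 <= 1 + lnn p :> R.
  have e : h%:R ^+ m / (h%:R ^+ m / p%:R) = p%:R :> R by field; rewrite !gt_eqF ?exprn_gt0.
  have q0 : 0 < h%:R ^+ m :> R by rewrite exprn_gt0.
  have := @harm_up1 (h%:R ^+ m / p%:R) (h%:R ^+ m) NE; rewrite e; apply; first by pos.
  by rewrite ler_pdivrMr // ler_peMr ?(ltW q0) // ler1n.
have -> : 2 * (1 + lnn p) = (1 + lnn p) + (1 + lnn p) by ring.
apply: le_trans (lerD (hm 100%N) (hm 150%N)).
rewrite [X in _ <= X + _]big_mkcond [X in _ <= _ + X]big_mkcond -big_split /=.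
have N01 : (1 <= N0)%N by [].
have N0E : (N0 <= NE)%N by exact: natpow_le.
rewrite [X in _ <= X](big_cat_nat (n := N0)) //= -[X in X <= _]add0r; apply: lerD.
  by apply: sumr_ge0 => n _; apply: addr_ge0; case: ifP => // _; pos.
apply: ler_sum_nat => n /andP[n1 n2].
have n0 : (0 < n)%N by exact: leq_trans n1.
have nR : 0 <= n%:R^-1 :> R by pos.
have e m : (lo m <= n%:R) = (h ^ m <= p * n)%N by rewrite /lo ler_pdivrMr // -natrX -natrM ler_nat mulnC.
have e' m : (n%:R < hi m) = (n < h ^ m)%N by rewrite /hi -natrX ltr_nat.
rewrite !e !e' /b /c n2 andbT.
have pn : (n <= p * n)%N by rewrite leq_pmull.
have nn : N2 (f n) / n%:R <= n%:R^-1 by rewrite -[X in _ <= X]mul1r; apply: ler_wpM2r.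
case: (leqP (h ^ 100) n) => a1; case: (leqP (h ^ 150) (p * n)) => a2; rewrite /= ?andbF ?andbT.
- by rewrite subr0 add0r.
- by rewrite (leq_trans a1 pn) subrr N20 mul0r; apply: addr_ge0.
- by rewrite subr0 N20 mul0r; apply: addr_ge0 => //; case: ifP.
- by case: ifP => _; rewrite sub0r ?N2N ?oppr0 ?N20 ?mul0r ?addr0.
Qed.

(** By Turan-Kubilius, [f(p) p^(-it) FF(t)] is close to [FF(t)] for most [p], in mean square over
    the frequencies. Hence [|f(p) p^(-it) - 1|^2 |FF|^2] summed with weight [1/p] is under control,
    and the sum of the first factor is at least [KD]. The edges contribute [sum (1 + log p)/p],
    again of order [log h]. *)
Lemma H2 (KD : R) :
  (forall k, k \in ks -> KD <= \sum_(p <- ps) p%:R^-1 * (1 - cre (f p * eix (- (tt k * lnn p))))) ->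
  KD * \sum_(k <- ks) N2 (FF (tt k)) <= 300 * 1000 * lnn h / theta.
Proof.
move=> hK; have hr := hR; have hp : 0 < h%:R :> R by lra.
have l1 := lnh1; have e0 := eta0.
have CHb : CH theta eta ks <= 1731 / theta.
  rewrite /CH; have : 2 * eta * (size ks)%:R <= 3.
    apply: le_trans (_ : 2 * eta * h%:R ^+ 2 <= _); first by apply: ler_wpM2l => //; pos.
    rewrite /eta; have -> : 2 * (110 / h%:R ^+ 4) * h%:R ^+ 2 = 220 / h%:R ^+ 2 :> R by field; rewrite gt_eqF.
    by rewrite ler_pdivrMr ?exprn_gt0 // expr2; nra.
  have t1 : 1 <= theta^-1 by rewrite invf_ge1.
  by move: t1; set q := theta^-1; lra.
have C1b : 3 * eta * (size ks * size ps)%:R <= 33.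
  apply: le_trans (_ : 3 * eta * (h%:R ^+ 2 * h%:R) <= _).
    apply: ler_wpM2l; first by pos.
    by rewrite natrM; apply: ler_pM.
  rewrite /eta; have -> : 3 * (110 / h%:R ^+ 4) * (h%:R ^+ 2 * h%:R) = 330 / h%:R :> R by field; rewrite gt_eqF.
  by rewrite ler_pdivrMr //; lra.
have t1 : 1 <= theta^-1 by rewrite invf_ge1.
have Sb : \sum_(N0 <= n < NE) N2 (b n) / n%:R <= 1 + 50 * lnn h.
  have q0 m : 0 < h%:R ^+ m :> R by rewrite exprn_gt0.
  have := @harm_up1 (h%:R ^+ 100) (h%:R ^+ 150) NE (q0 _).
  have -> : ln (h%:R ^+ 150 / h%:R ^+ 100) = 50 * lnn h.
    by rewrite ln_div // !ln_pow // /lnn; ring.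
  have -> : h%:R ^+ 100 <= h%:R ^+ 150 :> R by rewrite ler_weXn2l //; lra.
  move=> /(_ isT); apply: le_trans; rewrite [X in _ <= X]big_mkcond.
  have N0E : (N0 <= NE)%N by exact: natpow_le.
  rewrite [X in _ <= X](big_cat_nat (n := N0)) //= -[X in X <= _]add0r; apply: lerD.
    by apply: sumr_ge0 => n _; case: ifP => // _; pos.
  apply: ler_sum_nat => n /andP[n1 n2]; rewrite -!natrX ler_nat ltr_nat n2 andbT /b.
  case: ifP => _; last by rewrite N20 mul0r.
  by rewrite -[X in _ <= X]mul1r; apply: ler_wpM2r => //; rewrite invr_ge0.
have lp p : p \in ps -> 1 + lnn p <= 3 * lnn p.
  move=> /psP[/prime_gt1 p1 _]; have := ler_lnn (isT : (0 < 2)%N) p1.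
  have := @ln_ge 2 (ltr0n _ _); rewrite /lnn; lra.
have Eb : \sum_(p <- ps) p%:R^-1 * (1 + lnn p) <= 6 * lnn h.
  apply: le_trans (_ : \sum_(p <- ps) 3 * (lnn p / p%:R) <= _).
    by apply: ler_sum_seq => p pS _; rewrite mulrA mulrC; apply: ler_wpM2r; [pos|exact: lp].
  rewrite -mulr_sumr big_filter; have := sum_lnp_le h0; set q := \sum_(_ <= _ < _ | _) _; lra.
have B1 := A1 b.
apply: le_trans (_ : \sum_(k <- ks) \sum_(p <- ps) (2 * (p%:R^-1 * N2 (f p * eix (- (tt k * lnn p)) * G p (tt k) - FF (tt k))) + 2 * (p%:R^-1 * N2 (FF (tt k) - G p (tt k)))) <= _).
  rewrite mulr_sumr; apply: ler_sum_seq => k kS _.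
  apply: le_trans (ler_wpM2r (N2_ge0 _) (hK k kS)) _; rewrite mulr_suml.
  apply: ler_sum_seq => p pS _; have /psP[pp _] := pS.
  have pi : 0 <= p%:R^-1 :> R by pos.
  have -> : 2 * (p%:R^-1 * N2 (f p * eix (- (tt k * lnn p)) * G p (tt k) - FF (tt k))) + 2 * (p%:R^-1 * N2 (FF (tt k) - G p (tt k))) =
    p%:R^-1 * (2 * N2 (f p * eix (- (tt k * lnn p)) * G p (tt k) - FF (tt k)) + 2 * N2 (FF (tt k) - G p (tt k))) by ring.
  rewrite -[X in X <= _]mulrA; apply: ler_wpM2l => //.
  apply: le_trans (ler_wpM2r (N2_ge0 _) (N2_sub1_ge (fp pp) (N2_eix _))) _.
  rewrite -N2M; set z := f p * _.
  have -> : (z - 1) * FF (tt k) = (z * G p (tt k) - FF (tt k)) + z * (FF (tt k) - G p (tt k)) by ring.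
  apply: le_trans (N2D_le _ _) _; rewrite lerD2l ler_pM2l ?ltr0n // N2M ler_piMl //.
  by rewrite /z N2M N2_eix mulr1.
under eq_bigr do rewrite big_split -!mulr_sumr /=.
rewrite big_split -!mulr_sumr /=.
have T1 : \sum_(k <- ks) \sum_(p <- ps) p%:R^-1 * N2 (f p * eix (- (tt k * lnn p)) * G p (tt k) - FF (tt k)) <= 1764 / theta * (1 + 50 * lnn h).
  apply: le_trans (_ : (CH theta eta ks + 3 * eta * (size ks * size ps)%:R) * \sum_(N0 <= n < NE) N2 (b n) / n%:R <= _).
    apply: le_trans B1; rewrite le_eqVlt; apply/orP; left; apply/eqP; apply: eq_bigr => k _.
    by rewrite big_seq [RHS]big_seq; apply: eq_bigr => p pS; rewrite h2_id.
  apply: ler_pM => //.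
  - by apply: addr_ge0; [exact: CH_ge0|pos].
  - by apply: sumr_ge0 => n _; pos.
  - by move: t1 CHb C1b; set q := theta^-1; lra.
have T2 : \sum_(k <- ks) \sum_(p <- ps) p%:R^-1 * N2 (FF (tt k) - G p (tt k)) <= 1731 / theta * (12 * lnn h).
  rewrite exchange_big /=.
  apply: le_trans (_ : \sum_(p <- ps) p%:R^-1 * (CH theta eta ks * (2 * (1 + lnn p))) <= _).
    by apply: ler_sum_seq => p pS _; rewrite -mulr_sumr; apply: ler_wpM2l; [pos|exact: h2_edge].
  have -> : \sum_(p <- ps) p%:R^-1 * (CH theta eta ks * (2 * (1 + lnn p))) = CH theta eta ks * 2 * \sum_(p <- ps) p%:R^-1 * (1 + lnn p).
    by rewrite mulr_sumr; apply: eq_bigr => p _; ring.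
  have C0 := CH_ge0 ks th0 eta0.
  apply: le_trans (ler_wpM2l _ Eb) _; first by pos.
  have -> : CH theta eta ks * 2 * (6 * lnn h) = CH theta eta ks * (12 * lnn h) by ring.
  by apply: ler_wpM2r => //; lra.
apply: h2_arith T1 T2 l1 t1.
Qed.
End HTwo.

(** * Short averages of multiplicative functions *)

Definition avgH (f : nat -> CC) (H n : nat) : CC := (H%:R^-1)%:C * \sum_(n.+1 <= m < (n + H).+1) f m.

(** The identity clamped to [[lo, lo + y + 1]] increases by 1 at each integer counted, and its
    increments telescope. *)
Lemma count_itv (lo y : R) (a b : nat) : 0 <= y -> (a <= b)%N ->
  \sum_(a <= m < b) ((lo < m%:R) && (m%:R < lo + y))%:R <= y + 1 :> R.
Proof.
move=> y0 ab; pose phi (t : R) := Num.min (Num.max t lo) (lo + y + 1).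
have hphi t : lo <= phi t <= lo + y + 1.
  by rewrite /phi le_min ge_min lexx orbT le_max lexx orbT /= andbT; lra.
have mono t u : t <= u -> phi t <= phi u.
  by move=> tu; rewrite /phi le_min !ge_min lexx orbT andbT; apply/orP; left; rewrite ge_max !le_max tu lexx !orbT.
apply: le_trans (_ : \sum_(a <= m < b) (phi m.+1%:R - phi m%:R) <= _).
  apply: ler_sum => m _; have := mono m%:R m.+1%:R; rewrite ler_nat leqnSn => /(_ isT) hm.
  case: (boolP (_ && _)) => [/andP[h1 h2]|_] /=; last by rewrite subr_ge0.
  have mS : m.+1%:R = m%:R + 1 :> R by rewrite -[m.+1%:R]natr1.
  have -> : phi m%:R = m%:R by rewrite /phi max_l ?min_l //; lra.
  by rewrite mS /phi max_l ?min_l //; lra.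
rewrite telescope_sumr //; have /andP[_ h1] := hphi b%:R; have /andP[h2 _] := hphi a%:R; lra.
Qed.

Lemma exp_le_lin (s : R) : 0 <= s -> s <= 1 / 2 -> exp s <= 1 + 2 * s.
Proof.
move=> s0 s1; have := exp_ge1D (- s); rewrite expN => h.
have e0 := exp_gt0 s; have p : 0 < 1 - s by lra.
have h2 : exp s <= (1 - s)^-1 by rewrite -[exp s]invrK lef_pV2 ?posrE ?invr_gt0.
apply: le_trans h2 _; rewrite invf_ple ?posrE //; last by lra.
by rewrite -[X in X <= _]mul1r ler_pdivrMr; [nra|lra].
Qed.

(** * Short averages as averages of logarithmic windows *)

Section ShortAvg.
Variables (f : nat -> CC) (H s1 s M Z : nat) (x eta : R).
Hypothesis f1 : forall n, N2 (f n) <= 1.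
Hypothesis H0 : (0 < H)%N.
Hypothesis s10 : (0 < s1)%N.
Hypothesis s0 : (0 < s)%N.
Hypothesis sig1 : s%:R / s1%:R <= 1 / 2 :> R.
Hypothesis x1 : 1 <= x.
Hypothesis Hx : H.+1%:R <= x.
Hypothesis xZ : x * exp 2 <= Z%:R.
Hypothesis hnu : forall n, (1 <= n < Z)%N -> (nu s1 n + s <= M)%N.
Hypothesis sx : s%:R / s1%:R * x <= eta * H%:R.

Let b n := if x <= n%:R < x * exp 2 then f n * (n%:R^-1)%:C else 0.
Let wn j := win s1 s Z b j.
(** The indices of the windows contained in [(n, n + H]]; [cnt n m] is the number of those that
    contain [m]. *)
Let J n := index_iota (nu s1 n + s) (nu s1 (n + H.+1)).
Let cnt n m := (\sum_(j <- J n) (nu s1 m <= j < nu s1 m + s)%N)%N.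

Lemma x0 : 0 < x. Proof. exact: lt_le_trans x1. Qed.
Lemma exp1_3 : exp 1 <= 3. Proof. exact/RleP/exp_le_3. Qed.
Lemma exp1_2 : 2 <= exp 1. Proof. by have := exp_ge1D 1; lra. Qed.

Lemma win_cnt n : \sum_(j <- J n) wn j = \sum_(1 <= m < Z) b m * (cnt n m)%:R%:C.
Proof.
rewrite /wn /win.
under eq_bigr do rewrite big_mkcond /=.
rewrite exchange_big /=; apply: eq_bigr => m _.
rewrite /cnt natr_sum rc_sum mulr_sumr; apply: eq_bigr => j _.
by case: (_ && _); rewrite /= ?mulr1 ?mulr0.
Qed.

Lemma cnt_le n m : (cnt n m <= s)%N.
Proof.
rewrite /cnt -big_mkcond /= sum1_count.
apply: leq_trans (_ : size (index_iota (nu s1 m) (nu s1 m + s)) <= _)%N; last by rewrite size_iota addKn.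
rewrite -size_filter; apply: uniq_leq_size; first by rewrite filter_uniq // iota_uniq.
by move=> j; rewrite mem_filter !mem_index_iota => /andP[].
Qed.

Lemma cnt_full n m : (nu s1 n + s <= nu s1 m)%N -> (nu s1 m + s <= nu s1 (n + H.+1))%N -> cnt n m = s.
Proof.
move=> h1 h2; apply/eqP; rewrite eqn_leq cnt_le /cnt -big_mkcond /= sum1_count.
apply: leq_trans (_ : size (index_iota (nu s1 m) (nu s1 m + s)) <= _)%N; first by rewrite size_iota addKn.
rewrite -size_filter; apply: uniq_leq_size; first by rewrite iota_uniq.
by move=> j; rewrite mem_filter !mem_index_iota => /andP[a1 a2]; rewrite a1 a2 /= (leq_trans h1) //= (leq_trans a2).
Qed.

Lemma cnt_low n m : (0 < m)%N -> (m <= n)%N -> cnt n m = 0%N.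
Proof.
move=> m0 mn; rewrite /cnt big_seq big1 // => j; rewrite mem_index_iota => /andP[a1 _].
apply/eqP; rewrite eqb0 negb_and -!ltnNge ltnS; apply/orP; right.
by apply: leq_trans a1; rewrite leq_add2r leq_nu.
Qed.

Lemma cnt_high n m : (n + H < m)%N -> cnt n m = 0%N.
Proof.
move=> mn; rewrite /cnt big_seq big1 // => j; rewrite mem_index_iota => /andP[_ a2].
apply/eqP; rewrite eqb0 negb_and -!ltnNge; apply/orP; left.
by apply: leq_trans a2 _; rewrite leq_nu // addnS.
Qed.

Lemma edge_low n m : (0 < n)%N -> (n < m)%N -> (nu s1 m < nu s1 n + s)%N -> m%:R < n%:R + 2 * (s%:R / s1%:R) * n%:R :> R.
Proof.
move=> n0 nm h; have m0 : (0 < m)%N by exact: leq_trans nm.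
have sR : 0 < s1%:R :> R by rewrite ltr0n.
have nR : 0 < n%:R :> R by rewrite ltr0n.
have /andP[_ a1] := nu_itv s1 m0; have /andP[a2 _] := nu_itv s1 n0.
have a3 : (nu s1 m).+1%:R <= (nu s1 n)%:R + s%:R :> R by rewrite -natrD ler_nat.
have a4 : lnn m < lnn n + s%:R / s1%:R.
  by rewrite -(ltr_pM2l sR) mulrDr mulrCA divff ?gt_eqF // mulr1; lra.
have mR : 0 < m%:R :> R by rewrite ltr0n.
move: a4; rewrite /lnn ln_lt_exp // expD lnK // => a4.
apply: lt_le_trans a4 _.
have -> : n%:R + 2 * (s%:R / s1%:R) * n%:R = n%:R * (1 + 2 * (s%:R / s1%:R)) :> R by ring.
by rewrite ler_pM2l //; apply: exp_le_lin => //; pos.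
Qed.

Lemma edge_high n m : (0 < n)%N -> (0 < m)%N -> (nu s1 n < nu s1 m + s)%N -> n%:R - (s%:R / s1%:R) * n%:R < m%:R :> R.
Proof.
move=> n0 m0 h.
have sR : 0 < s1%:R :> R by rewrite ltr0n.
have nR : 0 < n%:R :> R by rewrite ltr0n.
have mR : 0 < m%:R :> R by rewrite ltr0n.
have /andP[a1 _] := nu_itv s1 m0; have /andP[_ a2] := nu_itv s1 n0.
have a3 : (nu s1 n).+1%:R <= (nu s1 m)%:R + s%:R :> R by rewrite -natrD ler_nat.
have a4 : lnn n - s%:R / s1%:R < lnn m.
  by rewrite -(ltr_pM2l sR) mulrBr mulrCA divff ?gt_eqF // mulr1; lra.
move: a4; rewrite /lnn ln_gt_exp // expD lnK // => a4.
apply: le_lt_trans a4.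
have -> : n%:R - (s%:R / s1%:R) * n%:R = n%:R * (1 + - (s%:R / s1%:R)) :> R by ring.
by rewrite ler_pM2l //; exact: exp_ge1D.
Qed.

(** An [m] in fewer than [s] windows is within relative distance [O(s/s1)] of an end of the
    interval, and [s/s1 * x <= eta * H] makes these few. *)
Lemma edges_le n : x <= n%:R -> n%:R < x * exp 1 ->
  \sum_(n.+1 <= m < (n + H).+1) (cnt n m != s)%:R <= 10 * eta * H%:R + 2 :> R.
Proof.
move=> n1 n2; have xp := x0.
have n0 : (0 < n)%N by rewrite -(ltr0n R); exact: lt_le_trans n1.
have e3 := exp1_3.
have n3 : n%:R <= 3 * x :> R.
  apply: le_trans (ltW n2) _; rewrite mulrC; apply: ler_wpM2r => //; exact: ltW.
pose sg : R := s%:R / s1%:R; have sg0 : 0 <= sg by rewrite /sg; pos.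
pose y1 : R := 2 * sg * n%:R; pose N' := (n + H.+1)%N; pose y2 : R := sg * N'%:R.
apply: le_trans (_ : \sum_(n.+1 <= m < (n + H).+1) (((n%:R < m%:R) && (m%:R < n%:R + y1))%:R + ((N'%:R - y2 < m%:R) && (m%:R < N'%:R - y2 + y2))%:R) <= _ :> R).
  apply: ler_sum_nat => m /andP[m1 m2].
  have [_|ne] /= := eqVneq (cnt n m) s; first by apply: addr_ge0.
  have m0 : (0 < m)%N by exact: leq_trans m1.
  have [a1|a1] := leqP (nu s1 n + s) (nu s1 m); last first.
    by rewrite (edge_low n0 m1 a1) ltr_nat m1 /= lerDl.
  have [a2|a2] := leqP (nu s1 m + s) (nu s1 N'); first by rewrite (cnt_full a1 a2) eqxx in ne.
  have N0 : (0 < N')%N by rewrite /N' addnS.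
  have mN : m%:R < N'%:R :> R by rewrite ltr_nat /N' addnS.
  by rewrite (edge_high N0 m0 a2) subrK mN /= lerDr ler0n.
rewrite big_split /=.
have y10 : 0 <= y1 by rewrite /y1; pos.
have y20 : 0 <= y2 by rewrite /y2; pos.
have nn : (n.+1 <= (n + H).+1)%N by rewrite ltnS leq_addr.
apply: le_trans (lerD (count_itv _ y10 nn) (count_itv _ y20 nn)) _.
have N3 : N'%:R <= 4 * x :> R by rewrite natrD; move: Hx; lra.
have b1 : sg * n%:R <= sg * (3 * x) by exact: ler_wpM2l.
have b2 : sg * N'%:R <= sg * (4 * x) by exact: ler_wpM2l.
by have sx' : sg * x <= eta * H%:R := sx; rewrite /y1 /y2; lra.
Qed.

(** Away from the ends every [m] lies in exactly [s] windows, and the factor [n] undoes the weight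
    [1/m] of the coefficients up to the relative error [H/x]. *)
Lemma short_rest n : x <= n%:R -> n%:R < x * exp 1 ->
  cabs (\sum_(n.+1 <= m < (n + H).+1) f m - (n%:R / s%:R)%:C * \sum_(j <- J n) wn j) <= H%:R * (30 * eta + 6 / H%:R + H%:R / x).
Proof.
move=> n1 n2; have xp := x0.
have n0 : (0 < n)%N by rewrite -(ltr0n R); exact: lt_le_trans n1.
have nR : 0 < n%:R :> R by rewrite ltr0n.
have HR : 0 < H%:R :> R by rewrite ltr0n.
have sR : 0 < s%:R :> R by rewrite ltr0n.
have e2 := exp1_2.
have e22 : exp 2 = exp 1 * exp 1 by rewrite -expD.
have rng m : (n < m <= n + H)%N -> x <= m%:R /\ m%:R < x * exp 2.
  move=> /andP[m1 m2]; split; first by apply: le_trans n1 _; rewrite ler_nat ltnW.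
  apply: le_lt_trans (_ : n%:R + H%:R < _); first by rewrite -natrD ler_nat.
  have Hx' : H%:R <= x by move: Hx; rewrite -[H.+1%:R]natr1; lra.
  have q : x * exp 1 + x <= x * exp 2.
    rewrite e22 -{2}[x]mulr1 -mulrDr ler_pM2l //; nra.
  lra.
have nZ : (n + H < Z)%N.
  have hh : (n < n + H <= n + H)%N by rewrite leqnn -[X in (X < _)%N]addn0 ltn_add2l H0.
  by have [_ h] := rng _ hh; rewrite -(ltr_nat R); exact: lt_le_trans xZ.
rewrite win_cnt.
have -> : \sum_(1 <= m < Z) b m * (cnt n m)%:R%:C = \sum_(n.+1 <= m < (n + H).+1) f m * (m%:R^-1)%:C * (cnt n m)%:R%:C.
  rewrite -(@sum_nat_supp (fun m => b m * (cnt n m)%:R%:C) n.+1 (n + H).+1 1 Z) //.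
    apply: eq_big_nat => m mm; rewrite ltnS in mm; have [r1 r2] := rng m mm.
    by rewrite /b r1 r2.
  move=> m /andP[m1 _]; rewrite negb_and -!leqNgt => /orP[h|h].
    by rewrite cnt_low ?mulr0.
  by rewrite cnt_high ?mulr0.
rewrite mulr_sumr -sumrB; apply: le_trans (cabs_sum _ _ _) _.
apply: le_trans (_ : \sum_(n.+1 <= m < (n + H).+1) (H%:R / x + 3 * (cnt n m != s)%:R) <= _).
  apply: ler_sum_nat => m mm; rewrite ltnS in mm; have [r1 r2] := rng m mm.
  have /andP[m1 m2] := mm.
  have mR : 0 < m%:R :> R by exact: lt_le_trans r1.
  have -> : f m - (n%:R / s%:R)%:C * (f m * (m%:R^-1)%:C * (cnt n m)%:R%:C) = f m * (1 - n%:R / s%:R * m%:R^-1 * (cnt n m)%:R)%:C.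
    rewrite rcD rcN !rcM; ring.
  rewrite cabsM cabs_rc; apply: le_trans (_ : 1 * `|1 - n%:R / s%:R / m%:R * (cnt n m)%:R| <= _).
    by apply: ler_wpM2r => //; exact: cabs_le1.
  rewrite mul1r.
  have nm : n%:R <= m%:R :> R by rewrite ler_nat ltnW.
  have mn : m%:R - n%:R <= H%:R :> R by rewrite lerBlDl -natrD ler_nat.
  have [->|ne] := eqVneq (cnt n m) s.
    rewrite mulr0 addr0.
    have -> : 1 - n%:R / s%:R / m%:R * s%:R = (m%:R - n%:R) / m%:R :> R by field; rewrite !gt_eqF.
    rewrite ger0_norm; last by apply: divr_ge0; lra.
    by apply: ler_pM; rewrite ?subr_ge0 ?invr_ge0 ?(ltW mR) // lef_pV2 ?posrE.
  rewrite mulr1.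
  have [q0 q1] : 0 <= n%:R / s%:R / m%:R * (cnt n m)%:R :> R /\ n%:R / s%:R / m%:R * (cnt n m)%:R <= 1 :> R.
    split; first by pos.
    have -> : n%:R / s%:R / m%:R * (cnt n m)%:R = (n%:R / m%:R) * ((cnt n m)%:R / s%:R) :> R by ring.
    apply: mulr_ile1; [by pos|by pos|by rewrite ler_pdivrMr // mul1r|].
    by rewrite ler_pdivrMr // mul1r ler_nat cnt_le.
  have : 0 <= H%:R / x by pos.
  move: q0 q1; set q := n%:R / _ / _ * _ => q0 q1; set hx := H%:R / x => hx0.
  rewrite ler_norml; lra.
rewrite big_split /= -[X in _ + X <= _]mulr_sumr.
have E := edges_le n1 n2.
have -> : \sum_(n.+1 <= m < (n + H).+1) H%:R / x = H%:R * (H%:R / x).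
  by rewrite sumr_const_nat subSS addKn [RHS]mulr_natl.
have -> : H%:R * (30 * eta + 6 / H%:R + H%:R / x) = H%:R * (H%:R / x) + 3 * (10 * eta * H%:R + 2) by field; rewrite !gt_eqF.
by rewrite lerD2l ler_pM2l ?ltr0n.
Qed.

Lemma J_size n : (0 < n)%N -> (size (J n))%:R <= 2 * s1%:R * H%:R / n%:R :> R.
Proof.
move=> n0; have nR : 0 < n%:R :> R by rewrite ltr0n.
have HR : 1 <= H%:R :> R by rewrite ler1n.
have sR : 1 <= s%:R :> R by rewrite ler1n.
have s1R : 0 < s1%:R :> R by rewrite ltr0n.
rewrite size_iota; have N0 : (0 < n + H.+1)%N by rewrite addnS.
have [h|h] := leqP (nu s1 (n + H.+1)) (nu s1 n + s).
  by move: h; rewrite -subn_eq0 => /eqP->; pos.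
rewrite natrB ?natrD; last exact: ltnW.
have /andP[a1 _] := nu_itv s1 N0; have /andP[_ a2] := nu_itv s1 n0.
have S : (nu s1 n).+1%:R = (nu s1 n)%:R + 1 :> R by rewrite -[_.+1%:R]natr1.
apply: le_trans (_ : s1%:R * (lnn (n + H.+1) - lnn n) <= _); first by lra.
have -> : 2 * s1%:R * H%:R / n%:R = s1%:R * (2 * H%:R / n%:R) :> R by ring.
rewrite ler_pM2l // /lnn -ln_div ?ltr0n //.
have p : 0 < (n + H.+1)%:R / n%:R :> R by rewrite divr_gt0 // ltr0n.
apply: le_trans (ln_le_subr1 p) _.
have -> : (n + H.+1)%:R / n%:R - 1 = H.+1%:R / n%:R :> R by rewrite natrD; field; rewrite gt_eqF.
by rewrite ler_pM2r ?invr_gt0 // -[H.+1%:R]natr1; lra.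
Qed.

(** Membership of [j] forces [nu] to pass a threshold between [n] and [n + H + 1], so the count
    telescopes to at most [H + 1] terms. *)
Lemma count_n (j : nat) : \sum_(1 <= n < Z) (j \in J n)%:R <= H%:R + 1 :> R.
Proof.
pose v n : R := (nu s1 n < j)%N%:R.
apply: le_trans (_ : \sum_(1 <= n < Z) (v n - v (n + H.+1)%N) <= _).
  apply: ler_sum_nat => n /andP[n0 _]; rewrite mem_index_iota.
  have mono : (nu s1 n <= nu s1 (n + H.+1))%N by rewrite leq_nu // leq_addr.
  case: (boolP (_ && _)) => [/andP[h1 h2]|_] /=.
    rewrite /v; have -> : (nu s1 n < j)%N by apply: leq_trans h1; rewrite -addn1 leq_add2l.
    by rewrite ltnNge (ltnW h2) /= subr0.
  rewrite /v subr_ge0 ler_nat; case: (ltnP (nu s1 (n + H.+1)) j) => // h.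
  by rewrite (leq_ltn_trans mono h).
case: Z => [|Z']; first by rewrite big_geq // addr_ge0.
rewrite sumrB.
have -> : \sum_(1 <= n < Z'.+1) v (n + H.+1)%N = \sum_(1 + H.+1 <= n < Z'.+1 + H.+1) v n by rewrite big_addn addnK; apply: eq_big_nat.
have le1 : \sum_(1 <= n < Z'.+1) v n <= \sum_(1 <= n < Z'.+1 + H.+1) v n.
  rewrite [X in _ <= X](big_cat_nat (n := Z'.+1)) ?leq_addr //= lerDl; apply: sumr_ge0 => n _; exact: ler0n.
apply: le_trans (lerB le1 (lexx _)) _.
rewrite [X in X - _](big_cat_nat (n := (1 + H.+1)%N)) ?leq_add2r ?leq_addr //= addrK.
apply: le_trans (_ : \sum_(1 <= n < 1 + H.+1) 1 <= _); first by apply: ler_sum => n _; rewrite /v lern1 leq_b1.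
by rewrite sumr_const_nat addKn -[H.+1%:R]natr1.
Qed.

(** Cauchy-Schwarz over the at most [2 s1 H / n] windows of an interval; then each window is used by
    at most [H + 1] intervals. The factor [s1/s^2] is the one in [win_bound]. *)
Lemma short_avg :
  \sum_(1 <= n < Z | x <= n%:R < x * exp 1) N2 (avgH f H n) / n%:R <=
  8 * (s1%:R / s%:R ^+ 2 * \sum_(j < M) N2 (wn j)) + 4 * (30 * eta + 6 / H%:R + H%:R / x) ^+ 2.
Proof.
have xp := x0; have HR : 1 <= H%:R :> R by rewrite ler1n.
have sR : 0 < s%:R :> R by rewrite ltr0n.
have s1R : 0 < s1%:R :> R by rewrite ltr0n.
have e2 := exp1_2.
set d : R := 30 * eta + 6 / H%:R + H%:R / x.
rewrite -(big_mkord predT (fun j => N2 (wn j))).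
have pw n : x <= n%:R < x * exp 1 -> N2 (avgH f H n) / n%:R <= 4 * s1%:R / (s%:R ^+ 2 * H%:R) * (\sum_(0 <= j < M) (j \in J n)%:R * N2 (wn j)) + 2 * d ^+ 2 * n%:R^-1.
  move=> /andP[n1 n2].
  have nR : 0 < n%:R :> R by exact: lt_le_trans n1.
  have n0 : (0 < n)%N by rewrite -(ltr0n R).
  have HR0 : 0 < H%:R :> R by lra.
  set W := \sum_(j <- J n) wn j; set F := \sum_(n.+1 <= m < (n + H).+1) f m.
  have r := N2_le_sqr (short_rest n1 n2); rewrite -/W -/F -/d in r.
  have e : avgH f H n = (H%:R^-1)%:C * ((F - (n%:R / s%:R)%:C * W) + (n%:R / s%:R)%:C * W) by rewrite subrK.
  rewrite e N2M N2_rc.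
  have b2 := N2D_le (F - (n%:R / s%:R)%:C * W) ((n%:R / s%:R)%:C * W).
  rewrite [N2 ((n%:R / s%:R)%:C * W)]N2M N2_rc in b2.
  set Sj := \sum_(0 <= j < M) _.
  have bW : N2 W <= 2 * s1%:R * H%:R / n%:R * Sj.
    apply: le_trans (N2_sum_card _ _ _) _; rewrite sumr_const_size mulr1.
    apply: ler_pM => //; [by apply: sumr_ge0 => j _; pos|exact: J_size|].
    have bM : (nu s1 (n + H.+1) <= M)%N.
      apply: leq_trans (hnu (n := (n + H.+1)%N) _); first exact: leq_addr.
      rewrite addnS /= -(ltr_nat R); apply: lt_le_trans xZ.
      have e22 : exp 2 = exp 1 * exp 1 by rewrite -expD.
      have q : x * exp 1 + x <= x * exp 2 by rewrite e22 -{2}[x]mulr1 -mulrDr ler_pM2l //; nra.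
      have Hx' := Hx; rewrite -addnS natrD; lra.
    rewrite /Sj (big_nat_widen _ _ _ _ _ bM) (big_nat_widenl _ _ _ _ _ (leq0n _)) big_mkcond /=.
    apply: ler_sum => j _; rewrite mem_index_iota andbC.
    by case: (_ && _) => /=; rewrite ?mul1r ?mul0r.
  have Sj0 : 0 <= Sj by apply: sumr_ge0 => j _; pos.
  apply: le_trans (_ : H%:R^-1 ^+ 2 * (2 * (H%:R * d) ^+ 2 + 2 * ((n%:R / s%:R) ^+ 2 * (2 * s1%:R * H%:R / n%:R * Sj))) / n%:R <= _).
    apply: ler_wpM2r; first by pos.
    apply: ler_wpM2l; first exact: sqr_ge0.
    apply: le_trans b2 _; apply: lerD; first by rewrite ler_pM2l ?ltr0n.
    by rewrite ler_pM2l ?ltr0n //; apply: ler_wpM2l => //; exact: sqr_ge0.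
  by rewrite le_eqVlt; apply/orP; left; apply/eqP; field; rewrite !gt_eqF.
apply: le_trans (ler_sum _ pw) _.
rewrite big_split /= -!mulr_sumr; apply: lerD.
  apply: le_trans (_ : 4 * s1%:R / (s%:R ^+ 2 * H%:R) * ((H%:R + 1) * \sum_(0 <= j < M) N2 (wn j)) <= _).
    apply: ler_wpM2l; first by pos.
    rewrite exchange_big mulr_sumr /=; apply: ler_sum => j _; rewrite -mulr_suml; apply: ler_wpM2r => //.
    apply: le_trans (count_n j); rewrite big_mkcond /=; apply: ler_sum => n _; case: ifP => // _; exact: ler0n.
  have -> : 8 * (s1%:R / s%:R ^+ 2 * \sum_(0 <= j < M) N2 (wn j)) = 4 * s1%:R / (s%:R ^+ 2 * H%:R) * (2 * H%:R * \sum_(0 <= j < M) N2 (wn j)).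
    by field; rewrite !gt_eqF //; lra.
  apply: ler_wpM2l; first by pos.
  by apply: ler_wpM2r; [apply: sumr_ge0 => j _; pos|lra].
have xx1 : x <= x * exp 1 by rewrite ler_peMr ?(ltW xp) //; lra.
have := harm_upV Z xp xx1; rewrite mulrAC divff ?gt_eqF // mul1r expK => hh.
have xi : x^-1 <= 1 by rewrite invf_le1.
have -> : 4 * d ^+ 2 = 2 * d ^+ 2 * 2 by ring.
by apply: ler_wpM2l; [pos|lra].
Qed.
End ShortAvg.

Lemma nat_above (r : R) : exists n : nat, r <= n%:R.
Proof.
have [r0|r0] := lerP 0 r; last by exists 0%N; exact: ltW.
by exists (Num.truncn r).+1; have /andP[_ /ltW] := truncn_itv r0.
Qed.

Lemma PI_le4 : PI <= 4. Proof. apply/RleP; have -> : (4 : R) = IZR 4 by rewrite IZRposE INRE. exact: PI_4. Qed.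

Lemma tail_arith (p q x A Y k eH : R) : p <= 4 -> 0 < p -> 0 < q -> 0 < x -> 0 < A -> 0 < eH -> Y = 2 * x / eH ->
  A * Y / (p / q) <= k ->
  q^-1 * ((2 * q * Y) ^+ 2 * (2 * (2592 / (p / q)) / k ^+ 2 + 3 * (2592 / x) / k)) <= 16 * (5184 / A ^+ 2 + 15 * 1037 / (A * eH)).
Proof.
move=> p4 p0 q0 x0 A0 e0 Yd hk.
have Y0 : 0 < Y by rewrite Yd divr_gt0 // mulr_gt0.
have m0 : 0 < A * Y / (p / q) by rewrite !divr_gt0 // mulr_gt0.
have k0 : 0 < k by exact: lt_le_trans hk.
have ki : k^-1 <= (A * Y / (p / q))^-1 by rewrite lef_pV2 ?posrE.
have ki0 : 0 <= k^-1 by rewrite invr_ge0 ltW.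
set m := A * Y / (p / q) in m0 ki.
have ki2 : k^-1 ^+ 2 <= m^-1 ^+ 2 by rewrite ler_pXn2r ?nnegrE // invr_ge0 ltW.
apply: le_trans (_ : q^-1 * ((2 * q * Y) ^+ 2 * (2 * (2592 / (p / q)) * m^-1 ^+ 2 + 3 * (2592 / x) * m^-1)) <= _).
  apply: ler_wpM2l; first by pos.
  apply: ler_wpM2l; first exact: sqr_ge0.
  apply: lerD; last by apply: ler_wpM2l => //; pos.
  by rewrite -exprVn; apply: ler_wpM2l => //; pos.
have -> : q^-1 * ((2 * q * Y) ^+ 2 * (2 * (2592 / (p / q)) * m^-1 ^+ 2 + 3 * (2592 / x) * m^-1)) = 4 * p * (5184 / A ^+ 2 + 7776 * 2 / (A * eH)).
  by rewrite /m Yd; field; rewrite !gt_eqF.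
have u0 : 0 < (A ^+ 2)^-1 by rewrite invr_gt0 exprn_gt0.
have v0 : 0 < (A * eH)^-1 by rewrite invr_gt0 mulr_gt0.
move: u0 v0; set u := (A ^+ 2)^-1; set v := (A * eH)^-1 => u0 v0.
apply: ler_pM; [by apply: mulr_ge0 => //; exact: ltW| |by lra|].
  by apply: addr_ge0; apply: mulr_ge0; rewrite ?mulr_ge0 ?ler0n ?(ltW u0) ?(ltW v0).
lra.
Qed.

Lemma sb_final (X W e u v : R) : X <= 8 * W + e -> W <= u + v -> X <= 8 * u + (e + 8 * v).
Proof. lra. Qed.

Lemma three_sq : 3 * 3 <= 9 :> R. Proof. lra. Qed.

Lemma sb_add3 (a b c u v : R) : a <= u -> b <= 1 / v -> c <= 1 / v -> a + (b + c) <= u + 2 / v.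
Proof. by rewrite mul1r; move: v^-1 => w; lra. Qed.

(** * From short averages to Dirichlet polynomials *)

Section ShortBlock.
Variables (f : nat -> CC) (H Z Q' : nat) (x eta A : R).
Hypothesis f1 : forall n, N2 (f n) <= 1.
Hypothesis H0 : (0 < H)%N.
Hypothesis Q0 : (0 < Q')%N.
Hypothesis x4 : 4 <= x.
Hypothesis Hx : H.+1%:R <= x.
Hypothesis xZ : x * exp 2 <= Z%:R.
Hypothesis lZ : lnn Z <= Q'%:R.
Hypothesis eta0 : 0 < eta.
Hypothesis eta1 : eta <= 1 / 2.
Hypothesis A1 : 1 <= A.
Let theta : R := PI / Q'%:R.
Let b n := if x <= n%:R < x * exp 2 then f n * (n%:R^-1)%:C else 0.
Let B (k : R) : CC := \sum_(1 <= n < Z) b n * eix (- (theta * k * lnn n)).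
Let S : R := \sum_(1 <= n < Z) cabs (b n).

Lemma sb_basic : [/\ 0 < x, 0 < Q'%:R :> R, 0 < theta & theta <= x].
Proof.
have x0 : 0 < x by have := x4; lra.
have QR : 0 < Q'%:R :> R by rewrite ltr0n.
have Q1 : 1 <= Q'%:R :> R by rewrite ler1n.
have p0 := PI_gt0; have p4 := PI_le4.
split=> //; first by rewrite /theta divr_gt0.
by rewrite /theta ler_pdivrMr //; have := x4; nra.
Qed.

Lemma BE k : B k = dser Z x (x * exp 2) f (theta * k).
Proof.
by rewrite /B /dser [RHS]big_mkcond /=; apply: eq_bigr => n _; rewrite /b; case: ifP => // _; rewrite !mul0r.
Qed.

Lemma harm3 : \sum_(1 <= n < Z | x <= n%:R < x * exp 2) (n%:R^-1 : R) <= 3.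
Proof.
have [x0 _ _ _] := sb_basic.
have e2 : 1 <= exp 2 by have := exp_ge1D 2; lra.
have xx : x <= x * exp 2 by rewrite ler_peMr // ltW.
have := harm_upV Z x0 xx; rewrite mulrAC divff ?gt_eqF // mul1r expK.
have : x^-1 <= 1 by rewrite invf_le1 //; have := x4; lra.
lra.
Qed.

Lemma S_le : S <= 3.
Proof.
apply: le_trans harm3; rewrite /S [X in _ <= X]big_mkcond /=; apply: ler_sum => n _; rewrite /b.
case: ifP => _; last by rewrite cabs0.
rewrite cabsM cabs_rc ger0_norm ?invr_ge0 // -[X in _ <= X]mul1r.
by apply: ler_wpM2r; [rewrite invr_ge0|exact: cabs_le1].
Qed.

Lemma sb_mv N : \sum_(1 <= k < N.+1) (N2 (B k%:R) + N2 (B (- k%:R))) <= 2592 / theta + 2592 / x * N%:R.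
Proof.
have [x0 QR th0 thx] := sb_basic.
have thZ : theta * lnn Z <= PI.
  by rewrite /theta mulrAC ler_pdivrMr // ler_pM2l ?PI_gt0.
apply: le_trans (_ : symsum N (fun k => N2 (B k)) <= _); first by rewrite /symsum lerDr.
rewrite -(ler_pM2l th0).
have -> : symsum N (fun k => N2 (B k)) = \sum_(k < N.*2.+1) N2 (\sum_(1 <= n < Z) b n * eix (- ((- (theta * N%:R) + theta * k%:R) * lnn n))).
  rewrite symsum_ord; apply: eq_bigr => k _; congr N2; apply: eq_bigr => n _; congr (_ * eix _); ring.
apply: le_trans (mean_value _ _ _ th0 thZ) _.
set N' := N.*2.+1.
apply: le_trans (_ : 432 * ((1 + theta * N'%:R / x) * 3) <= _).
  rewrite ler_pM2l ?ltr0n //; apply: le_trans (ler_wpM2l _ harm3); last by pos.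
  rewrite mulr_sumr [X in _ <= X]big_mkcond /=; apply: ler_sum_nat => n /andP[n1 _]; rewrite /b.
  case: ifP => [/andP[xn _]|_]; last by rewrite N20 mul0r.
  have nR : 0 < n%:R :> R by rewrite ltr0n.
  rewrite N2M N2_rc; apply: le_trans (_ : 1 * n%:R^-1 ^+ 2 * (n%:R + theta * N'%:R) <= _).
    by apply: ler_wpM2r; [pos|apply: ler_wpM2r => //; exact: sqr_ge0].
  have -> : 1 * n%:R^-1 ^+ 2 * (n%:R + theta * N'%:R) = (1 + theta * N'%:R / n%:R) * n%:R^-1 by field; rewrite gt_eqF.
  apply: ler_wpM2r; first by pos.
  rewrite lerD2l; apply: ler_wpM2l; first by pos.
  by rewrite lef_pV2 ?posrE.
have -> : N'%:R = 2 * N%:R + 1 :> R by rewrite /N' -[_.+1%:R]natr1 -mul2n natrM.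
have -> : theta * (2592 / theta + 2592 / x * N%:R) = 2592 + 2592 * (theta / x) * N%:R by field; rewrite !gt_eqF.
have q1 : theta / x <= 1 by rewrite ler_pdivrMr // mul1r.
have -> : theta * (2 * N%:R + 1) / x = 2 * (theta / x) * N%:R + theta / x by field; rewrite gt_eqF.
move: q1; set q := theta / x; set w := q * N%:R => q1.
have -> : 2 * q * N%:R = 2 * w by rewrite /w; ring.
have -> : 2592 * q * N%:R = 2592 * w by rewrite /w; ring.
lra.
Qed.

Let Y : R := 2 * x / (eta * H%:R).

(** The windows have logarithmic length about [eta H / x], so frequencies beyond [A x / (eta H)] are
    damped and cost [O(1/A^2 + 1/(A eta H))] by the mean value theorem. [k1] marks this cut; [k2]
    and [s1] are auxiliary and so large that truncation and rounding cost [1/A^2] each. *)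
Lemma short_block : exists k1 : nat, [/\ (0 < k1)%N, theta * k1.*2.+1%:R <= 4 * A * x / (eta * H%:R) + 3 * theta &
  \sum_(1 <= n < Z | x <= n%:R < x * exp 1) N2 (avgH f H n) / n%:R <=
  8 * (Q'%:R^-1 * symsum k1 (fun k => N2 (dser Z x (x * exp 2) f (theta * k)))) +
  (4 * (30 * eta + 6 / H%:R + H%:R / x) ^+ 2 + 8 * (16 * (5184 / A ^+ 2 + 15 * 1037 / (A * (eta * H%:R))) + 2 / A ^+ 2))].
Proof.
have [x0 QR th0 thx] := sb_basic; have a1 := A1; have e0 := eta0; have e1 := eta1.
have HR : 1 <= H%:R :> R by rewrite ler1n.
have HR0 : 0 < H%:R :> R by lra.
have A0 : 0 < A by lra.
have Hx' : H%:R <= x by have := Hx; rewrite -[H.+1%:R]natr1; lra.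
have eH : 0 < eta * H%:R by rewrite mulr_gt0.
have Y0 : 0 < Y by rewrite /Y divr_gt0 // mulr_gt0.
have Y4 : 4 <= Y.
  rewrite /Y ler_pdivlMr //; have : eta * H%:R <= 1 / 2 * x by apply: ler_pM => //; exact: ltW.
  lra.
pose k1 := (Num.truncn (A * Y / theta)).+1.
have AY : 0 <= A * Y / theta by pos.
have /andP[t1 t2] := truncn_itv AY.
have k1S : k1%:R = (Num.truncn (A * Y / theta))%:R + 1 :> R by rewrite /k1 -[_.+1%:R]natr1.
have k1lo : A * Y / theta <= k1%:R by exact: ltW.
have k1R : 0 < k1%:R :> R by rewrite ltr0n.
have [k2' hk2] := nat_above (12 * Q'%:R * Y ^+ 2 * 9 * A ^+ 2).
pose k2 := (k1 + k2')%N.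
have k2R : 0 < k2%:R :> R by rewrite ltr0n addn_gt0.
pose C2 : R := Q'%:R^-1 * (2 * k2%:R + 1) * ((theta * k2%:R * 3) ^+ 2 * (1 + (2 * Q'%:R * Y) ^+ 2)).
have C20 : 0 <= C2 by rewrite /C2; pos.
(* [C2 / s1^2] bounds the cost of rounding the logarithms; it is known only once [k2] is. *)
have [s1' hs1] := nat_above (C2 * A ^+ 2 + Y).
pose s1 := (s1' + k2)%N.
have s1R : C2 * A ^+ 2 + Y <= s1%:R by apply: le_trans hs1 _; rewrite ler_nat leq_addr.
have s1p : 0 < s1%:R :> R by apply: lt_le_trans s1R; rewrite ltr_pwDr // mulr_ge0 // sqr_ge0.
have s10 : (0 < s1)%N by rewrite -(ltr0n R).
(* This puts [s/s1] between [1/Y] and [2/Y], that is between [eta H / (2 x)] and [eta H / x]. *)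
pose s := Num.truncn (2 * s1%:R / Y).
have sY0 : 0 <= 2 * s1%:R / Y by pos.
have /andP[u1 u2] := truncn_itv sY0.
have sY2 : 2 <= 2 * s1%:R / Y.
  rewrite ler_pdivlMr // ler_pM2l ?ltr0n //; apply: le_trans s1R; rewrite lerDr mulr_ge0 //; exact: sqr_ge0.
have sS : s.+1%:R = s%:R + 1 :> R by rewrite -[s.+1%:R]natr1.
have slo : s1%:R / Y <= s%:R.
  have : 2 * s1%:R / Y = 2 * (s1%:R / Y) by ring.
  move: u2 sY2; rewrite -/s sS; set q := 2 * s1%:R / Y; set q' := s1%:R / Y; lra.
have sp : 0 < s%:R :> R by apply: lt_le_trans slo; rewrite divr_gt0.
have s0 : (0 < s)%N by rewrite -(ltr0n R).
have ssR : s1%:R / s%:R <= Y.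
  by rewrite ler_pdivrMr // mulrC -ler_pdivrMr.
have sg : s%:R / s1%:R <= 2 / Y.
  rewrite ler_pdivrMr // mulrAC; exact: u1.
have sig1 : s%:R / s1%:R <= 1 / 2 :> R.
  apply: le_trans sg _; rewrite ler_pdivrMr //; lra_of Y4.
have sx : s%:R / s1%:R * x <= eta * H%:R.
  apply: le_trans (ler_wpM2r (ltW x0) sg) _.
  by rewrite /Y; have -> : 2 / (2 * x / (eta * H%:R)) * x = eta * H%:R; [field; rewrite !gt_eqF|].
have s_s1 : (s <= s1)%N.
  rewrite -(ler_nat R); move: sig1; rewrite ler_pdivrMr // => q; lra_of q s1p.
pose M := (2 * Q' * s1)%N.
have hnu n : (1 <= n < Z)%N -> (nu s1 n + s <= M)%N.
  move=> /andP[n1 n2]; have /andP[v1 _] := nu_itv s1 n1.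
  rewrite -(ler_nat R) natrD !natrM.
  have l1 : lnn n <= Q'%:R by apply: le_trans lZ; rewrite ler_lnn // ltnW.
  have l2 : s1%:R * lnn n <= s1%:R * Q'%:R by rewrite ler_pM2l.
  have l3 : s%:R <= s1%:R * Q'%:R :> R.
    by rewrite -natrM ler_nat; apply: leq_trans s_s1 _; rewrite leq_pmulr.
  lra.
have x1 : 1 <= x by lra_of x4.
have SA := @short_avg f H s1 s M Z x eta f1 H0 s10 s0 sig1 x1 Hx xZ hnu sx.
have k12 : (0 < k1 <= k2)%N by rewrite /k2 leq_addr.
have k2M : (k2 <= Q' * s1)%N by apply: leq_trans (leq_pmull _ Q0); rewrite leq_addl.
have WB := @win_bound Q' s1 s Z b Q0 s10 s0 hnu k1 k2 k12 k2M.
exists k1; split=> //.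
  have -> : k1.*2.+1%:R = 2 * k1%:R + 1 :> R by rewrite -[_.+1%:R]natr1 -mul2n natrM.
  have : theta * k1%:R <= A * Y + theta.
    rewrite k1S mulrDr mulr1 lerD2r mulrC -ler_pdivlMr //.
  have -> : 4 * A * x / (eta * H%:R) = 2 * (A * Y) by rewrite /Y; field; rewrite !gt_eqF.
  lra.
have symE : symsum k1 (fun k => N2 (dser Z x (x * exp 2) f (theta * k))) = symsum k1 (fun k => N2 (B k)).
  by rewrite !symsum_ord; apply: eq_bigr => k _; rewrite BE.
rewrite symE.
set W := s1%:R / s%:R ^+ 2 * _ in SA.
have WB' : W <= Q'%:R^-1 * symsum k1 (fun k => N2 (B k)) + (16 * (5184 / A ^+ 2 + 15 * 1037 / (A * (eta * H%:R))) + 2 / A ^+ 2); last first.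
  exact: sb_final SA WB'.
apply: le_trans WB _; rewrite -!/(B _) mulrDr -!addrA lerD2l.
have cle : (((2 * Q') * s1)%:R / s%:R) ^+ 2 <= (2 * Q'%:R * Y) ^+ 2.
  rewrite ler_pXn2r ?nnegrE //; [|by pos|by pos].
  rewrite !natrM -mulrA; apply: ler_wpM2l => //; by pos.
have T := @tail_sum (fun k => N2 (B k%:R) + N2 (B (- k%:R))) (2592 / theta) (2592 / x) k1 k2.
have gd k : 0 <= N2 (B k%:R) + N2 (B (- k%:R)) by pos.
have a0 : 0 <= 2592 / theta by pos.
have a1' : 0 <= 2592 / x by pos.
have {}T := T gd a0 a1' isT (leq_addr _ _) sb_mv.
have t1' : Q'%:R^-1 * (\sum_(k1.+1 <= k < k2.+1) ((2 * Q' * s1)%:R / s%:R) ^+ 2 / k%:R ^+ 2 * (N2 (B k%:R) + N2 (B (- k%:R)))) <= 16 * (5184 / A ^+ 2 + 15 * 1037 / (A * (eta * H%:R))).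
  apply: le_trans (_ : Q'%:R^-1 * ((2 * Q'%:R * Y) ^+ 2 * (2 * (2592 / theta) / k1%:R ^+ 2 + 3 * (2592 / x) / k1%:R)) <= _).
    apply: ler_wpM2l; first by pos.
    apply: le_trans (ler_wpM2l _ T); last by exact: sqr_ge0.
    rewrite mulr_sumr; apply: ler_sum => k _.
    have -> : ((2 * Q' * s1)%:R / s%:R) ^+ 2 / k%:R ^+ 2 * (N2 (B k%:R) + N2 (B (- k%:R))) = ((2 * Q' * s1)%:R / s%:R) ^+ 2 * ((N2 (B k%:R) + N2 (B (- k%:R))) / k%:R ^+ 2) by ring.
    by apply: ler_wpM2r => //; pos.
  exact: (@tail_arith PI Q'%:R x A Y k1%:R (eta * H%:R) PI_le4 PI_gt0 QR x0 A0 eH (erefl _) k1lo).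
have S3 := S_le.
have S0 : 0 <= S by apply: sumr_ge0 => n _.
have t2' : Q'%:R^-1 * (2 * k2%:R + 1) * ((theta * k2%:R * S / s1%:R) ^+ 2 * (1 + ((2 * Q' * s1)%:R / s%:R) ^+ 2)) <= 1 / A ^+ 2.
  apply: le_trans (_ : C2 / s1%:R ^+ 2 <= _).
    have -> : C2 / s1%:R ^+ 2 = Q'%:R^-1 * (2 * k2%:R + 1) * ((theta * k2%:R * 3 / s1%:R) ^+ 2 * (1 + (2 * Q'%:R * Y) ^+ 2)) by rewrite /C2; field; rewrite !gt_eqF.
    apply: ler_wpM2l; first by pos.
    apply: ler_pM; [exact: sqr_ge0|by apply: addr_ge0 => //; exact: sqr_ge0| |by rewrite lerD2l].
    rewrite ler_pXn2r ?nnegrE //; [|by pos|by pos].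
    apply: ler_wpM2r; first by pos.
    by apply: ler_wpM2l => //; pos.
  rewrite ler_pdivrMr ?exprn_gt0 // mulrAC ler_pdivlMr ?exprn_gt0 // mul1r.
  have s11 : 1 <= s1%:R :> R by rewrite ler1n.
  apply: le_trans (_ : s1%:R <= _); first by apply: le_trans s1R; rewrite lerDl ltW.
  by rewrite expr2 ler_peMl // ltW.
have t3' : 6 * (2 * Q')%:R * (s1%:R / s%:R) ^+ 2 * S ^+ 2 / k2%:R <= 1 / A ^+ 2.
  rewrite ler_pdivrMr // div1r [X in _ <= X]mulrC ler_pdivlMr ?exprn_gt0 //.
  apply: le_trans (_ : 12 * Q'%:R * Y ^+ 2 * 9 * A ^+ 2 <= _); last by apply: le_trans hk2 _; rewrite ler_nat leq_addl.
  apply: ler_wpM2r; first exact: sqr_ge0.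
  apply: ler_pM; [by pos|exact: sqr_ge0| |].
    rewrite natrM; have -> : 6 * (2 * Q'%:R) = 12 * Q'%:R :> R by ring.
    apply: ler_wpM2l; first by pos.
    by rewrite ler_pXn2r ?nnegrE //; [pos|exact: ltW].
  by rewrite expr2; apply: le_trans three_sq; exact: ler_pM.
exact: sb_add3 t1' t2' t3'.
Qed.
End ShortBlock.

(** * From the long polynomial back to single scales *)

Section SFive.
Variables (f : nat -> CC) (h Q' : nat) (ts : seq R) (X : R).
Hypothesis f1 : forall n, N2 (f n) <= 1.
Hypothesis h10 : (12 <= h)%N.
Hypothesis Q0 : (0 < Q')%N.
Hypothesis Qh : (Q' <= h)%N.
Hypothesis Ql : 150 * lnn h <= Q'%:R.
Hypothesis hS : 1 + 50 * lnn h <= h%:R.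
Let theta : R := PI / Q'%:R.
Hypothesis hX : forall x : R, `|x| <= h%:R ^+ 10 -> \sum_(t <- ts) N2 (FF f h (t + theta * x)) <= X.
Hypothesis sts : (size ts)%:R <= h%:R ^+ 2 :> R.

Definition bt (t : R) (n : nat) : CC := if (h ^ 100 <= n)%N then f n * (n%:R^-1)%:C * eix (- (t * lnn n)) else 0.
Let Z' := (h ^ 150)%N.

Let hR : 12 <= h%:R :> R. Proof. by rewrite ler_nat. Qed.
Let h0 : (0 < h)%N. Proof. exact: leq_trans h10. Qed.

Lemma btB t x : \sum_(1 <= n < Z') bt t n * eix (- (theta * x * lnn n)) = FF f h (t + theta * x).
Proof.
symmetry; rewrite /FF.
transitivity (\sum_(h ^ 100 <= n < h ^ 150) bt t n * eix (- (theta * x * lnn n))).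
  apply: eq_big_nat => n /andP[n1 _]; rewrite /bt n1.
  have -> : eix (- ((t + theta * x) * lnn n)) = eix (- (t * lnn n)) * eix (- (theta * x * lnn n)) by rewrite -eixD; congr eix; ring.
  by rewrite mulrA.
apply: sum_nat_supp => //; first by rewrite expn_gt0 h0.
by move=> n /andP[_ n2]; rewrite n2 andbT /bt => /negbTE->; rewrite mul0r.
Qed.

Lemma btS t : \sum_(1 <= n < Z') cabs (bt t n) <= h%:R.
Proof.
apply: le_trans hS; have hr := hR; have hp : 0 < h%:R :> R by lra.
have q0 m : 0 < h%:R ^+ m :> R by rewrite exprn_gt0.
have := @harm_up1 (h%:R ^+ 100) (h%:R ^+ 150) Z' (q0 _).
have -> : ln (h%:R ^+ 150 / h%:R ^+ 100) = 50 * lnn h by rewrite ln_div // !ln_pow // /lnn; ring.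
have -> : h%:R ^+ 100 <= h%:R ^+ 150 :> R by rewrite ler_weXn2l //; lra.
move=> /(_ isT); apply: le_trans; rewrite [X in _ <= X]big_mkcond.
apply: ler_sum_nat => n /andP[n1 n2]; rewrite -!natrX ler_nat ltr_nat n2 andbT /bt.
case: ifP => _; last by rewrite cabs0.
rewrite !cabsM cabs_eix mulr1 cabs_rc ger0_norm ?invr_ge0 // -[X in _ <= X]mul1r.
by apply: ler_wpM2r; [rewrite invr_ge0|exact: cabs_le1].
Qed.

(** Here the windows have logarithmic length 1 ([s = s1]), so frequencies beyond [Q'] are damped by
    [1/k^2], and a bound for the shifted frequencies, uniform in the shift, passes to the mean
    square over all scales. In 19, the low frequencies account for 3 and the damped ones for 16. *)
Lemma s_five : exists s1 : nat, (0 < s1)%N /\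
  \sum_(t <- ts) s1%:R^-1 * \sum_(j < 2 * Q' * s1) N2 (win s1 s1 Z' (bt t) j) <= 19 * X + 2.
Proof.
have hr := hR; have hp : 0 < h%:R :> R by lra.
have QR : 0 < Q'%:R :> R by rewrite ltr0n.
have Q1 : 1 <= Q'%:R :> R by rewrite ler1n.
have X0 : 0 <= X.
  apply: le_trans (hX (_ : `|0| <= _)); last by rewrite normr0 exprn_ge0.
  by apply: sumr_ge0 => t _.
(* The bound [X] is available for shifts up to [h^10]; beyond them the trivial bound is small enough
   even after summation over [h^2] frequencies. *)
pose k2 := (h ^ 10)%N.
have k20 : (0 < k2)%N by rewrite expn_gt0 h0.
pose C2 : R := Q'%:R^-1 * (2 * k2%:R + 1) * ((theta * k2%:R * h%:R) ^+ 2 * (1 + (2 * Q'%:R) ^+ 2)).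
have C20 : 0 <= C2 by rewrite /C2; have := PI_gt0 => ?; rewrite /theta; pos.
have [s1' hs1] := nat_above (C2 * h%:R ^+ 2).
pose s1 := (s1' + k2)%N; exists s1.
have s10 : (0 < s1)%N by rewrite addn_gt0 k20 orbT.
split=> //.
have s1R : C2 * h%:R ^+ 2 <= s1%:R by apply: le_trans hs1 _; rewrite ler_nat leq_addr.
have s1p : 0 < s1%:R :> R by rewrite ltr0n.
have Qk : (Q' <= k2)%N by apply: leq_trans Qh _; rewrite /k2 -{1}[h]expn1 leq_pexp2l.
have hnu n : (1 <= n < Z')%N -> (nu s1 n + s1 <= 2 * Q' * s1)%N.
  move=> /andP[n1 n2]; have /andP[v1 _] := nu_itv s1 n1.
  rewrite -(ler_nat R) natrD !natrM.
  have l1 : lnn n <= Q'%:R.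
    apply: le_trans Ql; apply: le_trans (ler_lnn n1 (ltnW n2)) _.
    by rewrite /Z' /lnn natrX ln_pow.
  have l2 : s1%:R * lnn n <= s1%:R * Q'%:R by rewrite ler_pM2l.
  have l3 : s1%:R <= s1%:R * Q'%:R :> R by rewrite ler_peMr // ltW.
  lra.
have k12 : (0 < Q' <= k2)%N by rewrite Q0.
have k2M : (k2 <= Q' * s1)%N by apply: leq_trans (leq_pmull _ Q0); rewrite leq_addl.
have ss : s1%:R / s1%:R = 1 :> R by rewrite divff // gt_eqF.
have cQ : (2 * Q' * s1)%:R / s1%:R = 2 * Q'%:R :> R by rewrite !natrM mulfK // gt_eqF.
have WB t := @win_bound Q' s1 s1 Z' (bt t) Q0 s10 s10 hnu Q' k2 k12 k2M.
pose e : R := Q'%:R^-1 * (2 * k2%:R + 1) * ((theta * k2%:R * h%:R / s1%:R) ^+ 2 * (1 + (2 * Q'%:R) ^+ 2)) + 6 * (2 * Q'%:R) * h%:R ^+ 2 / k2%:R.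
have th0 : 0 < theta by rewrite /theta divr_gt0 // PI_gt0.
have WB' t : s1%:R^-1 * \sum_(j < 2 * Q' * s1) N2 (win s1 s1 Z' (bt t) j) <=
  Q'%:R^-1 * (symsum Q' (fun x => N2 (FF f h (t + theta * x))) + \sum_(Q'.+1 <= k < k2.+1) (2 * Q'%:R) ^+ 2 / k%:R ^+ 2 * (N2 (FF f h (t + theta * k%:R)) + N2 (FF f h (t + theta * (- k%:R))))) + e.
  have := WB t; rewrite ss cQ expr1n mulr1.
  have -> : s1%:R / s1%:R ^+ 2 = s1%:R^-1 :> R by field; rewrite gt_eqF.
  move=> w; apply: le_trans w _; rewrite -addrA; apply: lerD.
    rewrite le_eqVlt; apply/orP; left; apply/eqP; congr (_ * (_ + _)).
      by rewrite !symsum_ord; apply: eq_bigr => k _; rewrite btB.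
    by apply: eq_bigr => k _; rewrite !btB.
  have S0 : 0 <= \sum_(1 <= n < Z') cabs (bt t n) by apply: sumr_ge0 => n _.
  have S1 := btS t; apply: lerD.
    apply: ler_wpM2l; first by pos.
    apply: ler_wpM2r; first by apply: addr_ge0 => //; exact: sqr_ge0.
    rewrite -/theta ler_pXn2r ?nnegrE //; [|by pos|by pos].
    apply: ler_wpM2r; first by pos.
    by apply: ler_wpM2l => //; pos.
  rewrite natrM; apply: ler_wpM2r; first by pos.
  apply: ler_wpM2l; first by pos.
  by rewrite ler_pXn2r ?nnegrE.
have e_le : (size ts)%:R * e <= 2.
  have e0 : 0 <= e by rewrite /e; pos.
  apply: le_trans (ler_wpM2r e0 sts) _; rewrite /e mulrDr.
  rewrite [X in _ <= X](_ : 2 = 1 + 1 :> R); last by ring.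
  apply: lerD.
    apply: le_trans (_ : h%:R ^+ 2 * (C2 / s1%:R ^+ 2) <= _).
      rewrite le_eqVlt; apply/orP; left; apply/eqP; rewrite /C2; field; rewrite !gt_eqF //.
    rewrite mulrA ler_pdivrMr ?exprn_gt0 // mul1r mulrC; apply: le_trans s1R _.
    by rewrite expr2 ler_peMl ?(ltW s1p) // ler1n.
  rewrite /k2 natrX [X in X <= _]mulrA ler_pdivrMr ?exprn_gt0 // mul1r.
  have Qh' : Q'%:R <= h%:R :> R by rewrite ler_nat.
  apply: le_trans (_ : h%:R ^+ 2 * (6 * (2 * h%:R) * h%:R ^+ 2) <= _).
    apply: ler_wpM2l; first by pos.
    apply: ler_wpM2r; first by pos.
    by rewrite !ler_pM2l ?ltr0n.
  have -> : h%:R ^+ 2 * (6 * (2 * h%:R) * h%:R ^+ 2) = 12 * h%:R ^+ 5 :> R by ring.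
  apply: le_trans (_ : h%:R * h%:R ^+ 5 <= _); first by apply: ler_wpM2r => //; pos.
  by rewrite -exprS ler_weXn2l //; lra.
apply: le_trans (ler_sum _ (fun t _ => WB' t)) _.
rewrite big_split /= sumr_const_size; apply: lerD => //.
rewrite -mulr_sumr big_split /= -symsum_sum.
have s_le : symsum Q' (fun x => \sum_(t <- ts) N2 (FF f h (t + theta * x))) <= 3 * Q'%:R * X.
  apply: le_trans (_ : symsum Q' (fun x => 0 * 0 + X) <= _).
    apply: symsum_le => x xQ; rewrite mul0r add0r; apply: hX; apply: le_trans xQ _.
    by rewrite -natrX ler_nat.
  rewrite symsum_lin mul0r add0r; apply: ler_wpM2r => //; lra.
have t_le : \sum_(t <- ts) \sum_(Q'.+1 <= k < k2.+1) (2 * Q'%:R) ^+ 2 / k%:R ^+ 2 * (N2 (FF f h (t + theta * k%:R)) + N2 (FF f h (t + theta * (- k%:R)))) <= 16 * Q'%:R * X.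
  rewrite exchange_big /=.
  apply: le_trans (_ : \sum_(Q'.+1 <= k < k2.+1) (2 * Q'%:R) ^+ 2 * (2 * X) * (k%:R ^- 2) <= _).
    apply: ler_sum_nat => k /andP[_ kk]; rewrite -mulr_sumr big_split /=.
    have -> : (2 * Q'%:R) ^+ 2 * (2 * X) * k%:R ^- 2 = (2 * Q'%:R) ^+ 2 / k%:R ^+ 2 * (2 * X) by ring.
    apply: ler_wpM2l; first by pos.
    have kb : k%:R <= h%:R ^+ 10 :> R by rewrite -natrX ler_nat -ltnS.
    have -> : 2 * X = X + X by ring.
    by apply: lerD; apply: hX; rewrite ?normrN ger0_norm.
  rewrite -mulr_sumr; apply: le_trans (ler_wpM2l _ (sum_inv_sqr k2.+1 (ltn0Sn Q'))) _; first by pos.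
  have q : 2 / Q'.+1%:R <= 2 / Q'%:R :> R by rewrite ler_pM2l ?ltr0n // lef_pV2 ?posrE ?ltr0n // ler_nat.
  apply: le_trans (ler_wpM2l _ q) _; first by pos.
  by rewrite le_eqVlt; apply/orP; left; apply/eqP; field; rewrite gt_eqF.
rewrite ler_pdivrMl //; have -> : Q'%:R * (19 * X) = 3 * Q'%:R * X + 16 * Q'%:R * X by ring.
exact: lerD.
Qed.
End SFive.

Lemma le_nu (s1 m n : nat) : (0 < s1)%N -> (0 < n)%N -> (m <= nu s1 n)%N = (exp (m%:R / s1%:R) <= n%:R).
Proof.
move=> s0 n0; have sR : 0 < s1%:R :> R by rewrite ltr0n.
have nR : 0 < n%:R :> R by rewrite ltr0n.
rewrite -ln_ge_exp // -/(lnn n) ler_pdivrMr // mulrC.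
have /andP[h1 h2] := nu_itv s1 n0.
apply/idP/idP => [h|h]; first by apply: le_trans h1; rewrite ler_nat.
by rewrite -ltnS -(ltr_nat R); exact: le_lt_trans h2.
Qed.

Lemma N2_avgH_le1 (f : nat -> CC) H n : (forall n, N2 (f n) <= 1) -> N2 (avgH f H n) <= 1.
Proof.
move=> f1; rewrite -[X in _ <= X](expr1n _ 2); apply: N2_le_sqr.
rewrite /avgH cabsM cabs_rc ger0_norm ?invr_ge0 //.
case: H => [|H]; first by rewrite invr0 mul0r.
rewrite ler_pdivrMl ?ltr0n // mulr1; apply: le_trans (cabs_sum _ _ _) _.
apply: le_trans (_ : \sum_(n.+1 <= m < (n + H.+1).+1) 1 <= _); first by apply: ler_sum => m _; exact: cabs_le1.
by rewrite sumr_const_nat subSS addKn.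
Qed.

Lemma sub_sum_nat (F : nat -> R) (a b M : nat) : (forall j, 0 <= F j) -> (b <= M)%N ->
  \sum_(a <= j < b) F j <= \sum_(j < M) F j.
Proof.
move=> F0 bM; rewrite -(big_mkord predT F) (big_nat_widen _ _ _ _ _ bM) (big_nat_widenl _ _ _ _ _ (leq0n a)) big_mkcond /=.
by apply: ler_sum => j _; case: ifP.
Qed.

Lemma dser_split Z (x y z : R) f t : x <= y -> y <= z -> dser Z x z f t = dser Z x y f t + dser Z y z f t.
Proof.
move=> xy yz; rewrite /dser [LHS]big_mkcond [X in _ = X + _]big_mkcond [X in _ = _ + X]big_mkcond -big_split /=.
apply: eq_bigr => n _.
have [h1|h1] := lerP x n%:R; have [h2|h2] := ltrP n%:R y; have [h3|h3] := ltrP n%:R z;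
  rewrite /= ?addr0 ?add0r //; exfalso; lra.
Qed.

(** The admissible [i] are exactly the [s1] integers up to [v]; the hypotheses keep them within the
    range. *)
Lemma count_block (i0 i1 s1 v : nat) : (0 < s1)%N -> (i0 + s1 <= v)%N -> (v < i1)%N ->
  (\sum_(i0 <= i < i1) (i <= v < i + s1))%N = s1.
Proof.
move=> s0 b1 b2; rewrite -big_mkcond /= sum1_count -size_filter.
have -> : [seq i <- index_iota i0 i1 | (i <= v < i + s1)%N] = index_iota (v - s1.-1) v.+1.
  apply: irr_sorted_eq; [exact: ltn_trans|exact: ltnn| | |].
  - by apply: sorted_filter; [exact: ltn_trans|exact: iota_ltn_sorted].
  - exact: iota_ltn_sorted.
  move=> i; rewrite mem_filter !mem_index_iota; lia.
by rewrite size_iota; lia.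
Qed.

Lemma ln_mulexp (y e : R) : 0 < y -> ln (y * exp e / y) = e.
Proof. by move=> y0; rewrite mulrAC divff ?gt_eqF // mul1r expK. Qed.

Lemma sum_const_rng (a b : nat) (c : R) : \sum_(a <= i < b) c = (b - a)%:R * c.
Proof. by rewrite sumr_const_nat mulr_natl. Qed.

(** * Mean square of short averages between [h^100] and [h^150] *)

Section LongBlock.
Variables (f : nat -> CC) (h D K J Q' H : nat) (al eps eta A KD : R).
Hypothesis f1 : forall n, N2 (f n) <= 1.
Hypothesis fM : forall m n, (0 < m)%N -> (0 < n)%N -> f (m * n)%N = f m * f n.
Hypothesis fp : forall p, prime p -> N2 (f p) = 1 \/ f p = 0.
Hypothesis h23 : (23 <= h)%N.
Hypothesis lnh1 : 1 <= lnn h.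
Hypothesis hJ : (h ^ 51 <= 2 ^ h)%N.
Hypothesis al0 : 0 < al.
Hypothesis al1 : 1510 * al <= 1.
Hypothesis eps0 : 0 < eps.
Hypothesis eps1 : eps <= 1.
Hypothesis D2 : (1 < D)%N.
Hypothesis K0 : (0 < K)%N.
Hypothesis gG : forall j, goodG al eps K (Gs D j)%:R.
Hypothesis GJ1 : (Gs D J ^ 9)%:R <= 10 * lnn h.
Hypothesis GJ2 : 10 * lnn h <= (Gs D J)%:R ^+ 27.
Hypothesis Q4 : (4 <= Q')%N.
Hypothesis Qh : (Q' <= h)%N.
Hypothesis Ql : 700 * lnn h <= Q'%:R.
Hypothesis hS : 1 + 50 * lnn h <= h%:R.
Hypothesis KD0 : 0 < KD.
Hypothesis hD : forall t : R, `|t| <= 3 * h%:R ^+ 150 ->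
  KD <= \sum_(p <- [seq p <- index_iota 1 h.+1 | prime p]) p%:R^-1 * (1 - cre (f p * eix (- (t * lnn p)))).
Hypothesis H0 : (0 < H)%N.
Hypothesis HX : H.+1%:R <= h%:R ^+ 100 :> R.
Hypothesis eta0 : 0 < eta.
Hypothesis eta1 : eta <= 1 / 2.
Hypothesis A1 : 1 <= A.
Hypothesis hHA : 4 * A / (eta * H%:R) <= exp (- (Gs D 0 ^ 9)%:R) / 2.
Hypothesis h3 : 6 <= h%:R ^+ 100 * exp (- (Gs D 0 ^ 9)%:R).
Let theta : R := PI / Q'%:R.
(** The frequencies reach [h^151], and the moments that count the exceptional ones then have length
    up to [e h^604]. *)
Let Z := (h ^ 700)%N.
Let NR := Num.truncn (h%:R ^+ 150 / theta).
Let tb : R := - (theta * NR%:R).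
Let sm t := smallj f D K al J t.
Let ks := [seq k <- iota 0 NR.*2.+1 | ~~ sm (tb + theta * k%:R)].
Let ts : seq R := [seq tb + theta * k%:R | k <- ks].
Let c0 := cc D K eps.
Let E : R := 4 * (30 * eta + 6 / H%:R + H%:R / h%:R ^+ 100) ^+ 2 + 8 * (16 * (5184 / A ^+ 2 + 15 * 1037 / (A * (eta * H%:R))) + 2 / A ^+ 2).

Lemma hR : 23 <= h%:R :> R. Proof. by rewrite ler_nat. Qed.
Lemma hp : 0 < h%:R :> R. Proof. by have := hR; lra. Qed.
Lemma h0 : (0 < h)%N. Proof. exact: leq_trans h23. Qed.
Lemma hpow_gt0 m : 0 < h%:R ^+ m :> R. Proof. exact: exprn_gt0 hp. Qed.
Lemma hpow_le m n : (m <= n)%N -> h%:R ^+ m <= h%:R ^+ n :> R.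
Proof. by move=> mn; rewrite ler_weXn2l //; have := hR; lra. Qed.
Lemma hpow_exp m : h%:R ^+ m = exp (m%:R * lnn h). Proof. by rewrite expMn /lnn lnK // hp. Qed.
Lemma QR : 4 <= Q'%:R :> R. Proof. by rewrite ler_nat. Qed.
Lemma th_gt0 : 0 < theta. Proof. by rewrite /theta divr_gt0 ?PI_gt0 //; have := QR; lra. Qed.
Lemma th_le1 : theta <= 1.
Proof. have q := QR; have p := PI_le4; rewrite /theta ler_pdivrMr; lra. Qed.
Lemma lnZ m : (m <= 700)%N -> theta * lnn (h ^ m) <= PI.
Proof.
move=> mm; rewrite /theta mulrAC ler_pdivrMr; last by have := QR; lra.
rewrite ler_pM2l ?PI_gt0 //; apply: le_trans Ql; rewrite /lnn natrX ln_pow ?hp //.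
by apply: ler_wpM2r; [have := lnh1; rewrite /lnn; lra|rewrite ler_nat].
Qed.

Lemma NR_le : theta * NR%:R <= h%:R ^+ 150.
Proof.
have t0 := th_gt0; have q : 0 <= h%:R ^+ 150 / theta by apply: divr_ge0; [exact: ltW (hpow_gt0 _)|exact: ltW].
by have /andP[u _] := truncn_itv q; rewrite mulrC -ler_pdivlMr.
Qed.

Lemma NR2_le : theta * NR.*2.+1%:R <= h%:R ^+ 151.
Proof.
have -> : NR.*2.+1%:R = 2 * NR%:R + 1 :> R by rewrite -[_.+1%:R]natr1 -mul2n natrM.
have n := NR_le; have t := th_le1; have r := hR; have p := hpow_gt0 150; have p1 := hpow_le (leq0n 150).
rewrite expr0 in p1; rewrite exprS; have : 3 * h%:R ^+ 150 <= h%:R * h%:R ^+ 150 :> R by apply: ler_wpM2r; lra.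
lra.
Qed.

Lemma sum_ks (phi : R -> R) : symsum NR (fun k => if sm (theta * k) then 0 else phi (theta * k)) = \sum_(t <- ts) phi t.
Proof.
rewrite (symsum_affine theta NR (fun t => if sm t then 0 else phi t)) /ts big_map /ks big_filter.
rewrite -(big_mkord predT (fun k => if sm (tb + theta * k%:R) then 0 else phi (tb + theta * k%:R))).
rewrite /index_iota subn0 [RHS]big_mkcond; apply: eq_bigr => k _; by case: (sm _).
Qed.

(** [count_U] with [Lam = 151 log h] gives [theta] times the size at most [h^(1510 al) <= h], and
    [1/theta] is at most [h]. *)
Lemma size_ts : (size ts)%:R <= h%:R ^+ 2 :> R.
Proof.
have t0 := th_gt0.
have q := sum_ks (fun=> 1); rewrite sumr_const_size mulr1 in q.
have L1 : (Gs D J ^ 9)%:R <= 151 * lnn h by have := GJ1; have := lnh1; lra.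
have L2 : 151 * lnn h <= 20 * (Gs D J)%:R ^+ 27 by have := GJ2; have := lnh1; lra.
have LZ : exp (4 * (151 * lnn h) + 1) <= Z%:R.
  by rewrite /Z natrX hpow_exp ler_exp; have := lnh1; lra.
have LN : theta * NR.*2.+1%:R <= exp (151 * lnn h) by rewrite -hpow_exp; exact: NR2_le.
have CU := @count_U f Z NR D K theta al eps f1 t0 (lnZ (leqnn _)) al0 D2 K0 gG J (151 * lnn h) eps1 L1 L2 LZ LN.
rewrite q in CU.
have e1 : exp (10 * al * (151 * lnn h)) <= h%:R.
  rewrite -[h%:R]expr1 hpow_exp mul1r ler_exp.
  have -> : 10 * al * (151 * lnn h) = 1510 * al * lnn h by ring.
  by rewrite ler_piMl //; have := lnh1; lra.
have := le_trans CU e1; rewrite mulrC -ler_pdivlMr // => b1; apply: le_trans b1 _.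
rewrite /theta invf_div mulrA ler_pdivrMr ?PI_gt0 //.
have Qh' : Q'%:R <= h%:R :> R by rewrite ler_nat.
apply: le_trans (_ : h%:R * h%:R <= _); first by rewrite ler_pM2l // hp.
by rewrite -expr2 ler_peMr ?sqr_ge0 //; have := PI_ge3; lra.
Qed.

Let X : R := 300 * 1000 * lnn h / (theta * KD).

(** The shift is absorbed into the base point of the lattice; the frequencies stay within [3 h^150],
    where [hD] bounds the distance from below. *)
Lemma X_bound (x : R) : `|x| <= h%:R ^+ 10 -> \sum_(t <- ts) N2 (FF f h (t + theta * x)) <= X.
Proof.
move=> xb; have t0 := th_gt0; have t1 := th_le1.
rewrite big_map /X -(ler_pM2l KD0).
have -> : KD * (300 * 1000 * lnn h / (theta * KD)) = 300 * 1000 * lnn h / theta by field; rewrite !gt_eqF.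
have uk : uniq ks by rewrite filter_uniq // iota_uniq.
pose tt k : R := tb + theta * x + theta * k%:R.
have kb k : k \in ks -> (k%:R <= 2 * NR%:R :> R).
  by rewrite mem_filter mem_iota => /andP[_ /andP[_]]; rewrite add0n ltnS -(ler_nat R) -mul2n natrM.
have kR k : 0 <= k%:R :> R by [].
have nr := NR_le.
have q150 := hpow_gt0 150.
have tk k : k \in ks -> `|tb + theta * k%:R| <= h%:R ^+ 150.
  move=> kS; have := kb k kS; have := kR k => a1 a2.
  have -> : tb + theta * k%:R = theta * (k%:R - NR%:R) by rewrite /tb; ring.
  rewrite normrM (gtr0_norm t0); apply: le_trans nr; rewrite ler_pM2l // ler_norml; lra.
have td k l : k \in ks -> l \in ks -> `|tt k - tt l| <= h%:R ^+ 151.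
  move=> /tk a /tk b; have -> : tt k - tt l = (tb + theta * k%:R) - (tb + theta * l%:R) by rewrite /tt; ring.
  apply: le_trans (ler_normB _ _) _; apply: le_trans (lerD a b) _; rewrite exprS; have := hR => r.
  have : 2 * h%:R ^+ 150 <= h%:R * h%:R ^+ 150 :> R by apply: ler_wpM2r; lra.
  lra.
have sk : (size ks)%:R <= h%:R ^+ 2 :> R by have := size_ts; rewrite size_map.
have hd k : k \in ks -> KD <= \sum_(p <- [seq p <- index_iota 1 h.+1 | prime p]) p%:R^-1 * (1 - cre (f p * eix (- (tt k * lnn p)))).
  move=> /tk a; apply: hD; have -> : tt k = (tb + theta * k%:R) + theta * x by rewrite /tt; ring.
  apply: le_trans (ler_normD _ _) _; rewrite [`|theta * x|]normrM (gtr0_norm t0).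
  have h1' := hpow_le (isT : (10 <= 150)%N).
  have : theta * `|x| <= 1 * h%:R ^+ 10 by apply: ler_pM => //; exact: ltW.
  lra.
have h10 : (10 <= h)%N by exact: leq_trans h23.
have R2 := @H2 f h theta (tb + theta * x) ks f1 fM fp h10 hJ t0 t1 (lnZ (isT : (150 <= 700)%N)) uk td sk lnh1 KD hd.
apply: le_trans R2; rewrite ler_pM2l // le_eqVlt; apply/orP; left; apply/eqP.
by apply: eq_bigr => k _; congr (N2 (FF _ _ _)); rewrite /tt; ring.
Qed.

(** Rounding down does not move lattice end points, so this window is exactly a block of ratio [e].
    A window is indexed by its last point, hence [i + s1 - 1]. *)
Lemma win_blk (s1 i : nat) (t : R) : (0 < s1)%N -> h%:R ^+ 100 <= exp (i%:R / s1%:R) -> exp (i%:R / s1%:R) * exp 1 <= h%:R ^+ 150 ->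
  win s1 s1 (h ^ 150) (bt f h t) (i + s1.-1)%N = dser Z (exp (i%:R / s1%:R)) (exp (i%:R / s1%:R) * exp 1) f t.
Proof.
move=> s0 x1 x2; have sR : 0 < s1%:R :> R by rewrite ltr0n.
rewrite /win /dser big_mkcond [RHS]big_mkcond /=.
have cond n : (0 < n)%N -> (nu s1 n <= i + s1.-1 < nu s1 n + s1)%N = (exp (i%:R / s1%:R) <= n%:R < exp (i%:R / s1%:R) * exp 1).
  move=> n0; rewrite -(prednK s0) addnS ltnS leq_add2r prednK // andbC le_nu //; congr (_ && _).
  have -> : exp (i%:R / s1%:R) * exp 1 = exp ((i + s1)%:R / s1%:R).
    by rewrite -expD; congr exp; rewrite natrD; field; rewrite gt_eqF.
  by rewrite ltNge -le_nu // -ltnNge -(prednK s0) addnS ltnS /=.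
have hh n : (0 < n)%N -> (nu s1 n <= i + s1.-1 < nu s1 n + s1)%N -> (h ^ 100 <= n < h ^ 150)%N.
  move=> n0; rewrite cond // => /andP[a b]; rewrite -(ler_nat R) -(ltr_nat R) !natrX.
  by rewrite (le_trans x1 a) (lt_le_trans b x2).
transitivity (\sum_(1 <= n < Z) (if (nu s1 n <= i + s1.-1 < nu s1 n + s1)%N then bt f h t n else 0)).
  apply: sum_nat_supp => //; first by rewrite leq_pexp2l // h0.
  move=> n /andP[n0 _]; rewrite n0 /=; case: ifP => // c; have /andP[_ ->] := hh n n0 c; by [].
apply: eq_big_nat => n /andP[n0 _]; rewrite -cond //; case: ifP => // c.
by have /andP[a _] := hh n n0 c; rewrite /bt a.
Qed.

Let V (x : R) : R := \sum_(t <- ts) N2 (dser Z x (x * exp 1) f t).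

(** The small frequencies are handled by the levels; the others belong to the fixed set [ts],
    whatever [x] and [k1] are. *)
Lemma sym_part (x : R) k1 : h%:R ^+ 100 <= x -> x * exp 1 <= h%:R ^+ 150 -> theta * k1.*2.+1%:R <= x * exp (- (Gs D 0 ^ 9)%:R) ->
  symsum k1 (fun k => N2 (dser Z x (x * exp 1) f (theta * k))) <= 2 * c0 / theta + V x.
Proof.
move=> x1 x2 kx; have t0 := th_gt0; have l1 := lnh1.
have x0 : 0 < x by apply: lt_le_trans x1; exact: hpow_gt0.
have gj := GJ1.
have e1 : 1 <= exp 1 by have := exp_ge1D 1; lra.
have xe : exp (10 * (Gs D J ^ 9)%:R) <= x by apply: le_trans x1; rewrite hpow_exp ler_exp; lra.
have xx : x <= h%:R ^+ 150 by apply: le_trans x2; rewrite ler_peMr // ltW.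
have xZ : x * exp (3 + 2 * (Gs D J ^ 9)%:R) <= Z%:R.
  apply: le_trans (_ : h%:R ^+ 150 * exp (3 + 2 * (Gs D J ^ 9)%:R) <= _); first by apply: ler_wpM2r.
  rewrite /Z [(h ^ 700)%:R]natrX !hpow_exp -expD ler_exp; lra.
have c00 : 0 <= c0 by rewrite /c0 /cc; have := ltW eps0 => ?; pos.
have LS := @level_sum f Z k1 D K theta x al eps f1 fM t0 (lnZ (leqnn _)) al0 eps0 D2 K0 gG J xe xZ kx.
rewrite (_ : (fun k => N2 (dser Z x (x * exp 1) f (theta * k))) = (fun k => N2 (dser Z x (x * exp 1) f (theta * k)))) //.
apply: le_trans (_ : symsum k1 (fun k => (if sm (theta * k) then N2 (dser Z x (x * exp 1) f (theta * k)) else 0) + (if sm (theta * k) then 0 else N2 (dser Z x (x * exp 1) f (theta * k)))) <= _).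
  by apply: symsum_le_all => k; case: (sm _); rewrite ?addr0 ?add0r.
rewrite symsumD; apply: lerD.
  rewrite ler_pdivlMr // mulrC; apply: le_trans LS _; rewrite -/c0 mulrC; apply: ler_wpM2r => //.
  have : 0 <= 2^-1 ^+ J :> R by pos.
  lra.
rewrite /V -(sum_ks (fun t => N2 (dser Z x (x * exp 1) f t))); apply: symsum_mono; last by move=> k; case: ifP.
have : theta * k1%:R <= h%:R ^+ 150.
  apply: le_trans xx; apply: le_trans (_ : x * exp (- (Gs D 0 ^ 9)%:R) <= _); last first.
    by rewrite ger_pMr // -[X in _ <= X]exp_zero ler_exp oppr_le0; exact: ler0n.
  apply: le_trans kx; by rewrite ler_pM2l // ler_nat -addnn leqW // leq_addr.
rewrite mulrC -ler_pdivlMr // => kk.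
have q : 0 <= h%:R ^+ 150 / theta by apply: divr_ge0; [exact: ltW (hpow_gt0 _)|exact: ltW].
have /andP[_ u] := truncn_itv q.
by rewrite -ltnS -(ltr_nat R); exact: le_lt_trans kk u.
Qed.

(** The intervals reach beyond [e x], so the polynomial covers [[x, e^2 x)]; it is cut into two
    blocks of ratio [e], the shape the levels require. *)
Lemma block_i (x : R) : h%:R ^+ 100 <= x -> x * exp 3 <= h%:R ^+ 150 ->
  \sum_(1 <= n < Z | x <= n%:R < x * exp 1) N2 (avgH f H n) / n%:R <=
  16 * (Q'%:R^-1 * (4 * c0 / theta + V x + V (x * exp 1))) + E.
Proof.
move=> x1 x2; have t0 := th_gt0; have l1 := lnh1; have hr := hR; have t1 := th_le1.
have x0 : 0 < x by apply: lt_le_trans x1; exact: hpow_gt0.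
have QR' := QR; have Qp : 0 < Q'%:R :> R by lra_of QR'.
have e1 : 1 <= exp 1 by have := exp_ge1D 1; hlra.
have h1' := hpow_le (isT : (1 <= 100)%N); rewrite expr1 in h1'.
have x4 : 4 <= x by lra_of h1' hr x1.
have Hx : H.+1%:R <= x by apply: le_trans x1.
have e123 : exp 1 * exp 1 = exp 2 by rewrite -expD.
have xe2 : x * exp 2 <= h%:R ^+ 150 by apply: le_trans x2; rewrite ler_pM2l // ler_exp; hlra.
have xZ : x * exp 2 <= Z%:R by apply: le_trans xe2 _; rewrite /Z natrX hpow_le.
have lZ : lnn Z <= Q'%:R by apply: le_trans Ql; rewrite /Z /lnn natrX ln_pow ?hp.
have Q0 : (0 < Q')%N by exact: leq_trans Q4.
have [k1 [k10 kb SB]] := @short_block f H Z Q' x eta A f1 H0 Q0 x4 Hx xZ lZ eta0 eta1 A1.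
have hH : 0 < eta * H%:R by rewrite mulr_gt0 // ltr0n.
have kx : theta * k1.*2.+1%:R <= x * exp (- (Gs D 0 ^ 9)%:R).
  apply: le_trans kb _.
  have b1 : 4 * A * x / (eta * H%:R) <= x * (exp (- (Gs D 0 ^ 9)%:R) / 2).
    have -> : 4 * A * x / (eta * H%:R) = x * (4 * A / (eta * H%:R)) by ring.
    by rewrite ler_pM2l.
  have b2 : 6 <= x * exp (- (Gs D 0 ^ 9)%:R) by apply: le_trans h3 _; apply: ler_wpM2r.
  by move: b1 b2; rewrite -/theta; set w := exp _ => q1 q2; lra_of q1 q2 t0 t1.
have kx' : theta * k1.*2.+1%:R <= x * exp 1 * exp (- (Gs D 0 ^ 9)%:R).
  by apply: le_trans kx _; apply: ler_wpM2r => //; rewrite ler_peMr // ltW.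
have xe1 : x * exp 1 <= h%:R ^+ 150 by apply: le_trans xe2; rewrite ler_pM2l // ler_exp; hlra.
have xe12 : x * exp 1 * exp 1 <= h%:R ^+ 150 by rewrite -mulrA e123.
have x1e : h%:R ^+ 100 <= x * exp 1 by apply: le_trans x1 _; rewrite ler_peMr // ltW.
have P1 := sym_part x1 xe1 kx; have P2 := sym_part x1e xe12 kx'.
apply: le_trans SB _; apply: lerD; last first.
  rewrite /E lerD2r ler_pM2l ?ltr0n // ler_pXn2r ?nnegrE //.
  - by rewrite lerD2l; apply: ler_wpM2l => //; rewrite lef_pV2 ?posrE ?hpow_gt0.
  - by have := ltW eta0 => ?; pos.
  - by have := ltW eta0 => ?; have := ltW (hpow_gt0 100) => ?; pos.
have -> : 16 * (Q'%:R^-1 * (4 * c0 / theta + V x + V (x * exp 1))) = 8 * (Q'%:R^-1 * (2 * (2 * c0 / theta + V x) + 2 * (2 * c0 / theta + V (x * exp 1)))) by ring.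
rewrite ler_pM2l ?ltr0n //; apply: ler_wpM2l; first by pos.
apply: le_trans (_ : symsum k1 (fun k => 2 * N2 (dser Z x (x * exp 1) f (theta * k)) + 2 * N2 (dser Z (x * exp 1) (x * exp 1 * exp 1) f (theta * k))) <= _).
  apply: symsum_le_all => k; rewrite (@dser_split Z x (x * exp 1) (x * exp 2)).
  - have -> : x * exp 1 * exp 1 = x * exp 2 by rewrite -mulrA e123.
    exact: N2D_le.
  - by rewrite ler_peMr // ltW.
  - by rewrite -e123 mulrA ler_peMr // mulr_ge0 // ltW.
by rewrite symsumD !symsumZ; apply: lerD; rewrite ler_pM2l ?ltr0n.
Qed.

(** The blocks starting at [e^(i/s1)] cover each [n] of the core exactly [s1] times, so the long sum
    is an average of block sums. For the exceptional frequencies this average is the mean square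
    over windows of [s_five], and there [KD] enters. *)
Lemma long_block : \sum_(h ^ 100 <= n < h ^ 150) N2 (avgH f H n) / n%:R <=
  24 + 50 * lnn h * (22 * c0 + E) + 608 * 100 * 1000 * lnn h / KD.
Proof.
have t0 := th_gt0; have l1 := lnh1; have hr := hR; have t1 := th_le1; have hp0 := hp.
have QR' := QR; have Qp : 0 < Q'%:R :> R by lra_of QR'.
have Q0 : (0 < Q')%N by exact: leq_trans Q4.
have h12 : (12 <= h)%N by exact: leq_trans h23.
have Ql150 : 150 * lnn h <= Q'%:R by lra_of Ql l1.
have [s1 [s10 SF]] := @s_five f h Q' ts X f1 h12 Q0 Qh Ql150 hS X_bound size_ts.
have sR : 0 < s1%:R :> R by rewrite ltr0n.
have sR1 : 1 <= s1%:R :> R by rewrite ler1n.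
pose i0 := (Num.truncn (s1%:R * (100 * lnn h))).+1.
pose i1 := Num.truncn (s1%:R * (150 * lnn h - 3)).
have p1 : 0 <= s1%:R * (100 * lnn h) by apply: mulr_ge0; [exact: ltW|lra_of l1].
have p2 : 0 <= s1%:R * (150 * lnn h - 3) by apply: mulr_ge0; [exact: ltW|lra_of l1].
have /andP[a1 a2] := truncn_itv p1; have /andP[a3 a4] := truncn_itv p2.
have i0S : i0%:R = (Num.truncn (s1%:R * (100 * lnn h)))%:R + 1 :> R by rewrite /i0 -[_.+1%:R]natr1.
have i1S : i1.+1%:R = i1%:R + 1 :> R by rewrite -[_.+1%:R]natr1.
pose xi i : R := exp (i%:R / s1%:R).
have xlo i : (i0 <= i)%N -> h%:R ^+ 100 <= xi i.
  move=> ii; rewrite hpow_exp /xi ler_exp ler_pdivlMr // mulrC; apply: le_trans (ltW a2) _.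
  by rewrite ler_nat.
have xhi i : (i < i1)%N -> xi i * exp 3 <= h%:R ^+ 150.
  move=> ii; rewrite hpow_exp /xi -expD ler_exp.
  have : i%:R / s1%:R <= 150 * lnn h - 3.
    by rewrite ler_pdivrMr // mulrC; apply: le_trans a3; rewrite ler_nat ltnW.
  hlra.
have xS i : xi i * exp 1 = xi (i + s1)%N.
  by rewrite /xi -expD natrD; congr exp; field; rewrite gt_eqF.
have e3 : exp 1 * exp 2 = exp 3 by rewrite -expD; congr exp; ring.
have e12 : 1 <= exp 1 /\ 1 <= exp 2 by have := exp_ge1D 1; have := exp_ge1D 2; hlra.
have [e1 e2] := e12.
have xi0 i : 0 < xi i by exact: exp_gt0.
pose M := (2 * Q' * s1)%N.
have iM : (i1 + s1.*2 <= M)%N.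
  rewrite -(ler_nat R) natrD -mul2n !natrM.
  have : s1%:R * (150 * lnn h - 3) <= s1%:R * (2 * Q'%:R - 2) by rewrite ler_pM2l //; lra_of Ql150 QR'.
  by move=> q; lra_of q a3.
have VE i t : (i0 <= i)%N -> xi i * exp 1 <= h%:R ^+ 150 -> dser Z (xi i) (xi i * exp 1) f t = win s1 s1 (h ^ 150) (bt f h t) (i + s1.-1)%N.
  by move=> ii xx; rewrite win_blk //; exact: xlo.
(* [c = 0] and [c = s1] serve the two halves of the blocks [[x, e^2 x)]. *)
have SV (c : nat) : (c <= s1)%N -> (forall i, (i0 <= i < i1)%N -> xi (i + c)%N * exp 1 <= h%:R ^+ 150) ->
    \sum_(i0 <= i < i1) V (xi (i + c)%N) <= s1%:R * (19 * X + 2).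
  move=> cs hx.
  have -> : \sum_(i0 <= i < i1) V (xi (i + c)%N) = \sum_(i0 <= i < i1) \sum_(t <- ts) N2 (win s1 s1 (h ^ 150) (bt f h t) (i + (c + s1.-1))%N).
    apply: eq_big_nat => i ii; rewrite /V; apply: eq_bigr => t _; rewrite VE ?hx // ?addnA //.
    by apply: leq_trans (leq_addr _ _); case/andP: ii.
  rewrite exchange_big /=; apply: le_trans (_ : \sum_(t <- ts) \sum_(j < M) N2 (win s1 s1 (h ^ 150) (bt f h t) j) <= _).
    apply: ler_sum => t _; have -> : \sum_(i0 <= i < i1) N2 (win s1 s1 (h ^ 150) (bt f h t) (i + (c + s1.-1))%N) = \sum_(i0 + (c + s1.-1) <= i < i1 + (c + s1.-1)) N2 (win s1 s1 (h ^ 150) (bt f h t) i).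
      by rewrite big_addn addnK.
    apply: sub_sum_nat => //; apply: leq_trans iM; rewrite leq_add2l -addnn; apply: leq_add => //; exact: leq_pred.
  rewrite -ler_pdivrMl //; apply: le_trans SF; rewrite mulr_sumr; apply: ler_sum => t _; by [].
have V0 : \sum_(i0 <= i < i1) V (xi i) <= s1%:R * (19 * X + 2).
  apply: le_trans (SV 0%N (leq0n _) _).
    by rewrite le_eqVlt; apply/orP; left; apply/eqP; apply: eq_bigr => i _; rewrite addn0.
  move=> i /andP[_ ii]; rewrite addn0; apply: le_trans (xhi i ii); rewrite ler_pM2l // ler_exp; hlra.
have V1 : \sum_(i0 <= i < i1) V (xi i * exp 1) <= s1%:R * (19 * X + 2).
  under eq_bigr do rewrite xS.
  apply: SV => // i /andP[_ ii]; rewrite -xS; apply: le_trans (xhi i ii).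
  by rewrite -mulrA ler_pM2l // -e3 ler_pM2l // ler_exp; hlra.
have X0 : 0 <= X by rewrite /X; have := ltW KD0 => ?; have := ltW t0 => ?; apply: divr_ge0; [apply: mulr_ge0; lra_of l1|exact: mulr_ge0].
have c00 : 0 <= c0 by rewrite /c0 /cc; have := ltW eps0 => ?; pos.
have E0 : 0 <= E.
  have := ltW eta0 => ?; have : 0 <= A by lra_of A1. move=> ?; rewrite /E; pos.
pose cnt n := (\sum_(i0 <= i < i1) (i <= nu s1 n < i + s1)%N)%N.
pose G n : R := N2 (avgH f H n) / n%:R.
have G0 n : 0 <= G n by rewrite /G; pos.
have I1 : \sum_(1 <= n < Z) (cnt n)%:R * G n <= \sum_(i0 <= i < i1) (16 * (Q'%:R^-1 * (4 * c0 / theta + V (xi i) + V (xi i * exp 1))) + E).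
  apply: le_trans (_ : \sum_(i0 <= i < i1) \sum_(1 <= n < Z | xi i <= n%:R < xi i * exp 1) G n <= _).
    rewrite le_eqVlt; apply/orP; left; apply/eqP; under [in RHS]eq_bigr do rewrite big_mkcond /=.
    rewrite exchange_big /=; apply: eq_big_nat => n /andP[n0 _]; rewrite /cnt natr_sum mulr_suml; apply: eq_bigr => i _.
    rewrite xS ltNge /xi -!le_nu // -ltnNge; by case: (_ && _); rewrite ?mul1r ?mul0r.
  apply: ler_sum_nat => i /andP[ii ij]; apply: block_i; [exact: xlo|exact: xhi].
have core n : (i0 + s1 <= nu s1 n)%N -> (nu s1 n < i1)%N -> cnt n = s1.
  by move=> b1 b2; exact: count_block.
(* The [n] near the two ends, not covered [s1] times, are estimated trivially; their harmonic mass
   is at most [3 + 5]. *)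
have I2 : \sum_(h ^ 100 <= n < h ^ 150) G n <= 8 + s1%:R^-1 * \sum_(1 <= n < Z) (cnt n)%:R * G n.
  pose y1 : R := h%:R ^+ 100; pose y2 : R := h%:R ^+ 150 * exp (- (4)).
  have y10 : 0 < y1 by exact: hpow_gt0.
  have y20 : 0 < y2 by rewrite mulr_gt0 // hpow_gt0.
  have yy1 : y1 <= y1 * exp 2 by rewrite ler_peMr // ltW.
  have yy2 : y2 <= y2 * exp 4 by rewrite ler_peMr // ?ltW //; have := exp_ge1D 4; hlra.
  have U1 := harm_up1 Z y10 yy1; have U2 := harm_up1 Z y20 yy2.
  rewrite ln_mulexp // in U1; rewrite ln_mulexp // in U2.
  apply: le_trans (_ : \sum_(1 <= n < Z) ((if y1 <= n%:R < y1 * exp 2 then n%:R^-1 else 0) + (if y2 <= n%:R < y2 * exp 4 then n%:R^-1 else 0) + s1%:R^-1 * ((cnt n)%:R * G n)) <= _); last first.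
    rewrite !big_split /= -!big_mkcond -mulr_sumr lerD2r /=; lra_of U1 U2.
  have nn0 n : 0 <= (if y1 <= n%:R < y1 * exp 2 then n%:R^-1 else 0) + (if y2 <= n%:R < y2 * exp 4 then n%:R^-1 else 0) + s1%:R^-1 * ((cnt n)%:R * G n) :> R.
    apply: addr_ge0; last by have := G0 n => ?; pos.
    by apply: addr_ge0; case: ifP => // _; pos.
  have hZ : (h ^ 150 <= Z)%N by rewrite leq_pexp2l // h0.
  rewrite (big_nat_widen _ _ _ _ _ hZ) (big_nat_widenl _ _ _ _ _ (_ : (1 <= h ^ 100)%N)); last by rewrite expn_gt0 h0.
  rewrite big_mkcond /=; apply: ler_sum_nat => n /andP[n0 _]; case: ifP => // /andP[n2 n1].
  have nR : 0 < n%:R :> R by rewrite ltr0n.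
  have Gn : G n <= n%:R^-1 by rewrite /G -[X in _ <= X]mul1r; apply: ler_wpM2r; [rewrite invr_ge0|exact: N2_avgH_le1].
  have ni : 0 <= n%:R^-1 :> R by rewrite invr_ge0.
  have cG : 0 <= s1%:R^-1 * ((cnt n)%:R * G n) by have := G0 n => ?; pos.
  have y1n : y1 <= n%:R by rewrite /y1 -natrX ler_nat.
  have [b1|b1] := leqP (i0 + s1) (nu s1 n); last first.
    have -> : y1 <= n%:R < y1 * exp 2.
      rewrite y1n /=; move: b1; rewrite ltnNge le_nu // -ltNge => b1; apply: lt_le_trans b1 _.
      rewrite /y1 hpow_exp -expD ler_exp ler_pdivrMr // natrD i0S; lra_of a1 sR1.
    by apply: le_trans Gn _; rewrite -addrA lerDl addr_ge0 //; case: ifP.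
  have [b2|b2] := leqP i1 (nu s1 n).
    have -> : y2 <= n%:R < y2 * exp 4.
      apply/andP; split.
        move: b2; rewrite le_nu //; apply: le_trans.
        rewrite /y2 hpow_exp -expD ler_exp ler_pdivlMr //; move: a4; rewrite -/i1 i1S => q; lra_of q sR1.
      rewrite /y2 -mulrA -expD addNr exp_zero mulr1 -natrX ltr_nat; by [].
    apply: le_trans Gn _; rewrite addrC addrA lerDr addr_ge0 //; by case: ifP.
  rewrite (core n b1 b2) mulrA mulVf ?gt_eqF // mul1r lerDr; by apply: addr_ge0; case: ifP.
apply: le_trans I2 _.
have I3 : \sum_(i0 <= i < i1) (16 * (Q'%:R^-1 * (4 * c0 / theta + V (xi i) + V (xi i * exp 1))) + E) <=
   s1%:R * (50 * lnn h * (22 * c0 + E) + 32 * (Q'%:R^-1 * (19 * X + 2))).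
  have -> : \sum_(i0 <= i < i1) (16 * (Q'%:R^-1 * (4 * c0 / theta + V (xi i) + V (xi i * exp 1))) + E) =
    (i1 - i0)%:R * (16 * (Q'%:R^-1 * (4 * c0 / theta)) + E) + 16 * Q'%:R^-1 * (\sum_(i0 <= i < i1) V (xi i) + \sum_(i0 <= i < i1) V (xi i * exp 1)).
    rewrite -sum_const_rng -big_split /= mulr_sumr -big_split /=; apply: eq_bigr => i _; ring.
  have Ic : (i1 - i0)%:R <= s1%:R * (50 * lnn h).
    have [le01|le10] := leqP i1 i0; first by move: le01; rewrite -subn_eq0 => /eqP->; apply: mulr_ge0; [exact: ltW|lra_of l1].
    rewrite natrB; last exact: ltnW.
    move: a2 a3; rewrite -/i0 -/i1 => q1 q2; lra_of q1 q2 sR1.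
  have cb : 16 * (Q'%:R^-1 * (4 * c0 / theta)) <= 22 * c0.
    have -> : 16 * (Q'%:R^-1 * (4 * c0 / theta)) = 64 * c0 / PI by rewrite /theta; field; rewrite !gt_eqF // PI_gt0.
    have p3 := PI_ge3; rewrite ler_pdivrMr; last by lra_of p3.
    have : c0 * 3 <= c0 * PI by apply: ler_wpM2l.
    by move=> q; lra_of q c00.
  apply: le_trans (_ : s1%:R * (50 * lnn h) * (22 * c0 + E) + 16 * Q'%:R^-1 * (s1%:R * (19 * X + 2) + s1%:R * (19 * X + 2)) <= _).
    apply: lerD.
      apply: ler_pM => //; last by rewrite lerD2r.
      apply: addr_ge0 => //; have := ltW t0 => ?; pos.
    by apply: ler_wpM2l; [pos|exact: lerD].
  by rewrite le_eqVlt; apply/orP; left; apply/eqP; ring.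
have I4 := le_trans I1 I3.
rewrite -ler_pdivrMl // in I4.
apply: le_trans (lerD (lexx 8) I4) _.
have XQ : 32 * (Q'%:R^-1 * (19 * X + 2)) <= 608 * 100 * 1000 * lnn h / KD + 16.
  have -> : 32 * (Q'%:R^-1 * (19 * X + 2)) = 608 * (Q'%:R^-1 * X) + 64 / Q'%:R by ring.
  have b1 : 64 / Q'%:R <= 16 :> R by rewrite ler_pdivrMr //; lra_of QR'.
  have b2 : Q'%:R^-1 * X <= 100 * 1000 * lnn h / KD.
    have -> : Q'%:R^-1 * X = 300 * 1000 * lnn h / KD / PI by rewrite /X /theta; field; rewrite !gt_eqF // PI_gt0.
    have p3 := PI_ge3; rewrite ler_pdivrMr; last by lra_of p3.
    have : 0 <= lnn h / KD by apply: divr_ge0; [lra_of l1|exact: ltW].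
    have -> : 100 * 1000 * lnn h / KD * PI = lnn h / KD * (100 * 1000 * PI) by ring.
    have -> : 300 * 1000 * lnn h / KD = lnn h / KD * (100 * 1000 * 3) by ring.
    by move=> q0; apply: ler_wpM2l => //; lra_of p3.
  have -> : 608 * 100 * 1000 * lnn h / KD = 608 * (100 * 1000 * lnn h / KD) by ring.
  by apply: lerD => //; rewrite ler_pM2l.
by move: XQ; set u := 32 * _; set v := 50 * lnn h * _; set w := _ / KD; hlra.
Qed.
End LongBlock.

(** * Parameters and induction over scales *)

Definition ev (P : nat -> Prop) : Prop := exists h0, forall h, (h0 <= h)%N -> P h.

Lemma ev_and (P Q : nat -> Prop) : ev P -> ev Q -> ev (fun h => P h /\ Q h).
Proof.
move=> [a ha] [b hb]; exists (maxn a b) => h; rewrite geq_max => /andP[h1 h2]; split; [exact: ha|exact: hb].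
Qed.

Lemma ev_ge (n : nat) : ev (fun h => (n <= h)%N). Proof. by exists n. Qed.

Lemma ev_geR (r : R) : ev (fun h => r <= h%:R).
Proof. by have [n hn] := nat_above r; exists n => h hh; apply: le_trans hn _; rewrite ler_nat. Qed.

Lemma ev_lnn (r : R) : ev (fun h => r <= lnn h).
Proof.
have [n hn] := nat_above (exp r); exists n.+1 => h hh.
have hp : 0 < h%:R :> R by rewrite ltr0n; apply: leq_trans hh.
by rewrite /lnn ln_ge_exp //; apply: le_trans hn _; rewrite ler_nat ltnW.
Qed.

Lemma ev_lin (c d : R) : 0 <= c -> ev (fun h => c * lnn h + d <= h%:R).
Proof.
move=> c0; have [n hn] := nat_above ((2 * c + `|d| + 1) ^+ 2); exists n.+1 => h hh.
have hn' : (2 * c + `|d| + 1) ^+ 2 <= h%:R by apply: le_trans hn _; rewrite ler_nat ltnW.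
have d0 : 0 <= `|d| by [].
have dd : d <= `|d| by exact: ler_norm.
have h1 : 1 <= h%:R :> R by rewrite ler1n; apply: leq_trans hh.
have l := ln_le_sqrt h1.
have sq : 2 * c + `|d| + 1 <= Num.sqrt h%:R.
  rewrite -(ger0_norm (_ : 0 <= 2 * c + `|d| + 1)); last by lra.
  by rewrite -sqrtr_sqr ler_sqrt //; lra.
have e : h%:R = Num.sqrt h%:R * Num.sqrt h%:R :> R by rewrite -expr2 sqr_sqrtr //; lra.
rewrite [X in _ <= X]e /lnn; move: sq l; set q := Num.sqrt _ => sq l.
have l2 : c * ln h%:R <= c * (2 * q) by exact: ler_wpM2l.
have : (2 * c + `|d| + 1) * q <= q * q by apply: ler_wpM2r; lra.
have : `|d| <= `|d| * q by rewrite ler_peMr //; lra.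
nra.
Qed.

Lemma ev_pow2 : ev (fun h => (h ^ 51 <= 2 ^ h)%N).
Proof.
have c0 : (0 : R) <= 102 by lra.
have [a ha] := ev_lin 0 c0; exists a.+1 => h hh.
have h0 : (0 < h)%N by apply: leq_trans hh.
have hp : 0 < h%:R :> R by rewrite ltr0n.
have := ha h (ltnW hh); rewrite addr0 => l.
have two0 : (0 : R) < 2 by lra.
have l2 := ln_ge two0.
rewrite -(ler_nat R) !natrX -[h%:R in X in X <= _](lnK hp) -[2 in X in _ <= X](lnK two0) -!expMn ler_exp.
rewrite -/(lnn h); have : h%:R * (1 - 2^-1) <= h%:R * ln 2 by apply: ler_wpM2l.
lra.
Qed.

(** [J] is the last level below [10 log h]. The next [G] is the cube of this one, and its being too
    large gives the bound by [G^27]. *)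
Lemma level_ex D h : (0 < D)%N -> (Gs D 0 ^ 9)%:R <= 10 * lnn h ->
  exists J, (Gs D J ^ 9)%:R <= 10 * lnn h /\ 10 * lnn h <= (Gs D J)%:R ^+ 27.
Proof.
move=> D0 g0.
pose P j := 10 * lnn h < (Gs D j ^ 9)%:R.
have exP : exists j, P j.
  have [n hn] := nat_above (10 * lnn h); exists n; rewrite /P; apply: le_lt_trans hn _.
  rewrite ltr_nat; apply: leq_trans (ltn_expl n (isT : (1 < 2)%N)) _.
  by apply: leq_trans (Gs_ge2 n D0) _; rewrite -{1}[Gs D n]expn1 leq_pexp2l // Gs_gt0.
have [m Pm mm] := ex_minnP exP.
case: m Pm mm => [|J] Pm mm; first by have := lt_le_trans Pm g0; rewrite ltxx.
exists J; split; first by rewrite leNgt; apply/negP => /mm; rewrite ltnn.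
by move: Pm; rewrite /P Gs_S -expnM natrX => /ltW.
Qed.

(** Non-pretentiousness of one twisted function as divergence uniform in [|t| <= 3 N]; the short
    averages use it with [N = h^150]. *)
Definition unpret (f : nat -> CC) : Prop := forall K : R, exists N0, forall N, (N0 <= N)%N -> forall t : R, `|t| <= 3 * N%:R ->
  K <= \sum_(1 <= p < N.+1 | prime p) p%:R^-1 * (1 - cre (f p * eix (- (t * lnn p)))).

(** Primes between [h] and [h^150] contribute at most [2/p] each, and Mertens' bound divided by
    [log h] limits their total to 600. Thus frequencies may be as large as [h^150] although [H2]
    uses only primes up to [h]. *)
Lemma dist_restrict (f : nat -> CC) (h : nat) (t : R) : (forall n, N2 (f n) <= 1) -> 1 <= lnn h -> (0 < h)%N ->
  \sum_(1 <= p < (h ^ 150).+1 | prime p) p%:R^-1 * (1 - cre (f p * eix (- (t * lnn p)))) - 600 <=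
  \sum_(1 <= p < h.+1 | prime p) p%:R^-1 * (1 - cre (f p * eix (- (t * lnn p)))).
Proof.
move=> f1 l1 h0; have hp : 0 < h%:R :> R by rewrite ltr0n.
pose F p : R := p%:R^-1 * (1 - cre (f p * eix (- (t * lnn p)))).
have hh : (h.+1 <= (h ^ 150).+1)%N by rewrite ltnS -{1}[h]expn1 leq_pexp2l.
rewrite (big_cat_nat (n := h.+1)) //= lerBlDr lerD2l.
have Fle p : F p <= 2 * p%:R^-1.
  have : - 1 <= cre (f p * eix (- (t * lnn p))).
    have := cre_le_cabs (f p * eix (- (t * lnn p))); rewrite cabsM cabs_eix mulr1 => c.
    have := le_trans c (cabs_le1 (f1 p)); rewrite ler_norml => /andP[]; by [].
  rewrite /F [p%:R^-1 * _]mulrC => c; apply: ler_wpM2r; [by rewrite invr_ge0|lra].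
apply: le_trans (_ : \sum_(h.+1 <= p < (h ^ 150).+1 | prime p) 2 / lnn h * (lnn p / p%:R) <= _).
  rewrite big_nat_cond [X in _ <= X]big_nat_cond; apply: ler_sum => p /andP[/andP[p1 _] _].
  have p0 : (0 < p)%N by apply: leq_trans p1.
  apply: le_trans (Fle p) _; rewrite mulrA; apply: ler_wpM2r; first by rewrite invr_ge0.
  rewrite mulrAC ler_pdivlMr; last by lra.
  by rewrite ler_pM2l ?ltr0n //; apply: ler_lnn => //; exact: ltnW.
rewrite -mulr_sumr.
have h150 : (0 < h ^ 150)%N by rewrite expn_gt0 h0.
have S := sum_lnp_le h150.
have e : lnn (h ^ 150) = 150 * lnn h by rewrite /lnn natrX ln_pow.
rewrite e in S.
apply: le_trans (_ : 2 / lnn h * (2 * (150 * lnn h)) <= _); last first.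
  have -> : 2 / lnn h * (2 * (150 * lnn h)) = 600 by field; rewrite gt_eqF //; lra.
  by [].
apply: ler_wpM2l; first by apply: divr_ge0; lra.
apply: le_trans S; rewrite [X in _ <= X](big_cat_nat (n := h.+1)) //= lerDr.
rewrite big_nat_cond; apply: sumr_ge0 => p /andP[/andP[p1 _] _].
by apply: divr_ge0 => //; exact: lnn_ge0.
Qed.

(* [hle] and [heq] keep hypotheses with large constants out of the sight of [lra]. *)
Definition hle (x y : R) : Prop := x <= y.

Lemma inv_le (c eps x : R) : 0 < eps -> 0 < c -> 0 < x -> hle (c / eps) x -> x^-1 <= eps / c.
Proof.
by move=> e0 c0 x0 h; rewrite -[X in _ <= X]invf_div lef_pV2 ?posrE ?divr_gt0.
Qed.

Lemma arith_DK (eps d k : R) : 0 < eps -> d <= eps / (20 * 1000 * 1000) -> k <= eps / (3 * 1000 * 1000) ->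
  22 * (1728 * (30 * d + 6 * k) + eps / 300) <= eps * (22 / 100).
Proof. lra. Qed.

Lemma arith_A (eps A : R) : 0 < eps -> eps <= 1 -> A = 11 * 1000 * 1000 / eps ->
  A^-1 <= eps / (10 * 1000 * 1000) /\ (A ^+ 2)^-1 <= eps / (10 * 1000 * 1000).
Proof.
move=> e0 e1 AE.
have Ai : A^-1 = eps / (11 * 1000 * 1000) by rewrite AE invf_div.
have Ai1 : A^-1 <= eps / (10 * 1000 * 1000) by rewrite Ai; lra.
have Ai2 : A^-1 <= 1 by lra.
have Ai0 : 0 <= A^-1 by rewrite Ai; lra.
split=> //; rewrite -exprVn expr2; apply: le_trans Ai1; exact: ler_piMl.
Qed.

Lemma arith_AH (eps eta A H : R) : 0 < eps -> 0 < A -> 0 < eta -> 0 < H -> A^-1 <= eps / (10 * 1000 * 1000) -> eps <= 1 ->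
  16 / (eta * eps) <= H -> (A * (eta * H))^-1 <= eps / (160 * 1000 * 1000).
Proof.
move=> e0 A0 eta0 H0 Ai e1 h16; rewrite invfM.
have b : (eta * H)^-1 <= eps / 16.
  have c16 : (0 : R) < 16 by lra.
  apply: inv_le => //; first exact: mulr_gt0.
  rewrite /hle ler_pdivrMr //; move: h16; rewrite ler_pdivrMr ?mulr_gt0 //; lra.
have b0 : 0 <= (eta * H)^-1 by rewrite invr_ge0 mulr_ge0 // ltW.
apply: le_trans (ler_pM _ b0 Ai b) _; first by rewrite invr_ge0 ltW.
have : eps * eps <= eps by rewrite ger_pMr.
have -> : eps / (10 * 1000 * 1000) * (eps / 16) = eps * eps / (160 * 1000 * 1000) by field.
lra.
Qed.

Lemma arith_sq (eps eta H X : R) : 0 < eps -> eps <= 1 -> eta = eps / 2880 -> 0 < H -> 0 < X -> 600 / eps <= H -> 96 * H / eps <= X ->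
  (30 * eta + 6 / H + H / X) ^+ 2 <= eps / 32.
Proof.
move=> e0 e1 -> H0 X0 h6 hX.
have c600 : (0 : R) < 600 by lra.
have a4 := inv_le e0 c600 H0 h6.
have a5 : H / X <= eps / 96 by move: hX; rewrite !ler_pdivrMr // => hX; lra.
have a5' : 0 <= H / X by apply: divr_ge0; exact: ltW.
have a4' : 0 < H^-1 by rewrite invr_gt0.
move: a4 a5 a5' a4'; set u := H / X; set v := H^-1 => a4 a5 a5' a4'; clear - e0 e1 a4 a5 a5' a4'.
have b1 : 30 * (eps / 2880) + 6 * v + u <= eps / 32 by lra.
have b0 : 0 <= 30 * (eps / 2880) + 6 * v + u by lra.
apply: le_trans (_ : (eps / 32) ^+ 2 <= _).
  by rewrite ler_pXn2r ?nnegrE //; lra.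
rewrite expr2; nra.
Qed.

Lemma arith_sum (eps dk s a c : R) : dk <= eps * (22 / 100) -> s <= eps / 32 -> a <= eps / (10 * 1000 * 1000) ->
  c <= eps / (160 * 1000 * 1000) -> 0 < eps ->
  dk + (4 * s + 8 * (16 * (5184 * a + 15 * 1037 * c) + 2 * a)) <= eps / 2.
Proof. lra. Qed.

Lemma final_arith (eps l u k : R) : 24 <= 12 * (eps * l) -> u <= 50 * l * (eps / 2) -> 0 < l -> k <= eps / (5 * 1000 * 1000) ->
  24 + u + 608 * 100 * 1000 * l * k <= 50 * eps * l.
Proof.
move=> h1 h2 l0 hk.
have : 608 * 100 * 1000 * l * k <= 608 * 100 * 1000 * l * (eps / (5 * 1000 * 1000)) by apply: ler_wpM2l => //; lra.
have -> : 608 * 100 * 1000 * l * (eps / (5 * 1000 * 1000)) = 608 / 50 * (eps * l) by field.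
move: h2; have -> : 50 * l * (eps / 2) = 25 * (eps * l) by field.
have -> : 50 * eps * l = 50 * (eps * l) by ring.
by move: h1; move: (eps * l) (608 * 100 * 1000 * l * k) => w v; lra.
Qed.

Lemma block_arith (eps ep eta A KD l H K D X : R) : 0 < eps -> eps <= 1 -> ep = eps / 300 -> eta = eps / 2880 ->
  A = 11 * 1000 * 1000 / eps -> hle (5 * 1000 * 1000 / eps) KD -> 2 / eps <= l -> 600 / eps <= H -> 16 / (eta * eps) <= H ->
  hle (3 * 1000 * 1000 / eps) K -> hle (20 * 1000 * 1000 / eps) D -> 96 * H / eps <= X -> 0 < H -> 0 < K -> 0 < D -> 0 < X -> 0 < KD -> 0 < A ->
  24 + 50 * l * (22 * (1728 * (30 / D + 6 / K) + ep) + (4 * (30 * eta + 6 / H + H / X) ^+ 2 + 8 * (16 * (5184 / A ^+ 2 + 15 * 1037 / (A * (eta * H))) + 2 / A ^+ 2)))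
   + 608 * 100 * 1000 * l / KD <= 50 * eps * l.
Proof.
move=> e0 e1 epE etaE AE hKD hl h600 h16 hK hD hX H0 K0 D0 X0 KD0 A0.
have l0 : 0 < l by apply: lt_le_trans hl; rewrite divr_gt0 // ltr0n.
have eta0 : 0 < eta by rewrite etaE divr_gt0 // ltr0n.
have a1 : 24 <= 12 * (eps * l) by move: hl; clear -e0; rewrite ler_pdivrMr //; lra.
have [A1 A2] := arith_A e0 e1 AE.
have A3 := arith_AH e0 A0 eta0 H0 A1 e1 h16.
have S := arith_sq e0 e1 etaE H0 X0 h600 hX.
have DK : 22 * (1728 * (30 / D + 6 / K) + ep) <= eps * (22 / 100).
  by rewrite epE; apply: arith_DK => //; apply: inv_le => //; clear; lra.
have c1 := arith_sum DK S A2 A3 e0.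
apply: final_arith => //; last by apply: inv_le => //; clear; lra.
by apply: ler_wpM2l c1; apply: mulr_ge0; [exact: ler0n|exact: ltW].
Qed.

Lemma KD_ex (eps : R) : 0 < eps -> exists KD : R, hle (5 * 1000 * 1000 / eps) KD /\ 0 < KD.
Proof. by move=> e0; eexists; split; [exact: lexx|apply: divr_gt0 => //; lra]. Qed.

Lemma harm_nat (a b : nat) : (0 < a)%N -> (a <= b)%N -> \sum_(a <= m < b.+1) (m%:R^-1 : R) <= a%:R^-1 + (lnn b - lnn a).
Proof.
move=> a0 /subnKC <-; elim: (b - a)%N => [|k IH]; first by rewrite addn0 big_nat1 subrr addr0.
rewrite addnS big_nat_recr ?leqW ?leq_addr //=; apply: le_trans (lerD IH (lexx _)) _.
have := @lnnS_ge (a + k)%N; rewrite addn_gt0 a0 => /(_ isT).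
set u := _.+1%:R^-1; lra.
Qed.

Lemma big_div (eps : R) : 0 < eps -> eps <= 1 -> 1 <= 11 * 1000 * 1000 / eps.
Proof. by move=> e0 e1; rewrite ler_pdivlMr; lra. Qed.

Definition heq (x y : R) : Prop := x = y.

Lemma A_ex (eps : R) : 0 < eps -> eps <= 1 -> exists A : R, heq A (11 * 1000 * 1000 / eps) /\ 1 <= A.
Proof. by move=> e0 e1; eexists; split; [reflexivity|exact: big_div]. Qed.

Lemma add3_le (a b c d : R) : a + b + c <= d -> 0 <= a -> 0 <= b -> 0 <= c -> [/\ a <= d, b <= d & c <= d].
Proof. by move=> *; split; lra. Qed.

Lemma half_le1 (x : R) : x <= 1 / 2 -> x <= 1.
Proof. lra. Qed.

Lemma log_tail_arith (u v a b c : R) : u <= 1 -> v <= 1 -> c <= 150 * b -> b - a <= v -> u + (c - 150 * a) <= 151.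
Proof. lra. Qed.

Lemma al_ex : exists al : R, 0 < al /\ 1510 * al <= 1.
Proof. by exists (2000)^-1; lra. Qed.

Lemma small_ex (n : nat) (eps : R) : (1 < n)%N -> 0 < eps -> eps <= 1 -> exists x : R, [/\ heq x (eps / n%:R), 0 < x & x <= 1 / 2].
Proof.
move=> n1 e0 e1; exists (eps / n%:R).
have n0 : 0 < n%:R :> R by rewrite ltr0n ltnW.
have n2 : 2 <= n%:R :> R by rewrite ler_nat.
split=> //; first by rewrite divr_gt0.
by rewrite ler_pdivrMr //; lra.
Qed.

Section ShortMean.
Variable f : nat -> CC.
Hypothesis f1 : forall n, N2 (f n) <= 1.
Hypothesis fM : forall m n, (0 < m)%N -> (0 < n)%N -> f (m * n)%N = f m * f n.
Hypothesis fp : forall p, prime p -> N2 (f p) = 1 \/ f p = 0.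
Hypothesis fu : unpret f.

Lemma block_at (h D K H : nat) (eps ep al eta A KD b0 : R) :
  0 < eps -> eps <= 1 -> 0 < al -> 1510 * al <= 1 -> heq ep (eps / 300) -> 0 < ep -> ep <= 1 -> heq eta (eps / 2880) -> 0 < eta -> eta <= 1 / 2 ->
  heq A (11 * 1000 * 1000 / eps) -> 1 <= A -> hle (5 * 1000 * 1000 / eps) KD -> 0 < KD ->
  hle (3 * 1000 * 1000 / eps) K%:R -> hle (20 * 1000 * 1000 / eps) D%:R -> (0 < K)%N -> (1 < D)%N -> (0 < H)%N ->
  (forall j, goodG al ep K (Gs D j)%:R) -> heq b0 (Gs D 0 ^ 9)%:R ->
  16 / (eta * eps) <= H%:R -> 8 * A * exp b0 / eta <= H%:R -> 600 / eps <= H%:R ->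
  (23 <= h)%N -> 1 <= lnn h -> (h ^ 51 <= 2 ^ h)%N -> b0 / 10 <= lnn h -> 700 * lnn h + 5 <= h%:R -> 50 * lnn h + 1 <= h%:R ->
  H.+1%:R + 6 * exp b0 + 96 * H%:R / eps <= h%:R ->
  (forall t : R, `|t| <= 3 * (h ^ 150)%:R -> 600 + KD <= \sum_(1 <= p < (h ^ 150).+1 | prime p) p%:R^-1 * (1 - cre (f p * eix (- (t * lnn p))))) ->
  2 / eps <= lnn h ->
  \sum_(h ^ 100 <= n < h ^ 150) N2 (avgH f H n) / n%:R <= 50 * eps * lnn h.
Proof.
move=> e0 e1 al0 al1 epE ep0 ep1 etaE eta0 eta1 AE A1 KDE KD0 KR DR K0 D2 H0 gG b0E p16 p8 p600 h23 lnh1 hJ lb0 l700 l50 hbig hN h24.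
have A0 : 0 < A by exact: lt_le_trans A1.
have HR0 : 0 < H%:R :> R by rewrite ltr0n.
have hp : 23 <= h%:R :> R by rewrite ler_nat.
have h1 : 1 <= h%:R :> R by rewrite ler1n; exact: leq_trans h23.
have hpw m : (0 < m)%N -> h%:R <= h%:R ^+ m :> R by move=> m0; rewrite -{1}[h%:R]expr1 ler_weXn2l.
have g0 : (Gs D 0 ^ 9)%:R <= 10 * lnn h by move: lb0; rewrite b0E ler_pdivrMr ?ltr0n // mulrC.
have [J [GJ1 GJ2]] := level_ex (ltnW D2) g0.
have p700 : 0 <= 700 * lnn h by apply: mulr_ge0 => //; exact: le_trans lnh1.
have /andP[t1 t2] := truncn_itv p700.
(* Four more than the integer part, so that both [700 log h <= Q'] and [4 <= Q'] hold. *)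
pose Q' := ((Num.truncn (700 * lnn h)).+4)%N.
have QS : Q'%:R = (Num.truncn (700 * lnn h))%:R + 4 :> R by rewrite /Q' -addn4 natrD.
have tS : (Num.truncn (700 * lnn h)).+1%:R = (Num.truncn (700 * lnn h))%:R + 1 :> R by rewrite -[_.+1%:R]natr1.
rewrite tS in t2.
have Qh : (Q' <= h)%N.
  rewrite -(ler_nat R) QS; apply: le_trans l700; apply: lerD => //; by rewrite ler_nat.
have Ql : 700 * lnn h <= Q'%:R.
  by rewrite QS; apply: le_trans (ltW t2) _; rewrite lerD2l ler1n.
have hS : 1 + 50 * lnn h <= h%:R by rewrite addrC.
have h96 : 0 <= 96 * H%:R / eps by have := ltW e0 => ?; pos.
have hH1 : 0 <= H.+1%:R :> R by [].
have eb : 0 <= 6 * exp b0 by apply: mulr_ge0.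
have [k1 k2 k3] : [/\ H.+1%:R <= h%:R :> R, 6 * exp b0 <= h%:R & 96 * H%:R / eps <= h%:R] by exact: add3_le.
have HX : H.+1%:R <= h%:R ^+ 100 :> R by exact: le_trans (hpw 100%N isT).
have h3 : 6 <= h%:R ^+ 100 * exp (- (Gs D 0 ^ 9)%:R).
  by rewrite -b0E expN ler_pdivlMr //; apply: le_trans (hpw 100%N isT).
have hD t : `|t| <= 3 * h%:R ^+ 150 -> KD <= \sum_(p <- [seq p <- index_iota 1 h.+1 | prime p]) p%:R^-1 * (1 - cre (f p * eix (- (t * lnn p)))).
  move=> tb; rewrite big_filter; apply: le_trans (dist_restrict _ f1 lnh1 _); last by exact: leq_trans h23.
  by have := hN t; rewrite natrX lerBrDl => /(_ tb).
have hHA : 4 * A / (eta * H%:R) <= exp (- (Gs D 0 ^ 9)%:R) / 2.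
  rewrite -b0E expN -invfM ler_pdivrMr ?mulr_gt0 //.
  rewrite [X in _ <= X]mulrC ler_pdivlMr ?mulr_gt0 ?ltr0n //.
  move: p8; rewrite ler_pdivrMr // => p8; apply: le_trans (_ : 8 * A * exp b0 <= _); last by rewrite [X in _ <= X]mulrC.
  by rewrite le_eqVlt; apply/orP; left; apply/eqP; ring.
have LB := @long_block f h D K J Q' H al ep eta A KD f1 fM fp h23 lnh1 hJ al0 al1 ep0 ep1 D2 K0 gG GJ1 GJ2 isT Qh Ql hS KD0 hD H0 HX eta0 eta1 A1 hHA h3.
apply: le_trans LB _.
have p96 : 96 * H%:R / eps <= h%:R ^+ 100 by apply: le_trans (hpw 100%N isT).
have KR0 : 0 < K%:R :> R by rewrite ltr0n.
have DR0 : 0 < D%:R :> R by rewrite ltr0n ltnW.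
have h100 : 0 < h%:R ^+ 100 :> R by apply: exprn_gt0; exact: lt_le_trans h1.
exact: (@block_arith eps ep eta A KD (lnn h) H%:R K%:R D%:R (h%:R ^+ 100)).
Qed.

(** Order of choice: [KD], [A], [eta] and the level parameters from [eps], then [H] in terms of the
    size [b0] of the first level, then [h]. *)
Lemma block_mean (eps : R) : 0 < eps -> eps <= 1 -> exists H, (0 < H)%N /\
  ev (fun h => \sum_(h ^ 100 <= n < h ^ 150) N2 (avgH f H n) / n%:R <= 50 * eps * lnn h).
Proof.
move=> e0 e1.
have [al [al0 al1]] : exists al : R, 0 < al /\ 1510 * al <= 1 by exact: al_ex.
have [ep [epE ep0 ep1]] := small_ex (isT : (1 < 300)%N) e0 e1.
have [eta [etaE eta0 eta1]] := small_ex (isT : (1 < 2880)%N) e0 e1.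
have [A [AE A1]] := A_ex e0 e1.
have [KD [KDE KD0]] := KD_ex e0.
have [K' hK'] := nat_above (3 * 1000 * 1000 / eps).
have KR : hle (3 * 1000 * 1000 / eps) K'.+1%:R by apply: le_trans hK' _; rewrite ler_nat.
have [G0 hG0] := goodG_ex K'.+1 al0 ep0.
have [D' hD'] := nat_above (20 * 1000 * 1000 / eps); have [D1 hD1] := nat_above G0.
have DR : hle (20 * 1000 * 1000 / eps) (D' + D1).+2%:R by apply: le_trans hD' _; rewrite ler_nat !leqW // leq_addr.
have DG : G0 <= (D' + D1).+2%:R by apply: le_trans hD1 _; rewrite ler_nat !leqW // leq_addl.
have D2 : (1 < (D' + D1).+2)%N by [].
move: (D' + D1).+2 DR DG D2 => D DR DG D2.
have K0 : (0 < K'.+1)%N by [].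
move: K'.+1 KR hG0 K0 => K KR hG0 K0.
have gG j : goodG al ep K (Gs D j)%:R.
  apply: hG0; apply: le_trans DG _.
  by rewrite ler_nat; apply: leq_trans (Gs_ge j (ltnW D2)); rewrite leq_pmulr // expn_gt0.
have [b0 b0E] : exists b0 : R, heq b0 (Gs D 0 ^ 9)%:R by eexists; reflexivity.
have [Ha hHa] := nat_above (16 / (eta * eps)).
have [Hb hHb] := nat_above (8 * A * exp b0 / eta).
have [Hc hHc] := nat_above (600 / eps).
pose H := (Ha + Hb + Hc).+1; exists H; split=> //.
have [N0 hN0] := fu (600 + KD).
have c700 : (0 : R) <= 700 by exact: ler0n.
have c50 : (0 : R) <= 50 by exact: ler0n.
have [h0 hh0] := ev_and (ev_ge 23) (ev_and (ev_lnn 1) (ev_and ev_pow2 (ev_and (ev_lnn (b0 / 10)) (ev_and (ev_lin 5 c700) (ev_and (ev_lin 1 c50) (ev_and (ev_geR (H.+1%:R + 6 * exp b0 + 96 * H%:R / eps)) (ev_and (ev_ge N0) (ev_lnn (2 / eps))))))))).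
exists h0 => h hh; have [h23 [lnh1 [hJ [lb0 [l700 [l50 [hbig [hN h24]]]]]]]] := hh0 h hh.
apply: (@block_at h D K H eps ep al eta A KD b0) => //.
- exact: half_le1.
- by apply: le_trans hHa _; rewrite ler_nat /H -addnA leqW // leq_addr.
- by apply: le_trans hHb _; rewrite ler_nat /H leqW // addnAC leq_addl.
- by apply: le_trans hHc _; rewrite ler_nat /H leqW // leq_addl.
- move=> t; apply: hN0; apply: leq_trans hN _; rewrite -{1}[h]expn1 leq_pexp2l //; exact: leq_trans h23.
Qed.

(** Strong induction on [N]. With [h] maximal such that [h^150 <= N], the part below [h^100] is the
    induction hypothesis, the middle part is [block_mean], and the part from [h^150] to [N] has
    harmonic mass at most 151. In units of [e log h] the account is [200 + 50 + 50 = 2 * 150]. *)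
Lemma short_mean (eps : R) : 0 < eps -> exists H, (0 < H)%N /\ exists C : R, forall N, (0 < N)%N ->
  \sum_(1 <= n < N.+1) N2 (avgH f H n) / n%:R <= C + eps * lnn N.
Proof.
move=> ep0; pose e : R := Num.min (eps / 2) 1.
have e0 : 0 < e by rewrite lt_min ltr01 andbT divr_gt0 // ltr0n.
have e1 : e <= 1 by rewrite ge_min lexx orbT.
have e2 : 2 * e <= eps by have : e <= eps / 2 by [rewrite ge_min lexx]; lra.
have [H [H0 BM]] := block_mean e0 e1; exists H; split=> //.
have [h1 hh1] := ev_and BM (ev_and (ev_lnn (151 / (50 * e))) (ev_and (ev_lnn 1) (ev_ge 2))).
pose G n : R := N2 (avgH f H n) / n%:R.
have G0 n : 0 <= G n by rewrite /G; pos.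
have Gle n : G n <= n%:R^-1 by rewrite /G -[X in _ <= X]mul1r; apply: ler_wpM2r; [rewrite invr_ge0|exact: N2_avgH_le1].
pose h2 := maxn h1 2.
exists (\sum_(1 <= n < (h2 ^ 150).+1) G n); set C := \sum_(_ <= _ < _) _.
have mono a b : (a <= b)%N -> \sum_(1 <= n < a.+1) G n <= \sum_(1 <= n < b.+1) G n.
  by move=> ab; rewrite [X in _ <= X](big_cat_nat (n := a.+1)) //= lerDl; apply: sumr_ge0.
suff main N : (0 < N)%N -> \sum_(1 <= n < N.+1) G n <= C + 2 * e * lnn N.
  move=> N N0; apply: le_trans (main N N0) _; rewrite lerD2l; apply: ler_wpM2r => //; exact: lnn_ge0.
elim/ltn_ind: N => N IH N0.
have [NC|NC] := leqP N (h2 ^ 150).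
  apply: le_trans (mono _ _ NC) _; rewrite lerDl; have := lnn_ge0 N0 => ?; have := ltW e0 => ?; pos.
have exh : exists h, (N < h.+1 ^ 150)%N.
  by exists N; apply: leq_trans (ltnSn N) _; rewrite -{1}[N.+1]expn1 leq_pexp2l.
have [h hN hmin] := ex_minnP exh.
have hle : (h ^ 150 <= N)%N.
  case: h hN hmin => [|h] hN hmin; first by rewrite exp0n.
  by rewrite leqNgt; apply/negP => /hmin; rewrite ltnn.
have hh2 : (h2 <= h)%N.
  by rewrite -ltnS -(ltn_exp2r _ _ (isT : (0 < 150)%N)); exact: ltn_trans NC hN.
have [B [l151 [l1 h2']]] := hh1 h (leq_trans (leq_maxl _ _) hh2).
have h0 : (0 < h)%N by exact: leq_trans h2'.
have hp : 0 < h%:R :> R by rewrite ltr0n.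
have lN : 150 * lnn h <= lnn N.
  have := ler_lnn (_ : (0 < h ^ 150)%N) hle; rewrite expn_gt0 h0 => /(_ isT).
  by rewrite /lnn natrX ln_pow.
have a1 : (0 < h ^ 100)%N by rewrite expn_gt0 h0.
have a2 : (h ^ 100 <= h ^ 150)%N by rewrite leq_pexp2l.
have a3 : (h ^ 100 < N)%N.
  by apply: leq_trans hle; rewrite ltn_exp2l.
rewrite (big_cat_nat (n := h ^ 100)) ?(leqW (ltnW a3)) //= [X in _ + X](big_cat_nat (n := h ^ 150)) ?(leqW hle) //=.
have b1 : \sum_(1 <= i < h ^ 100) G i <= C + 2 * e * (100 * lnn h).
  apply: le_trans (_ : \sum_(1 <= i < (h ^ 100).+1) G i <= _).
    by rewrite [X in _ <= X](big_cat_nat (n := h ^ 100)) //= lerDl; apply: sumr_ge0.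
  apply: le_trans (IH _ a3 a1) _; by rewrite {1}/lnn natrX ln_pow.
have b3 : \sum_(h ^ 150 <= i < N.+1) G i <= 151.
  apply: le_trans (_ : \sum_(h ^ 150 <= i < N.+1) i%:R^-1 <= _); first by apply: ler_sum.
  have a4 : (0 < h ^ 150)%N by rewrite expn_gt0 h0.
  apply: le_trans (harm_nat a4 hle) _.
  have c1 : (h ^ 150)%:R^-1 <= 1 :> R by rewrite invf_le1 ?ltr0n // ler1n.
  have c2 : lnn N <= 150 * lnn h.+1.
    have := ler_lnn N0 (ltnW hN); by rewrite /lnn natrX ln_pow ?ltr0n.
  have c3 : lnn (h ^ 150) = 150 * lnn h by rewrite /lnn natrX ln_pow.
  have c4 := lnnS_le h0.
  have c5 : h%:R^-1 <= 1 :> R by rewrite invf_le1 // ler1n.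
  rewrite c3; apply: (log_tail_arith c1 c5 c2); exact: c4.
have l151' : 151 <= 50 * e * lnn h by move: l151; rewrite ler_pdivrMr ?mulr_gt0 ?ltr0n //; lra.
have lN' : 2 * e * (150 * lnn h) <= 2 * e * lnn N by apply: ler_wpM2l => //; lra.
have B' : \sum_(h ^ 100 <= i < h ^ 150) G i <= 50 * e * lnn h := B.
lra_of b1 b3 l151' lN' B'.
Qed.
End ShortMean.

(** * Logarithmic averages of shifted and dilated sequences *)

Definition lsum (F : nat -> R) (N : nat) : R := \sum_(1 <= n < N.+1) F n / n%:R.
(** Comparison of logarithmic averages up to a bounded error in the unnormalised sums. With a
    constant [G] it bounds the upper logarithmic mean of [F], in a form that composes without
    limits. *)
Definition dom (F G : nat -> R) : Prop := exists C : R, forall N, lsum F N <= C + lsum G N.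

Lemma lsumS F N : lsum F N.+1 = lsum F N + F N.+1 / N.+1%:R.
Proof. by rewrite /lsum big_nat_recr. Qed.

Lemma lsum0 F : lsum F 0 = 0.
Proof. by rewrite /lsum big_geq. Qed.

Lemma lsum_mono F N M : (forall n, 0 <= F n) -> (N <= M)%N -> lsum F N <= lsum F M.
Proof.
move=> F0 NM; rewrite /lsum [X in _ <= X](big_cat_nat (n := N.+1)) //= lerDl.
by apply: sumr_ge0 => n _; rewrite divr_ge0.
Qed.

Lemma dom_le F G : (forall n, (0 < n)%N -> F n <= G n) -> dom F G.
Proof.
move=> h; exists 0 => N; rewrite add0r /lsum big_nat_cond [X in _ <= X]big_nat_cond; apply: ler_sum => n /andP[/andP[n0 _] _].
by apply: ler_wpM2r; rewrite ?invr_ge0 // h.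
Qed.

Lemma dom_trans G F K : dom F G -> dom G K -> dom F K.
Proof. by move=> [C h] [D k]; exists (C + D) => N; rewrite -addrA; apply: le_trans (h N) _; rewrite lerD2l. Qed.

Lemma domD F G F' G' : dom F G -> dom F' G' -> dom (fun n => F n + F' n) (fun n => G n + G' n).
Proof.
move=> [C h] [D k]; exists (C + D) => N.
have e A B : lsum (fun n => A n + B n) N = lsum A N + lsum B N.
  by rewrite /lsum -big_split /=; apply: eq_bigr => n _; rewrite mulrDl.
by rewrite !e addrACA; exact: lerD.
Qed.

Lemma domZ c F G : 0 <= c -> dom F G -> dom (fun n => c * F n) (fun n => c * G n).
Proof.
move=> c0 [C h]; exists (c * C) => N.
have e A : lsum (fun n => c * A n) N = c * lsum A N by rewrite /lsum mulr_sumr; apply: eq_bigr => n _; rewrite mulrA.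
by rewrite !e -mulrDr; exact: ler_wpM2l.
Qed.

Lemma dom_sum (I : eqType) (r : seq I) (F G : I -> nat -> R) : (forall i, i \in r -> dom (F i) (G i)) ->
  dom (fun n => \sum_(i <- r) F i n) (fun n => \sum_(i <- r) G i n).
Proof.
elim: r => [|i r IH] h; first by apply: dom_le => n _; rewrite !big_nil.
have hd := domD (h i (mem_head _ _)) (IH (fun j jr => h j (mem_behead (s := i :: r) jr))).
apply: dom_trans (dom_trans hd _); apply: dom_le => n _; by rewrite big_cons.
Qed.

(** The weights [1/n] and [1/(n+1)] differ by a telescoping amount, recorded by the term
    [B (1 - 1/(N+1))] of the induction. *)
Lemma dom_succ (F : nat -> R) (B : R) : (forall n, 0 <= F n <= B) -> dom (fun n => F n.+1) F.
Proof.
move=> FB; have B0 : 0 <= B by have /andP[a b] := FB 0%N; exact: le_trans b.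
have cl N : lsum (fun n => F n.+1) N <= lsum F N.+1 + B * (1 - N.+1%:R^-1).
  elim: N => [|N IH]; first by rewrite lsum0 lsumS lsum0 invr1 subrr mulr0 add0r addr0 mulr1; have /andP[] := FB 1%N.
  rewrite lsumS [lsum F _]lsumS; apply: le_trans (lerD IH (lexx _)) _.
  have /andP[f0 fB] := FB N.+2.
  have d0 : 0 <= N.+1%:R^-1 - N.+2%:R^-1 :> R by rewrite subr_ge0 lef_pV2 ?posrE ?ltr0n // ler_nat.
  have : F N.+2 * (N.+1%:R^-1 - N.+2%:R^-1) <= B * (N.+1%:R^-1 - N.+2%:R^-1) by exact: ler_wpM2r.
  move: (lsum F N.+1) (N.+1%:R^-1) (N.+2%:R^-1) => s u v; lra.
exists (B + B) => N; apply: le_trans (cl N) _; rewrite lsumS.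
have /andP[f0 fB] := FB N.+1.
have i1 : N.+1%:R^-1 <= 1 :> R by rewrite invf_le1 ?ltr0n // ler1n.
have i0 : 0 <= N.+1%:R^-1 :> R by rewrite invr_ge0.
have h1 : F N.+1 / N.+1%:R <= B * 1 by exact: ler_pM.
have h2 : 0 <= B * N.+1%:R^-1 by exact: mulr_ge0.
rewrite mulrBr mulr1; move: h1 h2; move: (F N.+1 / N.+1%:R) (B * N.+1%:R^-1) (lsum F N) => x y z; lra.
Qed.

Lemma dom_pred (F : nat -> R) (B : R) : (forall n, 0 <= F n <= B) -> dom F (fun n => F n.+1).
Proof.
move=> FB; exists B => N; apply: le_trans (_ : lsum F N.+1 <= _).
  by apply: lsum_mono => // n; have /andP[] := FB n.
elim: N => [|N IH]; first by rewrite lsumS !lsum0 add0r divr1 addr0; have /andP[] := FB 1%N.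
rewrite [lsum F _]lsumS [X in _ <= _ + X]lsumS addrA; apply: lerD IH _.
have /andP[f0 fB] := FB N.+2.
by apply: ler_wpM2l => //; rewrite lef_pV2 ?posrE ?ltr0n // ler_nat.
Qed.

Lemma dom_shift (F : nat -> R) (B : R) k : (forall n, 0 <= F n <= B) -> dom (fun n => F (n + k)%N) F.
Proof.
elim: k F => [|k IH] F FB; first by apply: dom_le => n _; rewrite addn0.
apply: dom_trans (dom_succ FB).
apply: dom_trans (IH (fun n => F n.+1) _) => // ; first by apply: dom_le => n _; rewrite addnS.
Qed.

Lemma dom_unshift (F : nat -> R) (B : R) k : (forall n, 0 <= F n <= B) -> dom F (fun n => F (n + k)%N).
Proof.
elim: k F => [|k IH] F FB; first by apply: dom_le => n _; rewrite addn0.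
apply: dom_trans (dom_pred FB) _.
apply: dom_trans (IH (fun n => F n.+1) _) _ => // ; by apply: dom_le => n _; rewrite addnS.
Qed.

(** Each value [G k] occurs at [p] consecutive integers with weights at most [1/(p k)]; the integers
    below [p] go into the constant. *)
Lemma dom_div (G : nat -> R) (B : R) p : (0 < p)%N -> (forall n, 0 <= G n <= B) -> dom (fun n => G (n %/ p)%N) G.
Proof.
move=> p0 GB; have G0 n : 0 <= G n by have /andP[] := GB n.
have pp : 0 < p%:R :> R by rewrite ltr0n.
have cl K : \sum_(1 <= n < p * K.+1) G (n %/ p)%N / n%:R <= p%:R * B + lsum G K.
  elim: K => [|K IH].
    rewrite muln1 lsum0 addr0; apply: le_trans (_ : \sum_(1 <= n < p) B <= _).
      rewrite big_nat_cond [X in _ <= X]big_nat_cond; apply: ler_sum => n /andP[/andP[n0 _] _].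
      have /andP[a b] := GB (n %/ p)%N; have n1 : 1 <= n%:R :> R by rewrite ler1n.
      have B0 : 0 <= B by exact: le_trans a b.
      by rewrite ler_pdivrMr ?ltr0n //; apply: (le_trans b); rewrite ler_peMr.
    rewrite sumr_const_nat -[B *+ _]mulr_natl; apply: ler_wpM2r; last by rewrite ler_nat leq_subr.
    by have /andP[a b] := GB 0%N; exact: le_trans b.
  have pK : (0 < p * K.+1)%N by rewrite muln_gt0 p0.
  rewrite (big_cat_nat (n := (p * K.+1)%N)) ?leq_mul2l ?leqnSn ?orbT //= lsumS addrA; apply: lerD IH _.
  apply: le_trans (_ : \sum_(p * K.+1 <= n < p * K.+2) G K.+1 / (p * K.+1)%:R <= _).
    rewrite big_nat_cond [X in _ <= X]big_nat_cond; apply: ler_sum => n /andP[/andP[n0 n1] _].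
    have -> : (n %/ p)%N = K.+1.
      by apply/eqP; rewrite eqn_leq leq_divRL // mulnC n0 andbT -ltnS ltn_divLR // mulnC.
    by apply: ler_wpM2l => //; rewrite lef_pV2 ?posrE ?ltr0n ?ler_nat //; exact: leq_trans n0.
  rewrite sumr_const_nat -mulnBr subSnn muln1 -[_ / _ *+ _]mulr_natl natrM invfM mulrCA mulVKf //; exact: lt0r_neq0.
exists (p%:R * B) => N; apply: le_trans (_ : \sum_(1 <= n < p * (N %/ p).+1) G (n %/ p)%N / n%:R <= _).
  have lt : (N.+1 <= p * (N %/ p).+1)%N by rewrite mulnC ltn_ceil.
  rewrite /lsum [X in _ <= X](big_cat_nat (n := N.+1)) //= lerDl.
  by apply: sumr_ge0 => n _; rewrite divr_ge0.
by apply: le_trans (cl _) _; rewrite lerD2l; apply: lsum_mono => //; exact: leq_div.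
Qed.

Lemma lnn_le_lsum1 N : (0 < N)%N -> lnn N <= lsum (fun _ => 1) N.
Proof.
move=> N0; apply: le_trans (_ : lnn N.+1 <= _); first by apply: ler_lnn.
elim: N {N0} => [|N IH]; first by rewrite lsum0 /lnn ln_1.
rewrite lsumS mul1r; have := @lnnS_le N.+1 isT; move: (lsum _ _) IH; set u := N.+1%:R^-1 => s; rewrite lerBlDl => IH h; apply: le_trans h _; exact: lerD.
Qed.

Lemma lsum_const c N : lsum (fun _ => c) N = c * lsum (fun _ => 1) N.
Proof. by rewrite /lsum mulr_sumr; apply: eq_bigr => n _; rewrite mul1r. Qed.

Lemma avgH_ord f H n : avgH f H n = (H%:R^-1)%:C * \sum_(j < H) f (n + j.+1)%N.
Proof.
rewrite /avgH; congr (_ * _); elim: H => [|H IH]; first by rewrite addn0 big_geq // big_ord0.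
by rewrite addnS big_nat_recr ?ltnS ?leq_addr //= IH big_ord_recr /= addnS.
Qed.

Lemma N2_avg_le (k : nat) (x : 'I_k -> CC) : (0 < k)%N -> N2 ((k%:R^-1)%:C * \sum_(j < k) x j) <= k%:R^-1 * \sum_(j < k) N2 (x j).
Proof.
move=> k0; have kp : 0 < k%:R :> R by rewrite ltr0n.
rewrite N2M N2_rc; apply: le_trans (ler_wpM2l (sqr_ge0 _) (N2_sum_card _ _ _)) _.
rewrite sumr_const card_ord mulrA expr2 -(mulrA k%:R^-1) mulVf ?mulr1 //; exact: lt0r_neq0.
Qed.

Lemma avgH_mulk f k H n : avgH f (k * H) n = (k%:R^-1)%:C * \sum_(j < k) avgH f H (n + j * H)%N.
Proof.
rewrite avgH_ord natrM invfM rmorphM /= -mulrA; congr (_ * _).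
under [in RHS]eq_bigr do rewrite avgH_ord.
rewrite -mulr_sumr; congr (_ * _).
elim: k => [|k IH]; first by rewrite mul0n !big_ord0.
rewrite big_ord_recr /= -IH mulSn addnC big_split_ord /=; congr (_ + _).
by apply: eq_bigr => j _; rewrite -addnS addnA.
Qed.

Lemma N2_avgH_bd f (B : R) H n : 0 <= B -> (forall m, N2 (f m) <= B) -> N2 (avgH f H n) <= B.
Proof.
move=> B0 fB; case: H => [|H]; first by rewrite avgH_ord big_ord0 mulr0 N20.
rewrite avgH_ord; apply: le_trans (N2_avg_le _ _) _ => //.
have Hp : 0 < H.+1%:R :> R by rewrite ltr0n.
rewrite mulrC ler_pdivrMr //; apply: le_trans (ler_sum _ (fun i _ => fB _)) _.
by rewrite sumr_const card_ord mulr_natr.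
Qed.

(** A long window is an average of [k] shifted short ones; convexity of the square and invariance of
    logarithmic means under shifts conclude. *)
Lemma dom_win f (B : R) k H : 0 <= B -> (forall m, N2 (f m) <= B) -> (0 < k)%N ->
  dom (fun n => N2 (avgH f (k * H) n)) (fun n => N2 (avgH f H n)).
Proof.
move=> B0 fB k0; have kp : 0 < k%:R :> R by rewrite ltr0n.
have bd n : 0 <= N2 (avgH f H n) <= B by rewrite N2_ge0 N2_avgH_bd.
have k0' : 0 <= k%:R^-1 :> R by rewrite invr_ge0.
have ds : dom (fun n => \sum_(j <- enum 'I_k) N2 (avgH f H (n + j * H)%N)) (fun n => \sum_(j <- enum 'I_k) N2 (avgH f H n)).
  by apply: dom_sum => j _; exact: dom_shift bd.
apply: dom_trans (dom_trans (domZ k0' ds) _); last first.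
- apply: dom_le => n _; rewrite big_enum /= sumr_const card_ord -[N2 _ *+ _]mulr_natl mulrA mulVf ?mul1r //; exact: lt0r_neq0.
by apply: dom_le => n _; rewrite big_enum /= avgH_mulk; exact: N2_avg_le.
Qed.

Lemma avgH_rest f H H' n : (forall m, N2 (f m) <= 1) -> (0 < H)%N -> (H <= H')%N ->
  N2 (avgH f H' n) <= 2 * N2 (avgH f ((H' %/ H) * H) n) + 2 * (H%:R / H'%:R) ^+ 2.
Proof.
move=> f1 H0 HH; have H'0 : (0 < H')%N by exact: leq_trans HH.
have Hp : 0 < H'%:R :> R by rewrite ltr0n.
set k := (H' %/ H)%N; set r := (H' %% H)%N.
have E : H' = (k * H + r)%N by exact: divn_eq.
have k0 : (0 < k)%N by rewrite divn_gt0.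
have kH0 : 0 < (k * H)%:R :> R by rewrite ltr0n muln_gt0 k0.
have kHle : (k * H)%:R <= H'%:R :> R by rewrite ler_nat leq_divM.
have -> : avgH f H' n = ((k * H)%:R / H'%:R)%:C * avgH f (k * H) n + (H'%:R^-1)%:C * \sum_(j < r) f (n + (k * H + j).+1)%N.
  rewrite !avgH_ord mulrA -rmorphM /= mulrAC mulfV ?mul1r; last exact: lt0r_neq0.
  by rewrite -mulrDr; congr (_ * _); rewrite -(big_mkord xpredT (fun j => f (n + j.+1)%N)) E big_mkord big_split_ord.
apply: le_trans (N2D_le _ _) _; apply: lerD; apply: ler_wpM2l => //.
  rewrite N2M N2_rc; apply: ler_piMl => //; rewrite expr_le1 ?divr_ge0 //.
  by rewrite ler_pdivrMr // mul1r.
apply: N2_le_sqr; rewrite cabsM cabs_rc mulrC ger0_norm ?invr_ge0 //; apply: ler_wpM2r; first by rewrite invr_ge0.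
apply: le_trans (cabs_sum _ _ _) _; apply: le_trans (ler_sum _ (fun i _ => cabs_le1 (f1 _))) _.
by rewrite sumr_const card_ord ler_nat ltnW // ltn_mod.
Qed.

Lemma dom_bigwin f H H' c : (forall m, N2 (f m) <= 1) -> (0 < H)%N -> (H <= H')%N ->
  dom (fun n => N2 (avgH f H n)) (fun _ => c) -> dom (fun n => N2 (avgH f H' n)) (fun _ => 2 * c + 2 * (H%:R / H'%:R) ^+ 2).
Proof.
move=> f1 H0 HH h.
have k0 : (0 < H' %/ H)%N by rewrite divn_gt0.
have two0 : (0 : R) <= 2 by [].
apply: dom_trans (domD (domZ two0 (dom_trans (@dom_win f 1 (H' %/ H) H ler01 f1 k0) h)) (dom_le (fun n _ => lexx (2 * (H%:R / H'%:R) ^+ 2)))).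
by apply: dom_le => n _; exact: avgH_rest.
Qed.

(** Among [d] consecutive integers exactly one is divisible by [d], hence an identity without error
    term. *)
Lemma avgH_dil f d H n : (0 < d)%N ->
  avgH (fun m => if (d %| m)%N then f (m %/ d)%N else 0) (d * H) n = (d%:R^-1)%:C * avgH f H (n %/ d)%N.
Proof.
move=> d0; rewrite !avgH_ord natrM invfM rmorphM /= -mulrA; congr (_ * (_ * _)).
elim: H => [|H IH]; first by rewrite muln0 !big_ord0.
rewrite mulnS addnC big_split_ord /= IH big_ord_recr /=; congr (_ + _).
set s := (n + d * H)%N.
have -> : \sum_(i < d) (if (d %| n + (d * H + i).+1)%N then f ((n + (d * H + i).+1) %/ d)%N else 0) =
   \sum_(i < d | (d %| s + i.+1)%N) f ((s + i.+1) %/ d)%N.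
  by rewrite [RHS]big_mkcond; apply: eq_bigr => i _; rewrite /s -addnS addnA.
have rlt : (d - (s %% d).+1 < d)%N by rewrite -subSn ?ltn_mod // subSS leq_subr.
rewrite (big_pred1 (Ordinal rlt)) /=.
  have -> : (s + (d - (s %% d).+1).+1)%N = ((s %/ d).+1 * d)%N.
    rewrite -subSn ?ltn_mod // subSS {1}(divn_eq s d) -addnA subnKC; first by rewrite mulSn addnC.
    by apply: ltnW; rewrite ltn_mod.
  by rewrite mulnK // /s addnC mulnC divnMDl // addnC addnS.
move=> i; rewrite /= -val_eqE /=.
have {1}-> : (s + i.+1)%N = (s %/ d * d + (s %% d + i.+1))%N by rewrite addnA -divn_eq.
rewrite dvdn_addr ?dvdn_mull //.
have slt : (s %% d < d)%N by rewrite ltn_mod.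
have il := ltn_ord i; move: (nat_of_ord i) (s %% d)%N il slt => {}i r il slt.
apply/idP/eqP => [/dvdnP[[|[|k]] hk]|->].
- by rewrite mul0n addnS in hk.
- by rewrite mul1n in hk; rewrite -hk addnS subSS addKn.
- exfalso; have := leq_add slt il; rewrite addSnnS addnS hk !mulSn addnA => h.
  by have := leq_ltn_trans (leq_addr _ _) h; rewrite ltnn.
by rewrite -subSn // subSS subnKC // ltnW.
Qed.

(** * Twists by periodic functions *)

Definition bounded (f : nat -> CC) : Prop := exists B : R, 0 <= B /\ forall m, N2 (f m) <= B.
(** One window length for each [eps] is asked for. By [dom_win] it may be replaced by any multiple,
    which lets several functions share a window. *)
Definition nullmean (f : nat -> CC) : Prop := bounded f /\ forall eps : R, 0 < eps ->
  exists H, (0 < H)%N /\ dom (fun n => N2 (avgH f H n)) (fun _ => eps).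

Lemma avgH_ext f g H n : (forall m, f m = g m) -> avgH f H n = avgH g H n.
Proof. by move=> e; rewrite /avgH; congr (_ * _); apply: eq_bigr. Qed.

Lemma nullmean_ext f g : (forall m, f m = g m) -> nullmean f -> nullmean g.
Proof.
move=> e [[B [B0 fB]] h]; split; first by exists B; split=> // m; rewrite -e.
move=> eps e0; have [H [H0 d]] := h eps e0; exists H; split=> //.
by apply: dom_trans d; apply: dom_le => n _; rewrite (avgH_ext H n e).
Qed.

Lemma avgHZ c f H n : avgH (fun m => c * f m) H n = c * avgH f H n.
Proof. by rewrite /avgH -mulr_sumr mulrCA. Qed.

Lemma avgHD f g H n : avgH (fun m => f m + g m) H n = avgH f H n + avgH g H n.
Proof. by rewrite /avgH big_split mulrDr. Qed.

Lemma avgH_sum I (r : seq I) (F : I -> nat -> CC) H n :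
  avgH (fun m => \sum_(i <- r) F i m) H n = \sum_(i <- r) avgH (F i) H n.
Proof. by rewrite /avgH exchange_big /= mulr_sumr. Qed.

Lemma nullmean0 : nullmean (fun _ => 0).
Proof.
split; first by exists 0; split=> // m; rewrite N20.
move=> eps e0; exists 1%N; split=> //; apply: dom_le => n _.
by rewrite /avgH big1 // mulr0 N20 ltW.
Qed.

Lemma nullmeanZ (c : CC) f : nullmean f -> nullmean (fun m => c * f m).
Proof.
move=> [[B [B0 fB]] h]; split.
  exists (N2 c * B); split; first exact: mulr_ge0.
  by move=> m; rewrite N2M; exact: ler_wpM2l.
move=> eps e0; have c1 : 0 < N2 c + 1 by apply: ltr_wpDl.
have [H [H0 d]] := h _ (divr_gt0 e0 c1); exists H; split=> //.
apply: dom_trans (dom_trans (domZ (N2_ge0 c) d) _); apply: dom_le => n _; first by rewrite avgHZ N2M.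
by rewrite mulrA ler_pdivrMr // mulrC ler_wpM2l ?ltW // ltrDl.
Qed.

Lemma nullmeanD f g : nullmean f -> nullmean g -> nullmean (fun m => f m + g m).
Proof.
move=> [[B [B0 fB]] h] [[D [D0 gD]] k]; split.
  exists (2 * B + 2 * D); split; first by pos.
  move=> m; apply: le_trans (N2D_le _ _) _; by apply: lerD; apply: ler_wpM2l.
move=> eps e0; have e4 : 0 < eps / 4 by apply: divr_gt0 => //; rewrite ltr0n.
have [H1 [H10 d1]] := h _ e4; have [H2 [H20 d2]] := k _ e4.
exists (H1 * H2)%N; split; first by rewrite muln_gt0 H10.
have two0 : (0 : R) <= 2 by [].
have d1' := dom_trans (dom_win H1 B0 fB H20) d1; have d2' := dom_trans (dom_win H2 D0 gD H10) d2.
apply: dom_trans (dom_trans (domD (domZ two0 d1') (domZ two0 d2')) _); apply: dom_le => n _.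
  by rewrite avgHD [(H2 * H1)%N]mulnC; exact: N2D_le.
lra.
Qed.

Lemma nullmean_sum I (r : seq I) (F : I -> nat -> CC) : (forall i, nullmean (F i)) -> nullmean (fun m => \sum_(i <- r) F i m).
Proof.
move=> h; elim: r => [|i r IH]; first by apply: nullmean_ext nullmean0 => m; rewrite big_nil.
by apply: nullmean_ext (nullmeanD (h i) IH) => m; rewrite big_cons.
Qed.

Lemma nullmean_dil f d : (0 < d)%N -> nullmean f -> nullmean (fun m => if (d %| m)%N then f (m %/ d)%N else 0).
Proof.
move=> d0 [[B [B0 fB]] h]; split; first by exists B; split=> // m; case: ifP => _ //; rewrite N20.
move=> eps e0; have [H [H0 k]] := h _ e0; exists (d * H)%N; split; first by rewrite muln_gt0 d0.
have bd n : 0 <= N2 (avgH f H n) <= B by rewrite N2_ge0 N2_avgH_bd.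
apply: dom_trans (dom_trans (dom_div d0 bd) k); apply: dom_le => n _.
rewrite avgH_dil // N2M N2_rc; apply: ler_piMl => //.
rewrite expr_le1 ?invr_ge0 // invf_le1 ?ltr0n //; by rewrite ler1n.
Qed.

Lemma nullmean_common (I : eqType) (r : seq I) (F : I -> nat -> CC) (eps : R) : (forall i, i \in r -> nullmean (F i)) -> 0 < eps ->
  exists H, (0 < H)%N /\ forall i, i \in r -> dom (fun n => N2 (avgH (F i) H n)) (fun _ => eps).
Proof.
move=> h e0; elim: r h => [|i r IH] h; first by exists 1%N.
have [H1 [H10 d1]] := IH (fun j jr => h j (mem_behead (s := i :: r) jr)).
have [_ /(_ _ e0) [H2 [H20 d2]]] := h i (mem_head _ _).
exists (H1 * H2)%N; split; first by rewrite muln_gt0 H10.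
move=> j jr; have [[B [B0 jB]] _] := h j jr.
move: jr; rewrite inE => /orP[/eqP E|jr].
  by rewrite E in jB *; apply: dom_trans d2; apply: dom_win jB H10.
by rewrite mulnC; apply: dom_trans (d1 j jr); apply: dom_win jB H20.
Qed.

(** * Dirichlet characters and functions of residues *)

Definition dchar (q : nat) (chi : nat -> CC) : Prop :=
  [/\ (0 < q)%N, chi 1%N = 1, (forall n, chi (n + q)%N = chi n), (forall m n, chi (m * n)%N = chi m * chi n)
    & forall n, (chi n != 0) = coprime n q].

Lemma per_mul (T : Type) (u : nat -> T) q : (forall n, u (n + q)%N = u n) -> forall n k, u (n + k * q)%N = u n.
Proof. by move=> p n; elim=> [|k IH]; [rewrite mul0n addn0|rewrite mulSn addnA addnAC p IH]. Qed.

Lemma per_mod (T : Type) (u : nat -> T) q : (forall n, u (n + q)%N = u n) -> forall n m, n = m %[mod q] -> u n = u m.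
Proof. by move=> p n m e; rewrite (divn_eq n q) (divn_eq m q) e ![(_ * _ + _)%N]addnC !(per_mul p). Qed.

Lemma multX (chi : nat -> CC) : chi 1%N = 1 -> (forall m n, chi (m * n)%N = chi m * chi n) -> forall n k, chi (n ^ k)%N = chi n ^+ k.
Proof. by move=> c1 cM n; elim=> [|k IH]; rewrite ?expn0 // expnS cM IH exprS. Qed.

Lemma dchar_N2 q chi n : dchar q chi -> coprime n q -> N2 (chi n) = 1.
Proof.
move=> [q0 c1 cp cM cz] cn.
have e : chi n ^+ totient q = 1.
  by rewrite -multX // -c1; apply: per_mod cp _ _ _; exact: cyclic.Euler_exp_totient.
have : N2 (chi n) ^+ totient q == 1 by rewrite -N2X e N21.
by rewrite pexpr_eq1 ?totient_gt0 // => /eqP.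
Qed.

Section Periodic.
Variable a : nat -> CC.
Hypothesis a0 : a 0%N = 0.
Hypothesis a1 : forall n, (0 < n)%N -> N2 (a n) = 1.
Hypothesis aM : forall m n, a (m * n)%N = a m * a n.
Hypothesis aU : forall q chi, dchar q chi -> unpret (fun n => a n * chi n).

Lemma a_le1 n : N2 (a n) <= 1.
Proof. by case: n => [|n]; rewrite ?a0 ?N20 // a1. Qed.

Lemma nullmean_char q chi : dchar q chi -> nullmean (fun n => a n * chi n).
Proof.
move=> hc; have [q0 c1 cp cM cz] := hc.
have cle n : N2 (a n * chi n) <= 1.
  rewrite N2M; have [cn|cn] := boolP (coprime n q); first by rewrite (dchar_N2 hc cn) mulr1 a_le1.
  by move: cn; rewrite -cz negbK => /eqP->; rewrite N20 mulr0.
split; first by exists 1.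
move=> eps e0.
have fM m n : (0 < m)%N -> (0 < n)%N -> a (m * n)%N * chi (m * n)%N = a m * chi m * (a n * chi n).
  by move=> _ _; rewrite aM cM mulrACA.
have fp p : prime p -> N2 (a p * chi p) = 1 \/ a p * chi p = 0.
  move=> pp; have [cn|cn] := boolP (coprime p q).
    by left; rewrite N2M (dchar_N2 hc cn) mulr1 a1 // prime_gt0.
  by right; move: cn; rewrite -cz negbK => /eqP->; rewrite mulr0.
have [H [H0 [C hC]]] := short_mean cle fM fp (aU hc) e0; exists H; split=> //.
exists `|C|; case=> [|N]; first by rewrite !lsum0 addr0.
apply: le_trans (hC N.+1 isT) _; apply: lerD; first exact: ler_norm.
by rewrite lsum_const; apply: ler_wpM2l; [exact: ltW|exact: lnn_le_lsum1].
Qed.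

Section Units.
Variable q : nat.
Hypothesis q0 : (0 < q)%N.

Definition unitfun (u : nat -> CC) := (forall n, u (n + q)%N = u n) /\ (forall n, ~~ coprime n q -> u n = 0).
Definition eigen (u : nat -> CC) g := exists l : CC, forall x, u (g * x)%N = l * u x.

(** If every unit dilation acts on [u] by a scalar, then [u / u(1)] is multiplicative and hence a
    Dirichlet character; if [u(1) = 0], then [u] vanishes identically. *)
Lemma eigen_all u : unitfun u -> (forall g, (g < q)%N -> coprime g q -> eigen u g) -> nullmean (fun n => a n * u n).
Proof.
move=> [up us] h.
have h' g : coprime g q -> eigen u g.
  move=> cg; have [|l hl] := h (g %% q)%N (ltn_pmod _ q0); first by rewrite coprime_modl.
  by exists l => x; rewrite -hl; apply: per_mod up _ _ _; rewrite modnMml.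
have [u1|u1] := eqVneq (u 1%N) 0.
  apply: nullmean_ext nullmean0 => m.
  have [cm|cm] := boolP (coprime m q); last by rewrite us // mulr0.
  by have [l hl] := h' m cm; rewrite -[m in u m]muln1 hl u1 !mulr0.
pose chi n := u n / u 1%N.
have cM m n : chi (m * n)%N = chi m * chi n.
  have [cm|cm] := boolP (coprime m q); last first.
    by rewrite /chi us ?(us m) ?mul0r // coprimeMl negb_and cm.
  have [l hl] := h' m cm.
  have um : u m = l * u 1%N by rewrite -hl muln1.
  by rewrite /chi hl um (mulfK u1) mulrA.
have c1 : chi 1%N = 1 by rewrite /chi divff.
have cp n : chi (n + q)%N = chi n by rewrite /chi up.
have hc : dchar q chi.
  split=> // n; have [cn|cn] := boolP (coprime n q); last by rewrite /chi us // mul0r eqxx.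
  apply/eqP => cn0; have e : chi n ^+ totient q = 1.
    by rewrite -multX // -c1; apply: per_mod cp _ _ _; exact: cyclic.Euler_exp_totient.
  by move/eqP: e; rewrite cn0 expr0n gtn_eqF ?totient_gt0 //= eq_sym oner_eq0.
apply: nullmean_ext (nullmeanZ (u 1%N) (nullmean_char hc)) => m.
by rewrite /chi mulrCA [u 1%N * _]mulrC divfK.
Qed.

(* Averaging u(g^j x) against w^j projects u onto an eigenspace of x |-> g x, and these
   projections over all n-th roots of unity w sum to u. *)
Definition proj (n g : nat) (w : CC) (u : nat -> CC) (x : nat) : CC :=
  n%:R^-1 * \sum_(j < n) w ^+ j * u (g ^ j * x)%N.

Lemma proj_unitfun n g w u : unitfun u -> unitfun (proj n g w u).
Proof.
move=> [up us]; split=> x.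
  by rewrite /proj; congr (_ * _); apply: eq_bigr => j _; rewrite mulnDr (per_mul up).
by move=> cx; rewrite /proj big1 ?mulr0 // => j _; rewrite us ?mulr0 // coprimeMl negb_and cx orbT.
Qed.

Lemma proj_other n g w u h : eigen u h -> eigen (proj n g w u) h.
Proof.
move=> [l hl]; exists l => x; rewrite /proj mulrCA; congr (_ * _); rewrite mulr_sumr; apply: eq_bigr => j _.
by rewrite mulnCA hl mulrCA.
Qed.

Lemma proj_eigen g w u : unitfun u -> coprime g q -> w ^+ totient q = 1 -> eigen (proj (totient q) g w u) g.
Proof.
move=> [up us] cg wn; set n := totient q in wn *.
have n0 : (0 < n)%N by rewrite totient_gt0.
exists (w ^+ n.-1) => x.
suff -> : proj n g w u x = w * proj n g w u (g * x)%N by rewrite mulrA -exprSr prednK // wn mul1r.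
rewrite /proj mulrCA; congr (_ * _).
pose F j := w ^+ j * u (g ^ j * x)%N.
(* Cyclic reindexing: [F n = F 0], by Euler's theorem and [w^n = 1]. *)
have E : \sum_(j < n) F j = \sum_(j < n) F j.+1.
  rewrite -(prednK n0) big_ord_recl big_ord_recr /= addrC; congr (_ + _).
  rewrite prednK // /F wn mul1r expr0 mul1r; apply: per_mod up _ _ _.
  by rewrite expn0 -modnMml -[in RHS]modnMml; congr ((_ * _) %% _)%N; rewrite cyclic.Euler_exp_totient.
rewrite -/(F _) E mulr_sumr; apply: eq_bigr => j _.
by rewrite /F exprS expnSr mulnA mulrA.
Qed.

Lemma root_orth n j : (0 < n)%N -> (j < n)%N ->
  \sum_(k < n) (eix (2 * PI / n%:R) ^+ k) ^+ j = (if j == 0%N then n%:R else 0) :> CC.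
Proof.
move=> n0 jn; case: eqP => [->|/eqP j0].
  by under eq_bigr do rewrite expr0; rewrite sumr_const card_ord.
rewrite -[RHS](@orth_eix n j 0); last by rewrite lt0n j0.
apply: eq_bigr => k _; rewrite -exprM -eixMn; congr eix; rewrite natrM subr0; field.
by rewrite pnatr_eq0 -lt0n.
Qed.

Lemma proj_sum n g u x : (0 < n)%N -> \sum_(k < n) proj n g (eix (2 * PI / n%:R) ^+ k) u x = u x.
Proof.
move=> n0; rewrite /proj -mulr_sumr exchange_big /=.
under eq_bigr => j _ do rewrite -mulr_suml root_orth //.
rewrite (bigD1 (Ordinal n0)) //= big1 ?addr0 => [|j]; last by rewrite -val_eqE /= => /negPf->; rewrite mul0r.
by rewrite mul1n mulKf // pnatr_eq0 -lt0n.
Qed.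

(** Induction on a list of units not yet known to act by scalars. Projecting onto the eigenspaces of
    one of them removes it from the list and, since dilations commute, preserves the others. So [u]
    splits into characters without any description of the group of units. *)
Lemma nullmean_unit u : unitfun u -> nullmean (fun n => a n * u n).
Proof.
move=> hu.
suff main (gs : seq nat) : forall u, unitfun u -> (forall g, (g < q)%N -> coprime g q -> g \in gs \/ eigen u g) -> nullmean (fun n => a n * u n).
  by apply: (main (iota 0 q)) => // g gq _; left; rewrite mem_iota.
elim: gs => [|g gs IH] {hu} u hu h; first by apply: eigen_all => // g gq cg; case: (h g gq cg).
have [cg|cg] := boolP (coprime g q); last first.
  apply: IH => // g' gq' cg'; case: (h g' gq' cg'); last by right.
  by rewrite inE => /orP[/eqP E|]; [rewrite E (negPf cg) in cg'|left].
have n0 : (0 < totient q)%N by rewrite totient_gt0.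
set w := eix (2 * PI / (totient q)%:R).
have wn : w ^+ totient q = 1.
  by rewrite /w -eixMn mulrC divfK ?eix_2PI // pnatr_eq0 -lt0n.
have hk : forall k : 'I_(totient q), nullmean (fun n => a n * proj (totient q) g (w ^+ k) u n).
  move=> k; apply: IH; first exact: proj_unitfun.
  move=> g' gq' cg'; case: (h g' gq' cg'); last by move=> ?; right; exact: proj_other.
  rewrite inE => /orP[/eqP E|]; last by left.
  by right; rewrite E; apply: proj_eigen => //; rewrite -exprM mulnC exprM wn expr1n.
apply: nullmean_ext (nullmean_sum (index_enum _) hk) => m.
by rewrite -mulr_sumr proj_sum.
Qed.
End Units.

(** With [e] the gcd of [j] and [d], the progression is [e] times one whose residue is prime to its
    modulus, and [a(e m) = a(e) a(m)]. *)
Lemma nullmean_residue d j : (0 < d)%N -> nullmean (fun m => a m * (m == j %[mod d])%:R).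
Proof.
move=> d0; set e := gcdn j d.
have e0 : (0 < e)%N by rewrite gcdn_gt0 d0 orbT.
have [j' hj] : exists j', j = (e * j')%N by have /dvdnP[x ->] := dvdn_gcdl j d; exists x; rewrite mulnC.
have [d' hd] : exists d', d = (e * d')%N by have /dvdnP[x ->] := dvdn_gcdr j d; exists x; rewrite mulnC.
have d'0 : (0 < d')%N by move: d0; rewrite hd muln_gt0 => /andP[].
have cj : coprime j' d'.
  rewrite /coprime -(eqn_pmul2l e0) muln_gcdr -hj -hd muln1 //.
have hu : unitfun d' (fun m => (m == j' %[mod d'])%:R).
  split=> n; first by rewrite modnDr.
  move=> cn; case: eqP => // E; move: cn.
  by rewrite -coprime_modl E coprime_modl cj.
apply: nullmean_ext (nullmean_dil e0 (nullmeanZ (a e) (nullmean_unit d'0 hu))) => m.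
case: ifP => em.
  have [x ->] := dvdnP em; rewrite mulnK // aM mulrCA mulrA; congr (_ * _%:R).
  by rewrite hj hd ![(x * e)%N]mulnC -!muln_modr (eqn_pmul2l e0).
case: eqP => [E|]; last by rewrite mulr0.
have ed : (e %| d)%N by exact: dvdn_gcdr.
have em' : (e %| m %% d)%N by rewrite E hj hd -muln_modr dvdn_mulr.
by rewrite (divn_eq m d) dvdn_addr ?em' // dvdn_mull in em.
Qed.

End Periodic.

(** * Twists by additive characters *)

Lemma count_dvd d M n : (0 < d)%N -> (0 < M)%N -> (d %| M)%N -> \sum_(j < M) (d %| n + j.+1)%N%:R = M%:R / d%:R :> R.
Proof.
move=> d0 M0 /dvdnP[H MH]; rewrite mulnC in MH.
have H0 : (0 < H)%N by move: M0; rewrite MH muln_gt0 => /andP[].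
have := avgH_dil (fun=> 1) H n d0; rewrite !avgH_ord -MH sumr_const card_ord => E.
have Mn : M%:R != 0 :> R by rewrite pnatr_eq0 -lt0n.
have Hn : H%:R != 0 :> R by rewrite pnatr_eq0 -lt0n.
have dn : d%:R != 0 :> R by rewrite pnatr_eq0 -lt0n.
have e : (\sum_(j < M) (d %| n + j.+1)%N%:R : R)%:C = \sum_(j < M) (if (d %| n + j.+1)%N then 1 else 0).
  by rewrite rc_sum; apply: eq_bigr => j _; case: (d %| _)%N.
have eH : (1 *+ H : CC) = (H%:R : R)%:C by rewrite rmorph_nat.
move: E; rewrite -e eH -!rmorphM /= => /(congr1 cre); rewrite !cre_rc mulVf // mulr1 => E.
by rewrite -[LHS](mulKf (invr_neq0 Mn)) E invrK.
Qed.

(** Every [p], hence every product of two distinct ones, divides [M], so the divisibilities are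
    exactly independent on the window and the variance has no error term. *)
Lemma tk_window (P : seq nat) M n : uniq P -> (forall p, p \in P -> prime p) -> (0 < M)%N -> (forall p, p \in P -> (p %| M)%N) ->
  \sum_(j < M) (\sum_(p <- P) ((p %| n + j.+1)%N%:R - p%:R^-1)) ^+ 2 <= M%:R * \sum_(p <- P) p%:R^-1 :> R.
Proof.
move=> uP pP M0 dP.
pose y p (j : 'I_M) : R := (p %| n + j.+1)%N%:R - p%:R^-1.
have dM0 p : (0 < p)%N -> (p %| M)%N -> \sum_(j < M) (p %| n + j.+1)%N%:R = M%:R / p%:R :> R by move=> p0; exact: count_dvd.
have key p p' : p \in P -> p' \in P -> \sum_(j < M) y p j * y p' j <= M%:R * ((p' == p)%:R * p%:R^-1).
  move=> hp hp'; have p0 := prime_gt0 (pP p hp); have p0' := prime_gt0 (pP p' hp').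
  have E : \sum_(j < M) y p j * y p' j = \sum_(j < M) ((p %| n + j.+1)%N && (p' %| n + j.+1)%N)%:R
     - p'%:R^-1 * (M%:R / p%:R) - p%:R^-1 * (M%:R / p'%:R) + M%:R * (p%:R^-1 * p'%:R^-1) :> R.
    rewrite -(dM0 p) ?dP // -(dM0 p') ?dP // !mulr_sumr -!sumrB.
    have -> : M%:R * (p%:R^-1 * p'%:R^-1) = \sum_(j < M) p%:R^-1 * p'%:R^-1 :> R by rewrite sumr_const card_ord mulr_natl.
    rewrite -big_split /=; apply: eq_bigr => j _; rewrite /y -mulnb natrM; ring.
  rewrite E; case: (eqVneq p' p) => [->|np].
    under eq_bigr do rewrite andbb.
    rewrite dM0 ?dP // mul1r.
    have : 0 <= M%:R * (p%:R^-1 * p%:R^-1) :> R by pos.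
    have -> : p%:R^-1 * (M%:R / p%:R) = M%:R * (p%:R^-1 * p%:R^-1) :> R by ring.
    lra.
  have cop : coprime p p' by rewrite prime_coprime ?pP // dvdn_prime2 ?pP // eq_sym.
  under eq_bigr do rewrite -Gauss_dvd //.
  rewrite dM0 ?muln_gt0 ?p0 ?p0' ?Gauss_dvd ?dP //.
  rewrite mul0r mulr0 natrM invfM le_eqVlt; apply/orP; left; apply/eqP; ring.
have -> : \sum_(j < M) (\sum_(p <- P) y p j) ^+ 2 = \sum_(p <- P) \sum_(p' <- P) \sum_(j < M) y p j * y p' j.
  under eq_bigr do rewrite expr2 mulr_suml.
  rewrite exchange_big /=; apply: eq_bigr => p _.
  rewrite [RHS]exchange_big /=; by apply: eq_bigr => j _; rewrite mulr_sumr.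
rewrite mulr_sumr; apply: ler_sum_seq => p hp _.
apply: le_trans (ler_sum_seq (fun p' hp' _ => key p p' hp hp')) _.
rewrite -mulr_sumr -mulr_suml ler_wpM2l // (bigD1_seq p) //= eqxx big1 ?addr0 ?mul1r // => i /negPf->; by [].
Qed.

Lemma sep_arith (L eps S : R) : 0 < L -> 0 < eps -> 6 / eps <= L -> S <= 2 -> 2 / L * S + 2 / L <= eps.
Proof.
move=> L0 e0 hL hS; have -> : 2 / L * S + 2 / L = (2 * S + 2) / L by ring.
by rewrite ler_pdivrMr //; move: hL; rewrite ler_pdivrMr // mulrC => hL; apply: le_trans hL; lra.
Qed.

Lemma near_arith (d N e' eps x : R) : 0 < eps -> eps <= 1 -> 0 <= d -> d <= N -> 0 < N -> e' = eps / (4 * N ^+ 2) -> 0 <= x -> x <= eps / 2 ->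
  2 * (d * (d * e')) + 2 * x ^+ 2 <= eps.
Proof.
move=> e0 e1 d0 dN N0 -> x0 hx.
have h1 : d * d <= N ^+ 2 by rewrite expr2; exact: ler_pM.
have N2 : 0 < N ^+ 2 by exact: exprn_gt0.
have h2 : d * (d * (eps / (4 * N ^+ 2))) <= eps / 4.
  have -> : d * (d * (eps / (4 * N ^+ 2))) = (d * d) / N ^+ 2 * (eps / 4) by field; exact: lt0r_neq0.
  by apply: ler_piMl; [lra|rewrite ler_pdivrMr // mul1r].
have h3 : x ^+ 2 <= eps / 2 * (eps / 2) by rewrite expr2; exact: ler_pM.
have h4 : eps * eps <= eps by exact: ler_piMr (ltW e0) e1.
lra.
Qed.

Lemma close_arith (H3 H2 k eps c D : R) : 0 < eps -> 0 < k -> 0 < H2 -> 0 <= H3 -> 0 <= c -> 4 * k * H3 / eps <= H2 -> H2 / k <= D -> c * D <= 2 ->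
  H3 * c <= eps / 2.
Proof.
move=> e0 k0 H20 H30 c0 hH hD h.
have h1 : c * (H2 / k) <= 2 by apply: le_trans h; exact: ler_wpM2l.
have h2 : c * H2 <= 2 * k by move: h1; rewrite mulrA ler_pdivrMr.
have h3 : 4 * k * H3 <= eps * H2 by move: hH; rewrite ler_pdivrMr // [H2 * _]mulrC.
have h4 : 4 * k * H3 * c <= eps * H2 * c by exact: ler_wpM2r.
have h5 : eps * (c * H2) <= eps * (2 * k) by rewrite ler_pM2l.
have h6 : (4 * k) * (H3 * c) <= (4 * k) * (eps / 2) by lra.
by move: h6; rewrite ler_pM2l // mulr_gt0.
Qed.

(** * Windows that serve all frequencies of the twist *)

Section Twist.
Variable a : nat -> CC.
Hypothesis a0 : a 0%N = 0.
Hypothesis a1 : forall n, (0 < n)%N -> N2 (a n) = 1.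
Hypothesis aM : forall m n, a (m * n)%N = a m * a n.
Hypothesis aU : forall q chi, dchar q chi -> unpret (fun n => a n * chi n).

Definition tw (al : R) (m : nat) : CC := a m * eix (m%:R * al).

Lemma tw_le1 al m : N2 (tw al m) <= 1.
Proof. by rewrite /tw N2M N2_eix mulr1; exact: a_le1. Qed.

(** The number of [p] in [P] dividing [m] is compared with its mean [L]. Multiples [m = p m']
    produce the twist by [p al] on a window shorter by the factor [p], since [a(p m') = a(p) a(m')];
    the deviation is bounded by [tk_window]. *)
Lemma tk_twist (P : seq nat) M n al : uniq P -> (forall p, p \in P -> prime p) -> (0 < M)%N -> (forall p, p \in P -> (p %| M)%N) ->
  let L : R := \sum_(p <- P) p%:R^-1 in 0 < L ->
  N2 (avgH (tw al) M n) <= 2 / L * (\sum_(p <- P) N2 (avgH (tw (p%:R * al)) (M %/ p) (n %/ p)%N)) + 2 / L.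
Proof.
move=> uP pP M0 dP L L0.
have Mp : 0 < M%:R :> R by rewrite ltr0n.
set X := avgH _ _ _.
pose U := \sum_(p <- P) a p * (p%:R^-1)%:C * avgH (tw (p%:R * al)) (M %/ p) (n %/ p)%N.
pose V := avgH (fun m => tw al m * (\sum_(p <- P) ((p %| m)%N%:R - p%:R^-1))%:C) M n.
have E : L%:C * X = U - V.
  have eU : U = avgH (fun m => tw al m * (\sum_(p <- P) (p %| m)%N%:R : R)%:C) M n.
    rewrite /U; transitivity (\sum_(p <- P) avgH (fun m => tw al m * ((p %| m)%N%:R : R)%:C) M n).
      rewrite big_seq [RHS]big_seq; apply: eq_bigr => p hp.
      have p0 := prime_gt0 (pP p hp).
      have -> : avgH (fun m => tw al m * ((p %| m)%N%:R : R)%:C) M n =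
         avgH (fun m => if (p %| m)%N then (fun m' => a p * tw (p%:R * al) m') (m %/ p)%N else 0) (p * (M %/ p)) n.
        rewrite mulnC divnK ?dP //; apply: avgH_ext => m; case: ifP => [/dvdnP[x ->]|_]; last by rewrite mulr0.
        rewrite mulr1 mulnK // /tw mulnC aM -mulrA; congr (_ * (_ * _)); congr eix; rewrite natrM; ring.
      by rewrite (avgH_dil (fun m' => a p * tw (p%:R * al) m')) // avgHZ mulrA [a p * _]mulrC.
    rewrite -avgH_sum; apply: avgH_ext => m; by rewrite rc_sum mulr_sumr.
  rewrite eU /V /X -avgHZ -[- avgH _ _ _]mulN1r -avgHZ -avgHD; apply: avgH_ext => m.
  by rewrite sumrB -/L rmorphB /=; ring.
have bU : N2 U <= L * \sum_(p <- P) p%:R^-1 * N2 (avgH (tw (p%:R * al)) (M %/ p) (n %/ p)%N).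
  have := @N2_sum_le _ P (fun p => p \in P) (fun p => p%:R^-1) (fun p => a p * (p%:R^-1)%:C * avgH (tw (p%:R * al)) (M %/ p) (n %/ p)%N).
  rewrite -!big_seq => h; apply: le_trans (h _) _; first by move=> p hp; rewrite invr_gt0 ltr0n prime_gt0 ?pP.
  rewrite -/L; apply: ler_wpM2l; first exact: ltW.
  rewrite le_eqVlt; apply/orP; left; apply/eqP; rewrite big_seq [RHS]big_seq; apply: eq_bigr => p hp.
  have p0 := prime_gt0 (pP p hp).
  rewrite !N2M N2_rc a1 //; field; by rewrite pnatr_eq0 -lt0n.
have bV : N2 V <= L.
  rewrite /V avgH_ord; apply: le_trans (N2_avg_le _ _) _ => //.
  rewrite mulrC ler_pdivrMr // [X in _ <= X]mulrC; apply: le_trans (tk_window n uP pP M0 dP).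
  apply: ler_sum => j _; rewrite N2M N2_rc; apply: ler_piMl; [exact: sqr_ge0|exact: tw_le1].
have bU' : \sum_(p <- P) p%:R^-1 * N2 (avgH (tw (p%:R * al)) (M %/ p) (n %/ p)%N) <= \sum_(p <- P) N2 (avgH (tw (p%:R * al)) (M %/ p) (n %/ p)%N).
  apply: ler_sum_seq => p hp _; apply: ler_piMl => //; rewrite invf_le1 ?ler1n ?ltr0n ?prime_gt0 ?pP //.
have : L ^+ 2 * N2 X <= 2 * N2 U + 2 * N2 V by rewrite -N2_rc -N2M E; exact: N2B_le.
move: bU' bU; set S1 := \sum_(p <- P) _; set S2 := \sum_(p <- P) _ => bU' bU h.
have L1 : L * S1 <= L * S2 by rewrite ler_pM2l.
have : L * (L * N2 X) <= L * (2 * S2 + 2) by move: h; rewrite expr2; lra.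
rewrite ler_pM2l // => h2.
have -> : 2 / L * S2 + 2 / L = (2 * S2 + 2) / L by ring.
by rewrite ler_pdivlMr // mulrC.
Qed.

Definition dker (H : nat) (b : R) : CC := \sum_(j < H) eix (j%:R * b).

(** The Gram matrix has diagonal [H] and off-diagonal entries at most [H / size P], hence norm at
    most [2 H]; the dual inequality is applied to the values of [a]. *)
Lemma bessel (P : seq nat) H n al : uniq P -> (0 < H)%N -> (0 < size P)%N ->
  (forall p p', p \in P -> p' \in P -> (p < p')%N -> cabs (dker H ((p' - p)%:R * al)) <= H%:R / (size P)%:R) ->
  \sum_(p <- P) N2 (avgH (tw (p%:R * al)) H n) <= 2.
Proof.
move=> uP H0 k0 hs; have Hp : 0 < H%:R :> R by rewrite ltr0n.
have kp : 0 < (size P)%:R :> R by rewrite ltr0n.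
pose A (p : nat) (j : 'I_H) : CC := eix ((n + j.+1)%:R * (p%:R * al)).
pose G p p' : CC := \sum_(j < H) A p j * cj (A p' j).
have Glt p p' : (p <= p')%N -> cabs (G p' p) = cabs (dker H ((p' - p)%:R * al)).
  move=> pp; rewrite /G /dker.
  have -> : \sum_(j < H) A p' j * cj (A p j) = eix (n.+1%:R * ((p' - p)%:R * al)) * \sum_(j < H) eix (j%:R * ((p' - p)%:R * al)).
    rewrite mulr_sumr; apply: eq_bigr => j _; rewrite /A -eixN -!eixD; congr eix.
    rewrite natrB // addnS -addSn natrD; ring.
  by rewrite cabsM cabs_eix mul1r.
have Gc p p' : cabs (G p p') = cabs (G p' p).
  rewrite -[LHS]cabs_cj /G cj_sum; congr cabs; apply: eq_bigr => j _; by rewrite cjM cjK mulrC.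
have Gb p p' : p \in P -> p' \in P -> cabs (G p p') <= (p' == p)%:R * H%:R + H%:R / (size P)%:R.
  move=> hp hp'; have q0 : 0 <= H%:R / (size P)%:R :> R by pos.
  case: (ltngtP p p') => [lt|gt|<-].
  - by rewrite mul0r add0r Gc (Glt _ _ (ltnW lt)); exact: hs.
  - by rewrite mul0r add0r (Glt _ _ (ltnW gt)); exact: hs.
  rewrite mul1r Glt // subnn mul0r /dker; apply: le_trans (cabs_sum _ _ _) _.
  under eq_bigr do rewrite cabs_eix. by rewrite sumr_const card_ord lerDl.
have dual (c : nat -> CC) : \sum_(j < H) N2 (\sum_(p <- P) c p * A p j) <= 2 * H%:R * \sum_(p <- P) N2 (c p).
  have -> : \sum_(j < H) N2 (\sum_(p <- P) c p * A p j) = \sum_(p <- P) \sum_(p' <- P) cre (c p * cj (c p') * G p p').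
    have e j : N2 (\sum_(p <- P) c p * A p j) = \sum_(p <- P) \sum_(p' <- P) cre (c p * cj (c p') * (A p j * cj (A p' j))).
      rewrite -[LHS]cre_rc -mulcj cj_sum mulr_suml cre_sum; apply: eq_bigr => p _.
      rewrite mulr_sumr cre_sum; apply: eq_bigr => p' _; by rewrite cjM mulrACA.
    under eq_bigr do rewrite e.
    rewrite exchange_big /=; apply: eq_bigr => p _; rewrite exchange_big /=; apply: eq_bigr => p' _.
    by rewrite /G mulr_sumr cre_sum.
  apply: le_trans (_ : \sum_(p <- P) \sum_(p' <- P) (N2 (c p) + N2 (c p')) / 2 * ((p' == p)%:R * H%:R + H%:R / (size P)%:R) <= _).
    apply: ler_sum_seq => p hp _; apply: ler_sum_seq => p' hp' _.
    apply: le_trans (ler_norm _) _; apply: le_trans (cre_le_cabs _) _; rewrite !cabsM cabs_cj.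
    apply: ler_pM => //; [by apply: mulr_ge0| |exact: Gb].
    have := sqr_ge0 (cabs (c p) - cabs (c p')); rewrite -!cabs_sqr; lra.
  have -> : \sum_(p <- P) \sum_(p' <- P) (N2 (c p) + N2 (c p')) / 2 * ((p' == p)%:R * H%:R + H%:R / (size P)%:R) =
     \sum_(p <- P) (N2 (c p) * H%:R + ((size P)%:R * N2 (c p) + \sum_(p' <- P) N2 (c p')) * (H%:R / (size P)%:R / 2)).
    rewrite big_seq [RHS]big_seq; apply: eq_bigr => p hp.
    under eq_bigr do rewrite mulrDr.
    rewrite big_split /=; congr (_ + _).
      rewrite (bigD1_seq p) //= eqxx mul1r big1 ?addr0; first by field.
      by move=> i /negPf->; rewrite mul0r mulr0.
    rewrite -sumr_const_size -big_split mulr_suml; apply: eq_bigr => p' _ /=; ring.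
  set S := \sum_(p <- P) N2 (c p).
  have -> : \sum_(p <- P) (N2 (c p) * H%:R + ((size P)%:R * N2 (c p) + S) * (H%:R / (size P)%:R / 2)) =
     S * H%:R + ((size P)%:R * S + (size P)%:R * S) * (H%:R / (size P)%:R / 2).
    rewrite big_split /= -mulr_suml -/S; congr (_ + _); rewrite -mulr_suml; congr (_ * _).
    by rewrite big_split /= -mulr_sumr sumr_const_size.
  rewrite le_eqVlt; apply/orP; left; apply/eqP; field.
  by rewrite pnatr_eq0 -lt0n.
have h2 : 0 <= 2 * H%:R :> R by pos.
have D := duality h2 dual (fun j : 'I_H => a (n + j.+1)%N).
have e p : N2 (avgH (tw (p%:R * al)) H n) = (H%:R^-1) ^+ 2 * N2 (\sum_(j < H) a (n + j.+1)%N * A p j).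
  by rewrite avgH_ord N2M N2_rc.
under eq_bigr do rewrite e.
rewrite -mulr_sumr; apply: le_trans (ler_wpM2l (sqr_ge0 _) D) _.
apply: le_trans (_ : (H%:R^-1) ^+ 2 * (2 * H%:R * \sum_(j < H) 1) <= _).
  apply: ler_wpM2l; first exact: sqr_ge0.
  by apply: ler_wpM2l => //; apply: ler_sum => j _; exact: a_le1.
rewrite sumr_const card_ord le_eqVlt; apply/orP; left; apply/eqP; field; exact: lt0r_neq0.
Qed.

Lemma dker_big H b : cabs (eix b - 1) * cabs (dker H b) <= 2.
Proof.
rewrite -cabsM (_ : (eix b - 1) * dker H b = eix b ^+ H - 1).
  apply: le_trans (cabsD _ _) _; rewrite cabsN -eixMn cabs_eix cabs1; lra.
by rewrite subrX1; congr (_ * _); apply: eq_bigr => j _; rewrite eixMn.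
Qed.

Lemma cabs_expB1 (w : CC) e : cabs w = 1 -> cabs (w ^+ e - 1) <= e%:R * cabs (w - 1).
Proof.
move=> w1; rewrite subrX1 cabsM mulrC; apply: ler_wpM2r => //.
apply: le_trans (cabs_sum _ _ _) _.
have e1 i : cabs (w ^+ i) = 1 by elim: i => [|i IH]; rewrite ?expr0 ?cabs1 // exprS cabsM IH w1 mulr1.
by under eq_bigr do rewrite e1; rewrite sumr_const card_ord.
Qed.

(** For [m = d q + r] the twist is [w^q] times a function of [r]. On the window [q] changes by at
    most [H + 1], and [w^q] is replaced by its value at the start. *)
Lemma near_periodic d H n al : (0 < d)%N -> (0 < H)%N ->
  N2 (avgH (tw al) H n) <= 2 * (d%:R * \sum_(r < d) N2 (avgH (fun m => a m * (m == r %[mod d])%:R) H n)) + 2 * (H.+1%:R * cabs (eix (d%:R * al) - 1)) ^+ 2.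
Proof.
move=> d0 H0; have Hp : 0 < H%:R :> R by rewrite ltr0n.
set w := eix (d%:R * al); have w1 : cabs w = 1 by rewrite cabs_eix.
pose g m := a m * eix ((m %% d)%:R * al).
have E m : tw al m = g m * w ^+ (m %/ d).
  rewrite /tw /g {2}(divn_eq m d) natrD natrM mulrDl addrC eixD mulrA /w -eixMn; congr (_ * eix _); ring.
have ->: avgH (tw al) H n = w ^+ (n %/ d) * (avgH g H n + avgH (fun m => g m * (w ^+ (m %/ d - n %/ d) - 1)) H n).
  rewrite -avgHD -avgHZ /avgH; congr (_ * _); rewrite big_nat_cond [RHS]big_nat_cond; apply: eq_bigr => m /andP[/andP[nm _] _].
  rewrite E mulrBr mulr1 addrC subrK mulrCA -exprD subnKC //; exact: leq_div2r (ltnW nm).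
rewrite N2M N2X (_ : N2 w = 1) ?N2_eix // expr1n mul1r; apply: le_trans (N2D_le _ _) _; apply: lerD; apply: ler_wpM2l => //.
  have -> : avgH g H n = \sum_(r < d) eix (r%:R * al) * avgH (fun m => a m * (m == r %[mod d])%:R) H n.
    rewrite /avgH; under [RHS]eq_bigr do rewrite mulrCA mulr_sumr.
    rewrite -mulr_sumr exchange_big /=; congr (_ * _); apply: eq_bigr => m _.
    have lt : (m %% d < d)%N by rewrite ltn_mod.
    rewrite (bigD1 (Ordinal lt)) //= modn_mod eqxx mulr1 big1 ?addr0 => [|i]; first by rewrite /g mulrC.
    by rewrite -val_eqE /= [(i %% d)%N]modn_small // eq_sym => /negPf->; rewrite !mulr0.
  apply: le_trans (N2_sum_card _ _ _) _; rewrite sumr_const card_ord; apply: ler_wpM2l => //.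
  by apply: ler_sum => r _; rewrite N2M N2_eix mul1r.
apply: N2_le_sqr; rewrite avgH_ord cabsM cabs_rc ger0_norm ?invr_ge0 // mulrC ler_pdivrMr //.
apply: le_trans (cabs_sum _ _ _) _.
apply: le_trans (_ : \sum_(j < H) H.+1%:R * cabs (w - 1) <= _); last by rewrite sumr_const card_ord mulr_natr.
apply: ler_sum => j _; rewrite cabsM.
have g1 : cabs (g (n + j.+1)%N) <= 1 by apply: cabs_le1; rewrite /g N2M N2_eix mulr1; exact: a_le1.
apply: le_trans (ler_piMl _ g1) _ => //.
apply: le_trans (cabs_expB1 _ w1) _; apply: ler_wpM2r => //; rewrite ler_nat leq_subLR.
apply: leq_trans (leq_div2r d (_ : (n + j.+1 <= n + H)%N)) _; first by rewrite leq_add2l.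
rewrite divnD // -addnA leq_add2l -addn1; apply: leq_add; [exact: leq_div|exact: leq_b1].
Qed.
(** Divergence of [sum 1/p] from non-pretentiousness for the character of modulus 1 at [t = 0],
    because [1 - Re a(p) <= 2]. *)
Lemma primes_sum (K : R) : exists N, (0 < N)%N /\ K <= \sum_(p <- [seq p <- index_iota 1 N.+1 | prime p]) p%:R^-1.
Proof.
have tr : dchar 1 (fun _ => 1) by split=> // *; rewrite ?mulr1 ?coprimen1 ?oner_eq0.
have [N0 hN0] := aU tr (2 * K); exists N0.+1; split=> //.
have := hN0 N0.+1 (leqnSn _) 0; rewrite normr0 mulr_ge0 // => /(_ isT) h; rewrite big_filter.
have : 2 * K <= 2 * \sum_(1 <= p < N0.+2 | prime p) p%:R^-1; last by rewrite ler_pM2l ?ltr0n.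
apply: le_trans h _; rewrite mulr_sumr; apply: ler_sum => p _.
rewrite mul0r oppr0 eix0 !mulr1 mulrC; apply: ler_wpM2r; first by rewrite invr_ge0.
have c := le_trans (cre_le_cabs (a p)) (cabs_le1 (a_le1 a0 a1 p)).
move: c; rewrite ler_norml => /andP[]; lra.
Qed.

(** The window must not depend on [al]. If two multiples [p al] and [p' al] are not separated at
    scale [H2], then [|e(d al) - 1| <= 2 (size P) / H2] for [d = p' - p], and [H2] exceeds [H3] so
    much that the twist is nearly periodic on windows of length [H3]. The length [H2 * (H3 * Q)] is
    a multiple of what either case needs. *)
Lemma twist_win (eps : R) : 0 < eps -> eps <= 1 -> exists M, (0 < M)%N /\
  forall al, dom (fun n => N2 (avgH (tw al) M n)) (fun _ => eps).
Proof.
move=> e0 e1.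
have [N [N0 hL]] := primes_sum (6 / eps).
set P := [seq p <- _ | _] in hL; set L : R := \sum_(p <- P) _ in hL.
have L0 : 0 < L by apply: lt_le_trans hL; rewrite divr_gt0 // ltr0n.
have uP : uniq P by rewrite filter_uniq // iota_uniq.
have pP p : p \in P -> prime p by rewrite mem_filter => /andP[].
have PN p : p \in P -> (p <= N)%N by rewrite mem_filter mem_index_iota ltnS => /and3P[].
have k0 : (0 < size P)%N by rewrite lt0n; apply/eqP => /size0nil E; move: L0; rewrite /L E big_nil ltxx.
have NR : 0 < N%:R :> R by rewrite ltr0n.
(* [near_periodic] loses the factor [d] twice, and [d] is at most [N]. *)
pose e' : R := eps / (4 * N%:R ^+ 2).
have e'0 : 0 < e' by rewrite divr_gt0 // mulr_gt0 ?ltr0n // exprn_gt0.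
pose F (x : nat * nat) m := a m * (m == x.2 %[mod x.1])%:R.
have hres x : x \in [seq (d, r) | d <- iota 1 N, r <- iota 0 N] -> nullmean (F x).
  by move=> /allpairsP[y [h _ ->]]; apply: nullmean_residue => //; move: h; rewrite mem_iota => /andP[].
have [H3 [H30 d3]] := nullmean_common hres e'0.
have [h2 hh2] := nat_above (4 * (size P)%:R * H3.+1%:R / eps); pose H2 := h2.+1.
have H2h : 4 * (size P)%:R * H3.+1%:R / eps <= H2%:R by apply: le_trans hh2 _; rewrite ler_nat.
pose Q := (\prod_(p <- P) p)%N.
have Q0 : (0 < Q)%N by rewrite /Q big_seq; apply: prodn_cond_gt0 => p /pP; exact: prime_gt0.
have dQ p : p \in P -> (p %| Q)%N by move=> hp; rewrite /Q (big_rem p) //= dvdn_mulr.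
exists (H2 * (H3 * Q))%N; split; first by rewrite !muln_gt0 H30.
have M0 : (0 < H2 * (H3 * Q))%N by rewrite !muln_gt0 H30.
move=> al.
have [sep|] := boolP (all (fun p => all (fun p' => (p < p')%N ==> (cabs (dker H2 ((p' - p)%:R * al)) <= H2%:R / (size P)%:R)) P) P).
  have hs p p' : p \in P -> p' \in P -> (p < p')%N -> cabs (dker H2 ((p' - p)%:R * al)) <= H2%:R / (size P)%:R.
    by move=> hp hp' lt; move/allP: sep => /(_ p hp) /allP /(_ p' hp'); rewrite lt.
  have dM p : p \in P -> (p %| H2 * (H3 * Q))%N by move=> hp; rewrite !dvdn_mull ?dQ.
  have d1 : dom (fun n => \sum_(p <- P) N2 (avgH (tw (p%:R * al)) (H2 * (H3 * Q) %/ p) (n %/ p)%N)) (fun n => \sum_(p <- P) N2 (avgH (tw (p%:R * al)) H2 n)).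
    apply: dom_sum => p hp; have p0 := prime_gt0 (pP p hp).
    have bd n : 0 <= N2 (avgH (tw (p%:R * al)) (H2 * (H3 * Q) %/ p) n) <= 1 by rewrite N2_ge0 N2_avgH_bd //; exact: tw_le1.
    apply: dom_trans (dom_div p0 bd) _.
    have -> : (H2 * (H3 * Q) %/ p = (H3 * (Q %/ p)) * H2)%N.
      by rewrite -muln_divA ?dvdn_mull ?dQ // -muln_divA ?dQ // mulnC.
    by apply: dom_win (ler01) (tw_le1 _) _; rewrite muln_gt0 H30 divn_gt0 //; apply: dvdn_leq => //; exact: dQ.
  have c0 : 0 <= 2 / L by apply: divr_ge0 => //; exact: ltW.
  apply: dom_trans (dom_trans (domD (domZ c0 d1) (dom_le (fun n _ => lexx (2 / L)))) _); apply: dom_le => n _; first exact: tk_twist.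
  by apply: sep_arith => //; exact: bessel.
move=> /allPn[p hp] /allPn[p' hp']; rewrite negb_imply -ltNge => /andP[lt /ltW hD].
set d := (p' - p)%N in hD.
have dd0 : (0 < d)%N by rewrite subn_gt0.
have dN : (d <= N)%N by apply: leq_trans (leq_subr _ _) (PN _ hp').
rewrite (_ : H2 * (H3 * Q) = (H2 * Q) * H3)%N; last by rewrite mulnCA mulnC.
apply: dom_trans (@dom_win _ 1 _ _ ler01 (tw_le1 al) _) _; first by rewrite muln_gt0.
set c := cabs (eix (d%:R * al) - 1).
have hc : H3.+1%:R * c <= eps / 2.
  by apply: close_arith H2h hD (dker_big _ _); rewrite ?ltr0n.
have dR : 0 <= d%:R :> R by [].
have two0 : (0 : R) <= 2 by [].
have d1 : dom (fun n => \sum_(r <- enum 'I_d) N2 (avgH (fun m => a m * (m == r %[mod d])%:R) H3 n)) (fun n => \sum_(r <- enum 'I_d) e').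
  apply: dom_sum => r _; apply: (d3 (d, nat_of_ord r)); apply: allpairs_f; rewrite mem_iota ?dd0 //=.
  by rewrite add0n; exact: leq_trans (ltn_ord r) dN.
have d2 := domD (domZ two0 (domZ dR d1)) (dom_le (fun n (_ : (0 < n)%N) => lexx (2 * (H3.+1%:R * c) ^+ 2))).
apply: dom_trans (dom_trans d2 _); apply: dom_le => n _.
  by rewrite big_enum; exact: near_periodic.
rewrite big_enum sumr_const card_ord -[e' *+ d]mulr_natl.
by apply: (@near_arith _ N%:R) => //; [rewrite ler_nat|pos].
Qed.

Lemma twist_uniform (eps : R) : 0 < eps -> exists M0, forall M, (M0 <= M)%N -> (0 < M)%N /\
  forall al, dom (fun n => N2 (avgH (tw al) M n)) (fun _ => eps).
Proof.
move=> ep0; pose e : R := Num.min eps 1.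
have e0 : 0 < e by rewrite lt_min ep0 ltr01.
have e1 : e <= 1 by rewrite ge_min lexx orbT.
have e2 : e <= eps by rewrite ge_min lexx.
have [M1 [M10 h]] : exists M, (0 < M)%N /\ forall al, dom (fun n => N2 (avgH (tw al) M n)) (fun _ => e / 4).
  by apply: twist_win; lra.
have [m hm] := nat_above (2 * M1%:R / e); exists (M1 + m)%N => M hM.
have MM : (M1 <= M)%N by apply: leq_trans hM; rewrite leq_addr.
have M0 : (0 < M)%N by exact: leq_trans MM.
split=> // al; apply: dom_trans (dom_bigwin (tw_le1 al) M10 MM (h al)) _; apply: dom_le => n _.
have q : M1%:R / M%:R <= e / 2.
  have Mp : 0 < M%:R :> R by rewrite ltr0n.
  have : 2 * M1%:R / e <= M%:R by apply: le_trans hm _; rewrite ler_nat; apply: leq_trans hM; rewrite leq_addl.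
  rewrite !ler_pdivrMr //; lra.
have q0 : 0 <= M1%:R / M%:R :> R by pos.
apply: le_trans e2; move: (M1%:R / M%:R) q q0 => x q q0.
have h3 : x ^+ 2 <= e / 2 * (e / 2) by rewrite expr2; exact: ler_pM.
have h4 : e * e <= e by exact: ler_piMr (ltW e0) e1.
lra.
Qed.
End Twist.

(** * Correlations with a bounded sequence *)

Section Inversion.
Variable N : nat.
Hypothesis N0 : (0 < N)%N.
Notation om := (eix (2 * PI / N%:R)).

Lemma omN k : (om ^+ k) ^+ N = 1.
Proof. by rewrite -exprM mulnC exprM -eixMn mulrC divfK ?eix_2PI ?expr1n // pnatr_eq0 -lt0n. Qed.

(** A negative power of a root of unity is written with the natural exponent [N - s]. *)
Lemma om_neg k s : (s <= N)%N -> (om ^+ k) ^+ (N - s) = eix (- (2 * PI * (k%:R - 0) * s%:R / N%:R)).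
Proof.
move=> sN; have u : (om ^+ k) ^+ s * eix (- (2 * PI * (k%:R - 0) * s%:R / N%:R)) = 1.
  rewrite -exprM -eixMn -eixD -[RHS]eix0; congr eix; rewrite natrM subr0; field; by rewrite pnatr_eq0 -lt0n.
by rewrite -[LHS]mulr1 -u mulrA -exprD subnK // omN mul1r.
Qed.

Lemma dft_inv (x : nat -> CC) i : (i < N)%N ->
  x i = N%:R^-1 * \sum_(k < N) (\sum_(j < N) x j * (om ^+ k) ^+ j) * (om ^+ k) ^+ (N - i).
Proof.
move=> iN; under eq_bigr do rewrite mulr_suml.
rewrite exchange_big /=.
have e (j : 'I_N) : \sum_(k < N) x j * (om ^+ k) ^+ j * (om ^+ k) ^+ (N - i) = x j * (if j == Ordinal iN then N%:R else 0).
  under eq_bigr do rewrite -mulrA -exprD -(expr_mod _ (omN _)).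
  rewrite -mulr_sumr root_orth ?ltn_mod //; congr (_ * _).
  rewrite -val_eqE /= addnBA ?(ltnW iN) //.
  have jN := ltn_ord j; move: (nat_of_ord j) jN => {}j jN.
  case: (ltngtP j i) => [lt|gt|->].
  - have /andP[h1 h2] : (0 < j + N - i < N)%N by apply/andP; split; lia.
    by rewrite modn_small // gtn_eqF.
  - have -> : (j + N - i = (j - i) + N)%N by lia.
    by rewrite modnDr modn_small ?gtn_eqF ?subn_gt0 //; apply: leq_ltn_trans (leq_subr _ _) _.
  by rewrite addKn modnn.
rewrite (eq_bigr _ (fun j _ => e j)) (bigD1 (Ordinal iN)) //= eqxx big1 ?addr0 => [|j /negPf->]; last by rewrite mulr0.
by rewrite mulrCA mulVf ?mulr1 // pnatr_eq0 -lt0n.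
Qed.
End Inversion.

Section Corr.
Variable a : nat -> CC.
Hypothesis a0 : a 0%N = 0.
Hypothesis a1 : forall n, (0 < n)%N -> N2 (a n) = 1.
Hypothesis aM : forall m n, a (m * n)%N = a m * a n.
Hypothesis aU : forall q chi, dchar q chi -> unpret (fun n => a n * chi n).

Definition corr (z : nat -> CC) (M n : nat) : CC := (M%:R^-1)%:C * \sum_(h < M) a (n + h.+1)%N * z h.+1.

(** For [s, h < M] all arguments lie in one window of length [N = 2 M], so the correlations at the
    shifts [s] are part of a cyclic convolution modulo [N] without wrap-around. Extending [s] to all
    residues adds nonnegative terms, and Parseval evaluates the result. *)
Lemma corr_shift_sum (z Y : nat -> CC) (M n : nat) : (0 < M)%N -> let N := (M + M)%N in
  (forall k, Y k = \sum_(h < M) z h.+1 * (eix (2 * PI / N%:R) ^+ k) ^+ (N - h)) ->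
  \sum_(s < M) N2 (corr z M (n + s)) <= (M%:R^-1) ^+ 2 * (N%:R * \sum_(k < N) N2 (Y k) * N2 (avgH (tw a (2 * PI / N%:R * k%:R)) N n)).
Proof.
move=> M0 N hY; have N0 : (0 < N)%N by rewrite addn_gt0 M0.
have Nn : N%:R != 0 :> R by rewrite pnatr_eq0 -lt0n.
set om := eix (2 * PI / N%:R) in hY *.
pose x j := a (n + j.+1)%N.
pose X k := \sum_(j < N) x j * (om ^+ k) ^+ j.
have hX k : N2 (X k) = N%:R ^+ 2 * N2 (avgH (tw a (2 * PI / N%:R * k%:R)) N n).
  rewrite avgH_ord N2M N2_rc mulrA -exprMn mulfV // expr1n mul1r.
  set th := 2 * PI / N%:R * k%:R.
  have -> : \sum_(j < N) tw a th (n + j.+1)%N = eix (n.+1%:R * th) * X k.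
    rewrite mulr_sumr; apply: eq_bigr => j _; rewrite /tw /x [RHS]mulrCA; congr (_ * _).
    rewrite -exprM -eixMn -eixD; congr eix; rewrite /th addnS -addSn natrD natrM; ring.
  by rewrite N2M N2_eix mul1r.
have hc s : (s < M)%N -> corr z M (n + s) = (M%:R^-1)%:C * (N%:R^-1 * \sum_(k < N) X k * Y k * eix (- (2 * PI * (k%:R - 0) * s%:R / N%:R))).
  move=> sM; rewrite /corr; congr (_ * _).
  have [W hW] : exists W : nat -> CC, forall k, eix (- (2 * PI * (k%:R - 0) * s%:R / N%:R)) = W k by eexists => k; reflexivity.
  under [in RHS]eq_bigr do rewrite hW.
  have e (h : 'I_M) : a (n + s + h.+1)%N * z h.+1 = \sum_(k < N) N%:R^-1 * (X k * (z h.+1 * (om ^+ k) ^+ (N - h)) * W k).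
    have sh : (s + h < N)%N by rewrite /N -addnS; apply: leq_add; [exact: ltnW|exact: ltn_ord].
    have -> : a (n + s + h.+1)%N = x (s + h)%N by rewrite /x -addnS addnA.
    rewrite (dft_inv N0 x sh) -/om -mulrA -mulr_sumr; congr (_ * _); rewrite mulr_suml; apply: eq_bigr => k _.
    rewrite -/(X k) -!mulrA; congr (_ * _); rewrite mulrC; congr (_ * _).
    have hN : (h <= N)%N by apply: ltnW; exact: leq_ltn_trans (leq_addl _ _) sh.
    have sN : (s <= N)%N by apply: ltnW; exact: leq_ltn_trans (leq_addr _ _) sh.
    rewrite -hW -(om_neg N0) // -exprD -/om -[LHS]mulr1 -(omN N0 k) -/om -exprD; congr (_ ^+ _).
    by move: (nat_of_ord h) sh hN sN => {}h; lia.
  rewrite (eq_bigr _ (fun h _ => e h)) exchange_big /= mulr_sumr; apply: eq_bigr => k _.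
  by rewrite -mulr_sumr -mulr_suml -mulr_sumr -hY.
apply: le_trans (_ : \sum_(s < N) N2 ((M%:R^-1)%:C * (N%:R^-1 * \sum_(k < N) X k * Y k * eix (- (2 * PI * (k%:R - 0) * s%:R / N%:R)))) <= _).
  rewrite [X in _ <= X]big_split_ord /=; apply: ler_wpDr; first by apply: sumr_ge0.
  by apply: ler_sum => s _; rewrite hc.
have NC : (N%:R^-1 : CC) = (N%:R^-1)%:C by rewrite fmorphV rmorph_nat.
under eq_bigr do rewrite NC !N2M !N2_rc.
rewrite -!mulr_sumr; apply: ler_wpM2l; first exact: sqr_ge0.
have -> : \sum_(s < N) N2 (\sum_(k < N) X k * Y k * eix (- (2 * PI * (k%:R - 0) * s%:R / N%:R))) =
   \sum_(s < N) N2 (\sum_(k < N) (X k * Y k) * eix (- (2 * PI * (s%:R - 0) * k%:R / N%:R))).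
  by apply: eq_bigr => s _; congr N2; apply: eq_bigr => k _; congr (_ * eix _); ring.
rewrite (dft_parseval 0 (fun k => X k * Y k) N0) le_eqVlt; apply/orP; left; apply/eqP.
rewrite mulrA (_ : N%:R^-1 ^+ 2 * N%:R = N%:R^-1); last by field.
rewrite !mulr_sumr; apply: eq_bigr => k _; rewrite N2M hX; field; exact: Nn.
Qed.

Lemma corr_le (z : nat -> CC) (B : R) M n : 0 <= B -> (forall h, (0 < h)%N -> N2 (z h) <= B) -> N2 (corr z M n) <= B.
Proof.
move=> B0 zB; case: M => [|M]; first by rewrite /corr big_ord0 mulr0 N20.
rewrite /corr; apply: le_trans (N2_avg_le _ (ltn0Sn M)) _; rewrite mulrC ler_pdivrMr ?ltr0n //.
apply: le_trans (_ : \sum_(j < M.+1) B <= _); last by rewrite sumr_const card_ord mulr_natr.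
apply: ler_sum => j _; rewrite N2M; apply: le_trans (zB j.+1 isT); apply: ler_piMl => //; exact: a_le1.
Qed.

(** The mean square at [n] is replaced by its average over the shifts [n + s]. Parseval gives the
    [|Y k|^2] total mass at most [N M B], and each twist contributes at most [eps / (4 B)]; the 4 is
    [(N/M)^2]. *)
Lemma corr_small (z : nat -> CC) (B : R) : 0 < B -> (forall h, (0 < h)%N -> N2 (z h) <= B) -> forall eps : R, 0 < eps ->
  exists M0, forall M, (M0 <= M)%N -> dom (fun n => N2 (corr z M n)) (fun _ => eps).
Proof.
move=> B0 zB eps e0.
have e4 : 0 < eps / (4 * B) by rewrite divr_gt0 // mulr_gt0 // ltr0n.
have [M1 h] := twist_uniform a0 a1 aM aU e4.
exists M1.+1 => M hM; have M0 : (0 < M)%N by exact: leq_trans hM.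
have Mp : 0 < M%:R :> R by rewrite ltr0n.
have [N0 hN] : (0 < M + M)%N /\ forall al, dom (fun n => N2 (avgH (tw a al) (M + M) n)) (fun _ => eps / (4 * B)).
  by apply: h; apply: leq_trans (leq_addr _ _); exact: ltnW.
set N := (M + M)%N in N0 hN.
have cB n : 0 <= N2 (corr z M n) <= B by rewrite N2_ge0 (corr_le _ _ (ltW B0) zB).
pose Y k := \sum_(h < M) z h.+1 * (eix (2 * PI / N%:R) ^+ k) ^+ (N - h).
have Ysum : \sum_(k < N) N2 (Y k) <= N%:R * (M%:R * B).
  pose y j := if (j < M)%N then z j.+1 else 0.
  have E k : Y k = \sum_(j < N) y j * eix (- (2 * PI * (k%:R - 0) * j%:R / N%:R)).
    rewrite big_split_ord /= [X in _ + X]big1 ?addr0 => [|j _]; last by rewrite /y ltnNge leq_addr mul0r.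
    apply: eq_bigr => j _; rewrite /y ltn_ord om_neg //; apply: leq_trans (leq_addr _ _); exact: ltnW.
  under eq_bigr do rewrite E.
  rewrite (dft_parseval 0 y N0); apply: ler_wpM2l => //; rewrite big_split_ord /=.
  rewrite [X in _ + X]big1 ?addr0 => [|j _]; last by rewrite /y ltnNge leq_addr N20.
  apply: le_trans (_ : \sum_(j < M) B <= _); last by rewrite sumr_const card_ord mulr_natl.
  by apply: ler_sum => j _; rewrite /y ltn_ord; exact: zB.
have d1 : dom (fun n => \sum_(s <- enum 'I_M) N2 (corr z M n)) (fun n => \sum_(s <- enum 'I_M) N2 (corr z M (n + s))).
  by apply: dom_sum => s _; exact: dom_unshift cB.
have d2 : dom (fun n => \sum_(k <- enum 'I_N) N2 (Y k) * N2 (avgH (tw a (2 * PI / N%:R * k%:R)) N n)) (fun n => \sum_(k <- enum 'I_N) N2 (Y k) * (eps / (4 * B))).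
  by apply: dom_sum => k _; apply: domZ.
have c1 : 0 <= (M%:R^-1) ^+ 2 * N%:R :> R by pos.
have d3 : dom (fun n => \sum_(s <- enum 'I_M) N2 (corr z M n)) (fun n => (M%:R^-1) ^+ 2 * N%:R * \sum_(k <- enum 'I_N) N2 (Y k) * (eps / (4 * B))).
  apply: dom_trans d1 (dom_trans _ (domZ c1 d2)); apply: dom_le => n _.
  by rewrite !big_enum /= -[_ * N%:R * _]mulrA; exact: (@corr_shift_sum z Y M n M0 (fun k => erefl)).
have c2 : 0 <= M%:R^-1 :> R by rewrite invr_ge0.
apply: dom_trans (dom_trans (domZ c2 d3) _); apply: dom_le => n _.
  by rewrite big_enum sumr_const card_ord -[N2 _ *+ _]mulr_natl mulKf // ; exact: lt0r_neq0.
rewrite big_enum -mulr_suml /=.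
have c4 : 0 <= eps / (4 * B) by exact: ltW.
apply: le_trans (_ : M%:R^-1 * ((M%:R^-1) ^+ 2 * N%:R * ((N%:R * (M%:R * B)) * (eps / (4 * B)))) <= _).
  by apply: ler_wpM2l => //; apply: ler_wpM2l => //; apply: ler_wpM2r.
rewrite le_eqVlt; apply/orP; left; apply/eqP; rewrite /N natrD; field.
by rewrite !lt0r_neq0.
Qed.
End Corr.

(** * The limit superior *)

Definition toC (x : Cx) : CC := Complex (fst x) (snd x).

Lemma toC_add x y : toC (Cadd x y) = toC x + toC y.
Proof. by apply: cplx_eq; rewrite ?creD ?cimD. Qed.

Lemma toC_mul x y : toC (Cmul x y) = toC x * toC y.
Proof. by apply: cplx_eq; rewrite ?creM ?cimM. Qed.

Lemma toC_scale r x : toC (Cscale r x) = r%:C * toC x.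
Proof. by apply: cplx_eq; rewrite ?creM ?cimM !cre_rc !cim_rc !mul0r ?subr0 ?addr0. Qed.

Lemma toC_inj x y : toC x = toC y -> x = y.
Proof. by case: x y => [a b] [c d] [-> ->]. Qed.

Lemma Cabs_toC x : Cabs x = cabs (toC x).
Proof.
have -> : Cabs x = R_sqrt.sqrt (N2 (toC x)) by rewrite /Cabs /N2 !expr2.
by rewrite RsqrtE.
Qed.

Lemma sum1E n (f : nat -> R) : sum1 n f = \sum_(1 <= i < n.+1) f i.
Proof. by elim: n => [|n IH] /=; [rewrite big_geq|rewrite big_nat_recr //= -IH]. Qed.

Lemma Csum1E n f : toC (Csum1 n f) = \sum_(h < n) toC (f h.+1).
Proof. by elim: n => [|n IH] /=; [rewrite big_ord0|rewrite big_ord_recr /= -IH toC_add]. Qed.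

Lemma logavgE N psi : logavg N psi = lsum psi N / lsum (fun _ => 1) N.
Proof.
rewrite /logavg !sum1E RdivE /lsum; congr (_ / _); apply: eq_bigr => i _; first by rewrite RdivE INRE.
by rewrite RinvE INRE mul1r.
Qed.

Lemma gcd_gcdn m n : Nat.gcd m n = gcdn m n.
Proof.
apply: Nat.gcd_unique.
- by have /dvdnP[k e] := dvdn_gcdl m n; exists k.
- by have /dvdnP[k e] := dvdn_gcdr m n; exists k.
move=> q [k hk] [l hl].
have /dvdnP[z e] : (q %| gcdn m n)%N by rewrite dvdn_gcd; apply/andP; split; apply/dvdnP; [exists k|exists l].
by exists z.
Qed.

Lemma primeZ p : Znumtheory.prime (Z.of_nat p) <-> prime p.
Proof.
rewrite -prime_alt; split.
  move=> [p1 h]; apply/primeP; split; first by apply/ssrnat.ltP; lia.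
  move=> d /dvdnP[k e]; apply/orP.
  have [d1|d1] := leqP d 1.
    left; case: d d1 e => [|[]] // _ e; move: p1; rewrite e muln0; lia.
  right; rewrite eqn_leq; apply/andP; split.
    by apply: dvdn_leq; [apply/ssrnat.ltP; lia|apply/dvdnP; exists k].
  rewrite leqNgt; apply/negP => dp; apply: (h (Z.of_nat d)); first by split; lia.
  by exists (Z.of_nat k); rewrite e; lia.
move=> /primeP[p1 h]; split; first by move/ssrnat.ltP: p1; lia.
move=> n [n1 np] [z hz].
have [d hd] : exists d, n = Z.of_nat d by exists (Z.to_nat n); lia.
have z0 : Z.le 0 z by nia.
have dv : (d %| p)%N by apply/dvdnP; exists (Z.to_nat z); nia.
by move: (h d dv) => /orP[] /eqP E; lia.
Qed.

Lemma Cpow_toC p t : toC (Cpow_neg_it p t) = eix (- (t * lnn p)).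
Proof. by rewrite eixN; apply: cplx_eq; rewrite ?cre_cj ?cim_cj /= INRE. Qed.

Lemma pretentious_distE (a chi : nat -> Cx) N t :
  pretentious_dist a chi N t = \sum_(1 <= p < N.+1 | prime p) p%:R^-1 * (1 - cre (toC (a p) * toC (chi p) * eix (- (t * lnn p)))).
Proof.
rewrite /pretentious_dist sum1E [RHS]big_mkcond; apply: eq_bigr => p _; rewrite /Defs.prime_ind.
case: prime_dec => hp.
  rewrite (iffLR (primeZ p) hp) RdivE INRE [RHS]mulrC.
  rewrite -Cpow_toC -!toC_mul; exact: mul1r.
by case: ifP => [/primeZ //|_]; exact: mul0r.
Qed.

(** * Transfer to the given multiplicative function *)

Section Final.
Variables (a : nat -> Cx).
Hypothesis ha_mult : completely_multiplicative a.
Hypothesis ha_circ : unit_circle_valued a.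
Hypothesis ha_unpret : unpretentious a.

(** The value 0 at 0 makes complete multiplicativity hold for all natural numbers. *)
Definition a0fun (n : nat) : CC := if n == 0%N then 0 else toC (a n).

Lemma a0fun0 : a0fun 0 = 0. Proof. by []. Qed.

Lemma a0funM m n : a0fun (m * n)%N = a0fun m * a0fun n.
Proof.
rewrite /a0fun muln_eq0; case: eqP => [_|/eqP m0] /=; first by rewrite mul0r.
case: eqP => [_|/eqP n0]; first by rewrite mulr0.
by have [_ h] := ha_mult; rewrite -toC_mul -h //; apply/ssrnat.leP; rewrite lt0n.
Qed.

Lemma a0fun1 n : (0 < n)%N -> N2 (a0fun n) = 1.
Proof.
move=> n0; rewrite /a0fun gtn_eqF //.
by have := ha_circ (elimT ssrnat.leP n0); rewrite Cabs_toC -cabs_sqr => ->; rewrite expr1n.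
Qed.

Lemma a0fun_unpret q chi : dchar q chi -> unpret (fun n => a0fun n * chi n).
Proof.
move=> [q0 c1 cp cM cz] K.
pose ch n : Cx := (cre (chi n), cim (chi n)).
have tch n : toC (ch n) = chi n by apply: cplx_eq.
have hch : dirichlet_character q ch.
  split; first exact/ssrnat.leP.
  split; first by apply: toC_inj; rewrite tch c1; apply: cplx_eq; rewrite ?cre1 ?cim1.
  split; first by move=> n; apply: toC_inj; rewrite !tch cp.
  split; first by move=> m n; apply: toC_inj; rewrite toC_mul !tch cM.
  move=> n; rewrite gcd_gcdn; have t0 : toC C0 = 0 by apply: cplx_eq; rewrite ?cre0 ?cim0.
  split=> [h|h].
    apply/eqP; rewrite -[_ == _]/(coprime n q) -cz; apply/eqP => e; apply: h; apply: toC_inj.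
    by rewrite tch e t0.
  have : chi n != 0 by rewrite cz /coprime h.
  by move=> /eqP h' e; apply: h'; rewrite -tch e t0.
have [vp [hv hu]] := ha_unpret.
have [m hm] := nat_above K.
have [A0 hA0] := hv m.
(* [A0] makes [varphi] large, [q] bounds the period, and 3 provides the frequency range [3 N]. *)
pose A := (A0 + q + 3)%N.
have qA : (q <= A)%coq_nat by apply/ssrnat.leP; rewrite /A -addnA addnCA leq_addr.
have [N0 hN0] := hu A q ch qA hch.
exists N0 => N hN t ht.
have tA : Rle (Rabs t) (Rmult (INR A) (INR N)).
  apply/RleP; rewrite !INRE; apply: le_trans ht _; apply: ler_wpM2r => //; by rewrite ler_nat /A leq_addl.
have := hN0 N (elimT ssrnat.leP hN) t tA => /RleP; rewrite pretentious_distE INRE => h.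
apply: le_trans (le_trans (le_trans hm _) h) _.
  by rewrite ler_nat; apply/ssrnat.leP; apply: hA0; apply/ssrnat.leP; rewrite /A -addnA leq_addr.
rewrite le_eqVlt; apply/orP; left; apply/eqP; rewrite big_nat_cond [RHS]big_nat_cond; apply: eq_bigr => p /andP[_ pp].
by rewrite /a0fun gtn_eqF ?prime_gt0 // tch.
Qed.

Definition term (M n : nat) (phi : nat -> Cx) : R := Cabs (Cavg M (fun h => Cmul (a (n + h)%nat) (phi h))).

Lemma termE M n phi : term M n phi = cabs (corr a0fun (fun h => toC (phi h)) M n).
Proof.
rewrite /term Cabs_toC toC_scale Csum1E /corr RinvE INRE; congr (cabs (_ * _)); apply: eq_bigr => h _.
by rewrite toC_mul /a0fun addn_eq0 andbF.
Qed.

Lemma growth_bounded phi : subquadratic_word_growth phi -> exists B : R, 0 < B /\ forall h, (0 < h)%N -> N2 (toC (phi h)) <= B.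
Proof.
move=> [[vals hv] _].
suff [B [B0 hB]] : exists B : R, 0 < B /\ forall v, In v vals -> N2 (toC v) <= B.
  by exists B; split=> // h h0; apply: hB; apply: hv; exact/ssrnat.leP.
elim: vals {hv} => [|v vals [B [B0 hB]]]; first by exists 1.
exists (N2 (toC v) + B); split; first by apply: ltr_wpDl.
move=> w [<-|hw]; first by rewrite lerDl ltW.
by apply: le_trans (hB w hw) _; rewrite lerDr.
Qed.

(** Passage from mean squares to means: when the mean square is at most [e^2], both terms are at
    most [e/2]. *)
Lemma cabs_le_avg (e : R) (z : CC) : 0 < e -> cabs z <= 2^-1 * e + (2 * e)^-1 * N2 z.
Proof.
move=> e0; rewrite -cabs_sqr; have := sqr_ge0 (cabs z - e); move: (cabs z) => x h.
have -> : 2^-1 * e + (2 * e)^-1 * x ^+ 2 = (e ^+ 2 + x ^+ 2) / (2 * e) by field; exact: lt0r_neq0.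
by rewrite ler_pdivlMr ?mulr_gt0 ?ltr0n //; lra.
Qed.

Lemma term_small phi : subquadratic_word_growth phi -> forall eps : R, 0 < eps ->
  exists M0, forall M, (M0 <= M)%N -> dom (fun n => term M n phi) (fun _ => eps).
Proof.
move=> hphi eps e0; have [B [B0 hB]] := growth_bounded hphi.
have e2 : 0 < eps ^+ 2 by exact: exprn_gt0.
have [M0 h] := corr_small a0fun0 a0fun1 a0funM a0fun_unpret B0 hB e2.
exists M0 => M hM.
have c0 : 0 <= (2 * eps)^-1 by rewrite invr_ge0 mulr_ge0 // ltW.
apply: dom_trans (dom_trans (domD (dom_le (fun n (_ : (0 < n)%N) => lexx (2^-1 * eps))) (domZ c0 (h M hM))) _); apply: dom_le => n _.
  by rewrite termE; exact: cabs_le_avg.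
rewrite le_eqVlt; apply/orP; left; apply/eqP; field; exact: lt0r_neq0.
Qed.

Lemma corr_term_bound phi M : subquadratic_word_growth phi -> exists B : R, forall n, term M n phi <= B.
Proof.
move=> hphi; have [B [B0 hB]] := growth_bounded hphi.
exists (2^-1 * 1 + (2 * 1)^-1 * B) => n; rewrite termE; apply: le_trans (cabs_le_avg _ ltr01) _.
rewrite lerD2l; apply: ler_wpM2l; first by rewrite invr_ge0 mulr_ge0.
exact: (corr_le a0fun0 a0fun1 _ _ (ltW B0) hB).
Qed.

Lemma term_ge0 M n phi : 0 <= term M n phi.
Proof. by rewrite termE. Qed.

Lemma RmaxE (x y : R) : Rmax x y = Num.max x y.
Proof.
rewrite /Rmax; case: Rle_dec => [/RleP h|/RleP h]; first by rewrite max_r.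
by rewrite max_l //; move: h; rewrite -ltNge => /ltW.
Qed.

Lemma sup_list_ge0 S M n : 0 <= sup_list S (term M n).
Proof. by elim: S => [|phi S IH] //=; rewrite RmaxE le_max IH orbT. Qed.

(** For a finite set the supremum may be bounded by the sum. *)
Lemma sup_list_cons phi S M n : sup_list (phi :: S) (term M n) <= term M n phi + sup_list S (term M n).
Proof.
by rewrite /= RmaxE ge_max lerDl lerDr sup_list_ge0 term_ge0.
Qed.

Lemma sup_bound S M : (forall phi, In phi S -> subquadratic_word_growth phi) -> exists B : R, forall n, sup_list S (term M n) <= B.
Proof.
elim: S => [|phi S IH] hS; first by exists 0.
have [B hB] := IH (fun psi h => hS psi (or_intror h)).
have [D hD] := corr_term_bound M (hS phi (or_introl erefl)).
by exists (D + B) => n; apply: le_trans (sup_list_cons _ _ _ _) _; apply: lerD.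
Qed.

Lemma sup_small S : (forall phi, In phi S -> subquadratic_word_growth phi) -> forall eps : R, 0 < eps ->
  exists M0, forall M, (M0 <= M)%N -> dom (fun n => sup_list S (term M n)) (fun _ => eps).
Proof.
elim: S => [|phi S IH] hS eps e0; first by exists 0%N => M _; apply: dom_le => n _; exact: ltW.
have e2 : 0 < eps / 2 by rewrite divr_gt0 // ltr0n.
have [M1 h1] := IH (fun psi h => hS psi (or_intror h)) _ e2.
have [M2 h2] := term_small (hS phi (or_introl erefl)) e2.
exists (M1 + M2)%N => M hM.
apply: dom_trans (dom_trans (domD (h2 M (leq_trans (leq_addl _ _) hM)) (h1 M (leq_trans (leq_addr _ _) hM))) _); apply: dom_le => n _.
  exact: sup_list_cons.
by rewrite -splitr.
Qed.

Lemma lsum1_gt0 N : (0 < N)%N -> 0 < lsum (fun _ => 1) N.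
Proof.
case: N => // N _; rewrite lsumS mul1r; apply: ltr_wpDl; last by rewrite invr_gt0 ltr0n.
by apply: sumr_ge0 => n _; rewrite mul1r invr_ge0.
Qed.

Lemma corr_quantity_bound S M : (forall phi, In phi S -> subquadratic_word_growth phi) ->
  exists B : R, forall N, 0 <= corr_quantity a S M N <= B.
Proof.
move=> hS; have [B hB] := sup_bound M hS; exists B => N.
have B0 : 0 <= B by exact: le_trans (sup_list_ge0 S M 0) (hB 0%N).
rewrite /corr_quantity logavgE -/(term M).
case: N => [|N]; first by rewrite !lsum0 mul0r lexx.
have p := lsum1_gt0 (ltn0Sn N); apply/andP; split.
  by apply: divr_ge0; [apply: sumr_ge0 => n _; apply: divr_ge0 => //; exact: sup_list_ge0|exact: ltW].
rewrite ler_pdivrMr // -lsum_const; apply: ler_sum => n _.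
by apply: ler_wpM2r; rewrite ?invr_ge0 //; exact: hB.
Qed.

Lemma corr_quantity_small S : (forall phi, In phi S -> subquadratic_word_growth phi) -> forall eps : R, 0 < eps ->
  exists M0, forall M, (M0 <= M)%N -> exists N0, forall N, (N0 <= N)%N -> corr_quantity a S M N <= eps.
Proof.
move=> hS eps e0; have e2 : 0 < eps / 2 by rewrite divr_gt0 // ltr0n.
have [M0 h] := sup_small hS e2; exists M0 => M hM; have [C hC] := h M hM.
have [N0 hN0] := ev_lnn (C / (eps / 2)); exists N0.+1 => N hN.
have Np : (0 < N)%N by exact: leq_trans hN.
rewrite /corr_quantity logavgE -/(term M) ler_pdivrMr; last exact: lsum1_gt0.
apply: le_trans (hC N) _; rewrite lsum_const.
have : C <= eps / 2 * lsum (fun _ => 1) N.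
  rewrite mulrC -ler_pdivrMr //; apply: le_trans (hN0 N (ltnW hN)) _; exact: lnn_le_lsum1.
move: (lsum _ N) => s; lra.
Qed.
End Final.

Local Close Scope ring_scope.
Local Close Scope complex_scope.
Bind Scope R_scope with RbaseSymbolsImpl.R.
Open Scope R_scope.

Theorem theorem1p6 (S : list (nat -> Cx)) (a : nat -> Cx)
  (hS : forall phi, In phi S -> subquadratic_word_growth phi)
  (ha_mult : completely_multiplicative a)
  (ha_circ : unit_circle_valued a)
  (ha_unpret : unpretentious a) :
  exists L : nat -> R,
    (forall H, is_limsup (fun N => corr_quantity a S H N) (L H)) /\
    Un_cv L 0.
Proof.
have lim H : exists l, is_limsup (fun N => corr_quantity a S H N) l.
  have [B hB] := corr_quantity_bound ha_circ H hS.
  by apply: (@limsup_exists _ B) => N; have /andP[h1 h2] := hB N; split; apply/RleP.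
(* A limsup exists for each [H]; a choice principle makes it a function of [H]. *)
pose L H := proj1_sig (ClassicalEpsilon.constructive_indefinite_description _ (lim H)).
have hL H : is_limsup (fun N => corr_quantity a S H N) (L H) by exact: proj2_sig.
exists L; split=> // eps e0.
have e2 : (0 < eps / 2)%R by apply: divr_gt0; [exact/RltP|rewrite ltr0n].
have [M0 h] := corr_quantity_small ha_mult ha_circ ha_unpret hS e2.
exists M0 => H /ssrnat.leP hH; have [N0 hN0] := h H hH.
have l1 : (L H <= eps / 2)%R.
  apply/RleP; apply: (limsup_le _ _ _ (hL H)); exists N0 => N /ssrnat.leP hN; apply/RleP; exact: hN0.
have l0 : Rle 0 (L H).
  apply: (limsup_ge0 _ _ (hL H)) => N; have [B hB] := corr_quantity_bound ha_circ H hS.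
  by have /andP[b _] := hB N; exact/RleP.
rewrite /R_dist Rminus_0_r Rabs_right; last exact: Rle_ge.
have e0' : (0 < eps)%R by exact/RltP.
apply/RltP; apply: le_lt_trans l1 _; lra.
Qed.
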